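(* Let $k\ge 2$ and $\delta>1/2$ be fixed. For every $\varepsilon>0$ there is $n_0$ (depending on $k,\delta,\varepsilon$) such that every $k$-uniform hypergraph $G$ on $n\ge n_0$ vertices with $\delta_{k-1}(G)\ge \delta n$ satisfies $$\log\Psi(G)\ge k\,h(G)-n\log\binom{n}{k-1}+n\log n-n\log e-\varepsilon n.$$ That is, $\log\Psi(G)\ge kh(G)-n\log\binom{n}{k-1}+n\log n-n\log e-o(n)$.
   Context: All logarithms are base 2, with $0\log 0=0$. A $k$-uniform hypergraph ($k$-graph) $G$ has vertex set $V(G)$ and edge set $E(G)$ consisting of $k$-element subsets of $V(G)$. For a $(k-1)$-subset $S\subseteq V(G)$, its degree is the number of vertices $v$ with $S\cup\{v\}\in E(G)$; $\delta_{k-1}(G)$ is the minimum degree over all $(k-1)$-subsets. A perfect fractional matching of $G$ is a function $\mathbf{x}:E(G)\to\mathbb{R}_{\ge0}$ with $\sum_{e\ni v}\mathbf{x}(e)=1$ for every vertex $v$; its entropy is $h(\mathbf{x})=\sum_{e\in E(G)}\mathbf{x}(e)\log\frac{1}{\mathbf{x}(e)}$, and the entropy of $G$ is $h(G)=\sup h(\mathbf{x})$ over all perfect fractional matchings $\mathbf{x}$ of $G$. A tight Hamilton cycle of $G$ is a cyclic ordering $(v_1,\dots,v_n)$ of $V(G)$ (considered up to cyclic rotation and reversal) such that every $k$ cyclically consecutive vertices form an edge of $G$; $\Psi(G)$ denotes the number of tight Hamilton cycles of $G$. *)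

(* Defs.v *)
From HB Require Import structures.
From mathcomp Require Import all_boot all_order all_algebra.
From mathcomp Require Import all_classical all_reals all_analysis.

Set Implicit Arguments.
Unset Strict Implicit.
Unset Printing Implicit Defensive.

Import Order.TTheory GRing.Theory Num.Theory.

Local Open Scope ring_scope.

Record kgraph (k : nat) (T : finType) := KGraph {
  edges : {set {set T}};
  edges_uniform : {in edges, forall e : {set T}, #|e| = k}
}.

Definition degree (k : nat) (T : finType) (G : kgraph k T) (S : {set T}) : nat :=
  #|[set v : T | v |: S \in edges G]%SET|.

(* The neutral element #|T| bounds every degree, so it only matters when there
   is no (k-1)-subset at all. *)
Definition min_codegree (k : nat) (T : finType) (G : kgraph k T) : nat :=
  \big[minn/#|T|]_(S : {set T} | #|S| == k.-1) degree G S.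

Definition log2 (R : realType) (x : R) : R := ln x / ln 2.

(* The same logarithm with values in the extended reals: log 0 = -oo, whereas
   ln 0 = 0. *)
Definition log2e (R : realType) (x : \bar R) : \bar R :=
  (lne x * ((ln 2)^-1)%:E)%E.

(* Only the values of x on the edges matter. *)
Definition perfect_fractional_matching (R : realType) (k : nat) (T : finType)
    (G : kgraph k T) (x : {set T} -> R) : Prop :=
  (forall e : {set T}, e \in edges G -> 0 <= x e) /\
  (forall v : T, \sum_(e in edges G | v \in e) x e = 1).

(* A term with x e = 0 vanishes, in accordance with 0 log 0 = 0. *)
Definition matching_entropy (R : realType) (k : nat) (T : finType)
    (G : kgraph k T) (x : {set T} -> R) : R :=
  \sum_(e in edges G) x e * log2 (1 / x e).

(* The supremum is taken in the extended reals; it is -oo when G has no perfect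
   fractional matching. *)
Definition entropy (R : realType) (k : nat) (T : finType) (G : kgraph k T) :
    \bar R :=
  ereal_sup [set (matching_entropy G x)%:E |
               x in [set x : {set T} -> R | perfect_fractional_matching G x]]%classic.

Definition tight_hamilton_order (k : nat) (T : finType) (G : kgraph k T)
    (s : #|T|.-tuple T) : bool :=
  uniq s && [forall i : 'I_#|T|,
    [set v in take k (rot i s)]%SET \in edges G].

Definition same_cycle (T : finType) (n : nat) (s t : n.-tuple T) : bool :=
  [exists i : 'I_n.+1, ((t : seq T) == rot i s) || ((t : seq T) == rot i (rev s))].

Lemma same_cycleP (T : finType) (n : nat) (s t : n.-tuple T) :
  reflect (exists i : nat, (t : seq T) = rot i s \/ (t : seq T) = rot i (rev s))
          (same_cycle s t).
Proof.
apply: (iffP existsP) => [[i /orP[]/eqP->]|[i H]].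
- by exists i; left.
- by exists i; right.
have red (u : seq T) : size u = n -> rot i u = rot (minn i n) u.
  move=> su; case: (leqP i n) => // /ltnW ni.
  by rewrite (rot_oversize (n := i)) ?su// -su rot_size.
have lt : (minn i n < n.+1)%N by rewrite ltnS geq_minr.
exists (Ordinal lt) => /=; case: H => ->.
- by rewrite red ?size_tuple// eqxx.
- by rewrite red ?size_rev ?size_tuple// eqxx orbT.
Qed.

Lemma same_cycle_equivalence (T : finType) (n : nat) :
  equivalence_rel (@same_cycle T n).
Proof.
have rotrE (j : nat) (u : seq T) : rotr j u = rot (size u - j) u by [].
have addE (i j : nat) (u : seq T) : exists l : nat, rot i (rot j u) = rot l u.
  have [ui|iu] := leqP (size u) i.
    by exists j; rewrite rot_oversize ?size_rot.
  have [uj|ju] := leqP (size u) j.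
    by exists i; rewrite (rot_oversize uj).
  by rewrite rot_add_mod ?(ltnW iu) ?(ltnW ju)//; eexists.
have revE (i : nat) (u : seq T) : exists l : nat, rev (rot i u) = rot l (rev u).
  by exists (size u - i)%N; rewrite rev_rot rotrE size_rev.
have refl : reflexive (@same_cycle T n).
  by move=> s; apply/same_cycleP; exists 0%N; left; rewrite rot0.
have sym (s t : n.-tuple T) : same_cycle s t -> same_cycle t s.
  move=> /same_cycleP[i H]; apply/same_cycleP.
  have K (u : seq T) : rot (size u - i) (rot i u) = u.
    by have := rotK i u; rewrite rotrE size_rot.
  case: H => E.
    by exists (size s - i)%N; left; rewrite E K.
  have [l El] := revE i (rev s); rewrite revK in El.
  by exists (size s - l)%N; right; rewrite E El -(size_rot l s) -rotrE rotK.
have trans : transitive (@same_cycle T n).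
  move=> t s u /same_cycleP[i H] /same_cycleP[j K]; apply/same_cycleP.
  case: H => Et; case: K => ->; rewrite Et.
  - by have [l ->] := addE j i s; exists l; left.
  - have [m ->] := revE i s; have [l ->] := addE j m (rev s).
    by exists l; right.
  - by have [l ->] := addE j i (rev s); exists l; right.
  - have [m ->] := revE i (rev s); rewrite revK.
    by have [l ->] := addE j m s; exists l; left.
apply/equivalence_relP; split=> // s t st u; apply/idP/idP; last exact: trans.
by apply: trans; apply: sym.
Qed.

Definition num_tight_hamilton_cycles (k : nat) (T : finType) (G : kgraph k T) :
    nat :=
  #|equivalence_partition (@same_cycle T #|T|)
      [set s | tight_hamilton_order G s]%SET|.

(* Main.v *)
Require Import Defs.
From HB Require Import structures.
From mathcomp Require Import all_boot all_order all_algebra.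
From mathcomp Require Import all_classical all_reals all_analysis.
From mathcomp Require Import zify ring lra.
From mathcomp Require Import fintype finset.

Set Implicit Arguments.
Unset Strict Implicit.
Unset Printing Implicit Defensive.

Import Order.TTheory GRing.Theory Num.Theory.

Local Open Scope ring_scope.

(** Let [x] be a perfect fractional matching of [G] of large entropy.
    - Reserve a short tight path made of absorbing blocks, into which any small set of
      leftover vertices can be inserted; a multiplicative-weights choice of the
      blocks gives every vertex linearly many absorbing blocks.
    - On the other [n] vertices, replace [x] by a matching with all weights of order
      [n^(1-k)], degrees almost 1 and almost the same entropy: truncate, and
      repair the degrees by minimising the squared defect over a box.
    - The stationary Markov chain on (k-1)-tuples with edge weights [x] gives weights
      on tight paths of large constant length [L].  Their entropy rate is at least
      [k h(x) / n] up to normalisation, since the (k-1)-tuples have at most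
      the entropy of the uniform distribution.
    - Remove such paths one after the other at random.  By Jensen's inequality, the
      logarithm of the number of outcomes is at least the expected sum of the
      entropies of the steps.  A backward induction, whose potentials are the
      quadratic deviation of the degrees and an exponential sum for the densities
      of the neighbourhoods, bounds this from below.
    - Connect the paths through the few remaining vertices and absorb the rest.  The
      data (blocks, paths, connections, insertions) are determined by the resulting
      cyclic order and the set of used blocks, which costs only a factor
      [exp (o(n))]. *)

(** * Tight walks, connectors and absorbers *)

(** The threshold 1/2 enters in two ways. Two (k-1)-sets have linearly many common neighbours, which
    gives connections and absorbers; and more than half of the vertices complete a given (k-1)-set,
    which lets surpluses outweigh deficits when the degrees are repaired.

    Weights of exact order [n^(1-k)] are wanted because all path weights then agree up to a constant
    factor: the surprisal of a single step is bounded and codegrees are [O(1/n)], which keeps the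
    degrees concentrated.

    Per vertex, a stationary chain has the entropy of a k-tuple minus that of a (k-1)-tuple.
    Bounding the latter by the uniform distribution produces the binomial coefficient; the shrinking
    of the vertex set during the process produces [- n log e].

    [L] has to be large, since each path loses its initial (k-1)-tuple, a term [log L] and a
    connector, but constant, so that the process can be compared with its ideal course.

    The process may run into states without continuation, where the logarithm of the count is
    useless. An exponentially small summand inside the logarithm gives such states a trivial bound,
    and potentials pay for it. *)

Section TightLists.

Local Open Scope nat_scope.

Variable T : finType.
Implicit Types (s x y z : seq T) (E : {set {set T}}).

(** Sequences shorter than [k] are tight, so that an arbitrary (k-1)-tuple can serve as the end of a
    path. *)
Fixpoint tight (k : nat) E s : bool :=
  if s is u :: s' then
    ((k <= size s) ==> ([set v in take k s]%SET \in E)) && tight k E s'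
  else true.

Definition link E (v : T) : {set {set T}} :=
  [set S : {set T} | (v \notin S) && (v |: S \in E)]%SET.

Lemma tight_catr k E x y : tight k E (x ++ y) -> tight k E y.
Proof. by elim: x => //= u x IH /andP[_ /IH]. Qed.

Lemma tight_small k E s : size s < k -> tight k E s.
Proof.
elim: s => //= u s IH sk; rewrite IH ?(ltnW sk)// andbT.
by rewrite leqNgt sk.
Qed.

Lemma tight_catl k E x y : tight k E (x ++ y) -> tight k E x.
Proof.
elim: x => //= u x IH /andP[h /IH ->]; rewrite andbT.
apply/implyP => kx; move: h; rewrite size_cat.
have -> : k <= (size x + size y).+1 by lia.
by rewrite /= -cat_cons takel_cat.
Qed.

Lemma tight_window k E s i : 0 < k -> tight k E s -> i + k <= size s ->
  [set v in take k (drop i s)]%SET \in E.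
Proof.
move=> k0; elim: s i => [|u s IH] i; first by move=> _ /=; lia.
case: i => [|i] /= /andP[/implyP h1 h2] h; first by rewrite ?drop0; apply: h1.
by apply: IH.
Qed.

Lemma tight_windowP k E s : 0 < k ->
  (forall i, i + k <= size s -> [set v in take k (drop i s)]%SET \in E) ->
  tight k E s.
Proof.
move=> k0; elim: s => //= u s IH h; apply/andP; split.
  by apply/implyP => ks; have := h 0 ks; rewrite drop0.
by apply: IH => i ik; have /= := h i.+1 ik.
Qed.

(** A window of [k] entries which starts in [x] ends before [z], because [y] has at least [k - 1]
    entries. *)
Lemma tight_glue k E x y z : k.-1 <= size y ->
  tight k E (x ++ y) -> tight k E (y ++ z) -> tight k E (x ++ y ++ z).
Proof.
move=> ky; elim: x => [|u x IH] //= /andP[h1 h2] h3.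
rewrite IH // andbT; apply/implyP => _.
have kxy : k <= (size (x ++ y)).+1 by rewrite size_cat; lia.
move: h1; rewrite /= kxy /= => h1.
by rewrite catA -cat_cons takel_cat.
Qed.

(** With [k - 1] entries on either side, every window of [k] entries contains [v]; without [v] it is
    a window of [x ++ y], hence an edge of the link. *)
Lemma tight_link_insert k E x y v : size x = k.-1 -> size y = k.-1 -> 1 < k ->
  tight k.-1 (link E v) (x ++ y) -> tight k E (x ++ v :: y).
Proof.
move=> sx sy k1 h; apply: tight_windowP; first by lia.
move=> i; rewrite size_cat /= sx sy => ik.
have ik' : i <= k.-1 by lia.
have := tight_window (i := i) _ h; rewrite size_cat sx sy => /(_ ltac:(lia) ltac:(lia)).
rewrite [_ \in link _ _]inE => /andP[_ h2].
suff -> : [set v0 in take k (drop i (x ++ v :: y))]%SET = (v |: [set v0 in take k.-1 (drop i (x ++ y))])%SET by [].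
apply/setP => u.
rewrite !inE !drop_cat sx.
case: (ltnP i k.-1) => ilt.
  rewrite !take_cat size_drop sx.
  have -> : k.-1 < k.-1 - i = false by lia.
  have -> : k < k.-1 - i = false by lia.
  have -> : k - (k.-1 - i) = (k.-1 - (k.-1 - i)).+1 by lia.
  by rewrite /= !mem_cat inE orbCA.
have -> : i = k.-1 by lia.
rewrite subnn !drop0 [in RHS]/=; by case: (k) k1 sy => //= k' _ sy.
Qed.

Definition chunks_with (ss : seq (seq T)) (cs : seq T) (last_chunk : seq T) :=
  foldr (fun p acc => p.1 ++ p.2 :: acc) last_chunk (zip ss cs).

(** The chunks have [k - 1] entries, so a window of [k] entries contains exactly one interleaved
    vertex [c], and deleting [c] leaves a window of the uninterrupted walk, which is tight in the
    link of [c]. *)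
Lemma tight_interleave k E ss cs t : 1 < k ->
  size ss = size cs -> all (fun s => size s == k.-1) ss -> size t = k.-1 ->
  all (fun c => tight k.-1 (link E c) (flatten ss ++ t)) cs ->
  tight k E (chunks_with ss cs t).
Proof.
move=> k1; elim: ss cs => [|s ss IH] [|c cs] //=.
  by move=> _ _ st _; apply: tight_small; rewrite st; lia.
move=> [sz] /andP[/eqP ss1 sss] st /andP[h1 h2].
rewrite /chunks_with /= -/(chunks_with ss cs t).
have tl : tight k E (chunks_with ss cs t).
  apply: IH => //; apply/allP => c' /(allP h2).
  by rewrite -catA; apply: tight_catr.
(* [w] is the chunk that follows [c], or [t] at the end; windows through [c] see only [s] and
   [w]. *)
have [w [rst [sw eqw eqf]]] : exists w rst, [/\ size w = k.-1,
    chunks_with ss cs t = w ++ rst & exists r2, flatten ss ++ t = w ++ r2].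
  case: (ss) (cs) sz sss => [|s' sr] [|c' cr] //=.
    by exists t, [::]; split=> //; rewrite ?cats0//; exists [::]; rewrite cats0.
  move=> _ /andP[/eqP ss' _]; exists s', (c' :: chunks_with sr cr t).
  by split=> //; exists (flatten sr ++ t); rewrite catA.
case: eqf => r2 eqf.
rewrite eqw in tl *.
rewrite -cat_cons catA -cat_rcons.
have -> : rcons s c ++ w = s ++ c :: w by rewrite cat_rcons.
rewrite -catA cat_cons -cat_rcons.
apply: tight_glue; [by rewrite sw| |exact: tl].
rewrite cat_rcons; apply: tight_link_insert => //.
by move: h1; rewrite -catA eqf catA; apply: tight_catl.
Qed.

End TightLists.

(** * Greedy counts of tuples *)

Section Counting.

Local Open Scope nat_scope.

(** Greedy choice of the entries. Only extensions of [good] prefixes are counted; other tuples can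
    only increase the right-hand side. *)
Lemma count_tree (R : realDomainType) (X : finType) (good : seq X -> bool)
    (m : nat) (b : R) : (0 <= b)%R ->
  good [::] ->
  (forall h, size h < m -> good h ->
     (b <= #|[set x | good (rcons h x)]%SET|%:R)%R) ->
  (b ^+ m <= #|[set t : m.-tuple X | good t]%SET|%:R)%R.
Proof.
move=> b0 g0; elim: m => [|m IH] step.
  rewrite expr0 -[1%R]/(1%:R)%R ler_nat; apply/card_gt0P; exists [tuple].
  by rewrite inE.
have {}IH := IH (fun h hm => step h (ltnW hm)).
rewrite exprSr.
pose A := [set t : m.-tuple X | good t]%SET.
pose F (t : m.-tuple X) := [set x | good (rcons t x)]%SET.
have -> : #|[set t : m.+1.-tuple X | good t]%SET| = \sum_(t : m.-tuple X) #|[set x | good (rcons t x)]%SET|.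
  pose f (p : m.-tuple X * X) : m.+1.-tuple X := [tuple of rcons p.1 p.2].
  have fI : injective f.
    move=> [t x] [t' x'] /(congr1 val) /= /rcons_inj [/val_inj -> ->] //.
  have -> : [set t : m.+1.-tuple X | good t]%SET = (f @: [set p : m.-tuple X * X | good (rcons p.1 p.2)])%SET.
    apply/setP => t; rewrite inE; apply/idP/imsetP.
      move=> gt; exists ([tuple of belast (thead t) (behead t)], last (thead t) (behead t)).
        rewrite inE /= -lastI; by case/tupleP: t gt => x0 t0 /=; rewrite theadE.
      apply: val_inj => /=; rewrite -lastI.
      by case/tupleP: t gt => x0 t0 /=; rewrite theadE.
    by case=> p; rewrite inE => gp ->.
  rewrite card_imset // -sum1dep_card -(pair_big_dep predT (fun (t : m.-tuple X) x => good (rcons t x)) (fun _ _ => 1)) /=.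
  by apply: eq_bigr => t _; rewrite sum1dep_card.
rewrite (bigID (fun t : m.-tuple X => good t)) /= natrD.
apply: (@le_trans _ _ ((\sum_(t : m.-tuple X | good t) #|[set x | good (rcons t x)]%SET|)%:R)%R); last by rewrite lerDl ler0n.
rewrite natr_sum.
apply: (@le_trans _ _ (\sum_(t : m.-tuple X | good t) b)%R).
  rewrite sumr_const -mulr_natl; apply: ler_wpM2r => //.
  by move: IH; rewrite cardsE.
by apply: ler_sum => t gt; apply: step => //; rewrite size_tuple.
Qed.

Lemma card_tuples_in (T : finType) (Z : {set T}) (l : nat) :
  #|[set t : l.-tuple T | all (mem Z) t]%SET| = #|Z| ^ l.
Proof.
have cZ : #|{: {x | x \in Z}}| = #|Z| by rewrite card_sig.
rewrite -cZ -card_tuple.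
pose f (t : l.-tuple {x | x \in Z}) : l.-tuple T := [tuple of map val t].
rewrite -(card_codom (f := f)); last first.
  by move=> t t' /(congr1 val) /= /(inj_map val_inj) /val_inj.
apply: eq_card => t; rewrite inE; apply/idP/codomP.
  move=> /allP tZ.
  have zP i : tnth t i \in Z by apply: tZ; rewrite mem_tnth.
  exists [tuple exist (fun x => x \in Z) (tnth t i) (zP i) | i < l].
  by apply: eq_from_tnth => i; rewrite tnth_map tnth_mktuple.
by case=> t' ->; apply/allP => x /= /mapP[y _ ->]; exact: valP.
Qed.

Lemma card_pairs_ge (R : realDomainType) (X Y : finType) (A : pred X)
    (B : X -> pred Y) (a b : R) : (0 <= b)%R -> (a <= #|[set x | A x]%SET|%:R)%R ->
  (forall x, A x -> (b <= #|[set y | B x y]%SET|%:R)%R) ->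
  (a * b <= #|[set p : X * Y | A p.1 && B p.1 p.2]%SET|%:R)%R.
Proof.
move=> b0 ha hb.
rewrite -sum1dep_card -(pair_big_dep A B (fun _ _ => 1)) /= natr_sum.
apply: (@le_trans _ _ (\sum_(x | A x) b)%R).
  rewrite sumr_const -[X in (_ <= X)%R]mulr_natl; apply: ler_wpM2r => //.
  by move: ha; rewrite cardsE.
by apply: ler_sum => x Ax; rewrite sum1dep_card; apply: hb.
Qed.

(** The proportion of tuples which repeat an entry or meet [U] is at most [(l^2 + l |U|) / |Z|]:
    either the first entry is one of [l + |U|] excluded ones or the tail is bad. This turns counts
    of walks into counts of paths avoiding a given set. *)
Lemma card_bad_tuples (T : finType) (Z U : {set T}) (l : nat) :
  #|[set t : l.-tuple T | all (mem Z) t && ~~ (uniq t && ~~ has (mem U) t)]%SET| * #|Z|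
    <= (l * l + l * #|U|) * #|Z| ^ l.
Proof.
elim: l => [|l IH].
  rewrite [X in X * _](_ : _ = 0) //; apply/eqP; rewrite cards_eq0; apply/eqP/setP => t.
  by rewrite !inE (tuple0 t) /=.
set B := (X in X * _).
set B' := (X in X * _ <= _) in IH.
have AC := card_tuples_in Z.
have le1 : B <= B' * #|Z| + (l + #|U|) * #|Z| ^ l.
  pose f (t : l.+1.-tuple T) : T * l.-tuple T := (thead t, [tuple of behead t]).
  have fI : injective f.
    move=> t t'; case/tupleP: t => x t; case/tupleP: t' => x' t'.
    rewrite /f /= !theadE => -[-> e].
    by rewrite (val_inj e).
  rewrite /B -(card_imset _ fI).
  pose S1 := setX Z [set t : l.-tuple T | all (mem Z) t && ~~ (uniq t && ~~ has (mem U) t)]%SET.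
  pose S2 := [set p : T * l.-tuple T | (all (mem Z) p.2) && ((p.1 \in p.2) || (p.1 \in U))]%SET.
  apply: (@leq_trans #|S1 :|: S2|).
    apply: subset_leq_card; apply/subsetP => p /imsetP[t].
    case/tupleP: t => x t; rewrite inE /= => /andP[/andP[xZ tZ]] h ->.
    rewrite !inE /f /= theadE.
    have -> : [tuple of behead [tuple of x :: t]] = t by apply: val_inj.
    rewrite xZ tZ /=; move: h; rewrite negb_and negbK !negb_and !negbK.
    by case: (x \in t) => /=; rewrite ?orbT //; case: (uniq t); case: (has _ _) => //=; rewrite ?orbT ?orbF //= ?orbT.
  apply: (leq_trans (leq_card_setU _ _)); rewrite cardsX mulnC leq_add2l.
  rewrite /S2 -sum1dep_card.
  rewrite (eq_bigl (fun p : T * l.-tuple T => ((p.1 \in p.2) || (p.1 \in U)) && all (mem Z) p.2)); last by move=> p; rewrite andbC.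
  rewrite -(pair_big_dep predT (fun x (t : l.-tuple T) => ((x \in t) || (x \in U)) && all (mem Z) t) (fun _ _ => 1)) /=.
  rewrite (exchange_big_dep (fun t : l.-tuple T => all (mem Z) t)) /=; last by move=> ? ? _ /andP[].
  rewrite -(AC l) -sum1dep_card mulnC big_distrl /=.
  rewrite [X in _ <= X](eq_bigl (fun t : l.-tuple T => all (mem Z) t)) //.
  apply: leq_sum => t _; rewrite mul1n sum1dep_card.
  apply: (@leq_trans #|[set x in t] :|: U|).
    by apply: subset_leq_card; apply/subsetP => x; rewrite !inE => /andP[].
  apply: (leq_trans (leq_card_setU _ _)); rewrite leq_add2r cardsE.
  by apply: (leq_trans (card_size _)); rewrite size_tuple.
apply: (@leq_trans ((B' * #|Z| + (l + #|U|) * #|Z| ^ l) * #|Z|)).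
  by rewrite leq_mul2r le1 orbT.
rewrite mulnDl expnS.
apply: (@leq_trans ((l * l + l * #|U|) * #|Z| ^ l * #|Z| + (l + #|U|) * #|Z| ^ l * #|Z|)).
  by rewrite leq_add2r leq_mul2r IH orbT.
set q := #|Z| ^ l; nia.
Qed.

End Counting.

(** * Connecting two (k-1)-tuples by many tight walks *)

Section Connect.

Local Open Scope nat_scope.

Lemma uniform_uniq (T : finType) k (E : {set {set T}}) (s : seq T) :
  (forall e, e \in E -> #|e| = k) -> [set v in s]%SET \in E -> size s <= k -> uniq s.
Proof.
move=> Ek /Ek; rewrite cardsE => h sk; apply/card_uniqP.
by apply/eqP; rewrite eqn_leq card_size h.
Qed.

(** The entries may repeat and may meet other pieces; [card_bad_tuples] later removes such
    tuples. *)
Definition connectors (T : finType) k (E : {set {set T}}) (Z : {set T}) a b l :=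
  [set u : l.-tuple T | all (mem Z) u && tight k E (a ++ u ++ b)]%SET.

(** [F] holds the vertices whose links have been taken: the edges of an iterated link avoid them,
    and the codegree condition is asked only of sets disjoint from [F]. *)
Definition dirac_on (R : numDomainType) (T : finType) k (d : R)
    (E : {set {set T}}) (Z F : {set T}) : Prop :=
  [/\ forall e : {set T}, e \in E -> #|e| = k,
      forall e : {set T}, e \in E -> [disjoint e & F] &
      forall S : {set T}, #|S| = k.-1 -> [disjoint S & F] ->
        (d * #|Z|%:R <= #|[set v in Z | v |: S \in E]%SET|%:R)%R].

Lemma set_consE (T : finType) (x : T) s : [set v in x :: s]%SET = (x |: [set v in s])%SET.
Proof. by apply/setP => v; rewrite !inE. Qed.

Lemma set_rconsE (T : finType) (x : T) s : [set v in rcons s x]%SET = (x |: [set v in s])%SET.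
Proof. by apply/setP => v; rewrite !inE mem_rcons inE. Qed.

Lemma card_set_uniq (T : finType) (s : seq T) : uniq s -> #|[set v in s]%SET| = size s.
Proof. by move=> us; rewrite cardsE; apply/card_uniqP. Qed.

Lemma disjoint_set_seq (T : finType) (s : seq T) (F : {set T}) :
  [disjoint [set v in s]%SET & F] = ~~ has (mem F) s.
Proof.
apply/pred0P/hasPn => h x.
  by move=> xs; have := h x; rewrite /= !inE xs /= => ->.
by rewrite /= !inE; case xs: (x \in s) => //=; apply/negbTE/h.
Qed.

Lemma connectors_cons (T : finType) k (E : {set {set T}}) (Z : {set T}) a0 a b l :
  size a = k.-2 -> 1 < k -> size b = k.-1 ->
  #|connectors k E Z (a0 :: a) b l.+1| =
  \sum_(x in Z | x |: [set v in a0 :: a] \in E) #|connectors k E Z (rcons a x) b l|.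
Proof.
move=> sa k1 sb.
pose f (p : T * l.-tuple T) : l.+1.-tuple T := [tuple of p.1 :: p.2].
have fI : injective f.
  by move=> [x t] [x' t'] /(congr1 val) [-> /val_inj ->].
have -> : connectors k E Z (a0 :: a) b l.+1 =
   (f @: [set p : T * l.-tuple T | ((p.1 \in Z) && (p.1 |: [set v in a0 :: a] \in E)) && (p.2 \in connectors k E Z (rcons a p.1) b l)])%SET.
  have key x (t : l.-tuple T) : ([tuple of x :: t] \in connectors k E Z (a0 :: a) b l.+1) =
     ((x \in Z) && (x |: [set v in a0 :: a] \in E)%SET) && (t \in connectors k E Z (rcons a x) b l).
    rewrite !inE /=.
    have -> : k <= (size (a ++ x :: t ++ b)).+1 by rewrite size_cat /= size_cat sa sb; lia.
    have -> : take k (a0 :: a ++ x :: t ++ b) = rcons (a0 :: a) x.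
      rewrite -cat_cons -cat_rcons take_size_cat //= size_rcons sa; lia.
    rewrite set_rconsE cat_rcons /=.
    by rewrite -!andbA; congr (_ && _); rewrite andbCA; congr (_ && _).
  apply/setP => u; apply/idP/imsetP.
    case/tupleP: u => x t; rewrite key => h; exists (x, t) => //; by rewrite inE.
  by case=> -[x t]; rewrite inE => h ->; rewrite /f key.
rewrite card_imset // -sum1dep_card.
rewrite -(pair_big_dep (fun x => (x \in Z) && (x |: [set v in a0 :: a] \in E)%SET) (fun x t => t \in connectors k E Z (rcons a x) b l) (fun _ _ => 1)) /=.
by apply: eq_bigr => x _; rewrite sum1_card.
Qed.

(** The hypergraph is quantified inside, since the induction on [k] applies the property to links of
    vertices, with the same [Z]. *)
Definition connects (R : numDomainType) k (d : R) l (beta : R) : Prop :=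
  forall (T : finType) (E : {set {set T}}) (Z F : {set T}) (a b : seq T),
    dirac_on k d E Z F -> size a = k.-1 -> size b = k.-1 -> uniq a -> uniq b ->
    ~~ has (mem F) a -> ~~ has (mem F) b ->
    (beta * #|Z|%:R ^+ l <= #|connectors k E Z a b l|%:R)%R.

(** The first vertex [x] of the connector has at least [d |Z|] choices, each of which shifts the
    starting tuple from [a0 :: a] to [rcons a x]. *)
Lemma connects_succ (R : realFieldType) k (d : R) l beta : 1 < k -> (0 <= d)%R -> (0 <= beta)%R ->
  connects k d l beta -> connects k d l.+1 (d * beta)%R.
Proof.
move=> k1 d0 b0 H T E Z F [|a0 a] b /[dup] D [Ek EF Ed] sa sb ua ub aF bF.
  by move: sa => /=; lia.
have sa' : size a = k.-2 by move: sa => /=; lia.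
rewrite connectors_cons //.
rewrite natr_sum.
apply: (@le_trans _ _ (\sum_(x in Z | x |: [set v in a0 :: a] \in E) (beta * #|Z|%:R ^+ l))%R).
  rewrite sumr_const -[X in (_ <= X)%R]mulr_natl exprS.
  rewrite mulrACA.
  apply: ler_wpM2r; first by rewrite mulr_ge0 // exprn_ge0.
  apply: (le_trans (Ed [set v in a0 :: a]%SET _ _)); last 1 first.
  - by rewrite ler_nat subset_leq_card //; apply/subsetP => x; rewrite inE.
  - by rewrite card_set_uniq.
  - by rewrite disjoint_set_seq.
apply: ler_sum => x /andP[xZ xE].
have us : uniq (rcons (a0 :: a) x).
  apply: (uniform_uniq Ek); first by rewrite set_rconsE.
  by rewrite size_rcons /= sa'; lia.
have k2 : (k.-2).+1 = k.-1 by move: k1; clear; lia.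
apply: (H _ _ _ F) => //; first by rewrite size_rcons sa'.
  by move: us; rewrite rcons_cons /= => /andP[].
have := EF _ xE; rewrite -set_rconsE disjoint_set_seq rcons_cons /=.
by rewrite negb_or => /andP[].
Qed.

Lemma common_nbrs (R : realFieldType) (T : finType) k (eta : R) (E : {set {set T}}) (Z F : {set T}) (S S' : {set T}) :
  dirac_on k (1 / 2 + eta)%R E Z F -> #|S| = k.-1 -> #|S'| = k.-1 -> [disjoint S & F] -> [disjoint S' & F] ->
  (2 * eta * #|Z|%:R <= #|[set v in Z | (v |: S \in E) && (v |: S' \in E)]%SET|%:R)%R.
Proof.
case=> _ _ Ed cS cS' SF SF'.
have h1 := Ed _ cS SF; have h2 := Ed _ cS' SF'.
set A := [set v in Z | v |: S \in E]%SET in h1; set B := [set v in Z | v |: S' \in E]%SET in h2.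
have -> : [set v in Z | (v |: S \in E) && (v |: S' \in E)]%SET = A :&: B.
  by apply/setP => v; rewrite !inE; case: (v \in Z) => //=.
have := cardsUI A B.
have AB : #|A :|: B| <= #|Z|.
  by apply: subset_leq_card; apply/subsetP => v; rewrite !inE => /orP[]/andP[].
move=> e; have {}e : (#|A :|: B|%:R + #|A :&: B|%:R = #|A|%:R + #|B|%:R :> R)%R by rewrite -!natrD e.
have {}AB : (#|A :|: B|%:R <= #|Z|%:R :> R)%R by rewrite ler_nat.
lra.
Qed.

Lemma connects_2 (R : realFieldType) (eta : R) : connects 2 (1 / 2 + eta)%R 1 (2 * eta)%R.
Proof.
move=> T E Z F [|a [|? ?]] // [|b [|? ?]] //= D _ _ _ _; rewrite !orbF => aF bF.
rewrite expr1.
have := common_nbrs (S := [set a]%SET) (S' := [set b]%SET) D; rewrite !cards1 => /(_ erefl erefl).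
rewrite !disjoints1 => /(_ aF bF) /le_trans; apply.
rewrite ler_nat -(card_imset (f := fun v : T => [tuple v])); last by move=> x y [].
apply: subset_leq_card; apply/subsetP => u /imsetP[v]; rewrite !inE => /and3P[vZ va vb] ->.
rewrite /= vZ /= !set_consE.
have -> : [set v0 in [::]] = set0 :> {set T} by apply/setP => w; rewrite !inE.
by rewrite setU0 setUC va /= setU0 vb.
Qed.

Lemma chunks_with_cat (T : finType) (ss : seq (seq T)) cs t :
  chunks_with ss cs t = chunks_with ss cs [::] ++ t.
Proof.
rewrite /chunks_with; elim: (zip ss cs) => //= p l ->; by rewrite -catA.
Qed.

Lemma size_chunks_with (T : finType) (ss : seq (seq T)) (cs : seq T) :
  size ss = size cs -> size (chunks_with ss cs [::]) = size (flatten ss) + size cs.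
Proof.
elim: ss cs => [|s ss IH] [|c cs] //= [h]; rewrite /chunks_with /= -/(chunks_with ss cs [::]).
by rewrite !size_cat /= IH // addnS addnA addnS.
Qed.

Lemma chunks_with_inj (T : finType) (ss ss' : seq (seq T)) (cs cs' : seq T) :
  size ss = size cs -> size ss' = size cs' -> shape ss = shape ss' ->
  chunks_with ss cs [::] = chunks_with ss' cs' [::] -> ss = ss' /\ cs = cs'.
Proof.
elim: ss ss' cs cs' => [|s ss IH] [|s' ss'] [|c cs] [|c' cs'] //= [h] [h'] [e1 e2].
rewrite /chunks_with /= -/(chunks_with ss cs [::]) -/(chunks_with ss' cs' [::]).
move/eqP; rewrite eqseq_cat // => /andP[/eqP -> /eqP [-> e]].
by have [-> ->] := IH _ _ _ h h' e2 e.
Qed.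

Lemma mem_chunks_with (T : finType) (A : {set T}) (ss : seq (seq T)) (cs : seq T) :
  all (mem A) (flatten ss) -> all (mem A) cs -> all (mem A) (chunks_with ss cs [::]).
Proof.
elim: ss cs => [|s ss IH] [|c cs] //=; rewrite all_cat => /andP[h1 h2] /andP[h3 h4].
by rewrite /chunks_with /= -/(chunks_with ss cs [::]) all_cat h1 /= h3 IH.
Qed.

(** Double counting: there are at least [2 p q |A| |B|] related pairs, and the elements [y] with few
    partners account for at most [p q |A| |B|] of them. *)
Lemma popular (R : realFieldType) (X Y : finType) (A : {set X}) (B : {set Y}) (r : X -> Y -> bool) (p q : R) :
  (0 <= q)%R -> (0 <= p)%R -> (0 < #|A|)%N ->
  (2 * p * #|A|%:R <= #|[set x in A | q * #|B|%:R <= #|[set y in B | r x y]|%:R :> R]|%:R)%R ->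
  (p * q * #|B|%:R <= #|[set y in B | p * q * #|A|%:R <= #|[set x in A | r x y]|%:R :> R]|%:R)%R.
Proof.
move=> q0 p0 A0 h.
set P := [set y in B | _]%SET.
have e : (\sum_(x in A) #|[set y in B | r x y]|%:R = \sum_(y in B) #|[set x in A | r x y]|%:R :> R)%R.
  transitivity (\sum_(x in A) \sum_(y in B | r x y) (1 : R))%R.
    by apply: eq_bigr => x xA; rewrite sumr_const; congr (_%:R)%R; apply: eq_card => y; rewrite !inE.
  rewrite (exchange_big_dep (mem B)) /=; last by move=> ? ? ? /andP[].
  apply: eq_bigr => y yB; rewrite sumr_const; congr (_%:R)%R; apply: eq_card => x.
  by rewrite [RHS]inE unfold_in yB.
have lo : (2 * p * #|A|%:R * (q * #|B|%:R) <= \sum_(x in A) #|[set y in B | r x y]|%:R)%R.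
  rewrite (bigID (fun x => (q * #|B|%:R <= #|[set y in B | r x y]|%:R :> R)%R)) /=.
  apply: (@le_trans _ _ (\sum_(x in A | (q * #|B|%:R <= #|[set y in B | r x y]|%:R :> R)%R) (q * #|B|%:R))%R).
    rewrite sumr_const -[X in (_ <= X)%R]mulr_natl; apply: ler_wpM2r; first by rewrite mulr_ge0.
    by move: h; rewrite cardsE.
  rewrite -[X in (X <= _)%R]addr0; apply: lerD; first by apply: ler_sum => x /andP[].
  by apply: sumr_ge0.
have hi : (\sum_(y in B) #|[set x in A | r x y]|%:R <= #|P|%:R * #|A|%:R + #|B|%:R * (p * q * #|A|%:R))%R.
  rewrite (bigID (fun y => (p * q * #|A|%:R <= #|[set x in A | r x y]|%:R :> R)%R)) /=.
  apply: lerD.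
    apply: (@le_trans _ _ (\sum_(y in B | (p * q * #|A|%:R <= #|[set x in A | r x y]|%:R :> R)%R) #|A|%:R)%R).
      by apply: ler_sum => y _; rewrite ler_nat subset_leq_card //; apply/subsetP => x; rewrite inE => /andP[].
    by rewrite sumr_const -[X in (X <= _)%R]mulr_natl /P cardsE.
  apply: (@le_trans _ _ (\sum_(y in B | ~~ (p * q * #|A|%:R <= #|[set x in A | r x y]|%:R :> R)%R) (p * q * #|A|%:R))%R).
    by apply: ler_sum => y /andP[_]; rewrite -ltNge => /ltW.
  rewrite sumr_const -[X in (X <= _)%R]mulr_natl; apply: ler_wpM2r; first by rewrite !mulr_ge0.
  by rewrite ler_nat subset_leq_card //; apply/subsetP => x; rewrite unfold_in => /andP[].
have A0' : (0 < #|A|%:R :> R)%R by rewrite ltr0n.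
rewrite -(ler_pM2r A0'); rewrite e in lo.
lra.
Qed.


Lemma flatten_reshape_nseq (T : finType) k r (u : seq T) :
  size u = r * k -> flatten (reshape (nseq r k) u) = u.
Proof. by move=> su; rewrite reshapeKr // sumn_nseq mulnC su. Qed.

(* A walk in the link of one vertex [c] becomes a tight walk of [E] once vertices
   are interleaved with its chunks.  Averaging over [c] produces many chunk
   sequences each of which lies in the links of linearly many vertices, so that the
   interleaved vertices can be chosen freely and distinct. *)
Lemma connects_link (R : realFieldType) k (eta : R) r (beta : R) : 1 < k ->
  (0 < eta)%R -> (0 < beta)%R -> connects k (1 / 2 + eta)%R (r * k) beta ->
  connects k.+1 (1 / 2 + eta)%R (r * k + r.+1) ((eta * beta) ^+ r.+2)%R.
Proof.
move=> k1 eta0 b0 H T E Z F a b /[dup] D [Ek EF Ed] /= sa sb ua ub aF bF.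
have [Z0|Z0] := posnP #|Z|.
  by rewrite Z0 addnS expr0n /= mulr0 ler0n.
pose lnk c := (link E c).
pose r1 (c : T) (u : (r * k).-tuple T) := tight k (lnk c) (a ++ u ++ b).
pose ZT := [set u : (r * k).-tuple T | all (mem Z) u]%SET.
have cZT : #|ZT|%:R = (#|Z|%:R ^+ (r * k) :> R)%R by rewrite /ZT card_tuples_in natrX.
have aD : [disjoint [set v in a]%SET & F] by rewrite disjoint_set_seq.
have bD : [disjoint [set v in b]%SET & F] by rewrite disjoint_set_seq.
(* For a common neighbour [c] of the two end sets, both are edges of the link of [c], where the
   induction hypothesis provides many walks. *)
have hC : (2 * eta * #|Z|%:R <= #|[set c in Z | (beta * #|ZT|%:R <= #|[set u in ZT | r1 c u]|%:R :> R)%R]%SET|%:R)%R.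
  have := common_nbrs (S := [set v in a]%SET) (S' := [set v in b]%SET) D.
  rewrite !card_set_uniq // => /(_ sa sb aD bD) /le_trans; apply.
  rewrite ler_nat; apply: subset_leq_card; apply/subsetP => c; rewrite !inE => /and3P[cZ ca cb].
  rewrite cZ /=.
  have cF : c \notin F.
    by have := EF _ ca; rewrite disjoints_subset => /subsetP/(_ c); rewrite !inE eqxx => /(_ isT).
  have notin s : uniq s -> size s = k -> (c |: [set v in s])%SET \in E -> c \notin s.
    move=> us ss h; have : uniq (c :: s) by apply: (uniform_uniq Ek); rewrite ?set_consE //= ss.
    by case/andP.
  have ca' := notin _ ua sa ca; have cb' := notin _ ub sb cb.
  have Dl : dirac_on k (1 / 2 + eta)%R (lnk c) Z (c |: F).
    split.
    - move=> e; rewrite inE => /andP[ce /Ek]; by rewrite cardsU1 ce => -[].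
    - move=> e; rewrite inE => /andP[ce /EF]; rewrite !disjoints_subset => /subsetP h.
      apply/subsetP => v ve; rewrite !inE negb_or; apply/andP; split.
        by apply: contraNneq ce => <-.
      by have := h v; rewrite !inE ve orbT => /(_ isT).
    - move=> S cS; rewrite disjoints_subset => /subsetP h.
      have cnS : c \notin S by apply/negP => /h; rewrite !inE eqxx.
      have c1 : #|c |: S| = k.+1.-1 by rewrite cardsU1 cnS cS add1n prednK // ltnW.
      have d1 : [disjoint c |: S & F].
        rewrite disjoints_subset; apply/subsetP => v; rewrite !inE => /orP[/eqP ->|/h]; first by [].
        by rewrite !inE negb_or => /andP[].
      apply: (le_trans (Ed _ c1 d1)); rewrite ler_nat; apply: subset_leq_card.
      apply/subsetP => v; rewrite !inE => /andP[vZ vE]; rewrite vZ /=.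
      have vc : c != v.
        apply: contraTneq vE => <-; rewrite setUA setUid; apply/negP => /Ek; rewrite c1 /=; by move/n_Sn.
      by rewrite (negbTE vc) (negbTE cnS) /= setUCA.
  have sl : forall s : seq T, size s = k -> uniq s -> (c |: [set v in s])%SET \in E -> tight k (lnk c) s.
    move=> s ss us sE; apply: tight_windowP; first exact: ltnW.
    case=> [|i]; rewrite ss; last by rewrite addSn ltnNge leq_addl.
    move=> _; rewrite drop0 -ss take_size !inE sE andbT; exact: notin.
  rewrite /r1; clear r1 aD bD ca' cb'.
  (* In the link, of uniformity [k], the ends have [k - 1] vertices: the first vertex of [a] and the
     last vertex of [b] are dropped here and glued back afterwards. *)
  case: a sa ua aF ca => [|a0 a] sa ua aF ca; first by exfalso; move: sa k1 => /= <-.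
  case/lastP: b sb ub bF cb => [|b' bl] sb ub bF cb; first by exfalso; move: sb k1 => /= <-.
  have sa' : size a = k.-1 by rewrite -sa.
  have sb' : size b' = k.-1 by rewrite -sb size_rcons.
  have aFc : ~~ has (mem (c |: F)%SET) a.
    apply/hasPn => v va; rewrite !inE negb_or; apply/andP; split.
      apply: contraNneq (notin _ ua sa ca) => <-; by rewrite inE va orbT.
    by move/hasPn: aF; apply; rewrite inE va orbT.
  have bFc : ~~ has (mem (c |: F)%SET) b'.
    apply/hasPn => v va; rewrite !inE negb_or; apply/andP; split.
      apply: contraNneq (notin _ ub sb cb) => <-; by rewrite mem_rcons inE va orbT.
    by move/hasPn: bF; apply; rewrite mem_rcons inE va orbT.
  have ua' : uniq a by move: ua => /= /andP[].
  have ub' : uniq b' by move: ub; rewrite rcons_uniq => /andP[].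
  have := H T (lnk c) Z (c |: F)%SET a b' Dl sa' sb' ua' ub' aFc bFc.
  rewrite -cZT => /le_trans; apply; rewrite ler_nat; apply: subset_leq_card.
  apply/subsetP => u; rewrite !inE => /andP[uZ ut]; rewrite uZ /=.
  rewrite -cats1.
  have h2 : tight k (lnk c) ((a ++ u) ++ b' ++ [:: bl]).
    apply: tight_glue; rewrite ?sb' // -?catA //.
    by rewrite cats1; apply: sl.
  have h3 : tight k (lnk c) (a0 :: a) by apply: sl.
  by have := @tight_glue _ k (lnk c) [:: a0] a (u ++ b' ++ [:: bl]); rewrite sa' -catA /= in h2 *; apply.
have hp := popular (ltW b0) (ltW eta0) Z0 hC.
rewrite cZT in hp.
set P := [set y in ZT | _]%SET in hp.
(* A popular walk [u] lies in the links of all vertices of [C u]. Cut into [r] chunks of [k]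
   vertices, it has [r + 1] gaps, counting those next to [a] and [b], to be filled from [C u]. *)
pose C u := [set c in Z | r1 c u]%SET.
have hpair : ((eta * beta * #|Z|%:R ^+ (r * k)) * (eta * beta * #|Z|%:R) ^+ r.+1 <=
   #|[set p : (r * k).-tuple T * r.+1.-tuple T | (p.1 \in P) && all (mem (C p.1)) p.2]|%:R)%R.
  apply: (@card_pairs_ge _ _ _ (mem P) (fun u => (fun t : r.+1.-tuple T => all (mem (C u)) t))).
  - by rewrite exprn_ge0 // !mulr_ge0 // ?ltW.
  - by apply: (le_trans hp); rewrite ler_nat subset_leq_card //; apply/subsetP => x; rewrite inE.
  move=> u uP; have {uP} : u \in P := uP.
  rewrite inE => /andP[_ hu]; rewrite card_tuples_in natrX.
  by apply: lerXn2r => //; rewrite nnegrE ?ler0n // !mulr_ge0 // ?ltW.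
have -> : ((eta * beta) ^+ r.+2 * #|Z|%:R ^+ (r * k + r.+1) = (eta * beta * #|Z|%:R ^+ (r * k)) * (eta * beta * #|Z|%:R) ^+ r.+1)%R.
  by rewrite exprD [in RHS]exprMn [in LHS]exprS mulrACA.
apply: (le_trans hpair); rewrite ler_nat.
pose ch (u : seq T) := reshape (nseq r k) u.
have sch (u : (r * k).-tuple T) : size (ch u) = r by rewrite size_reshape size_nseq.
pose f (p : (r * k).-tuple T * r.+1.-tuple T) : seq T :=
  thead p.2 :: chunks_with (ch p.1) (behead p.2) [::].
have szf p : size (f p) == r * k + r.+1.
  rewrite /f /= size_chunks_with; last by rewrite size_behead size_tuple sch.
  by rewrite flatten_reshape_nseq ?size_tuple //= addnS.
pose g p : (r * k + r.+1).-tuple T := Tuple (szf p).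
have gI : injective g.
  move=> [u cs] [u' cs'] /(congr1 val) /=; rewrite /f /= => -[e1 e2].
  have [] := chunks_with_inj _ _ _ e2; rewrite ?size_behead ?size_tuple ?sch //.
    rewrite /ch !reshapeKl // sumn_nseq size_tuple mulnC //.
  move=> e3 e4; congr (_, _).
    apply: val_inj => /=; rewrite -(@flatten_reshape_nseq _ k r u) ?size_tuple //.
    by rewrite -(@flatten_reshape_nseq _ k r u') ?size_tuple // -/(ch _) e3.
  apply: val_inj; case/tupleP: cs e1 e4 {e2} => x cs; case/tupleP: cs' => x' cs' /=.
  by rewrite !theadE => -> ->.
rewrite -(card_imset _ gI); apply: subset_leq_card; apply/subsetP => t /imsetP[[u cs]].
rewrite inE /= => /andP[uP csC] ->.
have uZ : all (mem Z) u by move: uP; rewrite !inE => /andP[].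
have csZ : all (mem Z) cs by apply: sub_all csC => x; rewrite /= inE => /andP[].
rewrite inE; apply/andP; split.
  rewrite /= /f /=; case/tupleP: cs csC csZ => x cs _ /= /andP[xZ csZ].
  rewrite theadE xZ /=; apply: mem_chunks_with => //.
  by rewrite flatten_reshape_nseq // size_tuple.
have -> : a ++ g (u, cs) ++ b = chunks_with (a :: ch u) cs b.
  rewrite /= /f /=; case/tupleP: cs {csC csZ} => x cs /=; rewrite theadE.
  by rewrite [in RHS]/chunks_with /= -/(chunks_with (ch u) cs b) [in RHS]chunks_with_cat.
apply: tight_interleave => //=.
- by rewrite ltnS ltnW.
- by rewrite sch size_tuple.
- rewrite sa eqxx /=; apply/allP => s sin.
  have : size s \in shape (ch u) by apply/mapP; exists s.
  by rewrite /ch reshapeKl ?sumn_nseq ?size_tuple 1?mulnC // mem_nseq => /andP[_].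
apply/allP => c cc; have := allP csC _ cc; rewrite /= inE => /andP[_].
by rewrite /r1 flatten_reshape_nseq ?size_tuple // catA.
Qed.

Lemma connects_exists (R : realFieldType) k (eta : R) : 1 < k -> (0 < eta)%R ->
  exists l0, forall l, l0 <= l -> exists2 beta : R, (0 < beta)%R & connects k (1 / 2 + eta)%R l beta.
Proof.
move=> k1 eta0.
have ext k' l0 : 1 < k' -> (exists2 beta : R, (0 < beta)%R & connects k' (1 / 2 + eta)%R l0 beta) ->
    forall l, l0 <= l -> exists2 beta : R, (0 < beta)%R & connects k' (1 / 2 + eta)%R l beta.
  move=> k'1 h l; elim: l => [|l IH]; first by rewrite leqn0 => /eqP l00; move: h; rewrite l00.
  rewrite leq_eqVlt => /orP[/eqP <- //|]; rewrite ltnS => /IH[beta b0 hb].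
  have d0 : (0 < 1 / 2 + eta)%R by lra.
  exists ((1 / 2 + eta) * beta)%R; first by rewrite mulr_gt0.
  by apply: connects_succ => //; apply: ltW.
elim: k k1 => [|[|[|k]] IH] // _.
  exists 1; apply: ext => //; exists (2 * eta)%R; [lra|exact: connects_2].
have [l0 hl0] := IH isT.
(* The length is at least [l0] and a multiple of the chunk length; longer lengths follow by
   [ext]. *)
have [beta b0 hb] := hl0 (l0 * k.+2) ltac:(nia).
exists (l0 * k.+2 + l0.+1); apply: ext => //.
exists ((eta * beta) ^+ l0.+2)%R; first by rewrite exprn_gt0 // mulr_gt0.
by apply: connects_link.
Qed.

End Connect.

(** * Absorbing blocks *)

Section Absorb.

Local Open Scope nat_scope.

Lemma tight_rcons (T : finType) k (E : {set {set T}}) (h : seq T) x :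
  0 < k -> k.-1 <= size h -> tight k E h ->
  (x |: [set v in drop (size h - k.-1) h])%SET \in E -> tight k E (rcons h x).
Proof.
move=> k0 kh th hE; rewrite -{1}(cat_take_drop (size h - k.-1) h) -cats1 -catA.
apply: tight_glue; rewrite ?cat_take_drop // ?size_drop ?subKn //.
apply: tight_windowP => // i; rewrite size_cat size_drop subKn //= addn1 prednK // => ik.
have -> : i = 0 by move: ik; rewrite -{2}(add0n k) leq_add2r leqn0 => /eqP.
by rewrite drop0 take_oversize ?size_cat ?size_drop ?subKn //= ?addn1 ?prednK // cats1 set_rconsE.
Qed.

Lemma uniform_link (T : finType) k (E : {set {set T}}) (v : T) (e : {set T}) :
  (forall e, e \in E -> #|e| = k.+1) -> e \in link E v -> #|e| = k.
Proof. by move=> Ek; rewrite inE => /andP[ve /Ek]; rewrite cardsU1 ve add1n => -[]. Qed.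

(* A block consists of a connecting part of length [l] followed by two
   (k-1)-tuples, between which [v] can be inserted. *)
Definition absorbs (T : finType) k (E : {set {set T}}) l (v : T) (t : seq T) : bool :=
  tight k E (take k.-1 (drop l t) ++ v :: drop k.-1 (drop l t)).

(** The tuple has to be tight in [E], where it stands if nothing is inserted, and in the link of
    [v]. After the first entries, each new one has to complete two (k-1)-sets, and common neighbours
    leave at least [eta |T|] choices. *)
Lemma absorbers_count (R : realFieldType) (T : finType) k (eta : R) (E : {set {set T}}) v :
  1 < k -> (0 < eta < 1 / 2)%R -> 2 * k <= #|T| ->
  dirac_on k (1 / 2 + eta)%R E [set: T] set0 ->
  ((eta * #|T|%:R) ^+ (2 * k.-1) <=
    #|[set p : (2 * k.-1).-tuple T | tight k E p && tight k.-1 (link E v) p]|%:R)%R.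
Proof.
case: k => [//|k] /= k1 /andP[eta0 eta1] kn /[dup] D [Ek _ Ed].
pose good (h : seq T) := [&& tight k.+1 E h, tight k (link E v) h & (size h < k) ==> (uniq h && (v \notin h))].
have cT : #|[set: T]| = #|T| by rewrite cardsT.
apply: (@le_trans _ _ (#|[set p : (2 * k).-tuple T | good p]%SET|%:R)%R); last first.
  by rewrite ler_nat; apply: subset_leq_card; apply/subsetP => p; rewrite !inE => /and3P[-> ->].
have n0 : (0 <= #|T|%:R :> R)%R by [].
apply: count_tree; rewrite ?mulr_ge0 // ?ltW //.
  by rewrite /good /= implybT.
move=> h _ /and3P[th tl hs].
(* No full window yet: the new entry only has to be new and different from [v]. *)
have [h1|h1] := ltnP (size h).+1 k.
  have /andP[uh vh] := implyP hs (ltnW h1).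
  apply: (@le_trans _ _ (#|~: (v |: [set x in h])%SET|%:R)%R).
    have c1 : #|v |: [set x in h]%SET| <= k.
      by rewrite cardsU1 card_set_uniq // inE vh add1n ltnW.
    have : #|T| <= k + #|~: (v |: [set x in h])%SET| by rewrite -(cardsC (v |: [set x in h])%SET) leq_add2r.
    rewrite -(ler_nat R) natrD => c2; have c3 : (2 * (k%:R + 1) <= #|T|%:R :> R)%R by rewrite natr1 -natrM ler_nat.
    by clear -eta0 eta1 c2 c3 n0; nra.
  rewrite ler_nat; apply: subset_leq_card; apply/subsetP => x; rewrite !inE negb_or => /andP[xv xh].
  rewrite /good !tight_small ?size_rcons //; last by apply: ltnW.
  by rewrite /= h1 rcons_uniq uh xh mem_rcons inE negb_or eq_sym xv vh.
(* This entry completes the first edge of the link, a single condition. *)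
have [h2|h2] := ltnP (size h) k.
  have /andP[uh vh] := implyP hs h2.
  have sh : (size h).+1 = k by apply/eqP; rewrite eqn_leq h2.
  have c1 : #|v |: [set x in h]%SET| = k by rewrite cardsU1 card_set_uniq // inE vh add1n.
  have d1 : [disjoint v |: [set x in h]%SET & set0] by rewrite -setI_eq0 setI0.
  have h0 := Ed _ c1 d1; rewrite cT in h0.
  apply: (@le_trans _ _ ((1 / 2 + eta) * #|T|%:R)%R); first by clear -eta0 n0; nra.
  apply: (le_trans h0).
  rewrite ler_nat; apply: subset_leq_card; apply/subsetP => x; rewrite !inE /= => xE.
  have ux : uniq (x :: v :: h).
    by apply: (uniform_uniq Ek); rewrite ?set_consE //= sh.
  rewrite /good tight_small ?size_rcons ?sh //=; apply/andP; split; last by rewrite ltnn.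
  apply: (tight_rcons k1 _ (tight_small _ h2)); first by rewrite -sh.
  rewrite -sh /= subnn drop0 !inE; move: ux; rewrite /= inE negb_or => /and3P[/andP[xv _] vh' _].
  by rewrite negb_or eq_sym xv vh' /= setUCA.
(* From here on the new entry has to complete both an edge of [E] and an edge of the link. *)
set s := drop (size h - k) h; set s' := drop (size h - k.-1) h.
have ss : size s = k by rewrite size_drop subKn.
have sE : [set x in s] \in link E v.
  have := tight_window (i := size h - k) _ tl; rewrite -/s subnK // => /(_ k1 (leqnn _)).
  by rewrite -{1}ss take_size.
have us : uniq s.
  have Ek' := fun e => @uniform_link T k E v e Ek.
  by apply: (uniform_uniq Ek' sE); rewrite ss.
have cs : #|[set x in s]%SET| = k by rewrite card_set_uniq.
have s'E : s' = behead s.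
  rewrite /s /s'; have -> : size h - k.-1 = (size h - k).+1 by move: k1 h2; clear; lia.
  by rewrite -add1n -drop_drop drop1.
have vs : v \notin s by move: sE; rewrite !inE => /andP[].
have sub s0 : s0 \in behead s -> s0 \in s by apply: mem_behead.
have c2 : #|v |: [set x in s']%SET| = k.
  rewrite cardsU1 s'E card_set_uniq ?inE; last by rewrite -drop1 drop_uniq.
  rewrite (contra (@sub v) vs) add1n size_behead ss prednK //; exact: k1.
have dj (S : {set T}) : [disjoint S & set0] by rewrite -setI_eq0 setI0.
have h0 := common_nbrs D cs c2 (dj _) (dj _); rewrite cT in h0.
apply: (@le_trans _ _ (2 * eta * #|T|%:R)%R); first by clear -eta0 n0; nra.
apply: (le_trans h0).
rewrite ler_nat; apply: subset_leq_card; apply/subsetP => x; rewrite !inE /= => /andP[x1 x2].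
have ux : uniq (x :: v :: s').
  apply: (uniform_uniq Ek); rewrite ?set_consE //= s'E size_behead ss ltnS prednK //; exact: k1.
apply/and3P; split.
- by apply: tight_rcons => //=.
- apply: tight_rcons => //.
    by apply: leq_trans h2; apply: leq_pred.
  rewrite -/s' !inE; move: ux; rewrite /= inE negb_or => /and3P[/andP[xv _] vh' _].
  by rewrite negb_or eq_sym xv vh' /= setUCA.
by rewrite size_rcons ltnNge (leq_trans h2).
Qed.

(** A connector of constant length joins the end [e] of the current path to an absorber. So,
    uniformly in [v], a fixed proportion of all tuples extends the path and absorbs [v]. *)
Lemma absorb_density (R : realFieldType) k (eta : R) : 1 < k -> (0 < eta < 1 / 2)%R ->
  exists l (beta : R), [/\ 0 < l, (0 < beta <= 1)%R &
    forall (T : finType) (E : {set {set T}}) (e : seq T) (v : T),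
      dirac_on k (1 / 2 + eta)%R E [set: T] set0 -> 2 * k <= #|T| ->
      size e = k.-1 -> uniq e ->
      (beta * #|T|%:R ^+ (l + 2 * k.-1) <=
       #|[set t : (l + 2 * k.-1).-tuple T | tight k E (e ++ t) && absorbs k E l v t]|%:R)%R].
Proof.
move=> k1 /[dup] eta01 /andP[eta0 eta1].
have [l0 hl] := connects_exists k1 eta0.
have [beta0 b00 hb] := hl l0.+1 (leqnSn _).
exists l0.+1; set l := l0.+1.
pose beta1 := (beta0 * eta ^+ (2 * k.-1))%R.
have b10 : (0 < beta1)%R by rewrite mulr_gt0 // exprn_gt0.
exists (Order.min beta1 1)%R; split => //.
  by rewrite lt_min b10 ltr01 ge_min lexx orbT.
move=> T E e v D kn se ue.
apply: (@le_trans _ _ (beta1 * #|T|%:R ^+ (l + 2 * k.-1))%R).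
  by apply: ler_wpM2r; rewrite ?exprn_ge0 // ge_min lexx.
have D' := D; case: D' => Ek _ _.
have hA := absorbers_count v k1 eta01 kn D.
pose A := [set p : (2 * k.-1).-tuple T | tight k E p && tight k.-1 (link E v) p]%SET.
have cT : #|[set: T]| = #|T| by rewrite cardsT.
have kk : k.-1 <= 2 * k.-1 by rewrite mul2n -addnn leq_addr.
have u1 (p : (2 * k.-1).-tuple T) : p \in A -> size (take k.-1 p) = k.-1 /\ uniq (take k.-1 p).
  rewrite inE => /andP[_ tl].
  have sz : size (take k.-1 p) = k.-1 by rewrite size_takel // size_tuple.
  split=> //.
  have := tight_window (i := 0) _ tl; rewrite drop0 size_tuple add0n => /(_ ltac:(by case: (k) k1 => [|[|?]]) kk) hE.
  apply: (@uniform_uniq _ k.-1 (link E v)) hE _; last by rewrite sz.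
  by move=> e'; apply: uniform_link; move=> e''; rewrite prednK; [exact: Ek|exact: ltnW].
have hpair := card_pairs_ge (A := mem A) (B := fun p : (2 * k.-1).-tuple T => (fun c : l.-tuple T => c \in connectors k E [set: T] e (take k.-1 p) l))
   (a := ((eta * #|T|%:R) ^+ (2 * k.-1))%R) (b := (beta0 * #|T|%:R ^+ l)%R).
have {}hpair : ((eta * #|T|%:R) ^+ (2 * k.-1) * (beta0 * #|T|%:R ^+ l) <=
    #|[set p : (2 * k.-1).-tuple T * l.-tuple T | (p.1 \in A) && (p.2 \in connectors k E [set: T] e (take k.-1 p.1) l)]|%:R)%R.
  apply: hpair; first by rewrite mulr_ge0 ?exprn_ge0 // ltW.
    by apply: (le_trans hA); rewrite ler_nat subset_leq_card //; apply/subsetP => p; rewrite [in X in _ -> X]inE.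
  move=> p pA; have [sz uz] := u1 _ pA.
  apply: (@le_trans _ _ (#|connectors k E [set: T] e (take k.-1 p) l|%:R)%R).
    by rewrite -cT; apply: (hb _ _ _ set0) => //; apply/hasPn => x; rewrite !inE.
  by rewrite ler_nat subset_leq_card //; apply/subsetP => c; rewrite [in X in _ -> X]inE.
have -> : (beta1 * #|T|%:R ^+ (l + 2 * k.-1) = (eta * #|T|%:R) ^+ (2 * k.-1) * (beta0 * #|T|%:R ^+ l))%R.
  rewrite /beta1 exprD [in RHS]exprMn.
  by move: (#|T|%:R ^+ l)%R (#|T|%:R ^+ (2 * k.-1))%R (eta ^+ (2 * k.-1))%R => x y z; ring.
apply: (le_trans hpair); rewrite ler_nat.
pose f (p : (2 * k.-1).-tuple T * l.-tuple T) : (l + 2 * k.-1).-tuple T := [tuple of p.2 ++ p.1].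
have fI : injective f.
  move=> [p c] [p' c'] /(congr1 val) /= /eqP; rewrite eqseq_cat ?size_tuple // => /andP[/eqP e1 /eqP e2].
  by rewrite (val_inj e1) (val_inj e2).
rewrite -(card_imset _ fI); apply: subset_leq_card; apply/subsetP => t /imsetP[[p c]].
rewrite inE /= => /andP[pA cC] ->.
have [sz uz] := u1 _ pA.
move: pA cC; rewrite !inE => /andP[tp tl] /andP[_ tc].
apply/andP; split.
  have -> : e ++ f (p, c) = (e ++ c) ++ take k.-1 p ++ drop k.-1 p by rewrite cat_take_drop /= catA.
  by apply: tight_glue; rewrite ?sz // ?cat_take_drop // -catA.
rewrite /absorbs /= drop_size_cat ?size_tuple //.
apply: tight_link_insert => //; last by rewrite cat_take_drop.
by rewrite size_drop size_tuple mul2n -addnn addnK.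
Qed.

Definition flat (X : finType) s (h : seq (s.-tuple X)) : seq X := flatten [seq val t | t <- h].

Lemma size_flat (X : finType) s (h : seq (s.-tuple X)) : size (flat h) = size h * s.
Proof.
rewrite /flat; elim: h => //= t h IH; by rewrite size_cat IH size_tuple mulSn.
Qed.

Lemma flat_rcons (X : finType) s (h : seq (s.-tuple X)) t : flat (rcons h t) = flat h ++ t.
Proof. by rewrite /flat map_rcons flatten_rcons. Qed.

(* Multiplicative weights: a choice of blocks for which the potential
   sum_v 2^-(number of blocks absorbing v) decays geometrically. *)
Lemma absorbing_blocks (R : realType) k (eta : R) : 1 < k -> (0 < eta < 1 / 2)%R ->
  exists l (c theta rho : R), [/\ 0 < l, (0 < c)%R, (0 < theta)%R & (0 < rho < 1)%R] /\
  exists n0, forall (T : finType) (E : {set {set T}}) (e0 : seq T) M,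
    dirac_on k (1 / 2 + eta)%R E [set: T] set0 -> n0 <= #|T| ->
    size e0 = k.-1 -> uniq e0 -> ((M * (l + 2 * k.-1))%:R <= theta * #|T|%:R)%R ->
    ((c * #|T|%:R ^+ (l + 2 * k.-1)) ^+ M <=
      #|[set bs : M.-tuple ((l + 2 * k.-1).-tuple T) |
          [&& uniq (e0 ++ flat bs), tight k E (e0 ++ flat bs) &
           [forall v, (1 / 2) ^+ count (absorbs k E l v) (map val bs) <= #|T|%:R * rho ^+ M :> R]]]|%:R)%R.
Proof.
move=> k1 eta01.
have [l [beta [l0 /andP[b0 b1] hab]]] := absorb_density k1 eta01.
exists l; set s := l + 2 * k.-1.
have s0 : 0 < s by rewrite /s addn_gt0 l0.
(* A proportion [beta] of the tuples extends the path and absorbs [v]; by the choice of [theta],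
   repeated or used vertices spoil at most [beta / 2]. Halving a term on the other [beta / 2] gains
   [beta / 4] on average, and half of this gain is kept as the guaranteed factor. *)
exists (beta / 8)%R, (beta / (4 * s%:R))%R, (1 - beta / 8)%R; split.
  by split=> //; rewrite ?divr_gt0 ?mulr_gt0 ?ltr0n //; apply/andP; split; lra.
pose n0 := (Num.bound (4 * (s * (s + k))%:R / beta)%R + 2 * k)%N.
exists n0 => T E e0 M D nn se0 ue0 hM.
set n := #|T|; pose N := (n%:R ^+ s : R)%R.
have s0R : (0 < s%:R :> R)%R by rewrite ltr0n.
have kn : 2 * k <= n by apply: leq_trans nn; rewrite leq_addl.
have n1 : (0 < n%:R :> R)%R by rewrite ltr0n (leq_trans _ kn) // mul2n double_gt0 (ltnW k1).
have N0 : (0 < N)%R by rewrite exprn_gt0.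
have nbig : (4 * (s * (s + k))%:R <= beta * n%:R :> R)%R.
  have hb0 : (4 * (s * (s + k))%:R / beta <= n%:R :> R)%R.
    apply: ltW; apply: (lt_le_trans (archi_boundP _)); first by rewrite divr_ge0 ?mulr_ge0 // ltW.
    by rewrite ler_nat (leq_trans _ nn) // leq_addr.
  by move: hb0; rewrite ler_pdivrMr // [(n%:R * _)%R]mulrC.
pose Xi (h : seq (s.-tuple T)) : R := (\sum_(v : T) (1 / 2) ^+ count (absorbs k E l v) (map val h))%R.
pose rho : R := (1 - beta / 8)%R.
pose good (h : seq (s.-tuple T)) := [&& uniq (e0 ++ flat h), tight k E (e0 ++ flat h) & (Xi h <= n%:R * rho ^+ size h)%R].
have half0 : (0 <= 1 / 2 :> R)%R by lra.
apply: (@le_trans _ _ (#|[set bs : M.-tuple (s.-tuple T) | good bs]|%:R)%R); last first.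
  rewrite ler_nat; apply: subset_leq_card; apply/subsetP => bs; rewrite !inE => /and3P[-> -> hX] /=.
  apply/forallP => v; move: hX; rewrite size_tuple; apply: le_trans.
  by rewrite /Xi (bigD1 v) //= lerDl; apply: sumr_ge0 => *; rewrite exprn_ge0.
apply: count_tree; rewrite ?mulr_ge0 ?exprn_ge0 ?divr_ge0 ?ltW //.
  rewrite /good /flat /= cats0 ue0 tight_small ?se0 ?prednK ?(ltnW k1) //= expr0 mulr1 /Xi.
  by under eq_bigr do rewrite expr0; rewrite sumr_const.
move=> h hM' /and3P[uh th hX].
set pre := e0 ++ flat h in uh th.
have spre : size pre = k.-1 + size h * s by rewrite size_cat se0 size_flat.
set e := drop (size pre - k.-1) pre.
have se : size e = k.-1 by rewrite size_drop subKn // spre leq_addr.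
have ue : uniq e by rewrite drop_uniq.
pose Val := [set t : s.-tuple T | uniq (pre ++ t) && tight k E (pre ++ t)]%SET.
have tpre (t : s.-tuple T) : tight k E (e ++ t) -> tight k E (pre ++ t).
  move=> te; rewrite -(cat_take_drop (size pre - k.-1) pre) -catA; apply: tight_glue.
  - by rewrite se.
  - by rewrite cat_take_drop.
  - by [].
have hbad : (#|[set t : s.-tuple T | all (mem [set: T]) t && ~~ (uniq t && ~~ has (mem [set x in pre]) t)]%SET|%:R <= beta / 2 * N)%R.
  have := card_bad_tuples [set: T] [set x in pre]%SET s.
  rewrite cardsT card_set_uniq // spre -(ler_nat R) !natrM natrX -/n -/N.
  set B := (X in (X * _)%R); move=> hB.
  have h1 : ((size h * s)%:R <= beta / (4 * s%:R) * n%:R :> R)%R.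
    by apply: le_trans hM; rewrite ler_nat leq_mul2r ltnW ?orbT.
  have h2 : ((s * s + s * (k.-1 + size h * s))%:R <= beta / 2 * n%:R :> R)%R.
    have e1 : ((s * s + s * (k.-1 + size h * s))%:R <= (s * (s + k))%:R + s%:R * (size h * s)%:R :> R)%R.
      rewrite -natrM -natrD ler_nat -mulnDr -mulnDr leq_mul2l -addnA leq_add2l leq_add2r leq_pred orbT //.
    have e2 : (s%:R * (size h * s)%:R <= s%:R * (beta / (4 * s%:R) * n%:R) :> R)%R by apply: ler_wpM2l.
    have e3 : (s%:R * (beta / (4 * s%:R) * n%:R) = beta / 4 * n%:R :> R)%R by field; rewrite lt0r_neq0.
    move: nbig e1 e2; rewrite e3; clear; lra.
  rewrite -(ler_pM2r n1); apply: (le_trans hB).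
  rewrite [X in (_ <= X)%R]mulrAC; apply: ler_wpM2r; first exact: ltW.
  exact: h2.
have hv v : (beta / 2 * N <= #|[set t in Val | absorbs k E l v t]|%:R)%R.
  have h1 := hab T E e v D kn se ue.
  set A := [set t : s.-tuple T | tight k E (e ++ t) && absorbs k E l v t]%SET in h1.
  set B := [set t : s.-tuple T | _] in hbad.
  have : #|A| <= #|[set t in Val | absorbs k E l v t]%SET| + #|B|.
    apply: leq_trans (leq_card_setU _ _); apply: subset_leq_card; apply/subsetP => t.
    rewrite !inE => /andP[te ->]; rewrite (tpre _ te) !andbT /=.
    have -> : all (mem [set: T]) t by apply/allP => x; rewrite !inE.
    rewrite /= cat_uniq uh /=.
    case: (uniq t); rewrite /= ?andbF ?orbT // !andbT.
    have hh : has (mem [set x in pre]%SET) t = has (mem pre) t by apply: eq_has => x; rewrite /= inE.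
    by rewrite hh negbK orNb.
  rewrite -(ler_nat R) natrD; move: h1 hbad; rewrite -/N; clear; lra.
have cVal : (#|Val|%:R <= N)%R.
  by rewrite /N -natrX ler_nat -card_tuple max_card.
pose Gd := [set t in Val | (Xi (rcons h t) <= rho * Xi h)%R]%SET.
have Xi0 : (0 < Xi h)%R.
  have /card_gt0P[v0 _] : 0 < #|T| by rewrite -(ltr0n R).
  rewrite /Xi (bigD1 v0) //=; apply: ltr_wpDr; last by rewrite exprn_gt0 //; lra.
  by apply: sumr_ge0 => *; rewrite exprn_ge0.
(* Appending a block that absorbs [v] halves the term of [v]. *)
have up : (\sum_(t in Val) Xi (rcons h t) <= Xi h * (#|Val|%:R - beta / 4 * N))%R.
  rewrite /Xi exchange_big /= mulr_suml; apply: ler_sum => v _.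
  have -> : (\sum_(t in Val) (1 / 2) ^+ count (absorbs k E l v) (map val (rcons h t)) =
     (1 / 2) ^+ count (absorbs k E l v) (map val h) * \sum_(t in Val) (1 - 1 / 2 * (absorbs k E l v t)%:R) :> R)%R.
    rewrite mulr_sumr; apply: eq_bigr => t _; rewrite map_rcons -cats1 count_cat exprD; congr (_ * _)%R.
    by rewrite /= addn0; case: absorbs => /=; rewrite ?expr1 ?expr0; lra.
  apply: ler_wpM2l; first by rewrite exprn_ge0.
  rewrite sumrB sumr_const -mulr_sumr -natr_sum.
  have -> : (\sum_(t in Val) absorbs k E l v t)%N = #|[set t in Val | absorbs k E l v t]%SET|.
    rewrite -sum1_card [RHS](eq_bigl (fun t => (t \in Val) && absorbs k E l v t)).
      by rewrite [RHS]big_mkcondr /=; apply: eq_bigr => t _; case: absorbs.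
    by move=> t; rewrite inE.
  move: (hv v); clear; lra.
(* A tuple outside [Gd] keeps more than the factor [rho] of the potential, so the average decay
   forces [Gd] to be large. *)
have lo : ((#|Val|%:R - #|Gd|%:R) * (rho * Xi h) <= \sum_(t in Val) Xi (rcons h t))%R.
  rewrite (bigID (fun t => (Xi (rcons h t) <= rho * Xi h)%R)) /=.
  have -> : (#|Val|%:R - #|Gd|%:R = #|Val :\: Gd|%:R :> R)%R.
    have GV : Gd \subset Val by apply/subsetP => t; rewrite inE => /andP[].
    have := cardsID Gd Val; rewrite (setIidPr GV) => <-; rewrite natrD; ring.
  rewrite -[X in (X <= _)%R]add0r; apply: lerD.
    by apply: sumr_ge0 => t _; apply: sumr_ge0 => *; rewrite exprn_ge0.
  rewrite mulr_natl -sumr_const.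
  rewrite (eq_bigl (fun t => (t \in Val) && ~~ (Xi (rcons h t) <= rho * Xi h)%R)).
    by apply: ler_sum => t /andP[_]; rewrite -ltNge => /ltW.
  by move=> t; rewrite in_setD [t \in Gd]inE; case: (t \in Val); rewrite ?andbF ?andbT.
have fin : (beta / 8 * N <= #|Gd|%:R)%R.
  have h1 : ((#|Val|%:R - #|Gd|%:R) * rho <= #|Val|%:R - beta / 4 * N)%R.
    by move: (le_trans lo up); rewrite mulrA [X in (X <= _)%R]mulrC ler_pM2l.
  have G0 : (0 <= #|Gd|%:R :> R)%R by [].
  have V0 : (0 <= #|Val|%:R :> R)%R by [].
  move: h1 cVal b0 b1 G0 V0 N0; rewrite /rho; clear; nra.
apply: (le_trans fin); rewrite ler_nat; apply: subset_leq_card; apply/subsetP => t.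
rewrite !inE => /andP[/andP[ut tt] ht].
rewrite /good flat_rcons catA ut tt size_rcons /=; apply: (le_trans ht).
rewrite exprS mulrCA; apply: ler_wpM2l => //; rewrite /rho; lra.
Qed.

End Absorb.

(** * The random path removal process *)

Section Step.

Variables (R : realType) (T : finType) (L : nat) (w : L.-tuple T -> R).

Implicit Types (V : {set T}) (v u : T).

Definition inV (V : {set T}) (P : L.-tuple T) : bool := all (mem V) P.

Definition wsum (f : L.-tuple T -> R) (V : {set T}) : R := \sum_(P | inV V P) f P.

Definition wdeg (f : L.-tuple T -> R) (V : {set T}) (v : T) : R :=
  \sum_(P : L.-tuple T | inV V P && (v \in P)) f P.

(** The codegree of two vertices, written as a degree for the modified weight so that the lemmas on
    [wdeg] apply. *)
Definition wcod (V : {set T}) (v : T) : T -> R := wdeg (fun P => w P * (v \in P)%:R) V.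

Lemma wdeg_exchange f V (g : T -> R) :
  \sum_(v in V) g v * wdeg f V v = \sum_(P | inV V P) f P * \sum_(v in P) g v.
Proof.
rewrite /wdeg; under eq_bigr do rewrite mulr_sumr.
rewrite (exchange_big_dep (inV V)) /=; last by move=> v P _ /andP[].
apply: eq_bigr => P PV; rewrite mulr_sumr; apply: eq_big => [v|v _]; last by rewrite mulrC.
by rewrite PV /=; case vP: (v \in P); rewrite ?andbF ?andbT //; exact: (allP PV).
Qed.

Lemma wdeg_mem f V v : wdeg f V v = wsum (fun P => f P * (v \in P)%:R) V.
Proof.
rewrite /wsum /wdeg big_mkcondr /=; apply: eq_bigr => P _.
by case: (v \in P); rewrite ?mulr1 ?mulr0.
Qed.

Lemma wcod_sym V v u : wcod V v u = wcod V u v.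
Proof. by rewrite /wcod !wdeg_mem; apply: eq_bigr => P _; rewrite mulrAC. Qed.

Lemma wdeg_diff f V (P : L.-tuple T) v :
  wdeg f (V :\: [set x in P]%SET) v =
  wdeg f V v - wdeg (fun Q => f Q * (has (mem P) Q)%:R) V v.
Proof.
apply/eqP; rewrite eq_sym subr_eq eq_sym; apply/eqP.
rewrite /wdeg [RHS](bigID (fun Q : L.-tuple T => has (mem P) Q)) /= [RHS]addrC; congr (_ + _).
  apply: eq_bigl => Q; rewrite /inV andbAC; congr (_ && _).
  rewrite -all_predC -all_predI; apply: eq_all => x; by rewrite /= !inE andbC.
rewrite [RHS]big_mkcondr; apply: eq_bigr => Q _; by case: has; rewrite ?mulr1 ?mulr0.
Qed.

Lemma wsum_diff f V (P : L.-tuple T) :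
  wsum f (V :\: [set x in P]%SET) =
  wsum f V - wsum (fun Q => f Q * (has (mem P) Q)%:R) V.
Proof.
apply/eqP; rewrite eq_sym subr_eq eq_sym; apply/eqP.
rewrite /wsum [RHS](bigID (fun Q : L.-tuple T => has (mem P) Q)) /= [RHS]addrC; congr (_ + _).
  apply: eq_bigl => Q; rewrite /inV.
  rewrite -all_predC -all_predI; apply: eq_all => x; by rewrite /= !inE andbC.
rewrite [RHS]big_mkcondr; apply: eq_bigr => Q _; by case: has; rewrite ?mulr1 ?mulr0.
Qed.

Hypothesis w0 : forall P, 0 <= w P.
Hypothesis wu : forall P : L.-tuple T, ~~ uniq P -> w P = 0.

Lemma card_tuple_le (P : L.-tuple T) : (#|P| <= L)%N.
Proof. by apply: (leq_trans (card_size _)); rewrite size_tuple. Qed.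

Lemma wdeg_total f V : (forall P : L.-tuple T, ~~ uniq P -> f P = 0) ->
  \sum_(v in V) wdeg f V v = L%:R * wsum f V.
Proof.
move=> fu; transitivity (\sum_(v in V) 1 * wdeg f V v); first by apply: eq_bigr => *; rewrite mul1r.
rewrite wdeg_exchange /wsum mulr_sumr; apply: eq_bigr => P _.
have [uP|/fu ->] := boolP (uniq P); last by rewrite mul0r mulr0.
by rewrite sumr_const mulrC; congr (_%:R * _); have /card_uniqP -> := uP; rewrite size_tuple.
Qed.

Lemma wcod_total V v : v \in V ->
  \sum_(u in V | u != v) wcod V v u = (L%:R - 1) * wdeg w V v.
Proof.
move=> vV; have fu (P : L.-tuple T) : ~~ uniq P -> w P * (v \in P)%:R = 0 by move/wu ->; rewrite mul0r.
have := wdeg_total V fu; rewrite (bigD1 v) //= -wdeg_mem -/(wcod V v).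
have -> : wcod V v v = wdeg w V v.
  by rewrite /wcod /wdeg; apply: eq_bigr => P /andP[_ ->]; rewrite mulr1.
by move/(canRL (addKr _)) => ->; ring.
Qed.

Lemma wdeg_ge0 f V v : (forall P, 0 <= f P) -> 0 <= wdeg f V v.
Proof. by move=> f0; apply: sumr_ge0. Qed.

Section OneStep.

(** [a] and [a'] are the ideal degrees before and after the removal of one path, and [hn] stands for
    [1 / n]. *)
Variables (V : {set T}) (a a' D hn k1 ke : R).
Hypothesis hn0 : 0 < hn.
Hypothesis k10 : 0 <= k1.
Hypothesis ke0 : 0 <= ke.
Hypothesis a01 : 0 <= a <= 1.
Hypothesis D1 : 1 <= D.
Hypothesis L0 : (0 < L)%N.
Hypothesis degD : forall v, v \in V -> wdeg w V v <= D.
Hypothesis codK : forall v u, v \in V -> u \in V -> v != u -> wcod V v u <= k1 * hn.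
Hypothesis Vn : #|V|%:R * hn <= 1.
Hypothesis aa' : `|a - a'| <= ke * hn.
Hypothesis aa'2 : `|a - a' - L%:R * (L%:R - 1) * a / #|V|%:R| <= ke * hn ^+ 2.

Let x v := wdeg w V v - a.
Let Psi := \sum_(v in V) x v ^+ 2.
Let k3 := L%:R * k1 + ke.
(** First-order estimate of the degree lost by [v] with the removal of [P]: a path meeting [P] in
    several vertices is counted once for each of them. Being additive over the vertices of [P], it
    has a computable average. *)
Let Dt (P : L.-tuple T) v := \sum_(u in P | u != v) wcod V v u.

Lemma dev_bound v : v \in V -> `|x v| <= D + 1.
Proof.
move=> vV; rewrite ler_norml /x; have := degD vV; have := wdeg_ge0 V v w0.
by case/andP: a01; move: D1; lra.
Qed.

Lemma Dt_bound P v : inV V P -> v \in V -> 0 <= Dt P v <= L%:R * k1 * hn.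
Proof.
move=> PV vV; apply/andP; split.
  by apply: sumr_ge0 => u _; apply: wdeg_ge0 => Q; rewrite mulr_ge0.
apply: (@le_trans _ _ (\sum_(u in P) k1 * hn)).
  rewrite /Dt big_mkcondr /=; apply: ler_sum => u uP; case: ifP => uv; last by rewrite mulr_ge0 // ltW.
  by apply: codK => //; [exact: (allP PV)|rewrite eq_sym].
rewrite sumr_const -[X in X <= _]mulr_natl -[X in _ <= X]mulrA; apply: ler_wpM2r; first by rewrite mulr_ge0 // ltW.
by rewrite ler_nat card_tuple_le.
Qed.

(** Apart from the linear terms everything is of order [hn]: the vertices of [P] leave the sum, [Dt]
    differs little in total from the true loss [Dl], and the squared increments are of order [hn^2]
    on at most [1 / hn] vertices. *)
Lemma Psi_fixed (P : L.-tuple T) : inV V P ->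
  \sum_(v in V :\: [set y in P]%SET) (wdeg w (V :\: [set y in P]%SET) v - a') ^+ 2 <=
  Psi + \sum_(v in V) 2 * x v * (a - a' - Dt P v) +
  (2 * (D + 1) * (L%:R * k3 + L%:R ^+ 3 * k1) + k3 ^+ 2) * hn.
Proof.
move=> PV.
pose t (Q : L.-tuple T) : R := \sum_(u in P) (u \in Q)%:R.
pose Dl v := wdeg (fun Q => w Q * (has (mem P) Q)%:R) V v.
have DtE v : v \notin P -> Dt P v = wdeg (fun Q => w Q * t Q) V v.
  move=> vP; rewrite /Dt (eq_bigl (mem P)); last first.
    by move=> u /=; case uP: (u \in P) => //=; apply: contraNneq vP => <-.
  rewrite wdeg_mem /wcod; under eq_bigr do rewrite wdeg_mem.
  rewrite /wsum exchange_big /=; apply: eq_bigr => Q _.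
  rewrite -mulrA [t Q * _]mulrC mulrA /t mulr_sumr; by apply: eq_bigr.
have tn Q : exists2 m : nat, t Q = m%:R & has (mem P) Q = (0 < m)%N.
  exists (\sum_(u in P) (u \in Q))%N; first by rewrite /t natr_sum.
  apply/hasP/idP.
    case=> y yQ yP; rewrite (bigD1 y) //= yQ //.
  rewrite lt0n sum_nat_eq0 => /forallPn /= [y]; rewrite negb_imply => /andP[yP].
  by case yQ: (y \in Q) => // _; exists y.
have Dl_bound v : v \in V -> v \notin P -> 0 <= Dl v <= Dt P v.
  move=> vV vP; rewrite DtE // wdeg_ge0 /=; last by move=> Q; rewrite mulr_ge0.
  apply: ler_sum => Q _; apply: ler_wpM2l => //.
  by have [m -> ->] := tn Q; rewrite ler_nat; case: m.
(* Only paths meeting [P] at least twice contribute; [t Q ^+ 2 - t Q] counts ordered pairs of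
   distinct common vertices, so the sum is controlled by codegrees. *)
have sumD : \sum_(v in V :\: [set y in P]%SET) (Dt P v - Dl v) <= L%:R ^+ 3 * k1 * hn.
  pose f Q := w Q * (t Q ^+ 2 - t Q).
  have f0 Q : 0 <= f Q.
    by rewrite mulr_ge0 //; have [m -> _] := tn Q; rewrite subr_ge0 expr2 -natrM ler_nat; case: m => // m; rewrite leq_pmulr.
  apply: (@le_trans _ _ (\sum_(v in V) wdeg f V v)).
    rewrite [X in _ <= X](bigID (mem (V :\: [set y in P]%SET))) /= -[X in X <= _]addr0.
    apply: lerD; last by apply: sumr_ge0 => v _; apply: wdeg_ge0.
    rewrite [X in _ <= X](eq_bigl (mem (V :\: [set y in P]%SET))); last first.
      by move=> v /=; rewrite !inE; case: (v \in V); rewrite ?andbF.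
    apply: ler_sum => v; rewrite !inE => /andP[vP vV].
    rewrite DtE // /Dl -sumrB; apply: ler_sum => Q _; rewrite -mulrBr; apply: ler_wpM2l => //.
    have [m -> ->] := tn Q; rewrite expr2 -natrM; case: m => [|m]; rewrite ?subrr ?mul0n ?subrr //=.
    by rewrite mulSn natrD addrAC subrr add0r mulnS natrD; rewrite -natr1 addrK lerDl.
  apply: (@le_trans _ _ (L%:R * wsum f V)).
    rewrite (eq_bigr (fun v => 1 * wdeg f V v)); last by move=> *; rewrite mul1r.
    rewrite wdeg_exchange /wsum mulr_sumr; apply: ler_sum => Q _; rewrite mulrC; apply: ler_wpM2r => //.
    by rewrite sumr_const ler_nat card_tuple_le.
  rewrite exprS expr2 -!mulrA; apply: ler_wpM2l => //.
  have -> : wsum f V = \sum_(u in P) Dt P u.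
    rewrite /Dt /wcod.
    have E u : u \in P -> \sum_(u' in P | u' != u) wdeg (fun Q => w Q * (u \in Q)%:R) V u' =
        wsum (fun Q => w Q * ((u \in Q)%:R * (t Q - (u \in Q)%:R))) V.
      move=> uP; under eq_bigr do rewrite wdeg_mem.
      rewrite /wsum exchange_big /=; apply: eq_bigr => Q _.
      rewrite -mulr_sumr -mulrA; congr (_ * (_ * _)).
      by rewrite /t [in RHS](bigD1 u) //= addrAC subrr add0r.
    rewrite (eq_bigr _ E) /wsum exchange_big /=; apply: eq_bigr => Q _.
    rewrite /f -mulr_sumr; congr (_ * _).
    under eq_bigr do rewrite mulrBr.
    rewrite sumrB -mulr_suml -/(t Q) expr2; congr (_ - _).
    by apply: eq_bigr => u _; case: (u \in Q); rewrite ?mulr1 ?mulr0.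
  apply: (@le_trans _ _ (\sum_(u in P) (L%:R * k1 * hn))).
    by apply: ler_sum => u uP; case/andP: (Dt_bound PV (allP PV u uP)).
  rewrite sumr_const -[X in X <= _]mulr_natl -!mulrA; apply: ler_wpM2r; first by rewrite !mulr_ge0 // ltW.
  by rewrite ler_nat card_tuple_le.
have k30 : 0 <= k3 by rewrite addr_ge0 // mulr_ge0.
have al v y : v \in V -> 0 <= y <= Dt P v -> `|a - a' - y| <= k3 * hn.
  move=> vV /andP[y0 y1]; have /andP[_ y2] := Dt_bound PV vV.
  by move: aa' y0 y1 y2; rewrite /k3 !ler_norml mulrDl; lra.
have term v : v \in V ->
   (if v \in V :\: [set y in P]%SET then (wdeg w (V :\: [set y in P]%SET) v - a') ^+ 2 else 0) <=
   x v ^+ 2 + 2 * x v * (a - a' - Dt P v) +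
   (2 * (D + 1) * ((v \in P)%:R * (k3 * hn) + (if v \in V :\: [set y in P]%SET then Dt P v - Dl v else 0)) + (k3 * hn) ^+ 2).
  move=> vV; rewrite !inE vV andbT.
  have hx := dev_bound vV; have /andP[dt0 dt1] := Dt_bound PV vV.
  have k3h : 0 <= k3 * hn by rewrite mulr_ge0 // ltW.
  have [vP|vP] /= := boolP (v \in P).
    have hal := al v (Dt P v) vV; rewrite dt0 lexx in hal; have {}hal := hal isT.
    have hm : `|x v * (a - a' - Dt P v)| <= (D + 1) * (k3 * hn) by rewrite normrM ler_pM.
    have := ler_norm (- (x v * (a - a' - Dt P v))); rewrite normrN => hm2.
    have := sqr_ge0 (x v); have := sqr_ge0 (k3 * hn); move: hm hm2; lra.
  have /andP[dl0 dl1] := Dl_bound v vV vP.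
  have hal := al v (Dl v) vV; rewrite dl0 dl1 in hal; have {}hal := hal isT.
  rewrite wdeg_diff -/(Dl v) mul0r add0r.
  have -> : wdeg w V v - Dl v - a' = x v + (a - a' - Dl v) by rewrite /x; ring.
  have h1 : (a - a' - Dl v) ^+ 2 <= (k3 * hn) ^+ 2.
    by rewrite -real_normK ?num_real // lerXn2r ?nnegrE ?normr_ge0.
  have h2 : x v * (Dt P v - Dl v) <= (D + 1) * (Dt P v - Dl v).
    by apply: ler_wpM2r; [rewrite subr_ge0|apply: le_trans (ler_norm _) hx].
  by move: h1 h2; rewrite sqrrD => h1 h2; lra.
rewrite big_mkcond /= (eq_bigr (fun v => if v \in V then (if v \in V :\: [set y in P]%SET then (wdeg w (V :\: [set y in P]%SET) v - a') ^+ 2 else 0) else 0)); last first.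
  by move=> v _; rewrite !inE; case: (v \in V); rewrite ?andbF.
rewrite -big_mkcond /=; apply: (le_trans (ler_sum _ term)).
rewrite big_split /= [X in X + _ <= _]big_split /= -/Psi lerD2l.
rewrite [X in X <= _]big_split /= -mulr_sumr [X in _ * X + _ <= _]big_split /= [X in _ <= X]mulrDl.
apply: lerD.
  rewrite -[X in _ <= X]mulrA; apply: ler_wpM2l; first by move: D1; lra.
  rewrite [X in _ <= X]mulrDl; apply: lerD.
    rewrite -mulr_suml -mulrA; apply: ler_wpM2r; first by rewrite mulr_ge0 // ltW.
    rewrite -natr_sum ler_nat; apply: leq_trans (card_tuple_le P).
    rewrite -sum1_card [X in (_ <= X)%N]big_mkcond /= [X in (X <= _)%N]big_mkcond /=; apply: leq_sum => v _.
    by case: (v \in V) => //; case: (v \in P).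
  apply: le_trans sumD; rewrite [X in _ <= X]big_mkcond /= [X in X <= _]big_mkcond /=.
  by apply: ler_sum => v _; rewrite !inE; case: (v \in V); rewrite ?andbF.
rewrite sumr_const -mulr_natl exprMn [hn ^+ 2]expr2 mulrCA; apply: ler_wpM2l; first exact: sqr_ge0.
by rewrite mulrA -[X in _ <= X]mul1r; apply: ler_wpM2r => //; exact: ltW.
Qed.

(* For a random [P], the terms linear in the deviations cancel against the drift
   [a - a'], and Cauchy-Schwarz bounds the remaining quadratic form. *)
Lemma Psi_step : (0 < #|V|)%N ->
  \sum_(P | inV V P) w P * \sum_(v in V :\: [set y in P]%SET)
      (wdeg w (V :\: [set y in P]%SET) v - a') ^+ 2 <=
  wsum w V * (Psi + (2 * (D + 1) * (L%:R * k3 + L%:R ^+ 3 * k1) + k3 ^+ 2 + 2 * (D + 1) * ke) * hn)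
  + 2 * (L%:R - 1) * D * Psi.
Proof.
move=> V0; have V0' : 0 < #|V|%:R :> R by rewrite ltr0n.
set C0 := 2 * (D + 1) * _ + k3 ^+ 2.
set W := wsum w V.
have W0 : 0 <= W by apply: sumr_ge0.
pose al := a - a'; pose X := \sum_(v in V) x v.
have LW : L%:R * W = a * #|V|%:R + X.
  rewrite -(wdeg_total V wu) /X /x sumrB sumr_const -mulr_natr; ring.
pose S := \sum_(v in V) x v * \sum_(u in V | u != v) wcod V v u * wdeg w V u.
have h1 : \sum_(P | inV V P) w P * \sum_(v in V :\: [set y in P]%SET)
      (wdeg w (V :\: [set y in P]%SET) v - a') ^+ 2 <= W * (Psi + C0 * hn) + (2 * al * X * W - 2 * S).
  apply: (@le_trans _ _ (\sum_(P | inV V P) w P * (Psi + \sum_(v in V) 2 * x v * (a - a' - Dt P v) + C0 * hn))).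
    by apply: ler_sum => P PV; apply: ler_wpM2l => //; apply: Psi_fixed.
  under eq_bigr do rewrite addrAC mulrDr.
  rewrite big_split /= -mulr_suml lerD2l.
  under eq_bigr do rewrite mulr_sumr.
  rewrite exchange_big /=.
  have E v : v \in V -> \sum_(P | inV V P) w P * (2 * x v * (a - a' - Dt P v)) =
      2 * x v * al * W - 2 * x v * \sum_(u in V | u != v) wcod V v u * wdeg w V u.
    move=> vV.
    have -> : \sum_(u in V | u != v) wcod V v u * wdeg w V u = \sum_(P | inV V P) w P * Dt P v.
      rewrite big_mkcondr /= (eq_bigr (fun u => (if u != v then wcod V v u else 0) * wdeg w V u)); last first.
        by move=> u _; case: ifP; rewrite ?mul0r.
      rewrite wdeg_exchange; apply: eq_bigr => P _; congr (_ * _); by rewrite /Dt big_mkcondr.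
    rewrite [in RHS]mulr_sumr -[2 * x v * al * W]mulrA mulrA /W /wsum mulr_sumr -sumrB.
    by apply: eq_bigr => P _; rewrite /al; ring.
  rewrite (eq_bigr _ E) sumrB le_eqVlt; apply/orP; left; apply/eqP; congr (_ - _).
    by rewrite -!mulr_suml -mulr_sumr -/X; ring.
  by rewrite /S mulr_sumr; apply: eq_bigr => v _; rewrite mulrA.
apply: (le_trans h1).
have Psi0 : 0 <= Psi by apply: sumr_ge0 => v _; exact: sqr_ge0.
have L1 : 1 <= L%:R :> R by rewrite ler1n.
(* Inserting [wdeg = a + x] and the row sums [(L - 1) wdeg] of the codegrees splits [S] into the
   drift, which cancels below, and the quadratic form [Q]. *)
have hS : a * (L%:R - 1) * (a * X + Psi) - (L%:R - 1) * D * Psi <= S.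
  pose Q := \sum_(v in V) x v * \sum_(u in V | u != v) wcod V v u * x u.
  have SE : S = a * (L%:R - 1) * (a * X + Psi) + Q.
    have -> : S = \sum_(v in V) (a * (L%:R - 1) * (a * x v + x v ^+ 2) + x v * \sum_(u in V | u != v) wcod V v u * x u).
      apply: eq_bigr => v vV.
      have -> : \sum_(u in V | u != v) wcod V v u * wdeg w V u = a * ((L%:R - 1) * wdeg w V v) + \sum_(u in V | u != v) wcod V v u * x u.
        by rewrite -wcod_total // mulr_sumr -big_split /=; apply: eq_bigr => u _; rewrite /x; ring.
      by rewrite /x; ring.
    by rewrite big_split /= -mulr_sumr big_split /= -mulr_sumr.
  rewrite SE lerD2l lerNl /Q.
  have hQ : - Q <= \sum_(v in V) \sum_(u in V | u != v) wcod V v u * (x v ^+ 2 + x u ^+ 2) / 2.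
    rewrite /Q -sumrN; apply: ler_sum => v vV; rewrite mulr_sumr -sumrN; apply: ler_sum => u _.
    have c0 : 0 <= wcod V v u by apply: wdeg_ge0 => P; rewrite mulr_ge0.
    have := mulr_ge0 c0 (sqr_ge0 (x v + x u)); rewrite sqrrD; lra.
  apply: (le_trans hQ).
  have e1 : \sum_(v in V) \sum_(u in V | u != v) wcod V v u * (x v ^+ 2 + x u ^+ 2) / 2 =
     \sum_(v in V) \sum_(u in V | u != v) wcod V v u * x v ^+ 2.
    transitivity (\sum_(v in V) \sum_(u in V | u != v) wcod V v u * x v ^+ 2 / 2 + \sum_(v in V) \sum_(u in V | u != v) wcod V v u * x u ^+ 2 / 2).
      by rewrite -big_split /=; apply: eq_bigr => v _; rewrite -big_split /=; apply: eq_bigr => u _; ring.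
    have -> : \sum_(v in V) \sum_(u in V | u != v) wcod V v u * x u ^+ 2 / 2 = \sum_(v in V) \sum_(u in V | u != v) wcod V v u * x v ^+ 2 / 2.
      rewrite (exchange_big_dep (mem V)) /=; last by move=> ? ? _ /andP[].
      apply: eq_bigr => v vV; apply: eq_big => [u|u _]; last by rewrite wcod_sym.
      by rewrite vV /= eq_sym.
    by rewrite -big_split /=; apply: eq_bigr => v _; rewrite -big_split /=; apply: eq_bigr => u _; field.
  rewrite e1 /Psi mulr_sumr; apply: ler_sum => v vV.
  rewrite -mulr_suml wcod_total //; apply: ler_wpM2r; first exact: sqr_ge0.
  by apply: ler_wpM2l; [rewrite subr_ge0|exact: degD].
have hX2 : X ^+ 2 / #|V|%:R <= Psi.
  have : 0 <= \sum_(v in V) (x v - X / #|V|%:R) ^+ 2 by apply: sumr_ge0 => v _; exact: sqr_ge0.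
  under eq_bigr do rewrite sqrrB.
  rewrite big_split sumrB /= -/Psi sumr_const.
  have -> : \sum_(v in V) x v * (X / #|V|%:R) *+ 2 = 2 * (X ^+ 2 / #|V|%:R).
    by rewrite sumrMnl -mulr_suml -/X mulr2n; ring.
  have -> : (X / #|V|%:R) ^+ 2 *+ #|V| = X ^+ 2 / #|V|%:R.
    by rewrite -mulr_natr; field; rewrite lt0r_neq0.
  by lra.
(* At the ideal value [L (L - 1) a / |V|] of [al] the terms linear in [X] cancel; the difference [e]
   is of second order. *)
pose e := al - L%:R * (L%:R - 1) * a / #|V|%:R.
have he : `|e| <= ke * hn ^+ 2 by [].
have hXb : `|X| <= (D + 1) * #|V|%:R.
  apply: (le_trans (ler_norm_sum _ _ _)); rewrite mulr_natr -sumr_const.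
  by apply: ler_sum => v vV; exact: dev_bound.
have heX : e * X <= (D + 1) * ke * hn.
  apply: (le_trans (ler_norm _)); rewrite normrM.
  apply: (@le_trans _ _ (ke * hn ^+ 2 * ((D + 1) * #|V|%:R))); first by rewrite ler_pM.
  have -> : ke * hn ^+ 2 * ((D + 1) * #|V|%:R) = (D + 1) * ke * hn * (#|V|%:R * hn) by ring.
  rewrite -[X in _ <= X]mulr1; apply: ler_wpM2l => //.
  by rewrite !mulr_ge0 // ?(ltW hn0) //; move: D1; lra.
have alE : 2 * al * X * W = 2 * (e * X) * W + 2 * (L%:R - 1) * a * (a * X + X ^+ 2 / #|V|%:R).
  have -> : al = e + L%:R * (L%:R - 1) * a / #|V|%:R by rewrite /e; ring.
  have -> : 2 * (e + L%:R * (L%:R - 1) * a / #|V|%:R) * X * W = 2 * (e * X) * W + 2 * (L%:R - 1) * a * X * (L%:R * W) / #|V|%:R by ring.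
  by rewrite LW; field; rewrite lt0r_neq0.
rewrite alE.
have heXW : (e * X) * W <= (D + 1) * ke * hn * W by apply: ler_wpM2r.
have hneg : (L%:R - 1) * a * (X ^+ 2 / #|V|%:R) <= (L%:R - 1) * a * Psi.
  by apply: ler_wpM2l => //; case/andP: a01 => a0 _; rewrite mulr_ge0 // subr_ge0.
move: hS heXW hneg; lra.
Qed.

End OneStep.

End Step.

(** * Elementary bounds for logarithms, exponentials and powers *)

Section LogLemmas.

Variable R : realType.
Implicit Types x y : R.

Lemma ln_le_sub1 x : 0 < x -> ln x <= x - 1.
Proof.
move=> x0; have := @le_ln1Dx R (x - 1); have -> : 1 + (x - 1) = x by ring.
by apply; lra.
Qed.

Lemma ln_ge_abs x : - (1 / 2) <= x -> - (2 * `|x|) <= ln (1 + x).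
Proof.
move=> hx; have p : 0 < 1 + x by lra.
have := ln_le_sub1 (x := (1 + x)^-1); rewrite invr_gt0 => /(_ p); rewrite lnV // => h.
suff : (1 + x)^-1 - 1 <= 2 * `|x| by lra.
have -> : (1 + x)^-1 - 1 = - x / (1 + x) by field; rewrite lt0r_neq0.
rewrite ler_pdivrMr //.
have := ler_norm x; have := ler_norm (- x); rewrite normrN => h1 h2.
have n0 := normr_ge0 x; nra.
Qed.

Lemma expR_quad x : `|x| <= 1 / 2 -> expR x <= 1 + x + 2 * x ^+ 2.
Proof.
rewrite ler_norml => /andP[x1 x2].
have h := @expR_ge1Dx R (- x); rewrite expRN in h.
have p : 0 < 1 - x by lra.
have e0 := expR_gt0 x.
have h2 : expR x <= (1 - x)^-1.
  by rewrite -[X in X <= _]invrK lef_pV2 ?posrE ?invr_gt0.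
apply: (le_trans h2); rewrite -[X in X <= _]div1r ler_pdivrMr //.
have := sqr_ge0 x; rewrite expr2; nra.
Qed.

(** Jensen's inequality for the logarithm. Each term uses the tangent bound [ln r <= r - 1] at
    [r = (t i / q i) (Q / S)], and the linear corrections sum to zero. *)
Lemma log_sum (I : finType) (A : pred I) (q t : I -> R) :
  (forall i, A i -> 0 < q i) -> (forall i, A i -> 0 < t i) -> 0 < \sum_(i | A i) q i ->
  \sum_(i | A i) q i * ln (t i / q i) <=
  (\sum_(i | A i) q i) * ln ((\sum_(i | A i) t i) / \sum_(i | A i) q i).
Proof.
move=> q0 t0 Q0; set Q := \sum_(i | A i) q i; set S := \sum_(i | A i) t i.
have [i0 Ai0] : exists i, A i.
  apply/existsP; apply: contraLR Q0; rewrite negb_exists => /forallP h.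
  by rewrite big_pred0 ?ltxx // => i; apply/negbTE/h.
have S0 : 0 < S.
  rewrite /S (bigD1 i0) //=; apply: ltr_wpDr; last exact: t0.
  by apply: sumr_ge0 => i /andP[/t0/ltW].
have step i : A i -> q i * ln (t i / q i) <= q i * ln (S / Q) + (t i * (Q / S) - q i).
  move=> Ai; have qi := q0 _ Ai; have ti := t0 _ Ai.
  have r0 : 0 < t i / q i * (Q / S) by rewrite !mulr_gt0 ?invr_gt0.
  have h := ln_le_sub1 r0.
  have e : ln (t i / q i) = ln (t i / q i * (Q / S)) + ln (S / Q).
    rewrite -lnM ?posrE ?divr_gt0 //; congr ln; field; by rewrite !lt0r_neq0.
  have e2 : t i * (Q / S) = q i * (t i / q i * (Q / S)) by field; rewrite !lt0r_neq0.
  have hh := ler_wpM2l (ltW qi) h; rewrite mulrBr mulr1 in hh.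
  by rewrite e e2 mulrDr addrC lerD2l.
apply: (le_trans (ler_sum _ step)); rewrite big_split /= sumrB -!mulr_suml -/Q -/S.
have -> : S * (Q / S) = Q by field; rewrite lt0r_neq0.
by rewrite subrr addr0.
Qed.

Lemma bernoulli_up (t : R) p : 0 <= t <= 1 ->
  1 - p%:R * t <= (1 - t) ^+ p <= 1 - p%:R * t + p%:R ^+ 2 * t ^+ 2.
Proof.
move=> /andP[t0 t1]; elim: p => [|p /andP[IH1 IH2]]; first by rewrite expr0 !mul0r subr0 expr0n mul0r addr0 lexx.
have u0 : 0 <= 1 - t by lra.
rewrite exprS -natr1; have p0 : 0 <= p%:R :> R by [].
have h1 := ler_wpM2l u0 IH1; have h2 := ler_wpM2l u0 IH2.
have t3 : 0 <= t ^+ 2 by exact: sqr_ge0.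
have t4 : 0 <= p%:R * t ^+ 2 by exact: mulr_ge0.
have t5 : 0 <= p%:R ^+ 2 * t ^+ 3 by rewrite mulr_ge0 ?exprn_ge0.
by apply/andP; split; [apply: le_trans h1|apply: (le_trans h2)]; rewrite -subr_ge0;
  [have -> : (1 - t) * (1 - p%:R * t) - (1 - (p%:R + 1) * t) = p%:R * t ^+ 2 by ring
  |have -> : 1 - (p%:R + 1) * t + (p%:R + 1) ^+ 2 * t ^+ 2 - (1 - t) * (1 - p%:R * t + p%:R ^+ 2 * t ^+ 2) = p%:R * t ^+ 2 + t ^+ 2 + p%:R ^+ 2 * t ^+ 3 by ring];
  rewrite ?addr_ge0.
Qed.

Lemma bernoulli_low (t : R) p : 0 <= t -> 1 + p%:R * t <= (1 + t) ^+ p.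
Proof.
move=> t0; elim: p => [|p IH]; first by rewrite expr0 mul0r addr0.
rewrite exprS -natr1; have u0 : 0 <= 1 + t by lra.
apply: le_trans (ler_wpM2l u0 IH); rewrite -subr_ge0.
have -> : (1 + t) * (1 + p%:R * t) - (1 + (p%:R + 1) * t) = p%:R * t ^+ 2 by ring.
by rewrite mulr_ge0 ?sqr_ge0.
Qed.

Lemma pow1D_expR (x : R) j : 0 <= x -> (1 + x) ^+ j <= expR (j%:R * x).
Proof.
move=> x0; rewrite mulrC expRM_natr lerXn2r ?nnegrE ?expR_ge0 ?expR_ge1Dx //; lra.
Qed.

End LogLemmas.

(** * One step of the process *)

Section Recursion.

Variables (R : realType) (T : finType) (L n : nat) (w g : L.-tuple T -> R) (K G : R).
Variable (ok : {set T} -> bool).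
Hypothesis w0 : forall P, 0 <= w P.
Hypothesis wu : forall P : L.-tuple T, ~~ uniq P -> w P = 0.
Hypothesis n0 : (0 < n)%N.
Hypothesis L0 : (0 < L)%N.
Hypothesis K0 : 0 < K.
(** [g] is the surprisal of a path, shifted by [ln (n K)]; as path weights agree up to constants,
    this makes it nonnegative and bounded in the application. *)
Hypothesis hg : forall P, 0 < w P -> ln ((n%:R ^+ L * w P)^-1) = g P - ln (n%:R * K).

(* The number of ways to remove [j] disjoint paths of positive weight one after the
   other and to arrive at a set satisfying [ok], scaled by [n ^ (- j L)]. *)
Fixpoint ncount (j : nat) (V : {set T}) : R :=
  if j is j'.+1 then
    \sum_(P : L.-tuple T | inV V P && (0 < w P)) (n%:R ^+ L)^-1 * ncount j' (V :\: [set x in P]%SET)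
  else (ok V)%:R.

Lemma ncount_ge0 j V : 0 <= ncount j V.
Proof.
elim: j V => [|j IH] V /=; first exact: ler0n.
by apply: sumr_ge0 => P _; rewrite mulr_ge0 // invr_ge0 exprn_ge0.
Qed.

Lemma wsum_pos (f : L.-tuple T -> R) (V : {set T}) : (forall P, w P = 0 -> f P = 0) ->
  wsum f V = \sum_(P : L.-tuple T | inV V P && (0 < w P)) f P.
Proof.
move=> hf; rewrite /wsum (bigID (fun P => 0 < w P)) /= [X in _ + X]big1 ?addr0 // => P /andP[_].
by rewrite lt0r w0 andbT negbK => /eqP/hf.
Qed.

(* Jensen's inequality for the random path drawn with probability proportional to
   [w]; the summand [e0] keeps the logarithm finite when the count vanishes. *)
Lemma ncount_step j (V : {set T}) (e0 : R) : 0 < e0 -> (#|V| <= n)%N -> 0 < wsum w V ->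
  ln (wsum w V / (n%:R * K)) + wsum (fun P => w P * g P) V / wsum w V +
  wsum (fun P => w P * ln (ncount j (V :\: [set x in P]%SET) + e0)) V / wsum w V
  <= ln (ncount j.+1 V + e0).
Proof.
move=> e00 Vn W0; set W := wsum w V.
have nL : 0 < n%:R ^+ L :> R by rewrite exprn_gt0 // ltr0n.
have nK : 0 < n%:R * K by rewrite mulr_gt0 // ltr0n.
pose t (P : L.-tuple T) := (n%:R ^+ L)^-1 * (ncount j (V :\: [set x in P]%SET) + e0).
have t0 P : 0 < t P by rewrite mulr_gt0 ?invr_gt0 // ltr_wpDl // ncount_ge0.
have WE : W = \sum_(P : L.-tuple T | inV V P && (0 < w P)) w P by apply: wsum_pos.
have hls := @log_sum R _ (fun P => inV V P && (0 < w P)) w t (fun P h => proj2 (andP h)) (fun P _ => t0 P).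
rewrite -WE in hls; have {}hls := hls W0.
(* There are at most [n^L] summands, so the regularising terms add up to at most [e0]. *)
have up : \sum_(P : L.-tuple T | inV V P && (0 < w P)) t P <= ncount j.+1 V + e0.
  rewrite /t /=; under eq_bigr do rewrite mulrDr.
  rewrite big_split /= lerD2l sumr_const -[X in X <= _]mulr_natr.
  rewrite -mulrA [e0 * _]mulrC mulrA -[X in _ <= X]mul1r; apply: ler_wpM2r; first exact: ltW.
  rewrite mulrC ler_pdivrMr // mul1r -natrX ler_nat.
  apply: (@leq_trans (#|V| ^ L)); last by rewrite leq_exp2r.
  rewrite -card_tuples_in; apply: subset_leq_card; apply/subsetP => P; rewrite unfold_in inE.
  by case/andP.
have S0 : 0 < \sum_(P : L.-tuple T | inV V P && (0 < w P)) t P.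
  rewrite lt0r sumr_ge0 ?andbT; last by move=> P _; exact: ltW.
  apply/negP => /eqP z; move: W0; rewrite -/W WE big1 ?ltxx // => P hP; exfalso.
  have := psumr_eq0P (fun P _ => ltW (t0 P)) z; move=> /(_ P hP) tz; by have := t0 P; rewrite tz ltxx.
have lnle : ln (\sum_(P : L.-tuple T | inV V P && (0 < w P)) t P) <= ln (ncount j.+1 V + e0).
  by rewrite ler_ln ?posrE // ltr_wpDl // ncount_ge0.
apply: le_trans lnle.
rewrite -(ler_pM2l W0) -/W.
have lhsE : W * (ln (W / (n%:R * K)) + wsum (fun P => w P * g P) V / W +
    wsum (fun P => w P * ln (ncount j (V :\: [set x in P]%SET) + e0)) V / W) =
    W * ln W + \sum_(P : L.-tuple T | inV V P && (0 < w P)) w P * ln (t P / w P).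
  have -> : \sum_(P : L.-tuple T | inV V P && (0 < w P)) w P * ln (t P / w P) =
     \sum_(P : L.-tuple T | inV V P && (0 < w P)) (w P * g P + w P * ln (ncount j (V :\: [set x in P]%SET) + e0) - w P * ln (n%:R * K)).
    apply: eq_bigr => P /andP[_ wP].
    have -> : t P / w P = (n%:R ^+ L * w P)^-1 * (ncount j (V :\: [set x in P]%SET) + e0).
      by rewrite /t invfM; ring.
    have cp : 0 < ncount j (V :\: [set x in P]%SET) + e0 by rewrite ltr_wpDl // ncount_ge0.
    have nw : 0 < (n%:R ^+ L * w P)^-1 by rewrite invr_gt0 mulr_gt0.
    by rewrite [in LHS]lnM ?posrE // hg //; ring.
  rewrite sumrB big_split /= -mulr_suml -WE.
  rewrite -(wsum_pos (f := fun P => w P * g P)); last by move=> P ->; rewrite mul0r.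
  rewrite -(wsum_pos (f := fun P => w P * ln (ncount j (V :\: [set x in P]%SET) + e0))); last by move=> P ->; rewrite mul0r.
  rewrite ln_div ?posrE //; field; by rewrite lt0r_neq0.
rewrite lhsE.
have -> : W * ln (\sum_(P : L.-tuple T | inV V P && (0 < w P)) t P) = W * ln W + W * ln ((\sum_(P : L.-tuple T | inV V P && (0 < w P)) t P) / W).
  by rewrite ln_div ?posrE //; ring.
by rewrite lerD2l.
Qed.

End Recursion.

Section GoodState.

Variables (R : realType) (T : finType) (L n : nat) (w : L.-tuple T -> R).
Hypothesis w0 : forall P, 0 <= w P.
Hypothesis wu : forall P : L.-tuple T, ~~ uniq P -> w P = 0.
Hypothesis n0 : (0 < n)%N.
Hypothesis L0 : (0 < L)%N.

Variables (V : {set T}) (a D delta gm : R).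
Hypothesis degD : forall v, v \in V -> wdeg w V v <= D.
Hypothesis D1 : 1 <= D.
Hypothesis aV : gm * n%:R <= a * #|V|%:R.
Hypothesis gm0 : 0 < gm.
Hypothesis dgm : 0 <= delta <= gm / 2.
(** States that violate this bound are handled by [proc_bad]. *)
Hypothesis good : \sum_(v in V) `|wdeg w V v - a| <= delta * n%:R.

Let W := wsum w V.
Let X := \sum_(v in V) (wdeg w V v - a).

Lemma LWE : L%:R * W = a * #|V|%:R + X.
Proof. by rewrite -(wdeg_total V wu) /X sumrB sumr_const -mulr_natr; ring. Qed.

Lemma X_le : `|X| <= delta * n%:R.
Proof. exact: le_trans (ler_norm_sum _ _ _) good. Qed.

Lemma W_ge : gm * n%:R / (2 * L%:R) <= W.
Proof.
have L0' : 0 < L%:R :> R by rewrite ltr0n.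
have n0' : 0 < n%:R :> R by rewrite ltr0n.
rewrite ler_pdivrMr ?mulr_gt0 //; have := LWE; have := X_le.
have h : delta * n%:R <= gm / 2 * n%:R by apply: ler_wpM2r; [exact: ltW|case/andP: dgm].
rewrite ler_norml => /andP[h1 h2] h3.
have -> : W * (2 * L%:R) = 2 * (L%:R * W) by ring.
rewrite h3; have := aV; lra.
Qed.

Lemma lnW_ge (K : R) : 0 < K ->
  ln (a * #|V|%:R / L%:R / (n%:R * K)) - 2 * delta / gm <= ln (W / (n%:R * K)).
Proof.
move=> K0.
have L0' : 0 < L%:R :> R by rewrite ltr0n.
have n0' : 0 < n%:R :> R by rewrite ltr0n.
have gn : 0 < gm * n%:R by rewrite mulr_gt0.
have aV0 : 0 < a * #|V|%:R by apply: lt_le_trans aV.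
pose y := X / (a * #|V|%:R).
have WE : W / (n%:R * K) = a * #|V|%:R / L%:R / (n%:R * K) * (1 + y).
  have -> : W = (a * #|V|%:R + X) / L%:R by rewrite -LWE; field; rewrite lt0r_neq0.
  by rewrite /y; move: aV0; set b := a * #|V|%:R => b0; field; rewrite !lt0r_neq0.
have yb : `|y| <= delta / gm.
  rewrite normrM normfV (gtr0_norm aV0) ler_pdivrMr //.
  have -> : delta / gm * (a * #|V|%:R) = delta * (a * #|V|%:R / gm) by ring.
  apply: (le_trans X_le); apply: ler_wpM2l; first by case/andP: dgm.
  by rewrite ler_pdivlMr // mulrC.
have d2 : delta / gm <= 1 / 2 by rewrite ler_pdivrMr //; case/andP: dgm => _; lra.
have y2 : - (1 / 2) <= y by move: yb; rewrite ler_norml => /andP[h _]; apply: le_trans h; lra.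
have p1 : 0 < a * #|V|%:R / L%:R / (n%:R * K) by rewrite !divr_gt0 // mulr_gt0.
have p2 : 0 < 1 + y by lra.
rewrite WE [X in _ <= X]lnM ?posrE //.
rewrite lerD2l; apply: le_trans (ln_ge_abs y2); rewrite lerN2 -mulrA.
by apply: ler_wpM2l => //; lra.
Qed.

(** A union bound over the vertices [u] of the removed path makes the average loss linear in
    [wdeg w V u]. Replacing these degrees by [a] gives the main term; the total deviation times
    [G D], a bound for [wdeg f], gives the error. *)
Lemma Y_step (f : L.-tuple T -> R) (G : R) : 0 <= G -> (forall P, 0 <= f P <= G * w P) -> 0 <= a ->
  wsum w V * wsum f V - L%:R * a * wsum f V - G * D * (delta * n%:R) <=
  wsum (fun P => w P * wsum f (V :\: [set x in P]%SET)) V.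
Proof.
move=> G0 hf a0.
have f0 P : 0 <= f P by case/andP: (hf P).
have fu (P : L.-tuple T) : ~~ uniq P -> f P = 0.
  by move=> uP; apply: le_anti; rewrite f0 andbT; case/andP: (hf P); rewrite wu // mulr0.
have h1 : wsum w V * wsum f V - \sum_(u in V) wdeg f V u * wdeg w V u <= wsum (fun P => w P * wsum f (V :\: [set x in P]%SET)) V.
  rewrite wdeg_exchange /wsum mulr_suml -sumrB; apply: ler_sum => P PV.
  rewrite -mulrBr; apply: ler_wpM2l => //.
  rewrite -/(wsum f V) -/(wsum f (V :\: [set x in P]%SET)) wsum_diff lerD2l lerN2.
  rewrite (eq_bigr (fun u => wsum (fun Q => f Q * (u \in Q)%:R) V)); last by move=> u _; rewrite wdeg_mem.
  rewrite /wsum exchange_big /=; apply: ler_sum => Q _; rewrite -mulr_sumr; apply: ler_wpM2l => //.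
  case: hasP => [[u uQ uP]|_]; last by apply: sumr_ge0.
  rewrite (bigD1 u) //= uQ lerDl; exact: sumr_ge0.
apply: le_trans h1; rewrite -addrA lerD2l -opprD lerN2.
have -> : \sum_(u in V) wdeg f V u * wdeg w V u = L%:R * a * wsum f V + \sum_(u in V) wdeg f V u * (wdeg w V u - a).
  rewrite -[L%:R * a]mulrC -mulrA -(wdeg_total V fu) mulr_sumr -big_split /=; apply: eq_bigr => u _; ring.
rewrite lerD2l; apply: (@le_trans _ _ (G * D * \sum_(v in V) `|wdeg w V v - a|)); last first.
  by apply: ler_wpM2l => //; rewrite mulr_ge0 //; have := D1; lra.
rewrite mulr_sumr; apply: ler_sum => u uV.
have y0 : 0 <= wdeg f V u by apply: wdeg_ge0.
have y1 : wdeg f V u <= G * D.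
  apply: (@le_trans _ _ (G * wdeg w V u)); last by apply: ler_wpM2l => //; exact: degD.
  by rewrite /wdeg mulr_sumr; apply: ler_sum => P _; case/andP: (hf P).
apply: (le_trans (ler_norm _)); rewrite normrM (ger0_norm y0); exact: ler_wpM2r.
Qed.

(** Removing a path moves each density by [O(1 / n)], so the exponential is expanded to second
    order. The linear term has a small mean, because in an almost regular system a random path meets
    [Nb i] in about its fair share [L u] of vertices. *)
Lemma Xi_step (I : finType) (Nb : I -> {set T}) (lam zt gam : R) :
  0 < gam -> 0 <= lam -> lam * (L%:R / gam) <= 1 / 2 -> (L < #|V|)%N ->
  gam * n%:R <= #|V|%:R - L%:R -> 0 <= a ->
  wsum (fun P => w P * \sum_i expR (lam * n%:R * (zt - #|Nb i :&: (V :\: [set x in P]%SET)|%:R / #|V :\: [set x in P]%SET|%:R))) V <=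
  W * ((1 + (lam * (4 * L%:R * delta / (gm * gam)) + 2 * (lam * (L%:R / gam)) ^+ 2)) *
       \sum_i expR (lam * n%:R * (zt - #|Nb i :&: V|%:R / #|V|%:R))).
Proof.
move=> gam0 lam0 lam1 LV gV a0.
have L0' : 0 < L%:R :> R by rewrite ltr0n.
have n0' : 0 < n%:R :> R by rewrite ltr0n.
have gn : 0 < gm * n%:R by rewrite mulr_gt0.
have W0 : 0 < W by apply: lt_le_trans W_ge; rewrite divr_gt0 // mulr_gt0.
have V0 : 0 < #|V|%:R :> R by rewrite ltr0n (leq_trans _ LV).
set N' := #|V|%:R - L%:R in gV.
have N'0 : 0 < N' by apply: lt_le_trans gV; rewrite mulr_gt0.
rewrite /wsum; under eq_bigr do rewrite mulr_sumr.
rewrite exchange_big /= !mulr_sumr; apply: ler_sum => i _.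
pose u : R := #|Nb i :&: V|%:R / #|V|%:R.
have u01 : 0 <= u <= 1.
  by rewrite divr_ge0 //= ler_pdivrMr // mul1r ler_nat subset_leq_card // subsetIr.
pose p (P : L.-tuple T) : R := \sum_(v in P) (v \in Nb i)%:R.
pose r P : R := n%:R * ((p P - L%:R * u) / N').
have pb P : 0 <= p P <= L%:R.
  rewrite sumr_ge0 //= /p -natr_sum ler_nat; apply: leq_trans (card_tuple_le P).
  by rewrite -sum1_card; apply: leq_sum => v _; case: (v \in Nb i).
have rb P : `|lam * r P| <= lam * (L%:R / gam).
  rewrite normrM (ger0_norm lam0); apply: ler_wpM2l => //.
  rewrite /r normrM (gtr0_norm n0') normrM normfV (gtr0_norm N'0).
  have h : `|p P - L%:R * u| <= L%:R.
    rewrite ler_norml; have /andP[p1 p2] := pb P; case/andP: u01 => u1 u2.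
    have h1 := mulr_ge0 (ltW L0') u1; have h2 := ler_wpM2l (ltW L0') u2; rewrite mulr1 in h2.
    by apply/andP; split; lra.
  rewrite mulrA ler_pdivrMr // mulrAC ler_pdivlMr //.
  have := ler_wpM2r (ltW gam0) (ler_wpM2l (ltW n0') h) => h3; apply: (le_trans h3).
  have -> : n%:R * L%:R * gam = L%:R * (gam * n%:R) by ring.
  by apply: ler_wpM2l => //; exact: ltW.
have key P : inV V P -> w P * expR (lam * n%:R * (zt - #|Nb i :&: (V :\: [set x in P]%SET)|%:R / #|V :\: [set x in P]%SET|%:R)) <=
    expR (lam * n%:R * (zt - u)) * (w P * (1 + lam * r P + 2 * (lam * (L%:R / gam)) ^+ 2)).
  move=> PV; have [uP|/wu ->] := boolP (uniq P); last by rewrite !mul0r mulr0.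
  have PsV : [set x in P]%SET \subset V by apply/subsetP => x; rewrite inE => /(allP PV).
  have cP : #|[set x in P]%SET| = L by rewrite card_set_uniq // size_tuple.
  have c1 : #|V :\: [set x in P]%SET|%:R = N' :> R.
    by rewrite cardsD (setIidPr PsV) cP natrB // ltnW.
  have c2 : #|Nb i :&: (V :\: [set x in P]%SET)|%:R = u * #|V|%:R - p P :> R.
    have -> : p P = #|Nb i :&: [set x in P]%SET|%:R.
      rewrite /p -natr_sum -sum1_card; congr (_%:R); rewrite [RHS](eq_bigl (fun v => (v \in P) && (v \in Nb i))).
        by rewrite [RHS]big_mkcondr /=; apply: eq_bigr => v _; case: (v \in Nb i).
      by move=> v; rewrite !inE andbC.
    have -> : u * #|V|%:R = #|Nb i :&: V|%:R by rewrite /u; field; rewrite lt0r_neq0.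
    have := cardsID [set x in P]%SET (Nb i :&: V).
    have -> : Nb i :&: V :&: [set x in P]%SET = Nb i :&: [set x in P]%SET by rewrite -setIA (setIidPr PsV).
    by rewrite -setIDA => <-; rewrite natrD; ring.
  rewrite c1 c2.
  have -> : lam * n%:R * (zt - (u * #|V|%:R - p P) / N') = lam * n%:R * (zt - u) + lam * r P.
    have -> : #|V|%:R = N' + L%:R by rewrite /N'; ring.
    by rewrite /r; field; rewrite lt0r_neq0.
  rewrite expRD mulrCA; apply: ler_wpM2l; first exact: expR_ge0.
  apply: ler_wpM2l => //; apply: (le_trans (expR_quad _)); first exact: le_trans (rb P) lam1.
  rewrite lerD2l; apply: ler_wpM2l => //.
  by rewrite -real_normK ?num_real // lerXn2r ?nnegrE ?normr_ge0 // (le_trans _ (rb P)).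
apply: (le_trans (ler_sum _ key)); rewrite -mulr_sumr -/u [X in X <= _]mulrC [X in _ <= X]mulrA.
apply: ler_wpM2r; first exact: expR_ge0.
have -> : \sum_(P | inV V P) w P * (1 + lam * r P + 2 * (lam * (L%:R / gam)) ^+ 2) =
   W * (1 + 2 * (lam * (L%:R / gam)) ^+ 2) + lam * (n%:R / N') * \sum_(P | inV V P) w P * (p P - L%:R * u).
  rewrite /W /wsum mulr_suml mulr_sumr -big_split /=; apply: eq_bigr => P _.
  by rewrite /r; ring.
have hm : \sum_(P | inV V P) w P * (p P - L%:R * u) <= 2 * (delta * n%:R).
  under eq_bigr do rewrite mulrBr.
  rewrite sumrB -mulr_suml -/(wsum w V) -/W -wdeg_exchange [W * _]mulrA [W * _]mulrC LWE.
  have -> : \sum_(v in V) (v \in Nb i)%:R * wdeg w V v = a * (u * #|V|%:R) + \sum_(v in V) (v \in Nb i)%:R * (wdeg w V v - a).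
    have -> : u * #|V|%:R = \sum_(v in V) (v \in Nb i)%:R.
      rewrite /u divfK ?lt0r_neq0 // -natr_sum -sum1_card; congr (_%:R).
      rewrite [LHS](eq_bigl (fun v => (v \in V) && (v \in Nb i))); last by move=> v; rewrite !inE andbC.
      by rewrite [LHS]big_mkcondr /=; apply: eq_bigr => v _; case: (v \in Nb i).
    rewrite mulr_sumr -big_split /=; apply: eq_bigr => v _; ring.
  have h1 : \sum_(v in V) (v \in Nb i)%:R * (wdeg w V v - a) <= delta * n%:R.
    apply: le_trans good; apply: ler_sum => v _; case: (v \in Nb i); rewrite ?mul1r ?mul0r //; exact: ler_norm.
  have h2 : - X * u <= delta * n%:R.
    have := X_le; rewrite ler_norml => /andP[x1 x2]; case/andP: u01 => u1 u2.
    have dn0 : 0 <= delta * n%:R by rewrite mulr_ge0 //; case/andP: dgm.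
    apply: (@le_trans _ _ (delta * n%:R * u)); first by apply: ler_wpM2r => //; lra.
    by rewrite -[X in _ <= X]mulr1; apply: ler_wpM2l.
  lra.
have h3 : lam * (n%:R / N') * \sum_(P | inV V P) w P * (p P - L%:R * u) <= lam / gam * (2 * (delta * n%:R)).
  have dn0 : 0 <= delta * n%:R by rewrite mulr_ge0 //; case/andP: dgm.
  apply: (@le_trans _ _ (lam * (n%:R / N') * (2 * (delta * n%:R)))).
    by apply: ler_wpM2l => //; rewrite mulr_ge0 // divr_ge0 // ltW.
  apply: ler_wpM2r; first by rewrite mulr_ge0.
  apply: ler_wpM2l => //; rewrite ler_pdivrMr // mulrC ler_pdivlMr // mulrC; exact: gV.
have h4 : lam / gam * (2 * (delta * n%:R)) <= W * (lam * (4 * L%:R * delta / (gm * gam))).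
  have -> : lam / gam * (2 * (delta * n%:R)) = gm * n%:R / (2 * L%:R) * (lam * (4 * L%:R * delta / (gm * gam))).
    by field; rewrite !lt0r_neq0.
  apply: ler_wpM2r; last exact: W_ge.
  have d0 : 0 <= delta by case/andP: dgm.
  apply: mulr_ge0 => //; apply: divr_ge0; first by rewrite !mulr_ge0.
  by rewrite mulr_ge0 // ltW.
lra.
Qed.

End GoodState.

(** * Numerical estimates behind the process *)

Section ProcessReal.

Variable R : realType.

(** [(j / Ws) Y] predicts the sum of the values of [g] over [j] steps. One step earns [Y / W] on
    average, and afterwards [Y] and the ideal weight have both shrunk by a factor of about
    [1 - L^2 / N], so the prediction persists. *)
Lemma Y_real (a N L W X Y Z G D delta gm gam nn j Ws Ws' : R) :
  L * W = a * N + X -> `|X| <= delta * nn -> gm * nn <= a * N ->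
  gm * nn / (2 * L) <= W -> 0 <= Y -> Y <= G * W -> L * W <= D * nn ->
  W * Y - L * a * Y - G * D * (delta * nn) <= Z ->
  Ws = a * N / L -> Ws' * (1 + L ^+ 2 / N) <= Ws -> L ^+ 2 / N <= 1 -> gm * nn / L <= Ws' ->
  gam * nn <= N -> j * L <= nn -> 0 <= j -> 0 <= delta -> 0 <= G -> 1 <= D -> 1 <= L ->
  0 < gm -> 0 < gam -> 0 < nn ->
  (j + 1) / Ws * Y - ((G * L / gam + 2 * G * D * L / gm) * delta / gm + G * delta / gm
     + G * D * L ^+ 4 / (gm * gam ^+ 2) / nn) <= Y / W + j / Ws' * (Z / W).
Proof.
move=> LW hX aN hW Y0 YG LWD hZ WsE hWs' q1 hWs'2 hN jL j0 d0 G0 D1 L1 gm0 gam0 nn0.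
have L0 : 0 < L by lra.
have gn0 : 0 < gm * nn by rewrite mulr_gt0.
have N0 : 0 < N by apply: lt_le_trans hN; rewrite mulr_gt0.
have W0 : 0 < W by apply: lt_le_trans hW; rewrite divr_gt0 // mulr_gt0.
have Ws'0 : 0 < Ws' by apply: lt_le_trans hWs'2; rewrite divr_gt0.
set q := L ^+ 2 / N in hWs' q1.
have q0 : 0 <= q by rewrite divr_ge0 ?sqr_ge0 // ltW.
have WsWs' : Ws' <= Ws.
  apply: le_trans hWs'; rewrite -[X in X <= _]mulr1; apply: ler_wpM2l; lra.
have Ws0 : 0 < Ws by apply: lt_le_trans WsWs'.
have dn0 : 0 <= delta * nn by rewrite mulr_ge0 // ltW.
have YW0 : 0 <= Y / W by rewrite divr_ge0 // ltW.
have YW : Y / W <= G by rewrite ler_pdivrMr.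
have YWX (c : R) : 0 <= c -> Y / W * X * c <= G * (delta * nn) * c.
  move=> c0; apply: ler_wpM2r => //; apply: (le_trans (ler_norm _)).
  by rewrite normrM (ger0_norm YW0) ler_pM.
have YWX' (c : R) : 0 <= c -> - (Y / W * X) * c <= G * (delta * nn) * c.
  move=> c0; apply: ler_wpM2r => //; apply: (le_trans (ler_norm _)).
  by rewrite normrN normrM (ger0_norm YW0) ler_pM.
pose C := G * L / gam + 2 * G * D * L / gm.
have T1 : (1 - q) * Y - C * delta <= Z / W.
  apply: (@le_trans _ _ ((W * Y - L * a * Y - G * D * (delta * nn)) / W)); last first.
    by apply: ler_wpM2r => //; rewrite invr_ge0 ltW.
  have -> : (W * Y - L * a * Y - G * D * (delta * nn)) / W = Y - (q * Y + - (Y / W * X) * (L / N)) - G * D * (delta * nn) / W.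
    have -> : a = (L * W - X) / N by rewrite LW; field; rewrite lt0r_neq0.
    by rewrite /q; field; rewrite !lt0r_neq0.
  have h1 : - (Y / W * X) * (L / N) <= G * L / gam * delta.
    apply: (le_trans (YWX' _ _)); first by rewrite divr_ge0 // ltW.
    have -> : G * (delta * nn) * (L / N) = G * delta * L * (nn / N) by ring.
    have -> : G * L / gam * delta = G * delta * L * gam^-1 by ring.
    apply: ler_wpM2l; first by rewrite !mulr_ge0 // ltW.
    by rewrite ler_pdivrMr // mulrC ler_pdivlMr // mulrC.
  have h2 : G * D * (delta * nn) / W <= 2 * G * D * L / gm * delta.
    rewrite ler_pdivrMr //.
    have -> : G * D * (delta * nn) = (2 * G * D * L / gm * delta) * (gm * nn / (2 * L)).
      by field; rewrite !lt0r_neq0.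
    apply: ler_wpM2l => //; rewrite !mulr_ge0 // ?invr_ge0 ?ltW //; lra.
  rewrite /C; lra.
have rj0 : 0 <= j / Ws' by rewrite divr_ge0 // ltW.
have rj1 : j / Ws' <= gm^-1.
  rewrite ler_pdivrMr //.
  apply: (@le_trans _ _ (gm^-1 * (gm * nn / L))); last by apply: ler_wpM2l => //; rewrite invr_ge0 ltW.
  have -> : gm^-1 * (gm * nn / L) = nn / L by field; rewrite !lt0r_neq0.
  by rewrite ler_pdivlMr.
have C0 : 0 <= C * delta.
  rewrite mulr_ge0 // /C addr_ge0 // !mulr_ge0 // ?invr_ge0 ?ltW //; lra.
have S1 : j / Ws' * ((1 - q) * Y) - C * delta / gm <= j / Ws' * (Z / W).
  apply: (@le_trans _ _ (j / Ws' * ((1 - q) * Y - C * delta))); last exact: ler_wpM2l.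
  rewrite mulrBr lerD2l lerN2 [C * delta / gm]mulrC; exact: ler_wpM2r.
have rjWs : j / Ws * (1 + q) <= j / Ws'.
  rewrite ler_pdivlMr //.
  have -> : j / Ws * (1 + q) * Ws' = j * (Ws' * (1 + q) / Ws) by ring.
  rewrite -[X in _ <= X]mulr1; apply: ler_wpM2l => //; by rewrite ler_pdivrMr // mul1r.
have jWs0 : 0 <= j / Ws by rewrite divr_ge0 // ltW.
have jWs1 : j / Ws <= gm^-1.
  apply: le_trans rj1; apply: ler_wpM2l => //; by rewrite lef_pV2 ?posrE.
have q1Y : 0 <= (1 - q) * Y by rewrite mulr_ge0 //; lra.
(* The factors [1 + q] and [1 - q] multiply to [1 - q^2], and [q] is of order [1 / n]. *)
have S2 : j / Ws * Y - j / Ws * (q ^+ 2 * Y) <= j / Ws' * ((1 - q) * Y).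
  apply: le_trans (ler_wpM2r q1Y rjWs).
  by rewrite le_eqVlt; apply/orP; left; apply/eqP; ring.
have S3 : j / Ws * (q ^+ 2 * Y) <= G * D * L ^+ 4 / (gm * gam ^+ 2) / nn.
  have qb : q <= L ^+ 2 / (gam * nn).
    by apply: ler_wpM2l; [exact: sqr_ge0|rewrite lef_pV2 ?posrE ?mulr_gt0].
  have Yb : Y <= G * D * nn.
    apply: (le_trans YG); rewrite -mulrA; apply: ler_wpM2l => //; apply: le_trans LWD.
    rewrite -[X in X <= _]mul1r; apply: ler_wpM2r => //; exact: ltW.
  have q2 : q ^+ 2 <= (L ^+ 2 / (gam * nn)) ^+ 2 by rewrite lerXn2r ?nnegrE // divr_ge0 ?sqr_ge0 // mulr_ge0 // ltW.
  have -> : G * D * L ^+ 4 / (gm * gam ^+ 2) / nn = gm^-1 * ((L ^+ 2 / (gam * nn)) ^+ 2 * (G * D * nn)).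
    by field; rewrite !lt0r_neq0.
  have st : q ^+ 2 * Y <= (L ^+ 2 / (gam * nn)) ^+ 2 * (G * D * nn) by apply: ler_pM => //; exact: sqr_ge0.
  by apply: ler_pM => //; rewrite mulr_ge0 ?sqr_ge0.
have S4 : Y / Ws - G * delta / gm <= Y / W.
  have -> : Y / Ws = Y / W + Y / W * X * (L * Ws)^-1.
    have -> : X = L * W - a * N by rewrite LW; ring.
    have aNE : a * N = L * Ws by rewrite WsE; field; rewrite lt0r_neq0.
    by rewrite aNE; field; rewrite !lt0r_neq0.
  have LWs0 : 0 < L * Ws by rewrite mulr_gt0.
  have h := YWX (L * Ws)^-1; rewrite invr_ge0 in h; have {}h := h (ltW LWs0).
  have h5 : G * (delta * nn) * (L * Ws)^-1 <= G * delta / gm.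
    rewrite ler_pdivrMr //.
    have -> : G * (delta * nn) = G * delta / gm * (gm * nn) by field; rewrite lt0r_neq0.
    apply: ler_wpM2l; first by rewrite divr_ge0 ?mulr_ge0 // ltW.
    by rewrite WsE; have -> : L * (a * N / L) = a * N by field; rewrite lt0r_neq0.
  lra.
have -> : (j + 1) / Ws * Y = j / Ws * Y + Y / Ws by ring.
have -> : (G * L / gam + 2 * G * D * L / gm) * delta / gm = C * delta / gm by [].
lra.
Qed.

(** A path through a vertex survives when its other [L - 1] vertices do, which suggests the degree
    [(N / n)^(L - 1)]. Bernoulli bounds for powers of [1 - t], with [t = L / N], compare consecutive
    values. *)
Lemma schedule (N nn gam : R) (L : nat) : (0 < L)%N -> 0 < nn -> 0 < gam <= 1 ->
  gam * nn <= N - L%:R -> N <= nn ->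
  let a := (N / nn) ^+ L.-1 in let a' := ((N - L%:R) / nn) ^+ L.-1 in
  let ke := L%:R ^+ 4 / gam ^+ 2 in
  [/\ `|a - a'| <= ke * nn^-1,
      `|a - a' - L%:R * (L%:R - 1) * a / N| <= ke * nn^-1 ^+ 2 &
      a' * (N - L%:R) / L%:R * (1 + L%:R ^+ 2 / N) <= a * N / L%:R].
Proof.
move=> L0 nn0 /andP[gam0 gam1] hN Nn a a' ke.
have L1 : 1 <= L%:R :> R by rewrite ler1n.
have gn : 0 < gam * nn by rewrite mulr_gt0.
have N0 : 0 < N by lra.
pose t := L%:R / N.
have t0 : 0 <= t by rewrite divr_ge0 // ltW.
have t1 : t <= 1 by rewrite ler_pdivrMr // mul1r; lra.
have tb : t <= L%:R / gam * nn^-1.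
  rewrite /t -mulrA -invfM; apply: ler_wpM2l => //; rewrite lef_pV2 ?posrE //; lra.
have t01 : 0 <= t <= 1 by rewrite t0.
have NL : N - L%:R = N * (1 - t) by rewrite /t; field; rewrite lt0r_neq0.
have a'E : a' = a * (1 - t) ^+ L.-1 by rewrite /a' /a NL mulrAC exprMn.
have p1 : L.-1%:R = L%:R - 1 :> R by rewrite -[in RHS](prednK L0) -natr1; ring.
have := bernoulli_up L.-1 t01; rewrite p1 => /andP[b1 b2].
have a0 : 0 <= a by rewrite exprn_ge0 // divr_ge0 // ltW.
have a1 : a <= 1 by rewrite exprn_ile1 // ?divr_ge0 ?ler_pdivrMr ?mul1r // ltW.
have u1 : (1 - t) ^+ L.-1 <= 1 by rewrite exprn_ile1 //; lra.
have nV0 : 0 <= nn^-1 by rewrite invr_ge0 ltW.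
have Lg : 1 <= L%:R / gam by rewrite ler_pdivlMr // mul1r; lra.
have keE : ke = (L%:R / gam) ^+ 2 * L%:R ^+ 2 by rewrite /ke; field; rewrite lt0r_neq0.
have L2 : 1 <= L%:R ^+ 2 :> R by rewrite exprn_ege1.
split.
- have -> : a - a' = a * (1 - (1 - t) ^+ L.-1) by rewrite a'E; ring.
  rewrite ger0_norm; last by rewrite mulr_ge0 //; lra.
  apply: (@le_trans _ _ (1 * (L%:R * t))).
    apply: ler_pM => //; [lra|].
    have : (L%:R - 1) * t <= L%:R * t by apply: ler_wpM2r => //; lra.
    lra.
  rewrite mul1r; apply: (@le_trans _ _ (L%:R * (L%:R / gam * nn^-1))); first by apply: ler_wpM2l.
  rewrite mulrA; apply: ler_wpM2r => //; rewrite keE expr2.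
  have h1 : L%:R <= L%:R ^+ 2 :> R by rewrite expr2 -[X in X <= _]mul1r; apply: ler_wpM2r.
  have h2 : L%:R / gam <= L%:R / gam * (L%:R / gam) by rewrite -[X in X <= _]mul1r; apply: ler_wpM2r => //; lra.
  by rewrite mulrC; apply: ler_pM => //; lra.
- have -> : L%:R * (L%:R - 1) * a / N = a * ((L%:R - 1) * t) by rewrite /t; ring.
  have -> : a - a' - a * ((L%:R - 1) * t) = - (a * ((1 - t) ^+ L.-1 - (1 - (L%:R - 1) * t))) by rewrite a'E; ring.
  rewrite normrN ger0_norm; last by rewrite mulr_ge0 //; lra.
  apply: (@le_trans _ _ (1 * (L%:R ^+ 2 * t ^+ 2))).
    apply: ler_pM => //; [lra|].
    have : (L%:R - 1) ^+ 2 * t ^+ 2 <= L%:R ^+ 2 * t ^+ 2.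
      by apply: ler_wpM2r; [exact: sqr_ge0|rewrite lerXn2r ?nnegrE //; lra].
    lra.
  rewrite mul1r; have -> : ke * nn^-1 ^+ 2 = L%:R ^+ 2 * (L%:R / gam * nn^-1) ^+ 2 by rewrite keE; ring.
  apply: ler_wpM2l; first by rewrite exprn_ge0.
  by rewrite lerXn2r ?nnegrE // mulr_ge0 //; lra.
have -> : a' * (N - L%:R) / L%:R * (1 + L%:R ^+ 2 / N) = a * N / L%:R * ((1 - t) ^+ L * (1 + L%:R * t)).
  rewrite a'E NL; have -> : (1 - t) ^+ L = (1 - t) * (1 - t) ^+ L.-1 by rewrite -exprS prednK.
  have -> : L%:R ^+ 2 / N = L%:R * t by rewrite /t; ring.
  by ring.
rewrite -[X in _ <= X]mulr1; apply: ler_wpM2l; first by rewrite divr_ge0 // mulr_ge0 // ltW.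
apply: (@le_trans _ _ ((1 - t) ^+ L * (1 + t) ^+ L)).
  by apply: ler_wpM2l; [rewrite exprn_ge0 //; lra|exact: bernoulli_low].
rewrite -exprMn exprn_ile1 //; have := sqr_ge0 t; rewrite expr2; nra.
Qed.

Lemma cauchy_card (T : finType) (V : {set T}) (x : T -> R) :
  (\sum_(v in V) `|x v|) ^+ 2 <= #|V|%:R * \sum_(v in V) x v ^+ 2.
Proof.
set X := \sum_(v in V) `|x v|.
have [V0|V0] := posnP #|V|.
  have -> : X = 0 by rewrite /X big_pred0 // => v; rewrite (cards0_eq V0) inE.
  by rewrite V0 mul0r expr0n.
have V0' : 0 < #|V|%:R :> R by rewrite ltr0n.
have : 0 <= \sum_(v in V) (`|x v| - X / #|V|%:R) ^+ 2 by apply: sumr_ge0 => v _; exact: sqr_ge0.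
under eq_bigr do rewrite sqrrB.
rewrite big_split sumrB /= sumr_const.
have -> : \sum_(v in V) `|x v| * (X / #|V|%:R) *+ 2 = 2 * (X ^+ 2 / #|V|%:R).
  by rewrite sumrMnl -mulr_suml -/X mulr2n; ring.
have -> : (X / #|V|%:R) ^+ 2 *+ #|V| = X ^+ 2 / #|V|%:R.
  by rewrite -mulr_natr; field; rewrite lt0r_neq0.
under eq_bigr do rewrite real_normK ?num_real //.
move=> h; have : X ^+ 2 / #|V|%:R <= \sum_(v in V) x v ^+ 2 by lra.
by rewrite ler_pdivrMr // mulrC.
Qed.

End ProcessReal.

(** * The potential and the backward induction *)

Section Process.

Variables (R : realType) (T I : finType) (L n Nend : nat) (w g : L.-tuple T -> R).
Variables (Nb : I -> {set T}) (D k1 K G gam zt delta lam B B1 bs : R).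

Let nn : R := n%:R.
Let Lr : R := L%:R.
Let gm := gam ^+ L.
Let ke := Lr ^+ 4 / gam ^+ 2.
Let k3 := Lr * k1 + ke.

(* With [j] paths still to be removed, [proc_N], [proc_a] and [proc_W] are the ideal
   size of the vertex set, degree and total weight; [proc_Psi] measures the
   deviation of the degrees, and [proc_Xi] is the exponential potential of the
   events that some [Nb i] loses density below [zt]. *)
Definition proc_N (j : nat) : nat := (Nend + j * L)%N.
Definition proc_a (j : nat) : R := ((proc_N j)%:R / n%:R) ^+ L.-1.
Definition proc_W (j : nat) : R := proc_a j * (proc_N j)%:R / L%:R.
Definition proc_Psi (j : nat) (V : {set T}) : R := \sum_(v in V) (wdeg w V v - proc_a j) ^+ 2.
Definition proc_Y (V : {set T}) : R := wsum (fun P => w P * g P) V.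
(** The relative growth per step allowed by [Xi_step]; the power of [1 + proc_s] in [proc_Xi]
    compensates it. *)
Definition proc_s : R := lam * (4 * L%:R * delta / (gam ^+ L * gam)) + 2 * (lam * (L%:R / gam)) ^+ 2.
Definition proc_Xi (j : nat) (V : {set T}) : R :=
  (1 + proc_s) ^+ j * \sum_i expR (lam * n%:R * (zt - #|Nb i :&: V|%:R / #|V|%:R)).
(** [proc_C] and [proc_k] bound the additive and the multiplicative growth of [proc_Psi] in
    [Psi_step], after division by the total weight. *)
Definition proc_C : R := 2 * (D + 1) * (Lr * k3 + Lr ^+ 3 * k1) + k3 ^+ 2 + 2 * (D + 1) * ke.
Definition proc_k : R := 4 * L%:R ^+ 2 * D / gam ^+ L.
(** The price of [proc_Psi] grows with the number of remaining steps, by the factor [proc_Psi] may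
    gain in one step; over at most [n] steps this amounts to at most [expR proc_k]. *)
Definition proc_b (j : nat) : R := bs * (1 + proc_k / n%:R) ^+ j.
Definition proc_E1 : R := (G * L%:R / gam + 2 * G * D * L%:R / gam ^+ L) * delta / gam ^+ L
  + G * delta / gam ^+ L + G * D * L%:R ^+ 4 / (gam ^+ L * gam ^+ 2) / n%:R.
(** The loss per step: from the logarithm of the total weight, from [Y_real], and from the additive
    growth of [proc_Psi]. *)
Definition proc_E : R := 2 * delta / gam ^+ L + proc_E1 + bs * expR proc_k * proc_C / n%:R.
Definition proc_A (j : nat) : R := \sum_(i < j) (ln (proc_W i.+1 / (n%:R * K)) - proc_E).
Definition proc_ok (V : {set T}) : bool := [forall i, zt * #|V|%:R <= #|Nb i :&: V|%:R :> R].

Hypothesis w0 : forall P, 0 <= w P.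
Hypothesis wu : forall P : L.-tuple T, ~~ uniq P -> w P = 0.
Hypothesis n0 : (0 < n)%N.
Hypothesis L0 : (0 < L)%N.
Hypothesis K1 : 1 <= K.
Hypothesis G0 : 0 <= G.
Hypothesis g01 : forall P, 0 <= g P <= G.
Hypothesis hg : forall P, 0 < w P -> ln ((n%:R ^+ L * w P)^-1) = g P - ln (n%:R * K).
Hypothesis degD : forall V v, wdeg w V v <= D.
Hypothesis D1 : 1 <= D.
Hypothesis k10 : 0 <= k1.
Hypothesis codK : forall V v u, v != u -> wcod w V v u <= k1 * n%:R^-1.
Hypothesis gam01 : 0 < gam <= 1.
Hypothesis gamN : gam * n%:R <= Nend%:R.
Hypothesis Lbig : L%:R ^+ 2 <= gam * n%:R.
Hypothesis dgm : 0 <= delta <= gam ^+ L / 2.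
Hypothesis lam0 : 0 < lam.
Hypothesis lam1 : lam * (L%:R / gam) <= 1 / 2.
Hypothesis B0 : 0 <= B.
Hypothesis bs0 : 0 <= bs.
(** These two conditions let the price of a large potential exceed any possible gain, so that the
    claim falls below the trivial bound [- B n]. *)
Hypothesis hB1 : B + G * D / gam ^+ L <= B1.
Hypothesis hbs : B1 <= bs * delta ^+ 2.

Let nn0 : 0 < nn. Proof. by rewrite ltr0n. Qed.
Let Lr1 : 1 <= Lr. Proof. by rewrite ler1n. Qed.
Let gam0 : 0 < gam. Proof. by case/andP: gam01. Qed.
Let gm0 : 0 < gm. Proof. exact: exprn_gt0. Qed.
Let d0 : 0 <= delta. Proof. by case/andP: dgm. Qed.

Lemma proc_B1_ge0 : 0 <= B1.
Proof.
apply: le_trans hB1; rewrite addr_ge0 //; apply: divr_ge0; last exact: ltW.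
by rewrite mulr_ge0 //; have := D1; lra.
Qed.

Lemma proc_N_ge j : gam * nn <= (proc_N j)%:R.
Proof. by apply: (le_trans gamN); rewrite ler_nat leq_addr. Qed.

Lemma proc_a01 j : (proc_N j <= n)%N -> 0 < proc_a j <= 1.
Proof.
move=> h; have g1 := proc_N_ge j.
have N0 : 0 < (proc_N j)%:R :> R by apply: lt_le_trans g1; rewrite mulr_gt0.
rewrite /proc_a exprn_gt0 /=; last by rewrite divr_gt0.
apply: exprn_ile1; first by rewrite divr_ge0 //; exact: ltW.
by rewrite ler_pdivrMr // mul1r ler_nat.
Qed.

Lemma proc_aN j : gm * nn <= proc_a j * (proc_N j)%:R.
Proof.
have -> : proc_a j * (proc_N j)%:R = ((proc_N j)%:R / nn) ^+ L * nn.
  rewrite /proc_a -[in RHS](prednK L0) exprSr -/nn; by field; rewrite lt0r_neq0.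
apply: ler_wpM2r; first exact: ltW.
rewrite lerXn2r ?nnegrE //; [exact: ltW|by rewrite divr_ge0 //; exact: ltW|].
by rewrite ler_pdivlMr //; exact: proc_N_ge.
Qed.

Lemma proc_W_ge j : gm * nn / Lr <= proc_W j.
Proof. by apply: ler_wpM2r; [rewrite invr_ge0|exact: proc_aN]. Qed.

Lemma proc_W_gt0 j : 0 < proc_W j.
Proof.
apply: lt_le_trans (proc_W_ge j); rewrite divr_gt0 ?mulr_gt0 //.
by apply: lt_le_trans Lr1.
Qed.

Lemma proc_Y_bound (V : {set T}) : (#|V| <= n)%N -> 0 <= proc_Y V <= G * D * nn.
Proof.
move=> Vn; apply/andP; split.
  by apply: sumr_ge0 => P _; rewrite mulr_ge0 //; case/andP: (g01 P).
have h1 : proc_Y V <= G * wsum w V.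
  rewrite /proc_Y /wsum mulr_sumr; apply: ler_sum => P _; rewrite mulrC.
  by apply: ler_wpM2r => //; case/andP: (g01 P).
have h2 : L%:R * wsum w V <= D * nn.
  rewrite -(wdeg_total V wu); apply: (@le_trans _ _ (\sum_(v in V) D)); first exact: ler_sum.
  rewrite sumr_const -[X in X <= _]mulr_natr; apply: ler_wpM2l; last by rewrite ler_nat.
  by have := D1; lra.
have W0 : 0 <= wsum w V by apply: sumr_ge0.
apply: (le_trans h1); rewrite -mulrA; apply: ler_wpM2l; first exact: G0.
apply: le_trans h2; rewrite -[X in X <= _]mul1r; exact: ler_wpM2r Lr1.
Qed.

Lemma proc_C_ge0 : 0 <= proc_C.
Proof.
have Lr0 : 0 <= Lr by apply: le_trans Lr1.
have ke0 : 0 <= ke by rewrite divr_ge0 ?exprn_ge0 // ltW.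
have k30 : 0 <= k3 by rewrite addr_ge0 // mulr_ge0.
have DD : 0 <= 2 * (D + 1) by have := D1; lra.
by rewrite /proc_C !addr_ge0 ?sqr_ge0 // mulr_ge0 // addr_ge0 // mulr_ge0 // exprn_ge0.
Qed.

Lemma proc_k_ge0 : 0 <= proc_k.
Proof. by rewrite divr_ge0 ?mulr_ge0 ?exprn_ge0 // ?ltW //; have := D1; lra. Qed.

Lemma proc_E1_ge0 : 0 <= proc_E1.
Proof.
have D0 : 0 <= D by have := D1; lra.
have g0 := ltW gam0; have gm0' := ltW gm0; have dd := d0.
rewrite /proc_E1 !addr_ge0 // ?divr_ge0 ?mulr_ge0 ?addr_ge0 // ?divr_ge0 ?mulr_ge0 ?exprn_ge0 //.
Qed.

Lemma proc_E_ge0 : 0 <= proc_E.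
Proof.
rewrite /proc_E; apply: addr_ge0; first apply: addr_ge0; last first.
- by rewrite divr_ge0 // !mulr_ge0 ?expR_ge0 ?proc_C_ge0.
- exact: proc_E1_ge0.
by rewrite divr_ge0 ?mulr_ge0 ?d0 //; exact: ltW.
Qed.

Lemma proc_W_le j : (proc_N j <= n)%N -> proc_W j <= nn.
Proof.
move=> h; have /andP[a0 a1] := proc_a01 h.
rewrite /proc_W ler_pdivrMr ?ltr0n //.
apply: (@le_trans _ _ (1 * nn)); first by apply: ler_pM => //; [exact: ltW|rewrite ler_nat].
by rewrite mul1r -[X in X <= _]mulr1; apply: ler_wpM2l; [exact: ltW|exact: Lr1].
Qed.

Lemma proc_A_le0 j : (proc_N j <= n)%N -> proc_A j <= 0.
Proof.
move=> h; rewrite /proc_A; apply: sumr_le0 => i _.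
have hi : (proc_N i.+1 <= n)%N by apply: leq_trans h; rewrite leq_add2l leq_mul2r ltn_ord orbT.
suff : ln (proc_W i.+1 / (n%:R * K)) <= 0 by have := proc_E_ge0; lra.
have K0 : 0 < K by have := K1; lra.
apply: ln_le0; rewrite ler_pdivrMr ?mulr_gt0 // mul1r; apply: (le_trans (proc_W_le hi)).
rewrite -[X in X <= _]mulr1; apply: ler_wpM2l; [exact: ltW|exact: K1].
Qed.

Lemma proc_b_bounds j : (j <= n)%N -> bs <= proc_b j <= bs * expR proc_k.
Proof.
move=> jn; have kk : 0 <= proc_k / n%:R by rewrite divr_ge0 ?proc_k_ge0 // ltW.
apply/andP; split.
  rewrite -[X in X <= _]mulr1; apply: ler_wpM2l; first exact: bs0.
  by rewrite exprn_ege1 // lerDl.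
apply: ler_wpM2l; first exact: bs0.
apply: (le_trans (pow1D_expR j kk)); rewrite ler_expR mulrCA -[X in _ <= X]mulr1.
apply: ler_wpM2l; first exact: proc_k_ge0.
by rewrite ler_pdivrMr // mul1r ler_nat.
Qed.

Lemma proc_trivial j (V : {set T}) : (proc_N j <= n)%N -> (#|V| <= n)%N ->
  proc_A j + j%:R / proc_W j * proc_Y V <= (B1 - B) * nn.
Proof.
move=> h Vn; have h1 := proc_A_le0 h; have /andP[y0 y1] := proc_Y_bound Vn.
have jL : j%:R * Lr <= nn by rewrite -natrM ler_nat; apply: leq_trans h; rewrite leq_addl.
have W0 := proc_W_gt0 j.
have Lr0 : 0 < Lr by apply: lt_le_trans Lr1.
have r1 : j%:R / proc_W j <= gm^-1.
  rewrite ler_pdivrMr //; apply: (@le_trans _ _ (gm^-1 * (gm * nn / Lr))).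
    have -> : gm^-1 * (gm * nn / Lr) = nn / Lr by field; rewrite !lt0r_neq0.
    by rewrite ler_pdivlMr.
  by apply: ler_wpM2l; [rewrite invr_ge0 ltW|exact: proc_W_ge].
have : j%:R / proc_W j * proc_Y V <= gm^-1 * (G * D * nn).
  by apply: ler_pM => //; rewrite divr_ge0 // ltW.
have : (B + G * D / gm) * nn <= B1 * nn by apply: ler_wpM2r; [exact: ltW|exact: hB1].
lra.
Qed.

(* Once a potential is large the claimed bound is weaker than the trivial one. *)
Lemma proc_bad j (V : {set T}) : #|V| = proc_N j -> (proc_N j <= n)%N ->
  1 < proc_Xi j V \/ delta * nn < \sum_(v in V) `|wdeg w V v - proc_a j| ->
  proc_A j + j%:R / proc_W j * proc_Y V - proc_b j * proc_Psi j V - B1 * nn * proc_Xi j V <= - (B * nn).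
Proof.
move=> cV h bad; have Vn : (#|V| <= n)%N by rewrite cV.
have t1 := proc_trivial h Vn.
have jn : (j <= n)%N.
  by apply: leq_trans h; rewrite /proc_N (leq_trans (leq_pmulr j L0)) // leq_addl.
have /andP[b1 _] := proc_b_bounds jn.
have P0 : 0 <= proc_Psi j V by apply: sumr_ge0 => v _; exact: sqr_ge0.
have B10 := proc_B1_ge0.
have X0 : 0 <= proc_Xi j V.
  rewrite mulr_ge0 //; last by apply: sumr_ge0 => i _; exact: expR_ge0.
  rewrite exprn_ge0 // addr_ge0 // /proc_s addr_ge0 ?mulr_ge0 ?sqr_ge0 // ?invr_ge0 ?mulr_ge0 ?d0 //; exact: ltW.
have bP : bs * proc_Psi j V <= proc_b j * proc_Psi j V by apply: ler_wpM2r.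
have bP0 : 0 <= bs * proc_Psi j V by rewrite mulr_ge0.
have Bn0 : 0 <= B1 * nn by rewrite mulr_ge0 // ltW.
have BX0 : 0 <= B1 * nn * proc_Xi j V by rewrite mulr_ge0.
case: bad => [x1|s1].
  have : B1 * nn <= B1 * nn * proc_Xi j V by rewrite -[X in X <= _]mulr1; apply: ler_wpM2l => //; exact: ltW.
  lra.
have c := cauchy_card V (fun v => wdeg w V v - proc_a j).
have dn0 : 0 <= delta * nn by rewrite mulr_ge0 // ltW.
have h2 : (delta * nn) ^+ 2 <= nn * proc_Psi j V.
  apply: (@le_trans _ _ ((\sum_(v in V) `|wdeg w V v - proc_a j|) ^+ 2)).
    by rewrite lerXn2r ?nnegrE // ?ltW // (le_lt_trans dn0).
  apply: (le_trans c); apply: ler_wpM2r => //; by rewrite ler_nat.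
have h3 : delta ^+ 2 * nn <= proc_Psi j V.
  by rewrite -(ler_pM2l nn0); apply: le_trans h2; rewrite le_eqVlt; apply/orP; left; apply/eqP; ring.
have h4 : B1 * nn <= bs * proc_Psi j V.
  apply: (@le_trans _ _ (bs * (delta ^+ 2 * nn))); last exact: ler_wpM2l.
  rewrite mulrA; apply: ler_wpM2r; [exact: ltW|exact: hbs].
lra.
Qed.

(** Induction on the number of remaining steps. If a potential is large, the summand
    [expR (- (B * nn))] suffices; otherwise [ncount_step] passes to the average over the removed
    path, where [proc_Y], [proc_Psi] and [proc_Xi] change as their coefficients anticipate. *)
Lemma proc_main j (V : {set T}) : #|V| = proc_N j -> (proc_N j <= n)%N ->
  proc_A j + j%:R / proc_W j * proc_Y V - proc_b j * proc_Psi j V - B1 * nn * proc_Xi j V <=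
  ln (ncount n w proc_ok j V + expR (- (B * nn))).
Proof.
elim: j V => [|j IH] V cV h.
  have tr : - (B * nn) <= ln (ncount n w proc_ok 0 V + expR (- (B * nn))).
    rewrite -[X in X <= _]expRK ler_ln ?posrE ?expR_gt0 ?lerDr ?ncount_ge0 //.
    by rewrite ltr_wpDl ?expR_gt0 // ncount_ge0.
  have [x1|x1] := ltP 1 (proc_Xi 0 V); first by apply: le_trans tr; apply: proc_bad => //; left.
  (* A sum of exponentials which is at most [1] has no positive exponent, which is the required
     density. *)
  have okV : proc_ok V.
    apply/forallP => i.
    have V0 : 0 < #|V|%:R :> R by rewrite cV; apply: lt_le_trans (proc_N_ge 0); rewrite mulr_gt0.
    have : expR (lam * n%:R * (zt - #|Nb i :&: V|%:R / #|V|%:R)) <= 1.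
      apply: le_trans x1; rewrite /proc_Xi expr0 mul1r (bigD1 i) //= lerDl.
      by apply: sumr_ge0 => *; exact: expR_ge0.
    rewrite -[X in _ <= X -> _]expR0 ler_expR pmulr_rle0; first by rewrite subr_le0 ler_pdivlMr.
    by rewrite mulr_gt0.
  have bd : 0 <= B1 * nn * proc_Xi 0 V.
    have B10 := proc_B1_ge0.
    rewrite mulr_ge0 //; first by rewrite mulr_ge0 //; exact: ltW.
    by rewrite /proc_Xi expr0 mul1r; apply: sumr_ge0 => i _; exact: expR_ge0.
  have P0 : 0 <= proc_b 0 * proc_Psi 0 V.
    by rewrite mulr_ge0 ?sumr_ge0 // => [|v _]; rewrite ?sqr_ge0 // /proc_b expr0 mulr1.
  have l0 : 0 <= ln (ncount n w proc_ok 0 V + expR (- (B * nn))).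
    by rewrite ln_ge0 //= okV lerDl expR_ge0.
  rewrite /proc_A big_ord0 mul0r mul0r; lra.
set e0 := expR (- (B * nn)) in IH *.
have e00 : 0 < e0 by exact: expR_gt0.
have tr : - (B * nn) <= ln (ncount n w proc_ok j.+1 V + e0).
  rewrite -[X in X <= _]expRK ler_ln ?posrE // ?lerDr ?ncount_ge0 //.
  by rewrite ltr_wpDl // ncount_ge0.
have [x1|x1] := ltP 1 (proc_Xi j.+1 V); first by apply: le_trans tr; apply: proc_bad => //; left.
have [s1|s1] := ltP (delta * nn) (\sum_(v in V) `|wdeg w V v - proc_a j.+1|).
  by apply: le_trans tr; apply: proc_bad => //; right.
have h' : (proc_N j <= n)%N by apply: leq_trans h; rewrite leq_add2l leq_mul2r leqnSn orbT.
have NE : (proc_N j)%:R = (proc_N j.+1)%:R - Lr by rewrite /proc_N mulSn addnCA [(L + _)%:R]natrD [_ + (_)%:R]addrC addrK.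
have Vn : (#|V| <= n)%N by rewrite cV.
have jn : (j <= n)%N.
  by apply: leq_trans h'; rewrite /proc_N (leq_trans (leq_pmulr j L0)) // leq_addl.
have /andP[a0 a1] := proc_a01 h.
have aV : gm * nn <= proc_a j.+1 * #|V|%:R by rewrite cV; exact: proc_aN.
have dgV v : v \in V -> wdeg w V v <= D by move=> _; exact: degD.
have K0 : 0 < K by have := K1; lra.
have Wge : gm * nn / (2 * Lr) <= wsum w V := W_ge wu n0 L0 aV dgm s1.
have gn0 : 0 < gm * nn by rewrite mulr_gt0.
have Lr0 : 0 < Lr by apply: lt_le_trans Lr1.
have W0 : 0 < wsum w V by apply: lt_le_trans Wge; rewrite divr_gt0 // mulr_gt0.
set W := wsum w V in W0 Wge.
have st := ncount_step proc_ok w0 n0 L0 K0 hg j e00 Vn W0.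
apply: le_trans st; rewrite -/W -/(proc_Y V).
have hln := lnW_ge wu n0 L0 aV gm0 dgm s1 K0.
rewrite cV -/(proc_W j.+1) -/W in hln.
pose phi U := proc_A j + j%:R / proc_W j * proc_Y U - proc_b j * proc_Psi j U - B1 * nn * proc_Xi j U.
have hphi : wsum (fun P => w P * phi (V :\: [set x in P]%SET)) V <=
    wsum (fun P => w P * ln (ncount n w proc_ok j (V :\: [set x in P]%SET) + e0)) V.
  apply: ler_sum => P PV; have [uP|/wu ->] := boolP (uniq P); last by rewrite !mul0r.
  apply: ler_wpM2l => //; apply: IH => //.
  have PsV : [set x in P]%SET \subset V by apply/subsetP => x; rewrite inE => /(allP PV).
  rewrite cardsD (setIidPr PsV) card_set_uniq // size_tuple cV /proc_N mulSn.
  by rewrite addnCA addKn.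
set ZY := wsum (fun P => w P * proc_Y (V :\: [set x in P]%SET)) V.
set ZP := wsum (fun P => w P * proc_Psi j (V :\: [set x in P]%SET)) V.
set ZX := wsum (fun P => w P * proc_Xi j (V :\: [set x in P]%SET)) V.
have phiE : wsum (fun P => w P * phi (V :\: [set x in P]%SET)) V =
    proc_A j * W + j%:R / proc_W j * ZY - proc_b j * ZP - B1 * nn * ZX.
  rewrite /W /ZY /ZP /ZX /wsum !mulr_sumr -big_split /= -!sumrB; apply: eq_bigr => P _.
  by rewrite /phi; ring.
have iW0 : 0 <= W^-1 by rewrite invr_ge0 ltW.
have hdiv := ler_wpM2r iW0 hphi; rewrite phiE in hdiv.
have gN' : gam * nn <= (proc_N j.+1)%:R - Lr by rewrite -NE; exact: proc_N_ge.
have Nn : (proc_N j.+1)%:R <= nn by rewrite ler_nat.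
have [sc1 sc2 sc3] := schedule L0 nn0 gam01 gN' Nn.
rewrite -/(proc_a j.+1) -/Lr in sc1 sc2 sc3.
have a'E : (((proc_N j.+1)%:R - Lr) / nn) ^+ L.-1 = proc_a j by rewrite /proc_a NE.
rewrite a'E -/ke in sc1 sc2 sc3.
rewrite -NE in sc3.
have V0 : (0 < #|V|)%N by rewrite cV -(ltr0n R); apply: lt_le_trans (proc_N_ge j.+1); rewrite mulr_gt0.
have ke0 : 0 <= ke by rewrite divr_ge0 ?exprn_ge0 // ltW.
have nV0 : 0 < nn^-1 by rewrite invr_gt0.
have cod' v u : v \in V -> u \in V -> v != u -> wcod w V v u <= k1 * nn^-1 by move=> _ _; exact: codK.
have VnV : #|V|%:R * nn^-1 <= 1 by rewrite ler_pdivrMr // mul1r ler_nat.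
have a01' : 0 <= proc_a j.+1 <= 1 by rewrite (ltW a0).
have hP := Psi_step w0 wu nV0 k10 ke0 a01' D1 L0 dgV cod' VnV sc1.
rewrite cV in hP; have {}hP := hP sc2; rewrite -cV in hP; have {}hP := hP V0.
rewrite -/(proc_Psi j.+1 V) -/W in hP.
have Psi0 : 0 <= proc_Psi j.+1 V by apply: sumr_ge0 => v _; exact: sqr_ge0.
have hP2 : ZP * W^-1 <= (1 + proc_k / nn) * proc_Psi j.+1 V + proc_C / nn.
  have hPW : ZP <= W * (proc_Psi j.+1 V + proc_C * nn^-1) + 2 * (Lr - 1) * D * proc_Psi j.+1 V by [].
  rewrite ler_pdivrMr //; apply: (le_trans hPW).
  have hk : 2 * (Lr - 1) * D <= proc_k / nn * W.
    apply: (@le_trans _ _ (proc_k / nn * (gm * nn / (2 * Lr)))); last first.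
      by apply: ler_wpM2l => //; rewrite divr_ge0 ?proc_k_ge0 // ltW.
    have -> : proc_k / nn * (gm * nn / (2 * Lr)) = 2 * Lr * D.
      by rewrite /proc_k -/gm -/Lr; field; rewrite !lt0r_neq0.
    apply: ler_wpM2r; first exact: le_trans ler01 D1.
    by rewrite ler_pM2l // gerBl.
  have := ler_wpM2r Psi0 hk; lra.
have bj0 : 0 <= proc_b j by have /andP[b1 _] := proc_b_bounds jn; apply: le_trans b1.
have hP3 : proc_b j * (ZP * W^-1) <= proc_b j.+1 * proc_Psi j.+1 V + bs * expR proc_k * proc_C / nn.
  apply: (le_trans (ler_wpM2l bj0 hP2)).
  have -> : proc_b j.+1 = proc_b j * (1 + proc_k / nn) by rewrite /proc_b exprSr mulrA.
  have : proc_b j * (proc_C / nn) <= bs * expR proc_k * (proc_C / nn).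
    apply: ler_wpM2r; first by rewrite divr_ge0 ?proc_C_ge0 // ltW.
    by case/andP: (proc_b_bounds jn).
  lra.
have LV : (L < #|V|)%N.
  rewrite cV -(ltr_nat R) -/Lr -subr_gt0; apply: lt_le_trans gN'; by rewrite mulr_gt0.
have gV : gam * nn <= #|V|%:R - Lr by rewrite cV.
have hX := Xi_step w0 wu n0 L0 aV gm0 dgm s1 Nb zt gam0 (ltW lam0) lam1 LV gV (ltW a0).
have s0 : 0 <= 1 + proc_s.
  have dd := d0; have g0' := ltW gam0; have gm0' := ltW gm0; have l0' := ltW lam0.
  by rewrite addr_ge0 // /proc_s addr_ge0 ?mulr_ge0 ?sqr_ge0 // ?invr_ge0 ?mulr_ge0.
have hX2 : ZX * W^-1 <= proc_Xi j.+1 V.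
  rewrite ler_pdivrMr //.
  have -> : ZX = (1 + proc_s) ^+ j * wsum (fun P => w P * \sum_i expR (lam * nn * (zt - #|Nb i :&: (V :\: [set x in P]%SET)|%:R / #|V :\: [set x in P]%SET|%:R))) V.
    by rewrite /ZX /wsum mulr_sumr; apply: eq_bigr => P _; rewrite /proc_Xi mulrCA.
  have -> : proc_Xi j.+1 V * W = (1 + proc_s) ^+ j * (W * ((1 + proc_s) * \sum_i expR (lam * nn * (zt - #|Nb i :&: V|%:R / #|V|%:R)))).
    by rewrite /proc_Xi exprSr; ring.
  by apply: ler_wpM2l; [rewrite exprn_ge0|exact: hX].
have B10 : 0 <= B1 * nn.
  by rewrite mulr_ge0 ?proc_B1_ge0 //; exact: ltW.
have hX3 := ler_wpM2l B10 hX2.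
have hYs : W * proc_Y V - Lr * proc_a j.+1 * proc_Y V - G * D * (delta * nn) <= ZY.
  apply: (Y_step w0 wu dgV D1 s1 G0) => //; last exact: ltW.
  move=> P; case/andP: (g01 P) => g0 g1; rewrite mulr_ge0 //= mulrC; exact: ler_wpM2r.
have /andP[Y0 _] := proc_Y_bound Vn.
have YG : proc_Y V <= G * W.
  rewrite /proc_Y /W /wsum mulr_sumr; apply: ler_sum => P _; rewrite mulrC.
  by apply: ler_wpM2r => //; case/andP: (g01 P).
have LWD : Lr * W <= D * nn.
  rewrite -(wdeg_total V wu); apply: (@le_trans _ _ (\sum_(v in V) D)); first exact: ler_sum.
  rewrite sumr_const -[X in X <= _]mulr_natr; apply: ler_wpM2l; last by rewrite ler_nat.
  exact: le_trans ler01 D1.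
have LWe := LWE wu V (proc_a j.+1); have hXl := X_le s1.
have q1 : Lr ^+ 2 / (proc_N j.+1)%:R <= 1.
  have hh : gam * nn <= (proc_N j.+1)%:R := proc_N_ge _.
  rewrite ler_pdivrMr ?mul1r; first by apply: (le_trans Lbig).
  by apply: lt_le_trans hh; rewrite mulr_gt0.
have jL : j%:R * Lr <= nn by rewrite -natrM ler_nat; apply: leq_trans h'; rewrite leq_addl.
rewrite cV in LWe aV.
have hY := Y_real LWe hXl aV Wge Y0 YG LWD hYs erefl sc3 q1 (proc_W_ge j) (proc_N_ge j.+1) jL (ler0n _ _) d0 G0 D1 Lr1 gm0 gam0 nn0.
rewrite -/(proc_W j.+1) natr1 in hY.
have AE : proc_A j.+1 = proc_A j + (ln (proc_W j.+1 / (nn * K)) - proc_E) by rewrite /proc_A big_ord_recr.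
have E0E : proc_E = 2 * delta / gm + proc_E1 + bs * expR proc_k * proc_C / nn by [].
have hY' : j.+1%:R / proc_W j.+1 * proc_Y V - proc_E1 <= proc_Y V / W + j%:R / proc_W j * (ZY / W) by [].
have WW : W * W^-1 = 1 by rewrite divff // lt0r_neq0.
have hdiv' : proc_A j + j%:R / proc_W j * (ZY / W) - proc_b j * (ZP / W) - B1 * nn * (ZX / W) <=
   wsum (fun P => w P * ln (ncount n w proc_ok j (V :\: [set x in P]%SET) + e0)) V / W.
  apply: le_trans hdiv; rewrite le_eqVlt; apply/orP; left; apply/eqP.
  rewrite !mulrBl mulrDl -[proc_A j * W * _]mulrA WW; ring.
rewrite AE E0E.
move: hln hdiv' hP3 hX3 hY'.
move: (ln (proc_W j.+1 / (nn * K))) (ln (W / (nn * K))) (proc_Y V / W) (j%:R / proc_W j * (ZY / W))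
  (proc_b j * (ZP / W)) (B1 * nn * (ZX / W)) (j.+1%:R / proc_W j.+1 * proc_Y V) (proc_b j.+1 * proc_Psi j.+1 V)
  (B1 * nn * proc_Xi j.+1 V) (bs * expR proc_k * proc_C / nn) (proc_A j)
  (wsum (fun P => w P * ln (ncount n w proc_ok j (V :\: [set x in P]%SET) + e0)) V / W)
  (2 * delta / gm) proc_E1 => x1' x2 x3 x4 x5 x6 x7 x8 x9 x10 x11 x12 x13 x14; lra.
Qed.

End Process.

(** * Interpreting the count as a number of path systems *)

Section PathSequences.

Variables (R : realType) (T : finType) (L n : nat) (w : L.-tuple T -> R) (ok : {set T} -> bool).

Fixpoint pvalid (V : {set T}) (s : seq (L.-tuple T)) : bool :=
  if s is P :: s' then (inV V P && (0 < w P)) && pvalid (V :\: [set x in P]%SET) s' else ok V.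

Lemma ncount_card m (V : {set T}) : (0 < n)%N ->
  ncount n w ok m V * (n%:R ^+ L) ^+ m = #|[set Ps : m.-tuple (L.-tuple T) | pvalid V Ps]%SET|%:R.
Proof.
move=> n0; have nL : n%:R ^+ L != 0 :> R by rewrite expf_neq0 // pnatr_eq0 -lt0n.
elim: m V => [|m IH] V.
  rewrite /= expr0 mulr1; case okV: (ok V); last first.
    by rewrite (_ : [set _ | _]%SET = set0) ?cards0 //; apply/setP => Ps; rewrite !inE (tuple0 Ps) /= okV.
  rewrite (_ : [set _ | _]%SET = setT) ?cardsT ?card_tuple ?expn0 //; apply/setP => Ps; by rewrite !inE (tuple0 Ps) /= okV.
rewrite /= mulr_suml.
pose f (p : L.-tuple T * m.-tuple (L.-tuple T)) : m.+1.-tuple (L.-tuple T) := [tuple of p.1 :: p.2].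
have fI : injective f by move=> [x t] [x' t'] /(congr1 val) [-> /val_inj ->].
have -> : [set Ps : m.+1.-tuple (L.-tuple T) | pvalid V Ps]%SET =
   (f @: [set p : L.-tuple T * m.-tuple (L.-tuple T) | (inV V p.1 && (0 < w p.1)) && pvalid (V :\: [set x in p.1]%SET) p.2])%SET.
  apply/setP => Ps; apply/idP/imsetP.
    case/tupleP: Ps => P Ps; rewrite inE /= => h; exists (P, Ps) => //; by rewrite inE.
  by case=> -[P Qs]; rewrite inE => h ->; rewrite inE.
rewrite card_imset // -sum1dep_card.
rewrite -(pair_big_dep (fun P => inV V P && (0 < w P)) (fun P (Ps : m.-tuple (L.-tuple T)) => pvalid (V :\: [set x in P]%SET) Ps) (fun _ _ => 1%N)) /= natr_sum.
apply: eq_bigr => P _; rewrite sum1dep_card -IH exprS.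
by rewrite mulrACA mulVf // mul1r.
Qed.

Lemma pvalidP V s : (forall P : L.-tuple T, 0 < w P -> uniq P) -> pvalid V s ->
  [/\ uniq (flat s), all (mem V) (flat s), all (fun P => 0 < w P) s &
      ok (V :\: [set x in flat s]%SET)].
Proof.
move=> wU; elim: s V => [|P s IH] V /=.
  move=> okV; split=> //; suff -> : V :\: [set x in flat [::]]%SET = V by [].
  by move=> t; apply/setP => x; rewrite !inE.
move=> /andP[/andP[PV wP] /IH[us sV sw oks]]; split.
- rewrite /flat /= cat_uniq (wU _ wP) us andbT /=; apply/hasPn => x xs.
  by have := allP sV x xs; rewrite !inE => /andP[].
- rewrite /flat /= all_cat; apply/andP; split; first exact: PV.
  by apply/allP => x xs; have := allP sV x xs; rewrite !inE => /andP[].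
- by rewrite wP.
suff -> : V :\: [set x in flat (P :: s)]%SET = (V :\: [set x in P]%SET) :\: [set x in flat s]%SET by [].
by apply/setP => x; rewrite !inE /flat /= mem_cat negb_or andbA [X in _ = X && _]andbC.
Qed.

End PathSequences.

(** * Choosing the constants of the process *)

Section ProcessCount.

Variable R : realType.

Lemma poly_exp_small (c e : R) (k : nat) : 0 < c -> 0 < e ->
  exists n0, forall n, (n0 <= n)%N -> n%:R ^+ k * expR (- (c * n%:R)) <= e.
Proof.
move=> c0 e0.
pose C := (k.+1%:R / c) ^+ k.+1.
have k1 : 0 < k.+1%:R :> R by rewrite ltr0n.
have C0 : 0 < C by rewrite exprn_gt0 // divr_gt0.
exists (Num.bound (C / e)).+1 => n hn.
have n0 : 0 < n%:R :> R by rewrite ltr0n (leq_trans _ hn).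
have nC : C / e <= n%:R.
  apply: ltW; apply: (lt_le_trans (archi_boundP _)); first by rewrite divr_ge0 // ltW.
  by rewrite ler_nat ltnW.
have h1 : (c * n%:R / k.+1%:R) ^+ k.+1 <= expR (c * n%:R).
  have -> : c * n%:R = (c * n%:R / k.+1%:R) * k.+1%:R by field; rewrite lt0r_neq0.
  rewrite expRM_natr lerXn2r ?nnegrE ?expR_ge0 //.
    by rewrite divr_ge0 ?mulr_ge0 // ltW.
  rewrite -[X in X / _](_ : c * n%:R = _); last by field; rewrite lt0r_neq0.
  by apply: le_trans (expR_ge1Dx _); rewrite lerDr.
have h2 : n%:R ^+ k.+1 <= C * expR (c * n%:R).
  have -> : n%:R ^+ k.+1 = C * (c * n%:R / k.+1%:R) ^+ k.+1.
    by rewrite /C -exprMn; congr (_ ^+ _); field; rewrite !lt0r_neq0.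
  by apply: ler_wpM2l => //; exact: ltW.
rewrite expRN ler_pdivrMr ?expR_gt0 // -(ler_pM2r n0) -exprSr.
apply: (le_trans h2); rewrite mulrAC; apply: ler_wpM2r; first exact: expR_ge0.
by move: nC; rewrite ler_pdivrMr // mulrC.
Qed.

(** [zeta] is the permitted loss of neighbourhood density and [eps0] bounds the initial deviation of
    the degrees. The number of neighbourhoods is only polynomial, so the exponential gain from
    [zeta] beats it. *)
Lemma process_count (L kk : nat) (D k1 K G gam zeta eps Ci : R) :
  (0 < L)%N -> 1 <= D -> 0 <= k1 -> 1 <= K -> 0 <= G -> 0 < gam <= 1 -> 0 < zeta -> 0 < eps -> 0 <= Ci ->
  exists eps0 : R, 0 < eps0 /\ exists n0, forall (T I : finType) (n m Nend : nat)
    (w g : L.-tuple T -> R) (Nb : I -> {set T}) (V : {set T}) (z : R),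
    (n0 <= n)%N -> #|V| = n -> n = (Nend + m * L)%N -> gam * n%:R <= Nend%:R ->
    #|I|%:R <= Ci * n%:R ^+ kk ->
    (forall P, 0 <= w P) -> (forall P : L.-tuple T, ~~ uniq P -> w P = 0) ->
    (forall P, 0 <= g P <= G) ->
    (forall P, 0 < w P -> ln ((n%:R ^+ L * w P)^-1) = g P - ln (n%:R * K)) ->
    (forall V v, wdeg w V v <= D) ->
    (forall V v u, v != u -> wcod w V v u <= k1 * n%:R^-1) ->
    \sum_(v in V) (wdeg w V v - 1) ^+ 2 <= eps0 * n%:R ->
    (forall i, z * n%:R <= #|Nb i :&: V|%:R) ->
    expR (\sum_(i < m) ln ((n%:R * ((Nend + i.+1 * L)%N%:R / n%:R) ^+ L / L%:R) / (n%:R * K))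
          + (m * L)%N%:R / n%:R * wsum (fun P => w P * g P) V - eps * n%:R) <=
    ncount n w (proc_ok Nb (z - zeta)) m V.
Proof.
move=> L0 D1 k10 K1 G0 /[dup] gam01 /andP[gam0 gam1] ze0 eps0 Ci0.
have Lr0 : 0 < L%:R :> R by rewrite ltr0n.
have L1 : 1 <= L%:R :> R by rewrite ler1n.
pose gm := gam ^+ L.
have gm0 : 0 < gm by exact: exprn_gt0.
have gm1 : gm <= 1 by apply: exprn_ile1 => //; exact: ltW.
have K0 : 0 < K by lra.
have LKg : 1 <= L%:R * K / gm.
  rewrite ler_pdivlMr // mul1r; apply: (le_trans gm1).
  by rewrite -[X in X <= _]mulr1; apply: ler_pM.
(* No summand of the main term is below [- c0]; so [expR (- (B * n%:R))] is negligible against the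
   claimed bound. *)
pose c0 := ln (L%:R * K / gm).
have c00 : 0 <= c0 by rewrite ln_ge0.
pose B := c0 + eps + 1.
have B0 : 0 <= B by rewrite /B; lra.
pose B1 := B + G * D / gm.
have B10 : 0 < B1.
  have : 0 <= G * D / gm by rewrite divr_ge0 ?mulr_ge0 //; [lra|exact: ltW].
  by rewrite /B1 /B; lra.
pose s1 := 4 * L%:R / (gm * gam).
have s10 : 0 < s1 by rewrite divr_gt0 ?mulr_gt0.
pose C1 := 2 / gm + ((G * L%:R / gam + 2 * G * D * L%:R / gm) / gm + G / gm).
have C10 : 0 < C1.
  have h1 : 0 < 2 / gm by rewrite divr_gt0.
  have h2 : 0 <= (G * L%:R / gam + 2 * G * D * L%:R / gm) / gm + G / gm.
    have g0' := ltW gam0; have gm0' := ltW gm0; have D0 : 0 <= D by lra.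
    by rewrite addr_ge0 // ?divr_ge0 ?addr_ge0 // ?divr_ge0 ?mulr_ge0.
  by rewrite /C1; lra.
(* The three bounds keep the total weight away from [0], the loss [C1 * delta] per step below
   [eps / 8], and the linear part of [proc_s] below [lam * (zeta / 4)]. *)
pose delta := Order.min (gm / 2) (Order.min (eps / (8 * C1)) (zeta / (4 * s1))).
have de0 : 0 < delta.
  rewrite !lt_min; apply/andP; split; first by rewrite divr_gt0.
  by apply/andP; split; rewrite divr_gt0 // mulr_gt0.
have de1 : delta <= gm / 2 by rewrite ge_min lexx.
have de2 : delta <= eps / (8 * C1) by rewrite !ge_min lexx !orbT.
have de3 : delta <= zeta / (4 * s1) by rewrite !ge_min lexx !orbT.
(* The quadratic part of [proc_s] is of order [lam^2]. For small [lam] the growth over all steps is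
   at most [expR (lam * (zeta / 2) * n%:R)], half of the exponent gained initially. *)
pose lam := Order.min (gam / (2 * L%:R)) (zeta * gam ^+ 2 / (8 * L%:R ^+ 2)).
have la0 : 0 < lam by rewrite lt_min !divr_gt0 ?mulr_gt0 ?exprn_gt0.
have la1 : lam * (L%:R / gam) <= 1 / 2.
  apply: (@le_trans _ _ (gam / (2 * L%:R) * (L%:R / gam))).
    by apply: ler_wpM2r; [rewrite divr_ge0 //; exact: ltW|rewrite ge_min lexx].
  by rewrite le_eqVlt; apply/orP; left; apply/eqP; field; rewrite !lt0r_neq0.
have la2 : 2 * (lam * (L%:R / gam)) ^+ 2 <= lam * (zeta / 4).
  have -> : 2 * (lam * (L%:R / gam)) ^+ 2 = lam * (lam * (2 * (L%:R / gam) ^+ 2)) by ring.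
  apply: ler_wpM2l; first exact: ltW.
  apply: (@le_trans _ _ (zeta * gam ^+ 2 / (8 * L%:R ^+ 2) * (2 * (L%:R / gam) ^+ 2))).
    by apply: ler_wpM2r; [rewrite mulr_ge0 // exprn_ge0 // divr_ge0 //; exact: ltW|rewrite ge_min lexx orbT].
  by rewrite le_eqVlt; apply/orP; left; apply/eqP; field; rewrite !lt0r_neq0.
pose bs := B1 / delta ^+ 2.
have bs0 : 0 < bs by rewrite divr_gt0 // exprn_gt0.
pose s : R := proc_s L gam delta lam.
have s0 : 0 <= s.
  have l0' := ltW la0; have d0' := ltW de0; have g0' := ltW gam0; have gm0' := ltW gm0.
  rewrite /s /proc_s; apply: addr_ge0; last by rewrite mulr_ge0 ?sqr_ge0.
  by rewrite mulr_ge0 // divr_ge0 ?mulr_ge0.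
have s_le : s <= lam * (zeta / 2).
  have -> : s = lam * (s1 * delta) + 2 * (lam * (L%:R / gam)) ^+ 2 by rewrite /s /proc_s /s1 -/gm; ring.
  have h : lam * (s1 * delta) <= lam * (zeta / 4).
    apply: ler_wpM2l; first exact: ltW.
    apply: (@le_trans _ _ (s1 * (zeta / (4 * s1)))); first by apply: ler_wpM2l => //; exact: ltW.
    by rewrite le_eqVlt; apply/orP; left; apply/eqP; field; rewrite !lt0r_neq0.
  lra.
pose kp : R := proc_k L D gam.
pose Cc : R := proc_C L D k1 gam.
have Cc0 : 0 <= Cc by exact: proc_C_ge0.
have kp0 : 0 <= kp by exact: proc_k_ge0.
pose C2 := G * D * L%:R ^+ 4 / (gm * gam ^+ 2) + bs * expR kp * Cc.
have C20 : 0 <= C2.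
  have g0' := ltW gam0; have gm0' := ltW gm0; have D0 : 0 <= D by lra.
  rewrite addr_ge0 // ?mulr_ge0 ?invr_ge0 ?mulr_ge0 ?exprn_ge0 ?expR_ge0 //; exact: ltW.
exists (eps / (8 * (bs * expR kp))); have ek := expR_gt0 kp; split; first by rewrite divr_gt0 // mulr_gt0 // mulr_gt0.
have cc0 : 0 < lam * (zeta / 2) by rewrite mulr_gt0 // divr_gt0.
have e8 : 0 < eps / (8 * B1 * (Ci + 1)) by rewrite divr_gt0 // !mulr_gt0 //; lra.
have [n1 hn1] := poly_exp_small kk cc0 e8.
pose n0 := maxn n1 (maxn (Num.bound (L%:R ^+ 2 / gam)).+1 (maxn (Num.bound (8 * C2 / eps)).+1 (Num.bound (2 / eps)).+1)).
exists n0 => T I n m Nend w g Nb V z nn0 cV nE gN cI w0 wu g01 hg degD codK hPsi hNb.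
have bnd (x : R) : 0 <= x -> ((Num.bound x).+1 <= n)%N -> x <= n%:R.
  by move=> x0 h; apply: ltW; apply: (lt_le_trans (archi_boundP x0)); rewrite ler_nat ltnW.
move: nn0; rewrite !geq_max => /and4P[n1n n2n n3n n4n].
have n0' : (0 < n)%N by apply: leq_trans n2n.
have nR : 0 < n%:R :> R by rewrite ltr0n.
have Lbig : L%:R ^+ 2 <= gam * n%:R.
  have := bnd _ _ n2n; rewrite divr_ge0 ?exprn_ge0 //; last exact: ltW.
  by move=> /(_ isT); rewrite ler_pdivrMr // mulrC.
have nC2 : C2 / n%:R <= eps / 8.
  have := bnd _ _ n3n; rewrite divr_ge0 ?mulr_ge0 //; last exact: ltW.
  move=> /(_ isT); rewrite ler_pdivrMr // => h; rewrite ler_pdivrMr //; move: h; clear; lra.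
have neps : 2 <= eps * n%:R.
  have := bnd _ _ n4n; rewrite divr_ge0 //; last exact: ltW.
  by move=> /(_ isT); rewrite ler_pdivrMr // mulrC.
have dgm : 0 <= delta <= gam ^+ L / 2 by rewrite (ltW de0) de1.
have hbs : B1 <= bs * delta ^+ 2 by rewrite /bs divfK // expf_neq0 // lt0r_neq0.
have NE : proc_N L Nend m = n by rewrite /proc_N nE.
have mn : (m <= n)%N by rewrite nE (leq_trans (leq_pmulr m L0)) // leq_addl.
have main := @proc_main R T I L n Nend w g Nb D k1 K G gam (z - zeta) delta lam B B1 bs
  w0 wu n0' L0 K1 G0 g01 hg degD D1 k10 codK gam01 gN Lbig dgm la0 la1 B0 (ltW bs0) (lexx _) hbs m V.
rewrite NE in main; have {}main := main cV (leqnn _).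
have aE : proc_a R L n Nend m = 1 by rewrite /proc_a NE divff ?expr1n // lt0r_neq0.
have WE j : proc_W R L n Nend j = n%:R * ((Nend + j * L)%N%:R / n%:R) ^+ L / L%:R.
  rewrite /proc_W /proc_a /proc_N; congr (_ / _).
  have -> : ((Nend + j * L)%N%:R / n%:R) ^+ L = ((Nend + j * L)%N%:R / n%:R) ^+ L.-1 * ((Nend + j * L)%N%:R / n%:R) :> R.
    by rewrite -exprSr prednK.
  by rewrite mulrCA [n%:R * _]mulrC divfK // lt0r_neq0.
pose S := \sum_(i < m) ln (proc_W R L n Nend i.+1 / (n%:R * K)).
have SE : \sum_(i < m) ln ((n%:R * ((Nend + i.+1 * L)%N%:R / n%:R) ^+ L / L%:R) / (n%:R * K)) = S.
  by apply: eq_bigr => i _; rewrite WE.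
rewrite SE.
set E := proc_E L n D k1 G gam delta bs in main.
have AE : proc_A L n Nend D k1 K G gam delta bs m = S - m%:R * E.
  by rewrite /proc_A sumrB sumr_const card_ord [m%:R * _]mulr_natl.
have EE : E = C1 * delta + C2 / n%:R.
  rewrite /E /proc_E /proc_E1 -/gm -/kp -/Cc /C1 /C2; ring.
have mR : m%:R <= n%:R :> R by rewrite ler_nat.
have hE : m%:R * E <= eps / 4 * n%:R.
  have E1 : E <= eps / 4.
    have : C1 * delta <= eps / 8.
      apply: (@le_trans _ _ (C1 * (eps / (8 * C1)))); first by apply: ler_wpM2l => //; exact: ltW.
      by rewrite le_eqVlt; apply/orP; left; apply/eqP; field; rewrite lt0r_neq0.
    by rewrite EE; move: nC2; clear; lra.
  have E0 : 0 <= E by rewrite EE addr_ge0 // ?mulr_ge0 ?invr_ge0 //; exact: ltW.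
  by rewrite mulrC; apply: ler_pM.
set Y := wsum (fun P => w P * g P) V.
have rE : m%:R / proc_W R L n Nend m = (m * L)%N%:R / n%:R.
  by rewrite /proc_W aE NE mul1r natrM; field; rewrite !lt0r_neq0.
have hPs : proc_b L n D gam bs m * proc_Psi n Nend w m V <= eps / 8 * n%:R.
  have kkn : 0 <= kp / n%:R by rewrite divr_ge0.
  have b1 : proc_b L n D gam bs m <= bs * expR kp.
    rewrite /proc_b; apply: ler_wpM2l; first exact: ltW.
    apply: (le_trans (pow1D_expR m kkn)); rewrite ler_expR mulrCA -[X in _ <= X]mulr1.
    by apply: ler_wpM2l => //; rewrite ler_pdivrMr // mul1r.
  have P0 : 0 <= proc_Psi n Nend w m V by apply: sumr_ge0 => v _; exact: sqr_ge0.
  have P1 : proc_Psi n Nend w m V <= eps / (8 * (bs * expR kp)) * n%:R by rewrite /proc_Psi aE.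
  have bk0 : 0 < bs * expR kp by rewrite mulr_gt0 // expR_gt0.
  apply: (@le_trans _ _ (bs * expR kp * (eps / (8 * (bs * expR kp)) * n%:R))).
    apply: ler_pM => //; rewrite /proc_b mulr_ge0 ?(ltW bs0) // exprn_ge0 // addr_ge0 //.
  by rewrite le_eqVlt; apply/orP; left; apply/eqP; move: bk0; set q := bs * expR kp => q0; field; rewrite lt0r_neq0.
have hXi : B1 * n%:R * proc_Xi L n Nb gam (z - zeta) delta lam m V <= eps / 8 * n%:R.
  rewrite /proc_Xi -/s.
  have t1 i : expR (lam * n%:R * (z - zeta - #|Nb i :&: V|%:R / #|V|%:R)) <= expR (- (lam * zeta * n%:R)).
    rewrite ler_expR.
    have : z <= #|Nb i :&: V|%:R / #|V|%:R by rewrite cV ler_pdivlMr.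
    have ln0 : 0 <= lam * n%:R by rewrite mulr_ge0 //; exact: ltW.
    move=> hz; have h : z - zeta - #|Nb i :&: V|%:R / #|V|%:R <= - zeta by move: hz; clear; lra.
    by have := ler_wpM2l ln0 h; clear; lra.
  have t2 : \sum_i expR (lam * n%:R * (z - zeta - #|Nb i :&: V|%:R / #|V|%:R)) <= #|I|%:R * expR (- (lam * zeta * n%:R)).
    apply: (@le_trans _ _ (\sum_(i : I) expR (- (lam * zeta * n%:R)))); first exact: ler_sum.
    by rewrite sumr_const [X in _ <= X]mulr_natl.
  have t3 : (1 + s) ^+ m <= expR (lam * (zeta / 2) * n%:R).
    apply: (le_trans (pow1D_expR m s0)); rewrite ler_expR mulrC.
    by apply: ler_pM.
  have t4 : (1 + s) ^+ m * \sum_i expR (lam * n%:R * (z - zeta - #|Nb i :&: V|%:R / #|V|%:R)) <= eps / (8 * B1).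
    apply: (@le_trans _ _ (expR (lam * (zeta / 2) * n%:R) * (#|I|%:R * expR (- (lam * zeta * n%:R))))).
      by apply: ler_pM => //; [rewrite exprn_ge0 // addr_ge0|apply: sumr_ge0 => i _; exact: expR_ge0].
    rewrite mulrCA -expRD.
    have -> : lam * (zeta / 2) * n%:R + - (lam * zeta * n%:R) = - (lam * (zeta / 2) * n%:R) by field.
    have t5 := hn1 n n1n.
    apply: (@le_trans _ _ ((Ci + 1) * (n%:R ^+ kk * expR (- (lam * (zeta / 2) * n%:R))))).
      rewrite mulrA; apply: ler_wpM2r; first exact: expR_ge0.
      apply: (le_trans cI); apply: ler_wpM2r; first by rewrite exprn_ge0.
      by clear; lra.
    have Ci1 : 0 < Ci + 1 by move: Ci0; clear; lra.
    apply: (@le_trans _ _ ((Ci + 1) * (eps / (8 * B1 * (Ci + 1))))); first by apply: ler_wpM2l => //; exact: ltW.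
    by rewrite le_eqVlt; apply/orP; left; apply/eqP; field; rewrite !lt0r_neq0.
  apply: (@le_trans _ _ (B1 * n%:R * (eps / (8 * B1)))).
    by apply: ler_wpM2l => //; rewrite mulr_ge0 //; exact: ltW.
  by rewrite le_eqVlt; apply/orP; left; apply/eqP; field; rewrite lt0r_neq0.
rewrite AE rE -[proc_Y w g V]/Y in main.
set M := S + (m * L)%N%:R / n%:R * Y.
set c := ncount n w _ m V in main *.
have main2 : M - eps * n%:R + eps / 2 * n%:R <= ln (c + expR (- (B * n%:R))).
  apply: le_trans main; rewrite /M; move: hE hPs hXi; clear; lra.
have Y0 : 0 <= Y by apply: sumr_ge0 => P _; rewrite mulr_ge0 //; case/andP: (g01 P).
have M0 : - (c0 * n%:R) <= M.
  have r0 : 0 <= (m * L)%N%:R / n%:R * Y by rewrite mulr_ge0 // divr_ge0.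
  have S0 : - (m%:R * c0) <= S.
    rewrite -mulrN mulr_natl -[X in _ *+ X]card_ord -sumr_const; apply: ler_sum => i _.
    rewrite /c0 -lnV ?posrE; last by apply: lt_le_trans LKg.
    have nK0 : 0 < n%:R * K by rewrite mulr_gt0.
    have Wi : gm * n%:R / L%:R <= proc_W R L n Nend i.+1.
      by apply: proc_W_ge => //.
    have W0 : 0 < proc_W R L n Nend i.+1 by apply: lt_le_trans Wi; rewrite divr_gt0 // mulr_gt0.
    have WK0 : 0 < proc_W R L n Nend i.+1 / (n%:R * K) by apply: divr_gt0.
    have LK0 : 0 < (L%:R * K / gm)^-1 by rewrite invr_gt0; apply: lt_le_trans LKg.
    rewrite ler_ln ?posrE //.
    rewrite ler_pdivlMr //; apply: le_trans Wi.
    by rewrite le_eqVlt; apply/orP; left; apply/eqP; field; rewrite !lt0r_neq0.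
  have : m%:R * c0 <= n%:R * c0 by apply: ler_wpM2r.
  rewrite /M; move: r0 S0; clear; lra.
have cp : 0 < c + expR (- (B * n%:R)) by rewrite ltr_wpDl ?expR_gt0 // ncount_ge0.
have h1 : expR (M - eps * n%:R + eps / 2 * n%:R) <= c + expR (- (B * n%:R)).
  by rewrite -[X in _ <= X]lnK ?posrE // ler_expR.
(* The spare [eps / 2] in [main2] provides a factor [2], which absorbs the regularising summand. *)
have h2 : 2 * expR (M - eps * n%:R) <= expR (M - eps * n%:R + eps / 2 * n%:R).
  rewrite [X in _ <= X]expRD mulrC; apply: ler_wpM2l; first exact: expR_ge0.
  by apply: le_trans (expR_ge1Dx _); move: neps; clear; lra.
have h3 : expR (- (B * n%:R)) <= expR (M - eps * n%:R).
  rewrite ler_expR /B; move: M0 nR; clear; lra.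
move: h1 h2 h3; clear; lra.
Qed.

End ProcessCount.

(** * Almost regular fractional matchings of high entropy *)

Section FractionalRepair.

Variables (R : realType) (T : finType) (k : nat).
Implicit Types (E H : {set {set T}}) (V Lo S Q : {set T}) (z : {set T} -> R) (f y : T -> R).

Definition edeg E z (v : T) : R := \sum_(e in E | v \in e) z e.

Lemma leq_bin_expn n j : ('C(n, j) <= n ^ j)%N.
Proof.
have h : (n ^_ j <= n ^ j)%N.
  elim: j => [|j IH]; first by rewrite ffactn0.
  by rewrite ffactnSr expnSr leq_mul // leq_subr.
by apply: leq_trans h; rewrite -bin_ffact leq_pmulr // fact_gt0.
Qed.

Lemma card_edges_le E V : {in E, forall e : {set T}, #|e| = k} -> {in E, forall e : {set T}, e \subset V} ->
  (#|E| <= #|V| ^ k)%N.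
Proof.
move=> Eu EV; apply: leq_trans (leq_bin_expn _ _); rewrite -cards_draws.
by apply: subset_leq_card; apply/fintype.subsetP => e eE; rewrite inE EV //= Eu.
Qed.

Lemma card_star_le E V v : {in E, forall e : {set T}, #|e| = k} -> {in E, forall e : {set T}, e \subset V} ->
  (#|[set e in E | v \in e]%SET| <= #|V| ^ k.-1)%N.
Proof.
move=> Eu EV; apply: leq_trans (leq_bin_expn _ _); rewrite -cards_draws.
have -> : #|[set e in E | v \in e]%SET| = #|[set e :\ v | e in [set e in E | v \in e]]%SET|.
  rewrite card_in_imset // => e e'; rewrite !inE => /andP[_ ve] /andP[_ ve'] /= h.
  by rewrite -(finset.setD1K ve) h finset.setD1K.
apply: subset_leq_card; apply/fintype.subsetP => S /finset.imsetP[e]; rewrite !inE => /andP[eE ve] ->.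
apply/andP; split; first by apply: fintype.subset_trans (EV _ eE); exact: subsetDl.
by have := cardsD1 v e; rewrite ve (Eu _ eE) add1n => ->.
Qed.

Lemma sparse_pick H Lo S : {in H, forall e : {set T}, (#|e| <= k)%N} -> (0 < #|Lo :\: S|)%N ->
  exists2 q, q \in Lo :\: S & (#|Lo :\: S| * #|[set e in H | q |: S \subset e]%SET| <= k * #|[set e in H | S \subset e]%SET|)%N.
Proof.
move=> Hk; rewrite card_gt0 => /set0Pn[q0 q0L].
pose h q := #|[set e in H | q |: S \subset e]%SET|.
case: (@arg_minnP _ q0 (mem (Lo :\: S)) h q0L) => q qL qmin.
exists q => //; rewrite -/(h q).
apply: (@leq_trans (\sum_(p in Lo :\: S) h p)).
  by rewrite -sum_nat_const; apply: leq_sum => p pL; exact: qmin.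
have -> : \sum_(p in Lo :\: S) h p = \sum_(e in H | S \subset e) #|(Lo :\: S) :&: e|.
  rewrite (eq_bigr (fun p => \sum_(e in H | S \subset e) (p \in e : nat))%N); last first.
    move=> p _; rewrite /h -sum1dep_card big_mkcondr /= [RHS]big_mkcondr /=.
    apply: eq_bigr => e _; rewrite finset.subUset finset.sub1set; by case: (p \in e); case: (S \subset e).
  rewrite exchange_big /=; apply: eq_bigr => e _.
  rewrite -big_mkcondr /= sum1_card.
  by apply: eq_card => p; rewrite finset.in_setI.
rewrite -sum1dep_card big_distrr /=; apply: leq_sum => e /andP[eH _]; rewrite muln1.
by apply: leq_trans (Hk _ eH); apply: subset_leq_card; exact: subsetIr.
Qed.

(** The vertices of [Q] are chosen one at a time by averaging, each reducing the number of edges of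
    [H] above the set by the factor [k / b]. With the heavy edges as [H], this finds a (k-1)-set
    contained in few of them. *)
Lemma sparse_ext H Lo (b : R) : {in H, forall e : {set T}, (#|e| <= k)%N} -> 0 < b ->
  forall j S, b + (j + #|S|)%:R <= #|Lo|%:R ->
  exists Q, [/\ Q \subset Lo, [disjoint Q & S], #|Q| = j &
    #|[set e in H | S :|: Q \subset e]%SET|%:R * b ^+ j <= #|[set e in H | S \subset e]%SET|%:R * k%:R ^+ j].
Proof.
move=> Hk b0; elim=> [|j IH] S hS.
  exists set0; split; rewrite ?cards0 ?finset.sub0set ?finset.setU0 //.
  by rewrite -setI_eq0 finset.set0I.
have hb : b <= #|Lo :\: S|%:R.
  have : (#|Lo| <= #|Lo :\: S| + (j.+1 + #|S|))%N.
    rewrite -(cardsID S Lo) addnC leq_add2l (leq_trans (subset_leq_card (subsetIr _ _))) ?leq_addl //.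
  by rewrite -(ler_nat R) natrD; lra.
have L0 : (0 < #|Lo :\: S|)%N by rewrite -(ltr_nat R); apply: lt_le_trans hb.
have [q qL hq] := sparse_pick Hk L0.
move: qL; rewrite inE => /andP[qS qLo].
have [|Q [QL QS cQ hQ]] := IH (q |: S).
  by rewrite cardsU1 qS add1n addnS -addSn.
move: QS; rewrite disjoint_sym disjoints_subset finset.subUset finset.sub1set inE => /andP[qQ SQ].
exists (q |: Q); split.
- by rewrite finset.subUset finset.sub1set qLo.
- rewrite disjoint_sym disjoints_subset; apply/fintype.subsetP => x xS; rewrite !inE negb_or.
  have := fintype.subsetP SQ x xS; rewrite inE => ->; rewrite andbT.
  by apply: contraNneq qS => <-.
- by rewrite cardsU1 qQ cQ.
have -> : S :|: (q |: Q) = q |: S :|: Q by rewrite finset.setUA (finset.setUC S).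
rewrite exprS mulrCA; apply: (le_trans (ler_wpM2l (ltW b0) hQ)).
rewrite mulrA exprS [X in _ <= X]mulrA; apply: ler_wpM2r; first by rewrite exprn_ge0.
rewrite -(ler_nat R) !natrM in hq.
apply: (@le_trans _ _ (#|Lo :\: S|%:R * #|[set e in H | q |: S \subset e]%SET|%:R)).
  exact: ler_wpM2r.
by apply: (le_trans hq); rewrite mulrC.
Qed.

Lemma edeg_bump E z e0 s v : e0 \in E ->
  edeg E (fun e => z e + (e == e0)%:R * s) v = edeg E z v + (v \in e0)%:R * s.
Proof.
move=> e0E; rewrite /edeg big_split /=; congr (_ + _).
rewrite big_mkcondr (bigD1 e0) //= eqxx mul1r big1 ?addr0; first by case: (v \in e0); rewrite ?mul1r ?mul0r.
by move=> e /andP[_ /negbTE ->]; rewrite mul0r; case: ifP.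
Qed.

Lemma sumr_ind V Q : Q \subset V -> \sum_(v in V) (v \in Q)%:R = #|Q|%:R :> R.
Proof.
move=> QV; rewrite -natr_sum; congr (_%:R); rewrite -big_mkcondr /= sum1_card.
by apply: eq_card => v; rewrite unfold_in /=; case vQ: (v \in Q); rewrite ?andbF // (fintype.subsetP QV).
Qed.

(* Approximate first-order conditions for minimising the squared degree defect over
   the box; each violation allows a step which decreases it by a fixed amount. *)
Lemma box_descent E V f (c D al : R) : (0 < k)%N -> {in E, forall e : {set T}, #|e| = k} ->
  {in E, forall e : {set T}, e \subset V} -> 0 < c -> 2 * c <= D -> 0 < al ->
  exists z, [/\ {in E, forall e, c <= z e <= D},
    {in E, forall e, z e < D / 2 -> - al <= \sum_(v in e) (edeg E z v - f v)} &
    {in E, forall e, 2 * c <= z e -> \sum_(v in e) (edeg E z v - f v) <= al}].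
Proof.
move=> k0 Eu EV c0 cD al0; have kr : 0 < k%:R :> R by rewrite ltr0n.
(* A step [t] on a violating edge changes the defect by at most [- 2 t al + k t^2 <= - t al], and
   [t <= c] keeps the weight in the box. *)
pose t := Order.min (al / k%:R) c.
have t0 : 0 < t by rewrite lt_min divr_gt0.
have tc : t <= c by rewrite ge_min lexx orbT.
have tk : t * k%:R <= al by rewrite -ler_pdivlMr // ge_min lexx.
pose Q z := \sum_(v in V) (edeg E z v - f v) ^+ 2.
have Qbump z e0 s : e0 \in E -> Q (fun e => z e + (e == e0)%:R * s) =
    Q z + 2 * s * (\sum_(v in e0) (edeg E z v - f v)) + k%:R * s ^+ 2.
  move=> e0E; rewrite /Q.
  have sub : e0 \subset V by exact: EV.
  have ind (F : T -> R) : \sum_(v in e0) F v = \sum_(v in V) (v \in e0)%:R * F v.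
    rewrite [RHS](big_setID e0) /= [X in _ = _ + X]big1 ?addr0; last first.
      by move=> v; rewrite inE => /andP[/negbTE -> _]; rewrite mul0r.
    rewrite (finset.setIidPr sub); apply: eq_bigr => v ve; by rewrite ve mul1r.
  rewrite ind -(Eu _ e0E) -(sumr_ind sub) mulr_sumr mulr_suml -!big_split /=.
  by apply: eq_bigr => v _; rewrite edeg_bump //; case: (v \in e0) => /=; ring.
have step : forall m z, {in E, forall e, c <= z e <= D} -> Q z < m%:R * (t * al) ->
  exists z, [/\ {in E, forall e, c <= z e <= D},
    {in E, forall e, z e < D / 2 -> - al <= \sum_(v in e) (edeg E z v - f v)} &
    {in E, forall e, 2 * c <= z e -> \sum_(v in e) (edeg E z v - f v) <= al}].
  elim=> [|m IH] z zb hz.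
    suff : 0 <= Q z by move: hz; rewrite mul0r; lra.
    by apply: sumr_ge0 => v _; exact: sqr_ge0.
  have kt : k%:R * t ^+ 2 <= t * al by rewrite expr2 mulrC -mulrA; apply: ler_wpM2l tk; exact: ltW.
  have mE : m.+1%:R * (t * al) = m%:R * (t * al) + t * al by rewrite -natr1 mulrDl mul1r.
  case: (boolP [exists e in E, (z e < D / 2) && (\sum_(v in e) (edeg E z v - f v) < - al)]).
    move=> /existsP[e0 /and3P[e0E ze ye]].
    apply: (IH (fun e => z e + (e == e0)%:R * t)).
      move=> e eE; have := zb e eE; case: eqP => [->|_]; rewrite ?mul1r ?mul0r ?addr0 //.
      by move=> /andP[z1 z2]; apply/andP; split; lra.
    rewrite Qbump //; have := ler_wpM2l (ltW t0) (ltW ye); lra.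
  move=> /existsPn h1.
  case: (boolP [exists e in E, (2 * c <= z e) && (al < \sum_(v in e) (edeg E z v - f v))]).
    move=> /existsP[e0 /and3P[e0E ze ye]].
    apply: (IH (fun e => z e + (e == e0)%:R * (- t))).
      move=> e eE; have := zb e eE; case: eqP => [->|_]; rewrite ?mul1r ?mul0r ?addr0 //.
      by move=> /andP[z1 z2]; apply/andP; split; lra.
    rewrite Qbump // sqrrN; have := ler_wpM2l (ltW t0) (ltW ye); lra.
  move=> /existsPn h2; exists z; split=> // e eE ze.
  - by have := h1 e; rewrite eE ze /= -leNgt.
  - by have := h2 e; rewrite eE ze /= -leNgt.
have ta : 0 < t * al by rewrite mulr_gt0.
have q0 : 0 <= Q (fun=> c) by apply: sumr_ge0 => v _; exact: sqr_ge0.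
apply: (step (Num.bound (Q (fun=> c) / (t * al))) (fun=> c)).
  by move=> e _; rewrite lexx /=; lra.
by rewrite -ltr_pdivrMr //; apply: archi_boundP; rewrite divr_ge0 // ltW.
Qed.


Section Near.

Variables (E : {set {set T}}) (V : {set T}) (z : {set T} -> R) (f : T -> R) (D eta ze al e1 : R).

Let n : R := #|V|%:R.
Let N : R := n ^+ k.-1.
Let y v := edeg E z v - f v.

Hypothesis k1 : (1 < k)%N.
Hypothesis Eu : {in E, forall e : {set T}, #|e| = k}.
Hypothesis EV : {in E, forall e : {set T}, e \subset V}.
Hypothesis cod : forall S, S \subset V -> #|S| = k.-1 -> (1 / 2 + eta) * n <= #|[set v in V | v |: S \in E]%SET|%:R.
Hypothesis eta0 : 0 < eta <= 1.
Hypothesis ze0 : 0 < ze.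
Hypothesis nbig : 2 * k%:R <= ze * n.
Hypothesis D0 : 0 < D.
Hypothesis Dbig : 4 * (2 * k%:R / ze) ^+ k.-2 <= D * eta.
Hypothesis al0 : 0 <= al.
Hypothesis zpos : {in E, forall e, 0 <= z e}.
Hypothesis zlow : {in E, forall e, z e < D / N / 2 -> - al <= \sum_(v in e) y v}.

Let n0 : 0 < n.
Proof.
have := nbig; have := ze0; have := ler0n R k; case: (ltP 0 n) => // nn _ z0.
have kk : 1 < k%:R :> R by rewrite ltr1n.
have := mulr_ge0_le0 (ltW z0) nn; lra.
Qed.

(** Since [u] has degree at most [1], few heavy edges contain it, and [sparse_ext] extends it inside
    [Lo] to a set [S] in few heavy edges. All but [eta n / 2] of the completions [v] of [S] are
    light, and the first-order condition at [v |: S] bounds [y v] from below. *)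
Lemma good_set u Lo t : u \in V -> edeg E z u <= 1 -> Lo \subset V -> {in Lo, forall q, y q <= t} ->
  ze * n <= #|Lo|%:R ->
  exists Gd : {set T}, [/\ Gd \subset V, (1 / 2 + eta / 2) * n <= #|Gd|%:R &
    {in Gd, forall v, - y u - al - k.-2%:R * t <= y v}].
Proof.
move=> uV du LoV Lot cLo.
pose th := D / N / 2.
have N0 : 0 < N by rewrite exprn_gt0 // n0.
have th0 : 0 < th by rewrite !divr_gt0 // D0.
pose H := [set e in E | th <= z e]%SET.
have Hk : {in H, forall e : {set T}, (#|e| <= k)%N} by move=> e; rewrite inE => /andP[eE _]; rewrite Eu.
have hu : #|[set e in H | [set u] \subset e]%SET|%:R * th <= 1.
  apply: le_trans du; rewrite mulr_natl -sumr_const /edeg.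
  rewrite (eq_bigl (fun e => [&& e \in E, u \in e & th <= z e])); last first.
    by move=> e; rewrite !inE finset.sub1set -andbA [X in _ && X]andbC.
  under eq_bigl do rewrite andbA.
  rewrite big_mkcondr; apply: ler_sum => e /andP[eE _]; case: ifP => // _; exact: zpos.
have kE : k = k.-2.+2 by have := k1; case: (k) => [|[]].
have b0 : 0 < ze * n / 2 by rewrite divr_gt0 // mulr_gt0 // ?ze0 ?n0.
have [|Q [QLo Qu cQ hQ]] := @sparse_ext H Lo _ Hk b0 k.-2 [set u].
  rewrite cards1 addn1; apply: le_trans cLo.
  have : k%:R = k.-2.+1%:R + 1 :> R by rewrite {1}kE -natr1.
  have := nbig; lra.
pose S := [set u] :|: Q.
have uQ : u \notin Q by move: Qu; rewrite disjoint_sym disjoints_subset finset.sub1set inE.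
have cS : #|S| = k.-1 by rewrite /S cardsU1 uQ cQ {2}kE.
have SV : S \subset V by rewrite finset.subUset finset.sub1set uV (fintype.subset_trans QLo).
have hS : #|[set e in H | S \subset e]%SET|%:R <= eta / 2 * n.
  set h := _%:R in hQ *.
  have p0 : 0 < (ze / 2) ^+ k.-2 by rewrite exprn_gt0 // divr_gt0 // ze0.
  have np0 : 0 < n ^+ k.-2 by rewrite exprn_gt0 // n0.
  have e2 : (ze * n / 2) ^+ k.-2 = (ze / 2) ^+ k.-2 * n ^+ k.-2 by rewrite -exprMn; congr (_ ^+ _); field.
  have e3 : k%:R ^+ k.-2 = (2 * k%:R / ze) ^+ k.-2 * (ze / 2) ^+ k.-2 :> R.
    by rewrite -exprMn; congr (_ ^+ _); field; rewrite lt0r_neq0 // ze0.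
  have e4 : N = n ^+ k.-2 * n by rewrite /N {1}kE /= exprSr.
  rewrite e2 e3 in hQ.
  have h1 : h * ((ze / 2) ^+ k.-2 * n ^+ k.-2) * th <= (2 * k%:R / ze) ^+ k.-2 * (ze / 2) ^+ k.-2.
    apply: (le_trans (ler_wpM2r (ltW th0) hQ)); rewrite mulrAC -[X in _ <= X]mul1r.
    apply: ler_wpM2r hu; apply: mulr_ge0; last exact: ltW.
    by rewrite exprn_ge0 // divr_ge0 ?mulr_ge0 // ltW // ze0.
  have h2 : h * (D / n / 2) <= (2 * k%:R / ze) ^+ k.-2.
    rewrite -(ler_pM2r p0); apply: le_trans h1.
    rewrite le_eqVlt; apply/orP; left; apply/eqP; rewrite /th e4; field.
    by rewrite (lt0r_neq0 n0) (lt0r_neq0 np0).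
  have h3 : h * (D / n / 2) <= D * eta / 4 by have := Dbig; lra.
  have -> : h = h * (D / n / 2) * (2 * n / D) by field; rewrite (lt0r_neq0 n0) (lt0r_neq0 D0).
  apply: (le_trans (ler_wpM2r _ h3)).
    by rewrite divr_ge0 ?mulr_ge0 // ltW // ?n0 ?D0.
  by rewrite le_eqVlt; apply/orP; left; apply/eqP; field; rewrite lt0r_neq0 // D0.
pose Gd := [set v in V | (v |: S \in E) && (z (v |: S) < th)]%SET.
have notS v : v |: S \in E -> v \notin S.
  move=> /Eu; rewrite cardsU1 cS; case: (v \in S) => // h; have := k1; move: h.
  by case: (k) => [|j] //= /eqP; rewrite add0n eqn_leq ltnn andbF.
exists Gd; split.
- by apply/fintype.subsetP => v; rewrite inE => /andP[].
- have hb : (#|[set v in V | v |: S \in H]%SET| <= #|[set e in H | S \subset e]%SET|)%N.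
    have inj : {in [set v in V | v |: S \in H]%SET &, injective (fun v => v |: S)}.
      move=> v v'; rewrite !inE => /andP[_ /andP[h1 _]] _ /= h.
      have : v \in v' |: S by rewrite -h !inE eqxx.
      by rewrite finset.in_setU1 (negbTE (notS _ h1)) orbF => /eqP.
    rewrite -(card_in_imset inj); apply: subset_leq_card; apply/fintype.subsetP => e /finset.imsetP[v].
    by rewrite inE => /andP[_ vH] ->; rewrite inE vH finset.subsetUr.
  have hc : (#|[set v in V | v |: S \in E]%SET| <= #|Gd| + #|[set v in V | v |: S \in H]%SET|)%N.
    apply: leq_trans (leq_card_setU _ _); apply: subset_leq_card; apply/fintype.subsetP => v.
    by rewrite !inE => /andP[-> ->] /=; case: (ltP (z (v |: S)) th).
  have := cod SV cS; have := leq_trans hc (leq_add (leqnn _) hb); rewrite -(ler_nat R) natrD.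
  move: hS; lra.
move=> v; rewrite inE => /and3P[vV vE zv].
have := zlow vE zv; rewrite big_setU1 ?notS //= /S big_setU1 //=.
have : \sum_(q in Q) y q <= k.-2%:R * t.
  rewrite mulr_natl -cQ -sumr_const; apply: ler_sum => q qQ; apply: Lot; exact: (fintype.subsetP QLo).
lra.
Qed.

Hypothesis e10 : 0 < e1 <= 1.
Hypothesis zeE : ze = e1 / (8 * k%:R).
Hypothesis fb : {in V, forall v, e1 <= f v <= 1}.
Hypothesis fsum : \sum_(v in V) (f v - e1) <= e1 * eta / 2 * n.

(* [mu] is the largest deficit, attained at [u].  By the codegree condition more than
   half of the vertices complete an edge through [u] and k-2 vertices without
   large surplus; near-optimality forces these to have a surplus of about [mu],
   which outweighs all deficits. *)
Lemma corr_lower : exists mu, [/\ 0 <= mu, {in V, forall v, - mu <= y v} &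
  e1 * eta / (8 * k%:R) * n * mu - al * n <= \sum_(v in V) f v * y v].
Proof.
have /andP[e1p e1l] := e10; have /andP[etap etal] := eta0.
have al0' := al0; have n0' := n0.
have kr : 0 < k%:R :> R by rewrite ltr0n ltnW.
have kr2 : 2 <= k%:R :> R by rewrite ler_nat.
have [u0 u0V] : exists u, u \in V by apply/set0Pn; rewrite -card_gt0 -(ltr_nat R).
case: (arg_minP (P := mem V) y u0V) => u uV umin.
have f0 v : v \in V -> 0 <= f v by move=> /fb/andP[]; lra.
case: (lerP 0 (y u)) => yu.
  exists 0; split=> //; first by move=> v vV; rewrite oppr0; apply: le_trans (umin v vV).
  rewrite mulr0 sub0r; apply: (@le_trans _ _ 0); first by rewrite oppr_le0 mulr_ge0 // ltW.
  by apply: sumr_ge0 => v vV; rewrite mulr_ge0 ?f0 //; apply: le_trans (umin v vV).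
pose mu := - y u.
have mu0 : 0 < mu by rewrite oppr_gt0.
have ymu v : v \in V -> - mu <= y v by move=> vV; rewrite opprK umin.
exists mu; split=> //; first exact: ltW.
have du : edeg E z u <= 1.
  have := fb uV => /andP[_]; move: yu; rewrite /y; lra.
have nmu : 0 < n * mu by rewrite mulr_gt0.
have sumn (c : R) : \sum_(v in V) c = n * c by rewrite sumr_const mulr_natl.
have k2E : k.-2%:R + 2 = k%:R :> R.
  have : (k.-2 + 2 = k)%N by have := k1; case: (k) => [|[|j]] // _; rewrite addn2.
  by move=> {2}<-; rewrite natrD.
have zk : ze * k%:R = e1 / 8 by rewrite zeE; field; rewrite lt0r_neq0.
have ze8 : ze <= e1 / 16 by have := ler_wpM2l (ltW ze0) kr2; lra.
have keyE : e1 * eta / (8 * k%:R) * n * mu = ze * eta * (n * mu).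
  by rewrite zeE; field; rewrite lt0r_neq0.
rewrite keyE.
have zeta : ze * eta * (n * mu) <= ze * (n * mu).
  by apply: ler_wpM2r; [exact: ltW | have := ler_wpM2l (ltW ze0) etal; lra].
have aln : 0 <= al * n by rewrite mulr_ge0 // ltW.
have znm : 0 <= ze * (n * mu) by rewrite mulr_ge0 // ltW // ze0.
pose B0 := [set v in V | y v <= 0]%SET.
pose B1 := [set v in V | y v <= mu / (2 * k%:R)]%SET.
have B0V : B0 \subset V by apply/fintype.subsetP => v; rewrite inE => /andP[].
have B1V : B1 \subset V by apply/fintype.subsetP => v; rewrite inE => /andP[].
(* Many vertices without surplus: [S] is chosen among them, and more than half of all vertices have
   surplus about [mu]. As [f] is close to [e1] on average, this beats a deficit [mu] at all the
   others. *)
case: (lerP (ze * n) #|B0|%:R) => hB0.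
  have [|Gd [GV cG hG]] := good_set uV du B0V _ hB0 (t := 0); first by move=> q; rewrite inE => /andP[].
  have pt v : v \in V -> e1 * (- mu + (v \in Gd)%:R * (2 * mu - al)) - (f v - e1) * mu <= f v * y v.
    move=> vV; have y1 := ymu v vV; have /andP[f1 f2] := fb vV.
    have h1 : - ((f v - e1) * mu) <= (f v - e1) * y v by rewrite -mulrN ler_wpM2l // subr_ge0.
    have h2 : - mu + (v \in Gd)%:R * (2 * mu - al) <= y v.
      case vG: (v \in Gd); rewrite ?mul1r ?mul0r ?addr0 //.
      by have := hG v vG; rewrite mulr0 -/mu; lra.
    have := ler_wpM2l (ltW e1p) h2; lra.
  apply: le_trans (ler_sum _ pt).
  rewrite sumrB -mulr_sumr -mulr_suml big_split /= sumn -mulr_suml sumr_ind //.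
  have h3 : \sum_(v in V) (f v - e1) * mu <= e1 * eta / 2 * n * mu by rewrite -mulr_suml ler_wpM2r // ltW.
  rewrite -mulr_suml in h3.
  have h4 : #|Gd|%:R * al <= al * n by rewrite mulrC ler_wpM2l // ler_nat subset_leq_card.
  have h5 : (1 / 2 + eta / 2) * n * mu <= #|Gd|%:R * mu by rewrite ler_wpM2r // ltW.
  have h6 : e1 * (eta * n * mu - al * n) <= e1 * (n * - mu + #|Gd|%:R * (2 * mu - al)).
    by rewrite ler_pM2l //; move: h4 h5; lra.
  have h7 : e1 * (al * n) <= al * n by rewrite -[X in _ <= X]mul1r ler_wpM2r.
  have h8 : 0 <= e1 * (eta * n * mu) by rewrite !mulr_ge0 //; exact: ltW.
  have h9 : ze * eta * (n * mu) <= e1 / 16 * (eta * n * mu).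
    have -> : ze * eta * (n * mu) = ze * (eta * n * mu) by ring.
    by rewrite ler_wpM2r // !mulr_ge0 //; exact: ltW.
  move: h3 h6 h7 h8 h9; lra.
have cB0 : #|B0|%:R * mu <= ze * n * mu by rewrite ler_wpM2r // ltW.
(* Few deficits, but many surpluses that are at most small: more than half of the vertices have
   surplus about [mu / 2]. *)
case: (lerP (ze * n) #|B1|%:R) => hB1.
  have [|Gd [GV cG hG]] := good_set uV du B1V _ hB1 (t := mu / (2 * k%:R)); first by move=> q; rewrite inE => /andP[].
  have hG2 v : v \in Gd -> mu / 2 - al <= y v.
    move=> /hG; rewrite -/mu.
    have : k.-2%:R * (mu / (2 * k%:R)) <= mu / 2.
      have -> : mu / 2 = k%:R * (mu / (2 * k%:R)) by field; rewrite lt0r_neq0.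
      apply: ler_wpM2r; first by rewrite divr_ge0 ?mulr_ge0 // ltW.
      by rewrite -k2E; lra.
    lra.
  have pt v : v \in V -> (v \in B0)%:R * - mu + (v \in Gd)%:R * (e1 * (mu / 2 - al)) <= f v * y v.
    move=> vV; have y1 := ymu v vV; have /andP[f1 f2] := fb vV.
    rewrite inE vV /=; case: (lerP (y v) 0) => yv /=.
      have h1 : y v <= f v * y v by have := ler_wnM2r yv f2; rewrite mul1r.
      rewrite mul1r; case vG: (v \in Gd); rewrite ?mul1r ?mul0r ?addr0; last lra.
      have h2 := hG2 v vG.
      have : e1 * (mu / 2 - al) <= 0 by apply: mulr_ge0_le0; [exact: ltW|lra].
      lra.
    have h1 : e1 * y v <= f v * y v by rewrite ler_wpM2r // ltW.
    rewrite mul0r add0r; case vG: (v \in Gd); rewrite ?mul1r ?mul0r; last by rewrite mulr_ge0 ?f0 // ltW.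
    apply: le_trans h1; rewrite ler_pM2l //; exact: hG2.
  apply: le_trans (ler_sum _ pt); rewrite big_split /= -!mulr_suml !sumr_ind //.
  have h4 : #|Gd|%:R * al <= al * n by rewrite mulrC ler_wpM2l // ler_nat subset_leq_card.
  have h5 : (1 / 2 + eta / 2) * n * mu <= #|Gd|%:R * mu by rewrite ler_wpM2r // ltW.
  have h6 : 0 <= eta * n * mu by rewrite !mulr_ge0 //; exact: ltW.
  have h7 : e1 * (n * mu / 4 - al * n) <= e1 * (#|Gd|%:R * (mu / 2 - al)).
    by rewrite ler_pM2l //; move: h4 h5 h6; lra.
  have h8 : e1 * (al * n) <= al * n by rewrite -[X in _ <= X]mul1r ler_wpM2r.
  have h9 : ze * (n * mu) <= e1 / 16 * (n * mu) by rewrite ler_wpM2r // ltW.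
  move: h7 h8 h9 cB0 zeta znm; lra.
(* Almost all vertices have surplus above [mu / (2 k)]. *)
have pt v : v \in V -> (v \in B1)%:R * (- mu - e1 * (mu / (2 * k%:R))) + e1 * (mu / (2 * k%:R)) <= f v * y v.
  move=> vV; have y1 := ymu v vV; have /andP[f1 f2] := fb vV.
  rewrite inE vV /=; case: (lerP (y v) _) => yv /=; rewrite ?mul1r ?mul0r.
    rewrite addrNK; case: (lerP 0 (y v)) => h; first by apply: le_trans (mulr_ge0 _ h); [lra|exact: f0].
    have : y v <= f v * y v by have := ler_wnM2r (ltW h) f2; rewrite mul1r.
    lra.
  have m0 : 0 <= mu / (2 * k%:R) by rewrite divr_ge0 ?mulr_ge0 // ltW.
  by rewrite add0r; apply: ler_pM => //; [exact: ltW|exact: ltW].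
apply: le_trans (ler_sum _ pt); rewrite big_split /= -mulr_suml sumr_ind // sumn.
have cB1 : #|B1|%:R * mu <= ze * n * mu by rewrite ler_wpM2r // ltW.
set q := mu / (2 * k%:R).
have qE : e1 * q = 4 * ze * mu by rewrite /q zeE; field; rewrite lt0r_neq0.
rewrite qE.
have h1 : ze * (#|B1|%:R * mu) <= ze * (ze * n * mu) by rewrite ler_pM2l // ze0.
have h2 : ze * (ze * n * mu) <= 1 / 16 * (ze * n * mu).
  by rewrite ler_wpM2r //; [rewrite !mulr_ge0 // ltW // ze0|lra].
move: h1 h2 cB1 zeta aln znm; lra.
Qed.

End Near.

End FractionalRepair.

(** * Prescribing the degrees of a weighting in a box *)

Section Repair.

Variables (R : realType) (k : nat).

(** The equality case of [Dbig] for [ze = e1 / (8 k)]. *)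
Definition repair_D (eta e1 : R) : R := 4 * (16 * k%:R ^+ 2 / e1) ^+ k.-2 / eta.
(** The solution of [2 c (c2 + 2) = c2 e1], where [c2 = e1 eta / (8 k)] is the coefficient in
    [corr_lower]. For it the edges near the lower end of the box are paid for by the correlation of
    [f] and [y]. *)
Definition repair_c (eta e1 : R) : R :=
  e1 * (e1 * eta / (8 * k%:R)) / (2 * (e1 * eta / (8 * k%:R) + 2)).

Lemma repair_D_ge1 eta e1 : (1 < k)%N -> 0 < eta <= 1 -> 0 < e1 <= 1 -> 1 <= repair_D eta e1.
Proof.
move=> k1 /andP[h1 h2] /andP[h3 h4]; rewrite /repair_D.
have kr : 2 <= k%:R :> R by rewrite ler_nat.
have : 1 <= (16 * k%:R ^+ 2 / e1) ^+ k.-2.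
  apply: exprn_ege1; rewrite ler_pdivlMr // mul1r.
  have := ler_pM (ler0n R 2) (ler0n R 2) kr kr; rewrite -expr2; lra.
by move=> h; rewrite ler_pdivlMr //; lra.
Qed.

Lemma repair_c_gt0 eta e1 : (1 < k)%N -> 0 < eta -> 0 < e1 -> 0 < repair_c eta e1.
Proof.
move=> k1 h1 h3; rewrite /repair_c.
have kr : 0 < k%:R :> R by rewrite ltr0n ltnW.
have c20 : 0 < e1 * eta / (8 * k%:R) by rewrite divr_gt0 ?mulr_gt0.
apply: divr_gt0; first exact: mulr_gt0.
by rewrite mulr_gt0 // addr_gt0.
Qed.

Lemma repair_c_le eta e1 : (1 < k)%N -> 0 < eta -> 0 < e1 <= 1 -> 2 * repair_c eta e1 <= 1.
Proof.
move=> k1 h1 /andP[h3 h4]; rewrite /repair_c.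
have kr : 0 < k%:R :> R by rewrite ltr0n ltnW.
have : 0 < e1 * eta / (8 * k%:R) by rewrite divr_gt0 ?mulr_gt0.
move: (_ / _) => q q0; have q2 : 0 < q + 2 by lra.
have -> : 2 * (e1 * q / (2 * (q + 2))) = e1 * q / (q + 2) by field; rewrite lt0r_neq0.
rewrite ler_pdivrMr // mul1r; have := ler_wpM2r (ltW q0) h4; lra.
Qed.

Lemma edeg_exchange (T : finType) (E : {set {set T}}) (V : {set T}) (z : {set T} -> R) (g : T -> R) :
  {in E, forall e : {set T}, e \subset V} ->
  \sum_(v in V) edeg E z v * g v = \sum_(e in E) z e * \sum_(v in e) g v.
Proof.
move=> EV; rewrite (eq_bigr (fun v => \sum_(e in E | v \in e) z e * g v)); last first.
  by move=> v _; rewrite /edeg mulr_suml.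
rewrite (exchange_big_dep (mem E)) /=; last by move=> v e _ /andP[].
apply: eq_bigr => e eE; rewrite mulr_sumr; apply: eq_bigl => v; rewrite eE /=.
by case ve: (v \in e); rewrite ?andbF // (fintype.subsetP (EV _ eE)).
Qed.

Lemma edeg_sum (T : finType) (E : {set {set T}}) (V : {set T}) (z : {set T} -> R) :
  {in E, forall e : {set T}, #|e| = k} -> {in E, forall e : {set T}, e \subset V} ->
  \sum_(v in V) edeg E z v = k%:R * \sum_(e in E) z e.
Proof.
move=> Eu EV; have := edeg_exchange z (fun=> 1) EV.
under eq_bigr do rewrite mulr1; move=> ->; rewrite mulr_sumr; apply: eq_bigr => e eE.
by rewrite sumr_const (Eu _ eE) mulrC.
Qed.

(** Let [y] be the defect and [F] the sum of [f y]. Then the sum of [y^2] plus [F] equals the sum of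
    [z(e)] times the defect of [e]. By the first-order conditions this is at most [2 c] times the
    sum of [|y|], up to a small error, and by [corr_lower] so much is already contained in [F]. *)
Lemma repair_exists (T : finType) (E : {set {set T}}) (V : {set T}) (f : T -> R) (eta e1 al : R) :
  (1 < k)%N -> {in E, forall e : {set T}, #|e| = k} -> {in E, forall e : {set T}, e \subset V} ->
  (forall S : {set T}, S \subset V -> #|S| = k.-1 -> (1 / 2 + eta) * #|V|%:R <= #|[set v in V | v |: S \in E]%SET|%:R) ->
  0 < eta <= 1 -> 0 < e1 <= 1 -> 16 * k%:R ^+ 2 <= e1 * #|V|%:R ->
  {in V, forall v, e1 <= f v <= 1} -> \sum_(v in V) (f v - e1) <= e1 * eta / 2 * #|V|%:R -> 0 < al ->
  exists z : {set T} -> R, {in E, forall e, repair_c eta e1 / #|V|%:R ^+ k.-1 <= z e <= repair_D eta e1 / #|V|%:R ^+ k.-1} /\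
    \sum_(v in V) (edeg E z v - f v) ^+ 2 <= al.
Proof.
move=> k1 Eu EV cod eta01 e101 nbig fb fsum al0.
have /andP[eta0 eta1] := eta01; have /andP[e10 e11] := e101.
have kr : 0 < k%:R :> R by rewrite ltr0n ltnW.
set n := #|V|%:R in cod nbig fsum *.
have n0 : 0 < n.
  rewrite -(pmulr_rgt0 _ e10); apply: lt_le_trans nbig; by rewrite mulr_gt0 // exprn_gt0.
set N := n ^+ k.-1.
have N0 : 0 < N by rewrite exprn_gt0.
set c := repair_c eta e1; set D := repair_D eta e1.
have c0 : 0 < c by exact: repair_c_gt0.
have D1 : 1 <= D by exact: repair_D_ge1.
have D0 : 0 < D by lra.
have c1 : 2 * c <= D by apply: le_trans D1; exact: repair_c_le.
(* The final errors [a D n] and [a n] add up to [al]. *)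
pose a := al / ((D + 1) * n).
have a0 : 0 < a by rewrite divr_gt0 // mulr_gt0 //; lra.
have cN0 : 0 < c / N by rewrite divr_gt0.
have cDN : 2 * (c / N) <= D / N by rewrite mulrA ler_pM2r // invr_gt0.
have [z [zb zlow zhigh]] := @box_descent R T k E V f (c / N) (D / N) a (ltnW k1) Eu EV cN0 cDN a0.
exists z; split=> //.
have z0 : {in E, forall e, 0 <= z e} by move=> e /zb/andP[h _]; apply: le_trans h; exact: ltW.
pose ze := e1 / (8 * k%:R).
have ze0 : 0 < ze by rewrite divr_gt0 // mulr_gt0.
have nb : 2 * k%:R <= ze * n.
  have -> : ze * n = (e1 * n) / (8 * k%:R) by rewrite /ze; ring.
  by rewrite ler_pdivlMr ?mulr_gt0 //; apply: le_trans nbig; rewrite expr2; lra.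
have Db : 4 * (2 * k%:R / ze) ^+ k.-2 <= D * eta.
  rewrite /D /repair_D divfK ?lt0r_neq0 // le_eqVlt; apply/orP; left; apply/eqP; congr (_ * _ ^+ _).
  by rewrite /ze; field; rewrite !lt0r_neq0.
pose y v := edeg E z v - f v.
have [mu [mu0 ymu low]] := @corr_lower R T k E V z f D eta ze a e1 k1 Eu cod eta01 ze0 nb D0 Db (ltW a0) z0 zlow e101 erefl fb fsum.
rewrite -/n in low.
pose F : R := \sum_(v in V) f v * y v.
pose A : R := \sum_(v in V) `|y v|.
pose c2 : R := e1 * eta / (8 * k%:R).
have {}low : c2 * n * mu - a * n <= F := low.
have sc (q : R) : \sum_(v in V) q = n * q by rewrite sumr_const mulr_natl.
have c20 : 0 < c2 by rewrite divr_gt0 ?mulr_gt0.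
have hA : e1 * A <= F + 2 * (n * mu).
  have -> : F + 2 * (n * mu) = \sum_(v in V) (f v * y v + 2 * mu).
    by rewrite /F big_split /= sc; ring.
  rewrite mulr_sumr; apply: ler_sum => v vV; have y1 := ymu v vV; have /andP[f1 f2] := fb v vV.
  rewrite -/(y v) in y1; case: (lerP 0 (y v)) => h.
    rewrite ger0_norm //; have := ler_wpM2r h f1; lra.
  rewrite ltr0_norm // mulrN; have := ler_wnM2r (ltW h) f2; have := ler_wnM2r (ltW h) e11; lra.
have cE (g : R) : \sum_(e in E) g = #|E|%:R * g by rewrite sumr_const mulr_natl.
have kE : k = k.-1.+1 by rewrite prednK // ltnW.
have sz : \sum_(e in E) z e <= D * n.
  apply: (@le_trans _ _ (\sum_(e in E) D / N)); first by apply: ler_sum => e /zb/andP[].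
  rewrite cE mulrA ler_pdivrMr // [X in X <= _]mulrC -[X in _ <= X]mulrA; apply: ler_wpM2l; first exact: ltW.
  by rewrite /N /n -exprS -kE -natrX ler_nat; exact: card_edges_le.
have sy : \sum_(e in E) \sum_(v in e) `|y v| <= N * A.
  have := edeg_exchange (fun=> 1) (fun v => `|y v|) EV.
  under [in RHS]eq_bigr do rewrite mul1r.
  move=> <-; rewrite mulr_sumr; apply: ler_sum => v vV; apply: ler_wpM2r => //.
  rewrite /edeg (eq_bigl (mem [set e in E | v \in e]%SET)); last by move=> e; rewrite !inE.
  rewrite sumr_const /N /n -natrX ler_nat; exact: card_star_le.
have up : \sum_(v in V) (y v) ^+ 2 + F <= a * (D * n) + 2 * c * A.
  have -> : \sum_(v in V) (y v) ^+ 2 + F = \sum_(v in V) edeg E z v * y v.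
    by rewrite /F -big_split /=; apply: eq_bigr => v _; rewrite /y; ring.
  rewrite edeg_exchange //.
  apply: (@le_trans _ _ (\sum_(e in E) (a * z e + 2 * (c / N) * \sum_(v in e) `|y v|))).
    apply: ler_sum => e eE; have ay : \sum_(v in e) y v <= \sum_(v in e) `|y v| by apply: ler_sum => v _; exact: ler_norm.
    have s0 : 0 <= \sum_(v in e) `|y v| by apply: sumr_ge0.
    have ze' := z0 e eE.
    case: (lerP (2 * (c / N)) (z e)) => h.
      have := ler_wpM2l ze' (zhigh e eE h); rewrite -/(y _) mulrC.
      have : 0 <= 2 * (c / N) * \sum_(v in e) `|y v| by apply: mulr_ge0 => //; rewrite pmulr_rge0 // ltW.
      rewrite /y; clear; lra.
    have := ler_wpM2l ze' ay; have := ler_wpM2r s0 (ltW h).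
    have : 0 <= a * z e by rewrite mulr_ge0 // ltW.
    clear; lra.
  rewrite big_split /= -!mulr_sumr; apply: lerD; first by rewrite ler_pM2l.
  apply: (@le_trans _ _ (2 * (c / N) * (N * A))).
    by apply: ler_wpM2l => //; rewrite pmulr_rge0 // ltW.
  by rewrite le_eqVlt; apply/orP; left; apply/eqP; field; rewrite lt0r_neq0.
have cA : 2 * c * A <= F + a * n.
  have q2 : 0 < c2 + 2 by rewrite addr_gt0.
  have -> : 2 * c * A = c2 * (e1 * A) / (c2 + 2).
    by rewrite /c /repair_c -/c2; field; rewrite !lt0r_neq0.
  rewrite ler_pdivrMr //.
  have h1 := ler_wpM2l (ltW c20) hA.
  have h2 : 0 <= c2 * (a * n) := mulr_ge0 (ltW c20) (mulr_ge0 (ltW a0) (ltW n0)).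
  have h3 : c2 * (n * mu) - a * n <= F by move: low; rewrite mulrA.
  move: h1 h2 h3; clear; lra.
have aE : a * (D * n) + a * n = al.
  by rewrite /a; field; rewrite !lt0r_neq0 //; move: D0; clear; lra.
move: up cA aE; rewrite /y; clear; lra.
Qed.

End Repair.

(** * Entropy under truncation, scaling and addition *)

Section EntropyPhi.

Variable R : realType.
Implicit Types (N t p z K : R).

(** Entropy relative to the reference weight [1 / N]: weights of order [1 / N] contribute [O(1 / N)]
    each. *)
Definition phi N t : R := - (t * ln (t * N)).

Lemma phi_le N t : 0 < N -> 0 <= t -> phi N t <= N^-1.
Proof.
move=> N0; rewrite le_eqVlt => /orP[/eqP <-|t0]; first by rewrite /phi mul0r oppr0 invr_ge0 ltW.
have tN : 0 < t * N by rewrite mulr_gt0.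
have iN : 0 < (t * N)^-1 by rewrite invr_gt0.
have h := ln_le_sub1 iN.
rewrite lnV ?posrE // in h.
have := ler_wpM2l (ltW t0) h; rewrite /phi mulrN => h2; apply: (le_trans h2).
have -> : t * ((t * N)^-1 - 1) = N^-1 - t by field; rewrite !lt0r_neq0.
lra.
Qed.

Lemma phi_scale N t (q : R) : 0 < N -> 0 <= t -> 0 <= q <= 1 -> q * phi N t <= phi N (q * t).
Proof.
move=> N0 t0 /andP[]; rewrite le_eqVlt => /orP[/eqP <-|q0] q1; first by rewrite /phi !mul0r oppr0.
move: t0; rewrite le_eqVlt => /orP[/eqP <-|t0]; first by rewrite /phi !(mul0r, mulr0) oppr0 mulr0.
have tN : 0 < t * N by rewrite mulr_gt0.
rewrite /phi -(mulrA q t N) [ln (q * _)]lnM ?posrE // mulrN lerN2 -mulrA.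
apply: ler_wpM2l; first exact: ltW.
by apply: ler_wpM2l; [exact: ltW|rewrite gerDr ln_le0].
Qed.

Lemma phi_trunc N t K : 0 < N -> 0 <= t -> 1 <= K -> phi N t <= phi N (Order.min t (K / N)).
Proof.
move=> N0 t0 K1; case: (lerP t (K / N)) => // h; have K0 : 0 < K by lra.
rewrite /phi lerN2 divfK ?lt0r_neq0 //; have tN : K <= t * N by rewrite -ler_pdivrMr // ltW.
apply: ler_pM; [by rewrite divr_ge0 // ltW|exact: ln_ge0|exact: ltW|].
by rewrite ler_ln ?posrE //; apply: lt_le_trans tN.
Qed.

(** Mass above [K / N] costs [ln K] of entropy per unit, so a matching whose entropy is not too low
    has little of it. *)
Lemma trunc_loss N t K : 0 < N -> 0 <= t -> 1 <= K ->
  ln K * (t - Order.min t (K / N)) <= N^-1 - phi N t.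
Proof.
move=> N0 t0 K1; have K0 : 0 < K by lra.
case: (lerP t (K / N)) => h.
  by rewrite subrr mulr0 subr_ge0 phi_le.
have tN : K <= t * N by rewrite -ler_pdivrMr // ltW.
have lK : ln K <= ln (t * N) by rewrite ler_ln ?posrE //; apply: lt_le_trans tN.
have l0 := ln_ge0 K1.
have KN : 0 <= K / N by rewrite divr_ge0 // ltW.
have h1 := ler_wpM2l t0 lK; have h2 : 0 <= ln K * (K / N) by rewrite mulr_ge0.
have : 0 < N^-1 by rewrite invr_gt0.
by rewrite /phi; move: h1 h2; lra.
Qed.

(** [La] splits [ln ((p + z) N)] for the added weight [z] into [ln La] and a tangent error charged
    to [p + z]; the later choice [La = D / e1] makes this error [e1 (p + z)]. *)
Lemma phi_add N p z (D La : R) : 0 < N -> 0 <= p -> 0 < z -> z * N <= D -> 1 <= La ->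
  phi N p - z - z * ln La - D / La * (p + z) <= phi N (p + z).
Proof.
move=> N0 p0 z0 zD La1; have La0 : 0 < La by lra.
have pz : 0 < p + z by lra.
have pzN : 0 < (p + z) * N by rewrite mulr_gt0.
have h1 : p * ln ((p + z) * N) <= p * ln (p * N) + z.
  move: p0; rewrite le_eqVlt => /orP[/eqP <-|p0]; first by rewrite !mul0r; lra.
  have pN : 0 < p * N by rewrite mulr_gt0.
  have q0 : 0 < (p + z) / p by rewrite divr_gt0.
  have e : (p + z) * N = (p + z) / p * (p * N) by field; rewrite lt0r_neq0.
  rewrite e lnM ?posrE //.
  have := ler_wpM2l (ltW p0) (ln_le_sub1 q0).
  have -> : p * ((p + z) / p - 1) = z by field; rewrite lt0r_neq0.
  lra.
have h2 : z * ln ((p + z) * N) <= z * ln La + D / La * (p + z).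
  have q0 : 0 < (p + z) * N / La by rewrite divr_gt0.
  have e : (p + z) * N = (p + z) * N / La * La by field; rewrite lt0r_neq0.
  rewrite {1}e lnM ?posrE // mulrDr addrC lerD2l.
  have h := ler_wpM2l (ltW z0) (ln_le_sub1 q0).
  apply: (le_trans h).
  have : z * N * ((p + z) / La) <= D * ((p + z) / La) by rewrite ler_wpM2r // divr_ge0 // ltW.
  lra.
rewrite /phi; move: h1 h2; lra.
Qed.

End EntropyPhi.

(** * Almost regular matchings of almost the same entropy *)

Section RegularMatching.

Variable R : realType.

(** [repair_D] is polynomial in [1 / e1], so [e1 ln (repair_D / e1)] tends to [0]; writing
    [e1 = s^2] makes [s ln (1 / s) <= 1] applicable. *)
Lemma repair_loss (k : nat) (eta e2 : R) : (1 < k)%N -> 0 < eta <= 1 -> 0 < e2 ->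
  exists2 e1 : R, 0 < e1 <= 1 & 6 * e1 + 2 * e1 * ln (repair_D k eta e1 / e1) <= e2.
Proof.
move=> k1 /andP[eta0 eta1] e20.
have kr : 0 < k%:R :> R by rewrite ltr0n ltnW.
pose D0 := repair_D k eta 1.
have D01 : 1 <= D0 by apply: repair_D_ge1; rewrite ?eta0 //; lra.
have l0 := ln_ge0 D01.
pose C := 6 + 2 * ln D0 + 4 * k%:R.
have C0 : 0 < C by rewrite /C; lra.
pose s := Order.min 1 (e2 / C).
have s0 : 0 < s by rewrite lt_min ltr01 divr_gt0.
have s1 : s <= 1 by rewrite ge_min lexx.
have sC : s * C <= e2 by rewrite -ler_pdivlMr // ge_min lexx orbT.
have s20 : 0 < s ^+ 2 by rewrite exprn_gt0.
have s21 : s ^+ 2 <= s by rewrite expr2 -[X in _ <= X]mul1r ler_wpM2r // ltW.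
exists (s ^+ 2); first by rewrite s20; lra.
have kE : (k.-2.+1 <= k)%N by case: (k) k1 => [|[]].
have DE : repair_D k eta (s ^+ 2) / s ^+ 2 = D0 * ((s^-1) ^+ (2 * k.-2.+1)).
  have i1 : 16 * k%:R ^+ 2 / s ^+ 2 = (16 * k%:R ^+ 2 / 1) * (s^-1) ^+ 2.
    by rewrite divr1 exprVn.
  rewrite /repair_D i1 exprMn -exprM mulnS exprD /D0 /repair_D -[(s ^+ 2)^-1]exprVn.
  by set u := s^-1 ^+ (2 * k.-2); set w := (16 * _ / 1) ^+ k.-2; ring.
have is0 : 0 < s^-1 by rewrite invr_gt0.
rewrite DE lnM ?posrE ?exprn_gt0 //; last lra.
rewrite lnXn // -mulr_natl.
have h : s * ln s^-1 <= 1.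
  have := ler_wpM2l (ltW s0) (ln_le_sub1 is0).
  by rewrite mulrBr divff ?lt0r_neq0 //; lra.
have l1 : 0 <= ln s^-1 by apply: ln_ge0; rewrite invf_ge1.
have h2 : s ^+ 2 * ((2 * k.-2.+1)%:R * ln s^-1) <= 2 * k%:R * s.
  have -> : s ^+ 2 * ((2 * k.-2.+1)%:R * ln s^-1) = (2 * k.-2.+1)%:R * s * (s * ln s^-1) by ring.
  rewrite -[X in _ <= X]mulr1; apply: ler_pM => //; first by rewrite mulr_ge0 // ltW.
    by rewrite mulr_ge0 // ltW.
  by rewrite ler_wpM2r ?(ltW s0) // -natrM ler_nat leq_mul2l kE.
have h3 : s ^+ 2 * ln D0 <= s * ln D0 by rewrite ler_wpM2r.
apply: le_trans sC; rewrite /C; move: h2 h3 s21; lra.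
Qed.

Lemma sum_le_card (T : finType) (A : {set T}) (g : T -> R) (b : R) : (forall x, x \in A -> g x <= b) ->
  \sum_(x in A) g x <= #|A|%:R * b.
Proof. by move=> h; rewrite mulr_natl -sumr_const; exact: ler_sum. Qed.

(** If the entropy of [x] is very low, repairing the constant degree [1] from scratch already does
    better. Otherwise truncation at [K / N] removes little mass; the truncated weights are scaled by
    [1 - e1], so that the missing degrees [f] lie between [e1] and [1], mostly near [e1], and can be
    supplied by [repair_exists]. *)
Lemma regular_matching (k : nat) (eta e2 : R) : (1 < k)%N -> 0 < eta <= 1 -> 0 < e2 ->
  exists th c D : R, [/\ 0 < th, 0 < c <= 1 & 1 <= D] /\ exists n0 : nat,
  forall (T : finType) (E : {set {set T}}) (V : {set T}) (x : {set T} -> R) (al : R),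
  let N := #|V|%:R ^+ k.-1 : R in
  let E0 := [set e in E | e \subset V]%SET in
  {in E, forall e : {set T}, #|e| = k} ->
  (forall S : {set T}, S \subset V -> #|S| = k.-1 -> (1 / 2 + eta) * #|V|%:R <= #|[set v in V | v |: S \in E]%SET|%:R) ->
  (n0 <= #|V|)%N -> #|~: V|%:R <= th * #|V|%:R ->
  {in E, forall e, 0 <= x e} -> (forall v, edeg E x v = 1) -> 0 < al ->
  exists x' : {set T} -> R, [/\ {in E0, forall e, c / N <= x' e <= D / N},
    \sum_(v in V) (edeg E0 x' v - 1) ^+ 2 <= al &
    \sum_(e in E) phi N (x e) - e2 * #|V|%:R <= \sum_(e in E0) phi N (x' e)].
Proof.
move=> k1 eta01 e20; have /andP[eta0 eta1] := eta01.
have kr : 0 < k%:R :> R by rewrite ltr0n ltnW.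
have kr2 : 2 <= k%:R :> R by rewrite ler_nat.
have one01 : 0 < (1 : R) <= 1 by rewrite ltr01 lexx.
pose D0 := repair_D k eta 1; pose c0 := repair_c k eta 1.
have D01 : 1 <= D0 by exact: repair_D_ge1.
have c00 : 0 < c0 by exact: repair_c_gt0.
pose C1 := 2 * ln D0.
have C10 : 0 <= C1 by rewrite mulr_ge0 // ln_ge0.
have [|e1 e101 e1l] := @repair_loss k eta (e2 / 2) k1 eta01; first by rewrite divr_gt0.
have /andP[e10 e11] := e101.
pose D1 := repair_D k eta e1; pose c1 := repair_c k eta e1.
have D11 : 1 <= D1 by exact: repair_D_ge1.
have c10 : 0 < c1 by exact: repair_c_gt0.
have c11 : 2 * c1 <= 1 by exact: repair_c_le.
(* Makes the degree lost by truncation at most [e1 * eta / 4 * n] in total. *)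
pose lK := 4 * k%:R * (C1 + 2) / (e1 * eta).
have lK0 : 0 < lK by rewrite divr_gt0 ?mulr_gt0 //; lra.
pose K := expR lK.
have K1 : 1 <= K by rewrite /K -(expR0 R) ler_expR ltW.
have K0 : 0 < K by lra.
have p2 : 0 < 2 ^+ k.-1 :> R by rewrite exprn_gt0.
(* The vertices outside [V] may cost as much degree again, and the edges leaving [V] carry entropy
   at most [e2 / 2 * n]. *)
pose th := Order.min 1 (Order.min (e1 * eta / (4 * k%:R)) (Order.min (1 / 2 ^+ k.-1) (e2 / 2 / 2 ^+ k.-1))).
have th0 : 0 < th by rewrite !lt_min ltr01 !divr_gt0 ?mulr_gt0.
have th1 : th <= 1 by rewrite ge_min lexx.
have th2 : th <= e1 * eta / (4 * k%:R) by rewrite !ge_min lexx !orbT.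
have th3 : th * 2 ^+ k.-1 <= 1 by rewrite -ler_pdivlMr // !ge_min lexx !orbT.
have th4 : th * 2 ^+ k.-1 <= e2 / 2 by rewrite -ler_pdivlMr // !ge_min lexx !orbT.
exists th, (Order.min c0 c1), (Order.max D0 (K + D1)); split.
  split=> //; last by rewrite le_max D01.
  by rewrite lt_min c00 c10 /= ge_min; apply/orP; right; lra.
exists (Num.bound (16 * k%:R ^+ 2 / e1)).+1 => T E V x al N E0 Eu cod nbig cA x0 xdeg al0.
set n := #|V|%:R in cod cA N *.
have nb1 : 16 * k%:R ^+ 2 <= e1 * n.
  rewrite [e1 * n]mulrC -ler_pdivrMr //; apply: ltW; apply: (lt_le_trans (archi_boundP _)).
    by rewrite divr_ge0 ?mulr_ge0 ?exprn_ge0 // ltW.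
  by rewrite ler_nat ltnW.
have n0 : 0 < n by rewrite ltr0n (leq_trans _ nbig).
have n1 : 1 <= n by rewrite ler1n (leq_trans _ nbig).
have nb0 : 16 * k%:R ^+ 2 <= 1 * n by apply: (le_trans nb1); rewrite ler_wpM2r // ltW.
have N0 : 0 < N by rewrite exprn_gt0.
have sc (q : R) : \sum_(v in V) q = n * q by rewrite sumr_const mulr_natl.
have E0E e : e \in E0 -> e \in E by rewrite inE => /andP[].
have E0u : {in E0, forall e : {set T}, #|e| = k} by move=> e /E0E; exact: Eu.
have E0V : {in E0, forall e : {set T}, e \subset V} by move=> e; rewrite inE => /andP[].
have cod0 (S : {set T}) : S \subset V -> #|S| = k.-1 -> (1 / 2 + eta) * n <= #|[set v in V | v |: S \in E0]%SET|%:R.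
  move=> SV cS; apply: (le_trans (cod S SV cS)); rewrite ler_nat subset_leq_card //.
  apply/fintype.subsetP => v; rewrite !inE => /andP[vV ->].
  by rewrite vV /= finset.subUset finset.sub1set vV.
have kE : k = k.-1.+1 by rewrite prednK // ltnW.
have cE0 : #|E0|%:R * N^-1 <= n.
  rewrite ler_pdivrMr // /N /n -exprS -kE -natrX ler_nat; exact: card_edges_le.
(* The bound by [e1^2] keeps the total repairing weight [z] of order [e1 n]. *)
pose al' := Order.min al (e1 ^+ 2).
have al'0 : 0 < al' by rewrite lt_min al0 exprn_gt0.
have al'1 : al' <= al by rewrite ge_min lexx.
have al'2 : al' <= e1 ^+ 2 by rewrite ge_min lexx orbT.
have e1sq : e1 ^+ 2 <= e1 by rewrite expr2 -[X in _ <= X]mul1r ler_wpM2r // ltW.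
case: (lerP (\sum_(e in E) phi N (x e)) (- (C1 * n))) => hx.
  have [||z [zb zs]] := @repair_exists R k T E0 V (fun=> 1) eta 1 al' k1 E0u E0V cod0 eta01 one01 nb0 _ _ al'0.
  - by move=> v _; rewrite lexx.
  - by rewrite big1 ?mulr_ge0 ?divr_ge0 // ?mulr_ge0 // ?ltW // => v _; rewrite subrr.
  have zb' e : e \in E0 -> 0 < z e.
    by move=> /zb/andP[h _]; apply: lt_le_trans h; rewrite divr_gt0.
  exists z; split; [|exact: le_trans zs al'1|].
  - move=> e eE; have /andP[h1 h2] := zb e eE; apply/andP; split.
      by apply: le_trans h1; rewrite ler_pM2r ?invr_gt0 // ge_min lexx.
    by apply: (le_trans h2); rewrite ler_pM2r ?invr_gt0 // le_max lexx.
  have sz : \sum_(e in E0) z e <= 2 * n.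
    have h1 : \sum_(v in V) edeg E0 z v <= \sum_(v in V) (2 + (edeg E0 z v - 1) ^+ 2).
      apply: ler_sum => v _; have := sqr_ge0 (edeg E0 z v - 1 - 1 / 2); rewrite expr2 expr2; clear; lra.
    rewrite (edeg_sum _ E0u E0V) big_split /= sc in h1.
    rewrite -(ler_pM2l kr); apply: (le_trans h1); have := ler_wpM2r (ltW n0) kr2.
    move: zs al'2 e1sq e11 n1; clear; lra.
  have h : - (C1 * n) <= \sum_(e in E0) phi N (z e).
    apply: (@le_trans _ _ (\sum_(e in E0) - (z e * ln D0))).
      rewrite sumrN lerN2 -mulr_suml /C1.
      have := ler_wpM2r (ln_ge0 D01) sz; clear; lra.
    apply: ler_sum => e eE; rewrite /phi lerN2; have z0 := zb' e eE.
    rewrite ler_wpM2l ?(ltW z0) //; have /andP[_ h2] := zb e eE.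
    have D0p : 0 < D0 by apply: lt_le_trans D01.
    have zN : 0 < z e * N by apply: mulr_gt0.
    rewrite ler_ln ?posrE //.
    by rewrite -ler_pdivlMr.
  have : 0 < e2 * n by rewrite mulr_gt0.
  move: hx h; clear; lra.
have Tn : #|T|%:R <= 2 * n.
  have : (#|T| = #|V| + #|~: V|)%N by rewrite cardsC.
  move=> ->; rewrite natrD -/n; have := ler_wpM2r (ltW n0) th1; move: cA; clear; lra.
have cED : #|E :\: E0|%:R * N^-1 <= th * 2 ^+ k.-1 * n.
  have sub : E :\: E0 \subset \bigcup_(v in ~: V) [set e in E | v \in e]%SET.
    apply/fintype.subsetP => e; rewrite !inE => /andP[]; case eE: (e \in E) => //= eV _.
    have /subsetPn[v ve vV] := eV.
    by apply/finset.bigcupP; exists v; rewrite !inE ?eE.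
  have h : (#|E :\: E0| <= #|~: V| * #|T| ^ k.-1)%N.
    apply: (leq_trans (subset_leq_card sub)).
    rewrite -sum_nat_const; elim/big_ind2 : _ => [|A m B m' hA hB|v _].
    - by rewrite cards0.
    - by apply: (leq_trans (leq_card_setU _ _)); rewrite leq_add.
    - by rewrite -cardsT; apply: card_star_le => // e _; exact: finset.subsetT.
  rewrite ler_pdivrMr //; apply: (@le_trans _ _ (#|~: V|%:R * (#|T|%:R ^+ k.-1))).
    by rewrite -natrX -natrM ler_nat.
  apply: (@le_trans _ _ (th * n * (2 * n) ^+ k.-1)).
    by apply: ler_pM => //; rewrite ?exprn_ge0 // lerXn2r ?nnegrE ?mulr_ge0 // ltW.
  by rewrite exprMn /N; move: (2 ^+ _) (n ^+ _) => u w; rewrite le_eqVlt; apply/orP; left; apply/eqP; ring.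
have EID (g : {set T} -> R) : \sum_(e in E) g e = \sum_(e in E0) g e + \sum_(e in E :\: E0) g e.
  rewrite (big_setID E0) /=; congr (_ + _); apply: eq_bigl => e.
  by rewrite !inE; case: (e \in E).
have phiE0 : \sum_(e in E) phi N (x e) - th * 2 ^+ k.-1 * n <= \sum_(e in E0) phi N (x e).
  rewrite EID; suff : \sum_(e in E :\: E0) phi N (x e) <= th * 2 ^+ k.-1 * n by clear; lra.
  apply: le_trans cED; apply: sum_le_card => e; rewrite !inE => /andP[_ eE]; apply: phi_le => //; exact: x0.
pose a e := Order.min (x e) (K / N).
have KN0 : 0 < K / N by rewrite divr_gt0.
have a0 e : e \in E0 -> 0 <= a e by move=> /E0E/x0 h; rewrite le_min h ltW.
have ax e : a e <= x e by rewrite ge_min lexx.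
have edE0 v : edeg E0 x v <= 1.
  rewrite -(xdeg v) /edeg [X in X <= _]big_mkcond [X in _ <= X]big_mkcond /=; apply: ler_sum => e _; rewrite !inE.
  by case eE: (e \in E); case: (e \subset V); case: (v \in e) => //=; apply: x0.
have dega v : 0 <= edeg E0 a v <= 1.
  apply/andP; split; first by apply: sumr_ge0 => e /andP[h _]; exact: a0.
  by apply: le_trans (edE0 v); apply: ler_sum => e _; exact: ax.
have sxa : \sum_(e in E0) (x e - a e) <= (C1 + 2) * n / lK.
  rewrite ler_pdivlMr // mulrC; apply: (@le_trans _ _ (\sum_(e in E0) (N^-1 - phi N (x e)))).
    rewrite mulr_sumr; apply: ler_sum => e eE.
    by have := trunc_loss N0 (x0 _ (E0E _ eE)) K1; rewrite /K expRK.
  rewrite sumrB; have := sum_le_card (A := E0) (g := fun=> N^-1) (fun _ _ => lexx _).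
  have := ler_wpM2r (ltW n0) th3; move: phiE0 cE0 hx; clear; lra.
pose f v := 1 - (1 - e1) * edeg E0 a v.
have fb : {in V, forall v, e1 <= f v <= 1}.
  move=> v _; rewrite /f; have /andP[h1 h2] := dega v.
  have h3 : 0 <= (1 - e1) * edeg E0 a v by rewrite mulr_ge0 // subr_ge0.
  have h4 : (1 - e1) * edeg E0 a v <= (1 - e1) * 1 by rewrite ler_wpM2l // subr_ge0.
  by apply/andP; split; move: h3 h4; clear; lra.
have fsum : \sum_(v in V) (f v - e1) <= e1 * eta / 2 * n.
  have h1 : \sum_(v in V) (f v - e1) <= \sum_(v in V) (1 - edeg E0 a v).
    apply: ler_sum => v _; rewrite /f; have /andP[h1 h2] := dega v.
    have : 0 <= e1 * (1 - edeg E0 a v) by rewrite mulr_ge0 // ?(ltW e10) // subr_ge0.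
    clear; lra.
  have h2 : \sum_(v in V) (1 - edeg E0 a v) = (n - \sum_(v in V) edeg E0 x v) + k%:R * \sum_(e in E0) (x e - a e).
    rewrite sumrB sumr_const -/n !(edeg_sum _ E0u E0V) sumrB; ring.
  have h3 : n - \sum_(v in V) edeg E0 x v <= k%:R * (th * n).
    have -> : n - \sum_(v in V) edeg E0 x v = \sum_(v in V) (edeg E x v - edeg E0 x v).
      by rewrite sumrB; under [in RHS]eq_bigr do rewrite xdeg; rewrite sc mulr1.
    apply: (@le_trans _ _ (\sum_v edeg (E :\: E0) x v)).
      rewrite big_mkcond /=; apply: ler_sum => v _; have p : 0 <= edeg (E :\: E0) x v.
        by apply: sumr_ge0 => e; rewrite !inE => /andP[/andP[_ h] _]; exact: x0.
      case: ifP => // _; rewrite lerBlDl /edeg big_mkcondr /= EID.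
      by rewrite -!big_mkcondr /=.
    have := @edeg_sum R k T (E :\: E0) setT x; rewrite big_mkcond /=.
    under eq_bigr do rewrite finset.in_setT.
    move=> ->; last 2 first.
    - by move=> e; rewrite inE => /andP[_ /Eu].
    - by move=> e _; exact: finset.subsetT.
    rewrite ler_pM2l //; apply: le_trans cA.
    have -> : #|~: V|%:R = \sum_(v in ~: V) edeg E x v by under eq_bigr do rewrite xdeg; rewrite sumr_const.
    rewrite /edeg (exchange_big_dep (mem E)) /=; last by move=> v e _ /andP[].
    rewrite [X in X <= _]big_mkcond [X in _ <= X]big_mkcond /=; apply: ler_sum => e _; rewrite !inE.
    case eE: (e \in E) => /=; last by rewrite ?andbF.
    rewrite ?andbT; case: (boolP (e \subset V)) => eV /=.
      by apply: sumr_ge0 => v _; exact: x0.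
    have /subsetPn[v ve vV] := eV.
    rewrite (bigD1 v) /=; last by rewrite inE vV ve.
    by rewrite lerDl; apply: sumr_ge0 => w _; exact: x0.
  have h4 : k%:R * (th * n) <= e1 * eta / 4 * n.
    have := ler_wpM2r (ltW n0) (ler_wpM2l (ltW kr) th2).
    have -> : k%:R * (e1 * eta / (4 * k%:R)) = e1 * eta / 4 by field; rewrite lt0r_neq0.
    by rewrite mulrA.
  have h5 : k%:R * \sum_(e in E0) (x e - a e) <= e1 * eta / 4 * n.
    apply: (le_trans (ler_wpM2l (ltW kr) sxa)); rewrite /lK le_eqVlt; apply/orP; left; apply/eqP.
    by field; rewrite !lt0r_neq0 //; move: C10; clear; lra.
  move: h1 h2 h3 h4 h5; clear; lra.
have [z [zb zs]] := @repair_exists R k T E0 V f eta e1 al' k1 E0u E0V cod0 eta01 e101 nb1 fb fsum al'0.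
have z0 e : e \in E0 -> 0 < z e.
  by move=> /zb/andP[h _]; apply: lt_le_trans h; rewrite divr_gt0.
pose p e := (1 - e1) * a e.
have p0 e : e \in E0 -> 0 <= p e by move=> h; rewrite mulr_ge0 ?a0 // subr_ge0.
have pa e : e \in E0 -> p e <= a e.
  by move=> h; rewrite /p; have := mulr_ge0 (ltW e10) (a0 e h); clear; lra.
exists (fun e => p e + z e); split.
- move=> e eE; have /andP[h1 h2] := zb e eE; have h3 := p0 e eE; have h4 := pa e eE.
  have h5 : a e <= K / N by rewrite ge_min lexx orbT.
  apply/andP; split.
    apply: (@le_trans _ _ (c1 / N)); first by rewrite ler_pM2r ?invr_gt0 // ge_min lexx orbT.
    by move: h1 h3; rewrite -/c1; clear; lra.
  apply: (@le_trans _ _ ((K + D1) / N)); last by rewrite ler_pM2r ?invr_gt0 // le_max lexx orbT.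
  by rewrite mulrDl; move: h2 h4 h5; rewrite -/D1; clear; lra.
- apply: le_trans al'1; apply: le_trans zs; rewrite le_eqVlt; apply/orP; left; apply/eqP.
  apply: eq_bigr => v _; congr (_ ^+ 2); rewrite /edeg big_split /= -mulr_sumr /f -/(edeg E0 a v); ring.
have sz : \sum_(e in E0) z e <= 2 * e1 * n.
  have h1 : \sum_(v in V) edeg E0 z v <= \sum_(v in V) ((f v - e1) + (2 * e1 + (edeg E0 z v - f v) ^+ 2 / e1)).
    apply: ler_sum => v _; set t := edeg E0 z v - f v.
    have -> : edeg E0 z v = t + f v by rewrite /t; ring.
    have : t <= e1 + t ^+ 2 / e1.
      have -> : e1 + t ^+ 2 / e1 = (e1 ^+ 2 + t ^+ 2) / e1 by field; rewrite lt0r_neq0.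
      rewrite ler_pdivlMr //; have := sqr_ge0 (t - e1); have := sqr_ge0 t; have := sqr_ge0 e1; rewrite !expr2; clear; lra.
    clear; lra.
  rewrite (edeg_sum _ E0u E0V) big_split /= [X in _ <= _ + X]big_split /= sc -mulr_suml in h1.
  have h2 : (\sum_(v in V) (edeg E0 z v - f v) ^+ 2) / e1 <= e1.
    by rewrite ler_pdivrMr // -expr2; apply: le_trans zs al'2.
  rewrite -(ler_pM2l kr); apply: (le_trans h1).
  have h3 := ler_wpM2l (ltW e10) n1; have h4 : e1 * eta / 2 * n <= e1 / 2 * n.
    by rewrite ler_pM2r // ler_pM2r // ger_pMr.
  have h5 : 4 * e1 * n <= k%:R * (2 * e1 * n).
    have : 0 <= 2 * e1 * n by rewrite !mulr_ge0 //; exact: ltW.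
    by move=> h; have := ler_wpM2r h kr2; clear; lra.
  move: (mulr_ge0 (ltW e10) (ltW n0)) fsum h2 h3 h4 h5; clear; lra.
pose La := D1 / e1.
have La1 : 1 <= La by rewrite ler_pdivlMr // mul1r (le_trans e11).
have DLa : D1 / La = e1 by rewrite /La; field; rewrite !lt0r_neq0 //; apply: lt_le_trans D11.
have sp : \sum_(e in E0) p e <= n.
  apply: (@le_trans _ _ (\sum_(e in E0) x e)); first by apply: ler_sum => e eE; apply: (le_trans (pa e eE)).
  have : \sum_(v in V) edeg E0 x v <= n by rewrite -[n]mulr1; apply: sum_le_card => v _; exact: edE0.
  rewrite (edeg_sum _ E0u E0V); have : 0 <= \sum_(e in E0) x e by apply: sumr_ge0 => e /E0E; exact: x0.
  move=> s0; have := ler_wpM2r s0 kr2; move: s0; clear; lra.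
have step e : e \in E0 -> phi N (x e) - e1 * N^-1 - z e - z e * ln La - e1 * (p e + z e) <= phi N (p e + z e).
  move=> eE; have := @phi_add R N (p e) (z e) D1 La N0 (p0 e eE) (z0 e eE) _ La1.
  rewrite DLa -ler_pdivlMr //; have /andP[_ h2] := zb e eE => /(_ h2); apply: le_trans.
  have h : phi N (x e) - e1 * N^-1 <= phi N (p e).
    have h3 : (1 - e1) * phi N (a e) <= phi N (p e).
      by apply: phi_scale => //; [exact: a0|apply/andP; split; move: e10 e11; clear; lra].
    have h4 : phi N (x e) <= phi N (a e) by apply: phi_trunc => //; exact: x0 (E0E _ eE).
    have h5 := ler_wpM2l (ltW e10) (phi_le N0 (a0 e eE)).
    move: h3 h4 h5; clear; lra.
  move: h; clear; lra.
apply: le_trans (ler_sum _ step); rewrite !sumrB -[\sum_(e in E0) e1 * (p e + z e)]mulr_sumr big_split /=.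
have h1 : \sum_(e in E0) e1 * N^-1 <= e1 * n by rewrite sumr_const -[_ *+ _]mulr_natl mulrCA ler_pM2l.
have h2 := ler_wpM2r (ln_ge0 La1) sz; rewrite mulr_suml in h2.
have h3 := ler_wpM2r (ltW n0) th4.
have h4 := ler_wpM2r (ltW n0) e1l; rewrite -/D1 -/La in h4.
have h5 := ler_wpM2l (ltW e10) sp; have h6 := ler_wpM2l (ltW e10) sz.
have h7 : e1 * (2 * e1 * n) <= 2 * (e1 * n).
  by have := ler_wpM2r (ltW n0) e1sq; rewrite expr2; clear; lra.
have en : 0 <= e1 * n by rewrite mulr_ge0 // ltW.
move: phiE0 h1 h2 h3 h4 h5 h6 h7 sz en; rewrite mulrDr; clear; lra.
Qed.

End RegularMatching.

(** * Path weights from a stationary Markov chain *)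

Section ListSums.

Variables (R : realType) (T : finType).
Implicit Types (g h : seq T -> R).

(** Sums over sequences of length [n] by recursion, which avoids casts between tuple types under
    concatenation. *)
Fixpoint lsum (n : nat) g : R :=
  if n is m.+1 then \sum_u lsum m (fun s => g (u :: s)) else g [::].

Lemma lsumS n g : lsum n.+1 g = \sum_u lsum n (fun s => g (u :: s)).
Proof. by []. Qed.

Lemma lsumE n g : \sum_(t : n.-tuple T) g t = lsum n g.
Proof.
elim: n g => [|n IH] g /=.
  by rewrite (big_pred1 [tuple]) // => t; apply/esym/eqP; exact: tuple0.
under [RHS]eq_bigr do rewrite -IH.
rewrite [RHS]pair_big /= (reindex (fun p : T * n.-tuple T => [tuple of p.1 :: p.2])) /=; first by [].
exists (fun t : n.+1.-tuple T => (thead t, [tuple of behead t])) => [[u t] _|t _] /=.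
  by congr (_, _); apply: val_inj.
by rewrite -tuple_eta.
Qed.

Lemma eq_lsum n g h : (forall s, size s = n -> g s = h s) -> lsum n g = lsum n h.
Proof.
elim: n g h => [|n IH] g h gh /=; first exact: gh.
by apply: eq_bigr => u _; apply: IH => s ss; apply: gh; rewrite /= ss.
Qed.

Lemma lsum_sum n (I : finType) (g : I -> seq T -> R) : lsum n (fun s => \sum_i g i s) = \sum_i lsum n (g i).
Proof.
elim: n g => [|n IH] g //=; rewrite exchange_big /=; apply: eq_bigr => u _.
exact: (IH (fun i s => g i (u :: s))).
Qed.

Lemma lsumZ n c g : lsum n (fun s => c * g s) = c * lsum n g.
Proof. by elim: n g => [|n IH] g //=; rewrite mulr_sumr; apply: eq_bigr => u _; rewrite IH. Qed.

Lemma lsumD n g h : lsum n (fun s => g s + h s) = lsum n g + lsum n h.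
Proof. by elim: n g h => [|n IH] g h //=; rewrite -big_split; apply: eq_bigr => u _; rewrite IH. Qed.

Lemma lsumB n g h : lsum n (fun s => g s - h s) = lsum n g - lsum n h.
Proof.
rewrite (_ : lsum n g - lsum n h = lsum n g + -1 * lsum n h); last by ring.
by rewrite -lsumZ -lsumD; apply: eq_lsum => s _; ring.
Qed.

Lemma lsum_rcons n g : lsum n.+1 g = lsum n (fun s => \sum_v g (rcons s v)).
Proof.
elim: n g => [|n IH] g //.
by rewrite lsumS [RHS]lsumS; apply: eq_bigr => u _; rewrite IH.
Qed.

Lemma lsum_cat a b g : lsum (a + b) g = lsum a (fun s => lsum b (fun t => g (s ++ t))).
Proof. by elim: a g => [|a IH] g //=; apply: eq_bigr => u _; rewrite IH. Qed.

Lemma lsum_swap a b (g : seq T -> seq T -> R) :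
  lsum a (fun s => lsum b (fun t => g s t)) = lsum b (fun t => lsum a (fun s => g s t)).
Proof.
elim: a g => [|a IH] g //=; rewrite lsum_sum; apply: eq_bigr => u _; exact: IH.
Qed.

End ListSums.

(** * The Markov chain and its marginals *)

Section MarkovWeight.

Variables (R : realType) (T : finType) (h : nat) (E : {set {set T}}).
Hypothesis Eu : {in E, forall e : {set T}, #|e| = h.+2}.

(** A symmetric weight on ordered tuples; a tuple of [h + 2] entries with a repetition gets [0] by
    uniformity. *)
Definition ew (g : {set T} -> R) (s : seq T) : R :=
  if [set v in s]%SET \in E then g [set v in s]%SET else 0.

Lemma ew_eqi g s t : s =i t -> ew g s = ew g t.
Proof. by move=> st; rewrite /ew (_ : [set v in s]%SET = [set v in t]%SET) //; apply/setP => v; rewrite !inE st. Qed.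

Lemma ew_star g v : lsum h.+1 (fun s => ew g (v :: s)) = (h.+1)`!%:R * edeg E g v.
Proof.
rewrite -lsumE /edeg mulr_sumr.
pose A e := [set t : h.+1.-tuple T | [set u in v :: t]%SET == e]%SET.
transitivity (\sum_(t : h.+1.-tuple T) \sum_(e in E) (if t \in A e then g e else 0)).
  apply: eq_bigr => t _; rewrite /ew; case: ifP => hE; last first.
    rewrite big1 // => e eE; rewrite inE; case: eqP => // he; by rewrite he eE in hE.
  rewrite (bigD1 [set u in v :: t]%SET) //= inE eqxx big1 ?addr0 // => e /andP[_ /negbTE].
  by rewrite inE eq_sym => ->.
rewrite exchange_big [RHS]big_mkcondr; apply: eq_bigr => e eE.
rewrite -big_mkcond sumr_const; case ve: (v \in e); last first.
  rewrite (eq_card0 _) ?mulr0n // => t; rewrite inE; apply/negbTE/eqP => he.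
  by move: ve; rewrite -he !inE eqxx.
rewrite mulr_natl; congr (_ *+ _).
have ce : #|e :\ v| = h.+1 by have := cardsD1 v e; rewrite ve (Eu eE) add1n => -[].
have -> : (h.+1)`! = #|[set t : h.+1.-tuple T | all (mem (e :\ v)) t & uniq t]%SET|.
  by rewrite card_uniq_tuples [X in X ^_ _]ce ffactnn.
apply: eq_card => t; rewrite !inE; apply/eqP/andP.
  move=> he; have cu : uniq (v :: t).
    by apply/card_uniqP; rewrite /= size_tuple -[RHS](Eu eE) -he cardsE.
  move: cu => /= /andP[vt ut]; split=> //; apply/allP => u ut'; rewrite /= !inE.
  by rewrite -he !inE ut' orbT andbT; apply: contraNneq vt => <-.
move=> [/allP ae ut]; apply/eqP; rewrite eqEcard (Eu eE); apply/andP; split.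
  apply/fintype.subsetP => u; rewrite !inE => /orP[/eqP -> //|/ae].
  by rewrite /= !inE => /andP[].
rewrite cardsE (card_uniqP _) /= ?size_tuple //= ut andbT; apply/negP => /ae.
by rewrite /= !inE eqxx.
Qed.

Lemma ew_total g : lsum h.+2 (ew g) = (h.+2)`!%:R * \sum_(e in E) g e.
Proof.
rewrite lsumS; under eq_bigr do rewrite ew_star.
rewrite -mulr_sumr.
have := @edeg_sum R h.+2 T E setT g Eu (fun e _ => finset.subsetT e).
rewrite (eq_bigl xpredT); last by move=> v; rewrite inE.
by move=> ->; rewrite mulrA -natrM mulnC -factS.
Qed.

Lemma ew_pos g v i : (i < h.+2)%N ->
  lsum h.+2 (fun s => ew g s * (nth v s i == v)%:R) = (h.+1)`!%:R * edeg E g v.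
Proof.
move=> ih; have hE : h.+2 = (i + (h.+1 - i).+1)%N by move: ih; clear; lia.
rewrite [X in lsum X _]hE lsum_cat /= -ew_star.
have -> : h.+1 = (i + (h.+1 - i))%N by move: ih; clear; lia.
rewrite lsum_cat; apply: eq_lsum => p sp.
rewrite (bigD1 v) //= [X in _ + X]big1 ?addr0; last first.
  move=> u uv; apply: etrans (eq_lsum (h := fun=> 0 * 0) _) _.
    by move=> q _; rewrite nth_cat sp ltnn subnn /= (negbTE uv) mulr0 mul0r.
  by rewrite lsumZ mul0r.
have -> : (i + (h.+1 - i) - i)%N = (h.+1 - i)%N by rewrite addKn.
apply: eq_lsum => q _; rewrite nth_cat sp ltnn subnn /= eqxx mulr1; apply: ew_eqi => u.
by rewrite !(mem_cat, inE) orbCA.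
Qed.

Variable x : {set T} -> R.
Hypothesis x0 : {in E, forall e, 0 < x e}.

Notation xe := (ew x).
Definition xs (s : seq T) : R := \sum_v xe (v :: s).

(* The stationary Markov chain that prepends [u] to a sequence starting with the
   (k-1)-tuple [t] with probability [xe (u :: t) / xs t]; here k = h + 2. *)
Fixpoint mk (s : seq T) : R :=
  if size s == h.+1 then xs s
  else if s is u :: s' then xe (u :: take h.+1 s') / xs (take h.+1 s') * mk s' else 0.

Lemma xe_ge0 s : 0 <= xe s.
Proof. by rewrite /ew; case: ifP => // /x0/ltW. Qed.

Lemma xs_ge0 s : 0 <= xs s.
Proof. by apply: sumr_ge0 => v _; exact: xe_ge0. Qed.

Lemma xs0 s v : xs s = 0 -> xe (v :: s) = 0.
Proof. by move/eqP; rewrite psumr_eq0 => [/allP/(_ v (mem_index_enum v))/eqP|i _] //; exact: xe_ge0. Qed.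

Lemma mk_base s : size s = h.+1 -> mk s = xs s.
Proof. by case: s => [//|u s] ss; rewrite /mk ss eqxx. Qed.

Lemma mk_cons u s : (h < size s)%N -> mk (u :: s) = xe (u :: take h.+1 s) / xs (take h.+1 s) * mk s.
Proof. by move=> hs /=; rewrite eqSS gtn_eqF. Qed.

Lemma mk_ge0 s : 0 <= mk s.
Proof.
elim: s => [|u s IH] //=.
by case: ifP => _; rewrite ?xs_ge0 // mulr_ge0 // divr_ge0 ?xe_ge0 ?xs_ge0.
Qed.

(** Covers the division by [0] in [mk]: no edge extends the initial (k-1)-tuple, so the weight
    vanishes. *)
Lemma mk_xs0 s : (h < size s)%N -> xs (take h.+1 s) = 0 -> mk s = 0.
Proof.
move=> hs; case: (eqVneq (size s) h.+1) => [sE|sN].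
  by rewrite take_oversize ?sE // mk_base.
case: s hs sN => [//|u s] /=; rewrite eqSS ltnS leq_eqVlt => /orP[/eqP ->|hs _]; first by rewrite eqxx.
case: s hs => [//|v s] hs H; rewrite gtn_eqF //.
suff -> : xe (u :: take h.+1 (v :: s)) = 0 by rewrite !mul0r.
have hs' : (h < size (v :: s))%N by [].
have := xs0 (nth v (v :: s) h) H.
by move=> <-; apply: ew_eqi => w; rewrite (take_nth v hs') !(inE, mem_rcons) orbCA.
Qed.

Lemma mk_sum_cons s : (h < size s)%N -> \sum_u mk (u :: s) = mk s.
Proof.
move=> hs; under eq_bigr do rewrite mk_cons //.
rewrite -mulr_suml -mulr_suml -/(xs _); case: (eqVneq (xs (take h.+1 s)) 0) => [z|nz].
  by rewrite (mk_xs0 hs z) mulr0.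
by rewrite divff // mul1r.
Qed.

Lemma mk_edge s : size s = h.+2 -> mk s = xe s.
Proof.
case: s => [//|u s] [ss]; rewrite mk_cons ?ss // mk_base // take_oversize ?ss //.
case: (eqVneq (xs s) 0) => [z|nz]; first by rewrite z mulr0 xs0.
by rewrite divfK.
Qed.

(** Stationarity. At the shortest length it is the symmetry of [xe], and prepending a vertex
    commutes with summing over the last one. *)
Lemma mk_sum_rcons s : (h < size s)%N -> \sum_v mk (rcons s v) = mk s.
Proof.
elim: s => [//|u s IH] /=; rewrite ltnS leq_eqVlt => /orP[/eqP sE|hs].
  rewrite -[RHS]/(mk (u :: s)) mk_base /= -?sE //.
  apply: eq_bigr => v _; rewrite -[LHS]/(mk (rcons (u :: s) v)) mk_edge ?size_rcons /= -?sE //.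
  by apply: ew_eqi => w; rewrite -rcons_cons mem_rcons.
rewrite -[RHS]/(mk (u :: s)) mk_cons // -IH // mulr_sumr; apply: eq_bigr => v _.
rewrite -[LHS]/(mk (u :: rcons s v)) mk_cons ?size_rcons ?(ltnW hs) //.
  by rewrite -cats1 takel_cat.
exact: leq_trans hs _.
Qed.

Lemma mk_suml a s : (h < size s)%N -> lsum a (fun p => mk (p ++ s)) = mk s.
Proof.
move=> hs; elim: a => [//|a IH]; rewrite lsumS -lsum_sum -IH; apply: eq_lsum => p _.
by under eq_bigr do rewrite cat_cons; rewrite mk_sum_cons // size_cat (leq_trans hs) ?leq_addl.
Qed.

Lemma mk_sumr b s : (h < size s)%N -> lsum b (fun q => mk (s ++ q)) = mk s.
Proof.
move=> hs; elim: b => [|b IH]; first by rewrite /= cats0.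
rewrite lsum_rcons -[RHS]IH; apply: eq_lsum => q _.
by under eq_bigr do rewrite -rcons_cat; rewrite mk_sum_rcons // size_cat (leq_trans hs) ?leq_addr.
Qed.

(** Summing out both ends shows that every window of length [j] is distributed according to [mk]. *)
Lemma mk_marg a j b (f : seq T -> R) : (h < j)%N ->
  lsum (a + (j + b)) (fun P => mk P * f (take j (drop a P))) = lsum j (fun s => mk s * f s).
Proof.
move=> hj; rewrite lsum_cat (eq_lsum (h := fun p => lsum j (fun s => lsum b (fun q => f s * mk (p ++ (s ++ q)))))); last first.
  move=> p sp; rewrite lsum_cat; apply: eq_lsum => s ss; apply: eq_lsum => q sq.
  by rewrite drop_size_cat // take_size_cat // mulrC.
rewrite lsum_swap; apply: eq_lsum => s ss; rewrite lsum_swap.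
under [LHS]eq_lsum => q sq do rewrite lsumZ mk_suml ?size_cat ?ss ?(leq_trans hj) ?leq_addr //.
by rewrite lsumZ mk_sumr ?ss // mulrC.
Qed.

End MarkovWeight.

Arguments mk : simpl never.

Section ThroughVertex.

Variables (T : finType) (l' : nat).

(* Deleting one occurrence of [v] costs a factor [l.+1], its position. *)
Lemma card_through (V U : {set T}) (v : T) : (0 < l')%N ->
  (#|[set P : l'.-tuple T | [&& all (mem V) P, v \in P & ~~ (uniq (rem v P) && ~~ has (mem U) (rem v P))]]%SET| * #|V|
   <= l' * ((l'.-1 * l'.-1 + l'.-1 * #|U|) * #|V| ^ l'.-1))%N.
Proof.
case: l' => [//|l] _ /=.
pose Bad := [set t : l.-tuple T | all (mem V) t && ~~ (uniq t && ~~ has (mem U) t)]%SET.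
have sz (p : 'I_l.+1 * l.-tuple T) : size (take p.1 p.2 ++ v :: drop p.1 p.2) == l.+1.
  by rewrite size_cat /= addnS -size_cat cat_take_drop size_tuple.
pose f p : l.+1.-tuple T := Tuple (sz p).
have sub : [set P : l.+1.-tuple T | [&& all (mem V) P, v \in P & ~~ (uniq (rem v P) && ~~ has (mem U) (rem v P))]]%SET
   \subset f @: (finset.setX setT Bad).
  apply/fintype.subsetP => P; rewrite inE => /and3P[PV vP bad].
  have iP : (index v P < l.+1)%N by rewrite -[X in (_ < X)%N](size_tuple P) index_mem.
  have sr : size (rem v P) == l by rewrite size_rem // size_tuple.
  apply/finset.imsetP; exists (Ordinal iP, Tuple sr).
    rewrite !inE /= bad andbT; apply/allP => x /mem_rem; exact: (allP PV).
  apply: val_inj => /=; rewrite remE.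
  have st : size (take (index v P) P) = index v P by rewrite size_takel // ltnW // index_mem.
  rewrite take_size_cat // drop_size_cat // -[LHS](cat_take_drop (index v P)); congr (_ ++ _).
  by rewrite (drop_nth v) ?index_mem // nth_index.
have h1 := leq_trans (subset_leq_card sub) (leq_imset_card _ _).
rewrite cardsX cardsT card_ord in h1.
apply: (leq_trans (leq_mul h1 (leqnn _))); rewrite -mulnA leq_mul2l /=; exact: card_bad_tuples.
Qed.

End ThroughVertex.

(** * Degrees, codegrees and entropy of the path weights *)

Section MarkovBounds.

Variables (R : realType) (T : finType) (h : nat) (E : {set {set T}}) (V : {set T}) (x : {set T} -> R) (c D : R).

Let n : R := #|V|%:R.
Let N : R := n ^+ h.+1.

Hypothesis Eu : {in E, forall e : {set T}, #|e| = h.+2}.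
Hypothesis EV : {in E, forall e : {set T}, e \subset V}.
Hypothesis V0 : (0 < #|V|)%N.
Hypothesis c01 : 0 < c <= 1.
Hypothesis D1 : 1 <= D.
Hypothesis xb : {in E, forall e, c / N <= x e <= D / N}.
Hypothesis cod : forall S : {set T}, S \subset V -> #|S| = h.+1 -> n / 2 <= #|[set v in V | v |: S \in E]%SET|%:R.

Notation xe := (ew E x).
Notation xsum := (xs E x).
Notation mw := (mk h E x).

Let n0 : 0 < n. Proof. by rewrite ltr0n. Qed.
Let N0 : 0 < N. Proof. by rewrite exprn_gt0 // n0. Qed.
Let c0 : 0 < c. Proof. by case/andP: c01. Qed.
Let D0 : 0 < D. Proof. exact: lt_le_trans D1. Qed.

Let x0 : {in E, forall e, 0 < x e}.
Proof. by move=> e /xb/andP[+ _]; apply: lt_le_trans; rewrite divr_gt0 ?c0 ?N0. Qed.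

Lemma edge_list s : size s = h.+2 -> [set v in s]%SET \in E -> uniq s && all (mem V) s.
Proof.
move=> ss sE; apply/andP; split.
  by apply/card_uniqP; rewrite ss -(Eu sE) cardsE.
by apply/allP => v vs; have := fintype.subsetP (EV sE) v; rewrite inE; apply.
Qed.

Lemma xe_nz s : xe s != 0 -> [set v in s]%SET \in E.
Proof. by rewrite /ew; case: ifP => //; rewrite eqxx. Qed.

Lemma xe_bounds s : [set v in s]%SET \in E -> c / N <= xe s <= D / N.
Proof. by move=> sE; rewrite /ew sE; exact: xb. Qed.

Lemma xs_up s : size s = h.+1 -> xsum s <= n * (D / N).
Proof.
move=> ss; have DN : 0 <= D / N by rewrite divr_ge0 // ltW // ?D0 ?N0.
rewrite /n mulr_natl -sumr_const [X in _ <= X]big_mkcond; apply: ler_sum => v _.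
rewrite /ew; case: ifP => sE; last by case: ifP.
have /andP[_ /= /andP[vV _]] := @edge_list (v :: s) (congr1 S ss) sE.
by rewrite vV; case/andP: (xb sE).
Qed.

Lemma xs_low s : size s = h.+1 -> uniq s -> all (mem V) s -> n / 2 * (c / N) <= xsum s.
Proof.
move=> ss us sV; have cN : 0 <= c / N by rewrite divr_ge0 // ltW // ?c0 ?N0.
have SV : [set v in s]%SET \subset V by apply/fintype.subsetP => v; rewrite inE => vs; exact: (allP sV).
have cS : #|[set v in s]%SET| = h.+1 by rewrite cardsE (card_uniqP us).
apply: (le_trans (ler_wpM2r cN (cod SV cS))).
rewrite mulr_natl -sumr_const [X in X <= _]big_mkcond; apply: ler_sum => v _.
rewrite inE; case: ifP => [/andP[_ vE]|_]; last exact: (@xe_ge0 R T E x x0).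
by rewrite -set_consE in vE; case/andP: (xe_bounds vE).
Qed.

Lemma xs_nz s : size s = h.+1 -> xsum s != 0 -> uniq s && all (mem V) s.
Proof.
move=> ss nz; have [v] : exists v, xe (v :: s) != 0.
  apply/existsP; apply: contraNT nz => /existsPn H; rewrite /xs big1 // => v _.
  by have := H v; rewrite negbK => /eqP.
move=> /xe_nz sE; have := @edge_list (v :: s) (congr1 S ss) sE.
by rewrite /= => /andP[/andP[_ ->] /andP[_ ->]].
Qed.

(** Nonzero transition probabilities are [1 / n] up to the factor [B] either way. *)
Let B : R := 2 * D / c.

Lemma mB_ge2 : 2 <= B.
Proof.
have /andP[c0' c1] := c01; have D1' := D1.
by rewrite /B ler_pdivlMr //; move: c1 D1'; lra.
Qed.

Let B1 : 1 <= B. Proof. by apply: le_trans mB_ge2; rewrite ler1n. Qed.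
Let B0 : 0 < B. Proof. exact: lt_le_trans B1. Qed.

Lemma mk_bounds s : (h < size s)%N -> mw s = 0 \/ (B ^- size s <= mw s * n ^+ (size s).-1 <= B ^+ size s).
Proof.
have n0' := n0; have N0' := N0; have c0' := c0; have D0' := D0; have B1' := B1; have B0' := B0.
have NE : N = n ^+ h * n by rewrite /N exprSr.
have nh : 0 < n ^+ h by rewrite exprn_gt0.
have BV : B^-1 = c / (2 * D) by rewrite /B invf_div.
elim: s => [//|u s IH] hs; case: (eqVneq (size s) h) => [sE|sN].
  have ss : size (u :: s) = h.+1 by rewrite /= sE.
  rewrite mk_base //; case: (eqVneq (xsum (u :: s)) 0) => [->|nz]; first by left.
  right; have /andP[us sV] := xs_nz ss nz; rewrite ss /=; apply/andP; split.
    apply: (@le_trans _ _ (n / 2 * (c / N) * n ^+ h)); last by rewrite ler_pM2r //; exact: xs_low.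
    have -> : n / 2 * (c / N) * n ^+ h = c / 2 by rewrite NE; field; rewrite !lt0r_neq0.
    apply: (@le_trans _ _ B^-1).
      by rewrite -exprVn exprS ler_piMr ?invr_ge0 ?(ltW B0') // exprn_ile1 ?invr_ge0 ?(ltW B0') // invf_le1.
    rewrite BV ler_pdivrMr ?mulr_gt0 //; have := ler_wpM2l (ltW c0') D1; lra.
  apply: (@le_trans _ _ (n * (D / N) * n ^+ h)); first by rewrite ler_pM2r //; exact: xs_up.
  have -> : n * (D / N) * n ^+ h = D by rewrite NE; field; rewrite !lt0r_neq0.
  apply: (@le_trans _ _ B); last by rewrite exprS ler_peMr ?(ltW B0') // exprn_ege1.
  rewrite /B ler_pdivlMr //; have /andP[_ c1] := c01; have := ler_wpM2l (ltW D0') c1; lra.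
have hs' : (h < size s)%N by move: hs; rewrite /= ltnS leq_eqVlt eq_sym (negbTE sN).
rewrite mk_cons //; set t := take h.+1 s.
have st : size t = h.+1 by rewrite size_takel.
case: (IH hs') => [->|/andP[l1 l2]]; first by left; rewrite mulr0.
case: (eqVneq (xe (u :: t)) 0) => [->|nz]; first by left; rewrite !mul0r.
right; have sE := xe_nz nz; have /andP[e1 e2] := xe_bounds sE.
have := @edge_list (u :: t) (congr1 S st) sE; rewrite /= => /andP[/andP[_ ut] /andP[_ tV]].
have xl := xs_low st ut tV; have xu := xs_up st.
have xp : 0 < xsum t by apply: lt_le_trans xl; rewrite mulr_gt0 // divr_gt0.
have r1 : B^-1 <= xe (u :: t) / xsum t * n.
  rewrite mulrAC ler_pdivlMr //; apply: (@le_trans _ _ (B^-1 * (n * (D / N)))).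
    by rewrite ler_pM2l // invr_gt0.
  apply: (@le_trans _ _ (c / N * n)); last by rewrite ler_pM2r.
  have -> : B^-1 * (n * (D / N)) = c / N * n / 2 by rewrite BV; field; rewrite !lt0r_neq0.
  have : 0 < c / N * n by rewrite mulr_gt0 // divr_gt0.
  lra.
have r2 : xe (u :: t) / xsum t * n <= B.
  rewrite mulrAC ler_pdivrMr //; apply: (@le_trans _ _ (D / N * n)); first by rewrite ler_pM2r.
  apply: (@le_trans _ _ (B * (n / 2 * (c / N)))); last by rewrite ler_pM2l.
  by rewrite le_eqVlt; apply/orP; left; apply/eqP; rewrite /B; field; rewrite !lt0r_neq0.
have sp : (size s).-1.+1 = size s by rewrite prednK // (leq_trans _ hs').
have -> : xe (u :: t) / xsum t * mw s * n ^+ (size (u :: s)).-1 = (xe (u :: t) / xsum t * n) * (mw s * n ^+ (size s).-1).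
  by rewrite /= -{1}sp exprS; ring.
have i0 : 0 <= B^-1 by rewrite invr_ge0 ltW.
apply/andP; split; rewrite /=.
  by rewrite -exprVn exprS; apply: ler_pM => //; rewrite ?exprn_ge0 // exprVn.
rewrite exprS; apply: ler_pM => //; first by apply: le_trans r1.
by apply: le_trans l1; rewrite -exprVn exprn_ge0.
Qed.

Lemma mk_supp s : (h < size s)%N -> mw s != 0 -> all (mem V) s && tight h.+2 E s.
Proof.
elim: s => [//|u s IH] hs; case: (eqVneq (size s) h) => [sE|sN].
  have ss : size (u :: s) = h.+1 by rewrite /= sE.
  rewrite mk_base // => /(xs_nz ss)/andP[_ ->]; apply: tight_small; by rewrite ss.
have hs' : (h < size s)%N by move: hs; rewrite /= ltnS leq_eqVlt eq_sym (negbTE sN).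
rewrite mk_cons // mulf_eq0 negb_or mulf_eq0 negb_or => /andP[/andP[nz _] /(IH hs')/andP[sV st]].
have sE := xe_nz nz; have tz : size (take h.+1 s) = h.+1 by rewrite size_takel.
have := @edge_list (u :: take h.+1 s) (congr1 S tz) sE; rewrite /= => /andP[_ /andP[uV _]].
by rewrite uV sV st sE implybT.
Qed.

Variable L : nat.
Hypothesis hL : (h.+1 < L)%N.

Let hL' : (h < L)%N. Proof. exact: ltnW. Qed.
Let L0 : (0 < L)%N. Proof. exact: leq_trans hL. Qed.

Let kap : R := (L * (h.+1)`!)%:R.

Let kap1 : 1 <= kap.
Proof. by rewrite ler1n muln_gt0 L0 fact_gt0. Qed.

Let kap0 : 0 < kap. Proof. exact: lt_le_trans kap1. Qed.

Lemma mk_pos v i : (i < L)%N -> lsum L (fun P => mw P * (nth v P i == v)%:R) = (h.+1)`!%:R * edeg E x v.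
Proof.
move=> iL; pose a := minn i (L - h.+2); have LE : L = (a + (h.+2 + (L - h.+2 - a)))%N by move: hL iL; rewrite /a; clear; lia.
have ia : (i - a < h.+2)%N by move: hL iL; rewrite /a; clear; lia.
have ai : (a <= i)%N by rewrite geq_minl.
rewrite -(ew_pos Eu x v ia) {1}LE.
have := @mk_marg R T h E x x0 a h.+2 (L - h.+2 - a) (fun s => (nth v s (i - a) == v)%:R) (leqnSn _).
under [in RHS]eq_lsum => s ss do rewrite mk_edge //.
move=> <-; apply: eq_lsum => P _; by rewrite nth_take // nth_drop subnKC.
Qed.

Lemma sum_nth_eq v (P : seq T) : \sum_(i < size P) (nth v P i == v)%:R = (count_mem v P)%:R :> R.
Proof.
rewrite -natr_sum; congr (_%:R); rewrite -sum1_count (big_nth v) big_mkord [RHS]big_mkcond /=.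
by apply: eq_bigr => i _; case: eqP.
Qed.

Lemma mk_count v : lsum L (fun P => mw P * (count_mem v P)%:R) = kap * edeg E x v.
Proof.
transitivity (lsum L (fun P => \sum_(i < L) mw P * (nth v P i == v)%:R)).
  by apply: eq_lsum => P sP; rewrite -sum_nth_eq sP mulr_sumr.
rewrite lsum_sum; under eq_bigr => i _ do rewrite mk_pos //.
by rewrite sumr_const card_ord -[LHS]mulr_natl mulrA -natrM.
Qed.

(** Each of the [L] positions contributes [(h + 1)!] times the degree of a vertex in [x], so
    division by [kap] yields the degrees of [x], up to paths with repetitions. *)
Definition pw (P : L.-tuple T) : R := if uniq P then mw P / kap else 0.

Lemma pw_ge0 P : 0 <= pw P.
Proof. by rewrite /pw; case: ifP => // _; rewrite divr_ge0 ?(ltW kap0) //; exact: (@mk_ge0 R T h E x x0). Qed.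

Lemma pw_uniq (P : L.-tuple T) : ~~ uniq P -> pw P = 0.
Proof. by rewrite /pw => /negbTE ->. Qed.

Lemma pw_nz P : pw P != 0 -> uniq P && (mw P != 0).
Proof. by rewrite /pw; case: ifP => _; rewrite ?eqxx // mulf_eq0 negb_or => /andP[]. Qed.

Lemma pw_supp P : pw P != 0 -> inV V P && tight h.+2 E P.
Proof. by move=> /pw_nz/andP[_]; apply: mk_supp; rewrite size_tuple. Qed.

Lemma mk_le P : size P = L -> mw P <= B ^+ L / n ^+ L.-1.
Proof.
move=> sP; have p : 0 < n ^+ L.-1 by rewrite exprn_gt0 // n0.
rewrite ler_pdivlMr //; have := @mk_bounds P; rewrite sP => /(_ hL')[->|/andP[_ ->] //].
by rewrite mul0r exprn_ge0 // ltW // B0.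
Qed.

Lemma pw_bounds P : 0 < pw P -> (kap * B ^+ L)^-1 <= n ^+ L.-1 * pw P <= kap * B ^+ L.
Proof.
move=> p0; have /pw_nz/andP[uP nz] : pw P != 0 by rewrite gt_eqF.
have k0 := kap0; have k1 := kap1; have BL : 1 <= B ^+ L by rewrite exprn_ege1 // B1.
have BL0 : 0 < B ^+ L by apply: lt_le_trans BL.
have := @mk_bounds P; rewrite size_tuple => /(_ hL')[/eqP|]; first by rewrite (negbTE nz).
rewrite /pw uP (_ : n ^+ L.-1 * (mw P / kap) = mw P * n ^+ L.-1 / kap); last by ring.
move: (mw P * n ^+ L.-1) => q /andP[q1 q2]; apply/andP; split.
  by rewrite invfM mulrC ler_pM2r ?invr_gt0.
by rewrite ler_pdivrMr //; apply: (le_trans q2); rewrite mulrAC ler_peMl ?(ltW BL0) // -[X in X <= _]mulr1 ler_pM.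
Qed.

(** Among the tuples through [v], only a fraction [O(1 / n)] has a remainder with a repetition or
    containing [u], and no weight exceeds [B^L / n^(L - 1)]. Missing degrees and codegrees are both
    of this kind. *)
Lemma through_mass v u : #|[set P : L.-tuple T | [&& all (mem V) P, v \in P &
    ~~ (uniq (rem v P) && ~~ has (mem [set u]) (rem v P))]]%SET|%:R * (B ^+ L / n ^+ L.-1) <= L%:R ^+ 3 * B ^+ L / n.
Proof.
have n0' := n0; have p : 0 < n ^+ L.-1 by rewrite exprn_gt0.
have BL0 : 0 < B ^+ L by rewrite exprn_gt0 // B0.
have := @card_through T L V [set u] v L0; rewrite cards1 -mulnDr addn1 prednK //.
move: #|_| => q; rewrite -(ler_nat R) !natrM natrX -/n => hq.
have h1 : q%:R * n <= L%:R ^+ 3 * n ^+ L.-1.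
  apply: (le_trans hq); rewrite !exprS expr0 mulr1 !mulrA ler_wpM2r ?(ltW p) // ler_wpM2r //.
  by rewrite ler_wpM2l // ler_nat leq_pred.
rewrite ler_pdivlMr // (_ : q%:R * (B ^+ L / n ^+ L.-1) * n = (q%:R * n) * (B ^+ L / n ^+ L.-1)); last by ring.
rewrite (_ : L%:R ^+ 3 * B ^+ L = L%:R ^+ 3 * n ^+ L.-1 * (B ^+ L / n ^+ L.-1)); last by field; rewrite lt0r_neq0.
by rewrite ler_wpM2r // divr_ge0 // ltW.
Qed.

Lemma rem_bad v (P : seq T) : v \in P -> ~~ uniq P -> ~~ (uniq (rem v P) && ~~ has (mem [set v]) (rem v P)).
Proof.
move=> vP; rewrite (perm_uniq (perm_to_rem vP)) /= andbC; apply: contra => /andP[-> hv] /=.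
by apply: contra hv => vr; apply/hasP; exists v => //=; rewrite inE.
Qed.

Lemma pw_deg U v : wdeg pw U v <= edeg E x v.
Proof.
have k0 := kap0; rewrite -(ler_pM2l k0) -mk_count -lsumE /wdeg mulr_sumr [X in X <= _]big_mkcond.
apply: ler_sum => P _; have m0 : 0 <= mw P by exact: (@mk_ge0 R T h E x x0).
case: ifP => [/andP[_ vP]|_]; last by rewrite mulr_ge0.
rewrite /pw; case: ifP => uP; last by rewrite mulr0 mulr_ge0.
by rewrite mulrC divfK ?lt0r_neq0 // count_uniq_mem // vP mulr1.
Qed.

Lemma pw_deg_low v : edeg E x v - L%:R ^+ 4 * B ^+ L / n <= wdeg pw V v.
Proof.
have k0 := kap0; rewrite -(ler_pM2l k0) mulrBr -mk_count -lsumE lerBlDr.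
have n0' := n0; have q0 : 0 < B ^+ L / n ^+ L.-1 by rewrite divr_gt0 // exprn_gt0 // B0.
apply: (@le_trans _ _ (kap * wdeg pw V v + L%:R * (L%:R ^+ 3 * B ^+ L / n))); last first.
  rewrite lerD2l (_ : L%:R * (L%:R ^+ 3 * B ^+ L / n) = L%:R ^+ 4 * B ^+ L / n); last by ring.
  by rewrite ler_peMl // divr_ge0 ?mulr_ge0 ?exprn_ge0 ?(ltW n0') // ltW // B0.
have t := ler_wpM2l (ler0n R L) (through_mass v v).
apply: le_trans (lerD (lexx _) t).
rewrite mulrCA /wdeg mulr_sumr mulr_natl -sumr_const [X in _ <= X + _]big_mkcond [X in _ <= _ + X]big_mkcond -big_split /=.
apply: ler_sum => P _; have m0 : 0 <= mw P by exact: (@mk_ge0 R T h E x x0).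
rewrite !inE /inV.
have cL : (count_mem v P)%:R <= L%:R :> R by rewrite ler_nat -[X in (_ <= X)%N](size_tuple P) count_size.
case: (eqVneq (mw P) 0) => [z|nz].
  have pz : pw P = 0 by rewrite /pw z mul0r if_same.
  rewrite z mul0r pz mulr0 if_same add0r; case: ifP => // _; exact: mulr_ge0 (ler0n _ _) (ltW q0).
have /andP[PV _] : all (mem V) P && tight h.+2 E P by apply: mk_supp => //; rewrite size_tuple.
rewrite PV /=; case vP: (v \in P) => /=; last by rewrite (count_memPn _) ?vP // mulr0 addr0.
case uP: (uniq P).
  rewrite count_uniq_mem // vP mulr1 /pw uP mulrC divfK ?lt0r_neq0 // lerDl.
  by case: ifP => // _; exact: mulr_ge0 (ler0n _ _) (ltW q0).
rewrite rem_bad ?uP // /pw uP mulr0 add0r mulrC; apply: ler_pM => //; apply: mk_le; exact: size_tuple.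
Qed.

Lemma pw_cod U v u : v != u -> wcod pw U v u <= L%:R ^+ 3 * B ^+ L / n.
Proof.
move=> vu; have k0 := kap0; have k1 := kap1.
have n0' := n0; have q0 : 0 < B ^+ L / n ^+ L.-1 by rewrite divr_gt0 // exprn_gt0 // B0.
apply: le_trans (through_mass u v).
rewrite mulr_natl -sumr_const /wcod /wdeg [X in X <= _]big_mkcond [X in _ <= X]big_mkcond.
apply: ler_sum => P _; rewrite inE; case: ifP => [/andP[_ uP]|_]; last by case: ifP => // _; exact: ltW.
rewrite uP /=; case: (eqVneq (pw P) 0) => [->|nz]; first by rewrite mul0r; case: ifP => // _; exact: ltW.
case vP: (v \in P); last by rewrite mulr0; case: ifP => // _; exact: ltW.
have /andP[PV _] := pw_supp nz; rewrite [all _ _]PV /= mulr1.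
have -> : has (mem [set v]) (rem u P).
  apply/hasP; exists v; last by rewrite /= inE.
  by move: vP; rewrite (perm_mem (perm_to_rem uP)) inE (negbTE vu).
rewrite andbF /=; apply: le_trans (mk_le (size_tuple P)); have /andP[uqP _] := pw_nz nz; rewrite /pw uqP.
by rewrite ler_pdivrMr // ler_peMr //; exact: (@mk_ge0 R T h E x x0).
Qed.

Let A : R := lsum h.+1 (fun s => xsum s * ln (xsum s * n ^+ h)).
Let Bk : R := lsum h.+2 (fun s => xe s * ln (xe s * N)).

(** Chain rule: the first (k-1)-tuple contributes [A] and, by stationarity, each further vertex the
    conditional term [Bk - A]. *)
Lemma mk_entropy j : lsum (h.+1 + j) (fun P => mw P * ln (mw P * n ^+ (h + j))) = A + j%:R * (Bk - A).
Proof.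
have n0' := n0; elim: j => [|j IH].
  by rewrite mul0r addr0 !addn0; apply: eq_lsum => s ss; rewrite mk_base.
rewrite -natr1 mulrDl mul1r addrA -IH addnS -/(addn h.+1 j) lsumS -lsum_sum.
have hj (s : seq T) : size s = (h.+1 + j)%N -> (h < size s)%N by move=> ->; rewrite leq_addr.
pose f (s : seq T) := ln (xe s * N) - ln (xsum (behead s) * n ^+ h).
have -> : Bk - A = lsum (h.+1 + j).+1 (fun P => mw P * f (take h.+2 (drop 0 P))).
  have -> : (h.+1 + j).+1 = (0 + (h.+2 + j))%N by [].
  rewrite (mk_marg x0) //.
  rewrite (eq_lsum (h := fun s => xe s * ln (xe s * N) - xe s * ln (xsum (behead s) * n ^+ h))); last first.
    by move=> s ss; rewrite mk_edge // /f mulrBr.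
  rewrite lsumB; congr (_ - _); rewrite lsumS -lsum_sum; apply: eq_lsum => s ss /=.
  by rewrite -mulr_suml.
rewrite lsumS -lsum_sum -lsumD; apply: eq_lsum => s ss; have hs := hj s ss.
rewrite -[X in _ = X * _ + _](mk_sum_cons x0 hs) mulr_suml -big_split /=; apply: eq_bigr => u _.
case: (eqVneq (mw (u :: s)) 0) => [->|nz]; first by rewrite !mul0r addr0.
have mp (t : seq T) : mw t != 0 -> 0 < mw t by rewrite lt0r => ->; exact: (@mk_ge0 R T h E x x0).
rewrite -mulrDr; congr (_ * _); rewrite /f /=.
move: (nz); rewrite mk_cons // mulf_eq0 negb_or mulf_eq0 negb_or invr_eq0 => /andP[/andP[xz sz] mz].
have xep : 0 < xe (u :: take h.+1 s) by rewrite lt0r xz; exact: (@xe_ge0 R T E x x0).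
have xsp : 0 < xsum (take h.+1 s) by rewrite lt0r sz; exact: (@xs_ge0 R T E x x0).
have msp := mp s mz; have nh i : 0 < n ^+ i by rewrite exprn_gt0.
rewrite -lnV ?posrE ?mulr_gt0 // -[X in _ + X]lnM ?posrE ?mulr_gt0 ?invr_gt0 ?mulr_gt0 //.
rewrite -lnM ?posrE ?divr_gt0 ?mulr_gt0 //; congr (ln _).
rewrite /N addnS !exprS; move: (nh h) (nh (h + j)%N); move: (n ^+ h) (n ^+ (h + j)) => p q p0 q0.
by field; rewrite !lt0r_neq0.
Qed.

Lemma Bk_phi : Bk = - ((h.+2)`!%:R * \sum_(e in E) phi N (x e)).
Proof.
rewrite -mulrN -sumrN -(ew_total Eu (fun e => - phi N (x e))); apply: eq_lsum => s _.
by rewrite /ew /phi; case: ifP => _; rewrite ?opprK ?mul0r.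
Qed.

Lemma edeg_out v : v \notin V -> edeg E x v = 0.
Proof.
by move=> vV; rewrite /edeg big1 // => e /andP[eE ve]; case/negP: vV; exact: (fintype.subsetP (EV eE)).
Qed.

Lemma lsum_xs : lsum h.+1 xsum = (h.+1)`!%:R * \sum_(v in V) edeg E x v.
Proof.
rewrite /xs lsum_sum; under eq_bigr do rewrite (ew_star Eu).
rewrite -mulr_sumr; congr (_ * _); rewrite [RHS]big_mkcond; apply: eq_bigr => v _.
by case: ifPn => // /edeg_out.
Qed.

(** At most [n^(h + 1)] tuples carry weight, so the uniform distribution bounds their entropy; this
    is [log_sum] against the constant weight [n^- h]. *)
Lemma A_low : 0 < lsum h.+1 xsum -> lsum h.+1 xsum * ln (lsum h.+1 xsum / n) <= A.
Proof.
move=> S0; have n0' := n0; have nh : 0 < n ^+ h by rewrite exprn_gt0.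
pose I := fun t : h.+1.-tuple T => xsum t != 0.
have restr (g : seq T -> R) : (forall t, xsum t = 0 -> g t = 0) -> lsum h.+1 g = \sum_(t | I t) g t.
  by move=> g0; rewrite -lsumE [RHS]big_mkcond; apply: eq_bigr => t _; rewrite /I; case: eqP => // /g0.
have S0' := S0; rewrite restr // in S0'.
have xp t : I t -> 0 < xsum t by rewrite /I lt0r => ->; exact: (@xs_ge0 R T E x x0).
have inh : 0 < n ^- h by rewrite invr_gt0.
have H := @log_sum R _ I (fun t => xsum t) (fun=> n ^- h) xp (fun t _ => inh) S0'.
rewrite -(restr xsum) // in H.
have AE : A = - \sum_(t | I t) xsum t * ln (n ^- h / xsum t).
  rewrite /A restr; last by move=> t ->; rewrite mul0r.
  rewrite -sumrN; apply: eq_bigr => t It; have p := xp t It.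
  by rewrite -mulrN -lnV ?posrE ?divr_gt0 ?invr_gt0 // invf_div invrK.
rewrite AE lerNr; apply: (le_trans H); rewrite -mulrN -lnV ?posrE ?divr_gt0 // invf_div.
apply: ler_wpM2l; first exact: ltW.
set Sg := \sum_(t | I t) n ^- h.
have Sg0 : 0 < Sg.
  rewrite -(pmulr_rgt0 _ D0); apply: (lt_le_trans S0'); rewrite mulr_sumr; apply: ler_sum => t It.
  apply: (le_trans (xs_up (size_tuple t))); rewrite /N exprS le_eqVlt; apply/orP; left; apply/eqP.
  by field; rewrite !lt0r_neq0.
have Sgn : Sg <= n.
  have cI : (#|I| <= #|V| ^ h.+1)%N.
    rewrite -(card_tuples_in V h.+1) -(cardsE I); apply: subset_leq_card; apply/fintype.subsetP => t.
    by rewrite !inE => /(xs_nz (size_tuple t))/andP[_ ->].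
  rewrite /Sg sumr_const -[X in X <= _]mulr_natl ler_pdivrMr // -exprS -natrX ler_nat.
  exact: cI.
by rewrite ler_ln ?posrE ?divr_gt0 // ler_pM2r // invr_gt0.
Qed.

(** Tuples with repetitions are few, each of weight at most [B^L / n^(L - 1)] and with logarithm at
    least [- L ln B]; division by [kap >= 1] only lowers the logarithms. *)
Lemma pw_entropy : \sum_(P | inV V P) pw P * ln (n ^+ L.-1 * pw P) <=
  (lsum L (fun P => mw P * ln (mw P * n ^+ L.-1)) + L%:R ^+ 3 * B ^+ L * ln B) / kap.
Proof.
have n0' := n0; have p : 0 < n ^+ L.-1 by rewrite exprn_gt0.
have BL0 : 0 < B ^+ L by rewrite exprn_gt0 // B0.
have k0 := kap0; have k1 := kap1.
have q0 : 0 < B ^+ L / n ^+ L.-1 by rewrite divr_gt0.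
have lB : 0 <= ln B by rewrite ln_ge0 // B1.
pose S0 := [set P : L.-tuple T | all (mem V) P && ~~ (uniq P && ~~ has (mem set0) P)]%SET.
have cS0 : #|S0|%:R * (B ^+ L / n ^+ L.-1 * (L%:R * ln B)) <= L%:R ^+ 3 * B ^+ L * ln B.
  have := @card_bad_tuples T V set0 L; rewrite cards0 muln0 addn0 -(ler_nat R) !natrM natrX -/n => hq.
  have LE : n ^+ L = n ^+ L.-1 * n by rewrite -exprSr prednK.
  have h1 : #|S0|%:R <= L%:R ^+ 2 * n ^+ L.-1.
    by rewrite -(ler_pM2r n0') -mulrA -LE expr2.
  apply: (le_trans (ler_wpM2r _ h1)); first by apply: mulr_ge0; [exact: ltW|exact: mulr_ge0].
  by rewrite le_eqVlt; apply/orP; left; apply/eqP; field; rewrite lt0r_neq0.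
rewrite ler_pdivlMr // -lsumE; apply: le_trans (lerD (lexx _) cS0).
rewrite mulr_suml mulr_natl -sumr_const [X in X <= _]big_mkcond [X in _ <= _ + X]big_mkcond -big_split /=.
apply: ler_sum => P _; have m0 : 0 <= mw P by exact: (@mk_ge0 R T h E x x0).
have r0 : 0 <= B ^+ L / n ^+ L.-1 * (L%:R * ln B) by apply: mulr_ge0; [exact: ltW|exact: mulr_ge0].
case: (eqVneq (mw P) 0) => [z|nz].
  have pz : pw P = 0 by rewrite /pw z mul0r if_same.
  by rewrite z !mul0r pz !mul0r if_same add0r; case: ifP.
have /andP[PV _] : all (mem V) P && tight h.+2 E P by apply: mk_supp => //; rewrite size_tuple.
have mp : 0 < mw P by rewrite lt0r nz.
rewrite !inE /inV PV /=; have -> : has (mem set0) P = false by apply/hasP => -[w _]; rewrite /= inE.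
rewrite andbT /pw; case uP: (uniq P) => /=.
  rewrite addr0 (_ : n ^+ L.-1 * (mw P / kap) = mw P * n ^+ L.-1 / kap); last by ring.
  rewrite mulrAC divfK ?lt0r_neq0 //; apply: ler_wpM2l => //.
  rewrite ler_ln ?posrE ?divr_gt0 ?mulr_gt0 // ler_pdivrMr // ler_peMr // ltW // mulr_gt0 //.
rewrite !mul0r -lerBlDr sub0r -mulrN.
have := @mk_bounds P; rewrite size_tuple => /(_ hL')[/eqP|/andP[l1 _]]; first by rewrite (negbTE nz).
apply: (@le_trans _ _ (mw P * - (L%:R * ln B))).
  by rewrite !mulrN lerN2; apply: ler_wpM2r; [exact: mulr_ge0|apply: mk_le; exact: size_tuple].
apply: ler_wpM2l => //; rewrite [X in - X]mulr_natl -lnXn ?B0 // -lnV ?posrE //.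
by rewrite ler_ln ?posrE ?invr_gt0 ?mulr_gt0.
Qed.

End MarkovBounds.

Section PathWeights.

Variable R : realType.

(** The entropy rate is collected on [L - (k - 1)] of the [L] vertices only, so [L] has to be large
    in terms of [e3]. *)
Lemma path_weights (k : nat) (e3 : R) : (1 < k)%N -> 0 < e3 -> exists L0 : nat, forall L, (L0 <= L)%N ->
  (k < L)%N /\
  forall c D : R, 0 < c <= 1 -> 1 <= D -> exists B1 k1 al C5 : R,
  [/\ 1 <= B1, 0 <= k1, 0 < al <= 1 & 0 <= C5] /\ exists n0 : nat,
  forall (T : finType) (E : {set {set T}}) (V : {set T}) (x : {set T} -> R),
  let n := #|V|%:R : R in let N := n ^+ k.-1 in
  {in E, forall e : {set T}, #|e| = k} -> {in E, forall e : {set T}, e \subset V} -> (n0 <= #|V|)%N ->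
  {in E, forall e, c / N <= x e <= D / N} ->
  (forall S : {set T}, S \subset V -> #|S| = k.-1 -> n / 2 <= #|[set v in V | v |: S \in E]%SET|%:R) ->
  \sum_(v in V) (edeg E x v - 1) ^+ 2 <= al ->
  exists w : L.-tuple T -> R,
  [/\ forall P, 0 <= w P, forall P : L.-tuple T, ~~ uniq P -> w P = 0,
      forall P, 0 < w P -> inV V P && tight k E P,
      forall P, 0 < w P -> B1^-1 <= n ^+ L.-1 * w P <= B1 & forall U v, wdeg w U v <= 2] /\
  [/\ forall U v u, v != u -> wcod w U v u <= k1 / n,
      \sum_(v in V) (wdeg w V v - 1) ^+ 2 <= C5 &
      \sum_(P | inV V P) w P * ln (n ^+ L.-1 * w P) <=
        - (k%:R * \sum_(e in E) phi N (x e)) - n * ln (k.-1)`!%:R + e3 * n].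
Proof.
case: k => [|[|h]] // _ e30 /=.
pose f : R := ln (h.+1)`!%:R.
have f0 : 0 <= f by apply: ln_ge0; rewrite ler1n fact_gt0.
pose kr : R := h.+2%:R.
have kr0 : 0 < kr by rewrite ltr0n.
pose C0 := kr ^+ 2 + kr * f.
have C00 : 0 <= C0 by rewrite addr_ge0 ?exprn_ge0 ?mulr_ge0 // ltW.
exists (maxn h.+3 (Num.bound (3 * C0 / e3))) => L; rewrite geq_max => /andP[hL Lb]; split=> //.
have Lr0 : 0 < L%:R :> R by rewrite ltr0n (leq_trans _ hL).
have LC : C0 / L%:R <= e3 / 3.
  rewrite ler_pdivrMr //.
  have : 3 * C0 / e3 <= L%:R.
    apply: ltW; apply: (lt_le_trans (archi_boundP _)); last by rewrite ler_nat.
    by rewrite divr_ge0 ?mulr_ge0 // ltW.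
  by rewrite ler_pdivrMr //; clear; lra.
move=> c D c01 D1; have /andP[c0 c1] := c01.
have hL' : (h.+1 < L)%N by exact: ltnW.
pose B : R := 2 * D / c.
have B1 : 1 <= B by rewrite /B ler_pdivlMr // mul1r; move: c1 D1; clear; lra.
have B0 : 0 < B by apply: lt_le_trans B1.
have BL1 : 1 <= B ^+ L by rewrite exprn_ege1.
pose kap : R := (L * (h.+1)`!)%:R.
have kap1 : 1 <= kap by rewrite ler1n muln_gt0 fact_gt0 (leq_trans _ hL).
have kap0 : 0 < kap by apply: lt_le_trans kap1.
pose C4 := L%:R ^+ 4 * B ^+ L.
pose C6 := L%:R ^+ 3 * B ^+ L * ln B.
have C40 : 0 <= C4 by rewrite mulr_ge0 ?exprn_ge0 // ltW.
have C60 : 0 <= C6 by rewrite !mulr_ge0 ?exprn_ge0 ?ln_ge0 // ltW.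
pose de := Order.min (1 / 2) (e3 / (3 * (f + 1))).
have f1 : 0 < f + 1 by move: f0; clear; lra.
have de0 : 0 < de by rewrite lt_min !divr_gt0 // mulr_gt0.
have de1 : de <= 1 / 2 by rewrite ge_min lexx.
have de2 : de * (f + 1) <= e3 / 3.
  rewrite -ler_pdivlMr // (_ : e3 / 3 / (f + 1) = e3 / (3 * (f + 1))) ?ge_min ?lexx ?orbT //.
  by field; rewrite lt0r_neq0.
have dsq : de ^+ 2 <= 1 by rewrite exprn_ile1 ?(ltW de0) //; move: de1; clear; lra.
exists (kap * B ^+ L), (L%:R ^+ 3 * B ^+ L), (de ^+ 2), (2 + 2 * C4 ^+ 2); split.
  split; [|by rewrite mulr_ge0 ?exprn_ge0 // ltW|by rewrite exprn_gt0|].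
    by rewrite -[X in X <= _]mulr1 ler_pM.
  by rewrite addr_ge0 // mulr_ge0 ?exprn_ge0.
exists (Num.bound (3 * C6 / e3)).+1 => T E V x; pose n : R := #|V|%:R; pose N : R := n ^+ h.+1; rewrite -/n -/N => Eu EV nb xb cod hal.
have V0 : (0 < #|V|)%N by exact: leq_trans nb.
have n0 : 0 < n by rewrite ltr0n.
have n1 : 1 <= n by rewrite ler1n.
have nC6 : C6 <= e3 / 3 * n.
  have : 3 * C6 / e3 <= n.
    apply: ltW; apply: (lt_le_trans (archi_boundP _)); last by rewrite ler_nat ltnW.
    by apply: divr_ge0; [exact: mulr_ge0|exact: ltW].
  by rewrite ler_pdivrMr //; clear; lra.
pose w := @pw R T h E x L.
have deg2 v : edeg E x v <= 2.
  case: (boolP (v \in V)) => vV; last by rewrite (edeg_out x EV vV).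
  have h1 : (edeg E x v - 1) ^+ 2 <= 1.
    apply: le_trans dsq; apply: le_trans hal; rewrite (bigD1 v) //= lerDl.
    by apply: sumr_ge0 => u _; exact: sqr_ge0.
  have := sqr_ge0 (edeg E x v - 1 - 1); move: h1; rewrite !expr2; clear; lra.
exists w; split; first split.
- exact: (pw_ge0 V0 c01 xb hL').
- exact: pw_uniq.
- move=> P p0; have nz : w P != 0 by rewrite gt_eqF.
  exact: (pw_supp Eu EV hL' nz).
- exact: (pw_bounds Eu EV V0 c01 D1 xb cod hL').
- by move=> U v; apply: le_trans (deg2 v); exact: (pw_deg Eu V0 c01 xb hL').
split.
- exact: (pw_cod Eu EV V0 c01 D1 xb cod hL').
- apply: (@le_trans _ _ (\sum_(v in V) (2 * (edeg E x v - 1) ^+ 2 + 2 * C4 ^+ 2 / n))).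
    apply: ler_sum => v _.
    have u1 := pw_deg Eu V0 c01 xb hL' V v; have u2 := pw_deg_low Eu EV V0 c01 D1 xb cod hL' v.
    rewrite -/w -/B -/C4 -/n in u1 u2; move: (wdeg w V v) (edeg E x v) u1 u2 => a b u1 u2.
    have q0 : 0 <= C4 / n by rewrite divr_ge0 // ltW.
    have q2 : (C4 / n) ^+ 2 <= C4 ^+ 2 / n.
      rewrite exprMn exprVn ler_wpM2l ?exprn_ge0 // lef_pV2 ?posrE ?exprn_gt0 // expr2.
      by rewrite ler_peMr // ltW.
    have h1 : (b - a) ^+ 2 <= (C4 / n) ^+ 2.
      by rewrite lerXn2r ?nnegrE // ?subr_ge0 //; move: u2; clear; lra.
    have h2 := sqr_ge0 ((b - 1) + (b - a)).
    have h3 : (a - 1) ^+ 2 + ((b - 1) + (b - a)) ^+ 2 = 2 * (b - 1) ^+ 2 + 2 * (b - a) ^+ 2 by ring.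
    move: h1 h2 h3 q2; clear; lra.
  rewrite big_split /= -mulr_sumr sumr_const -[X in _ + X <= _]mulr_natl -/n.
  rewrite (_ : n * (2 * C4 ^+ 2 / n) = 2 * C4 ^+ 2); last by field; rewrite lt0r_neq0.
  by rewrite lerD2r; move: hal dsq; clear; lra.
have ent := pw_entropy Eu EV V0 c01 D1 xb cod hL'; rewrite -/n -/w -/B -/kap -/C6 in ent.
apply: (le_trans ent); rewrite ler_pdivrMr //.
pose j := (L - h.+1)%N.
have LE : L = (h.+1 + j)%N by rewrite /j subnKC // ltnW.
have LpE : L.-1 = (h + j)%N by rewrite LE.
have mE := mk_entropy V0 c01 xb j.
rewrite -/n -/N in mE; rewrite LpE {1}LE mE.
have BkE := (@Bk_phi R T h E V x Eu); rewrite -/n -/N in BkE; rewrite BkE.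
have SE := lsum_xs x Eu EV.
set S := lsum h.+1 (xs E x) in SE; set t := \sum_(v in V) edeg E x v in SE.
set Ph := \sum_(e in E) phi N (x e).
have fc0 : 0 < (h.+1)`!%:R :> R by rewrite ltr0n fact_gt0.
have t1 : n - de * n <= t.
  have -> : n - de * n = \sum_(v in V) (1 - de) by rewrite sumr_const -[RHS]mulr_natl -/n; ring.
  have h1 : \sum_(v in V) (1 - de) <= \sum_(v in V) (edeg E x v + ((edeg E x v - 1) ^+ 2 / (2 * de) - de / 2)).
    apply: ler_sum => v _; move: (edeg E x v) => b.
    have -> : b + ((b - 1) ^+ 2 / (2 * de) - de / 2) = 1 - de + ((b - 1 + de) ^+ 2) / (2 * de).
      by field; rewrite lt0r_neq0.
    by rewrite lerDl divr_ge0 ?sqr_ge0 // mulr_ge0 // ltW.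
  apply: (le_trans h1); rewrite big_split /= -/t gerDl sumrB -mulr_suml sumr_const -[X in _ - X]mulr_natl -/n subr_le0.
  rewrite ler_pdivrMr ?mulr_gt0 //; apply: (le_trans hal).
  have -> : n * (de / 2) * (2 * de) = n * de ^+ 2 by field.
  by rewrite ler_peMl // sqr_ge0.
have t0 : 0 < t.
  have : de * n <= 1 / 2 * n by rewrite ler_pM2r.
  by move: t1 n0; clear; lra.
have S0 : 0 < S by rewrite SE mulr_gt0.
have Alow := A_low Eu EV V0 c01 D1 xb S0; rewrite -/n in Alow.
set A := lsum h.+1 (fun s => xs E x s * ln _) in Alow *.
rewrite -/S in Alow.
have A1 : (h.+1)`!%:R * (n * f - de * n * (f + 1)) <= A.
  apply: le_trans Alow; rewrite SE (_ : (h.+1)`!%:R * t / n = (h.+1)`!%:R * (t / n)); last by ring.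
  rewrite -[X in _ <= X]mulrA ler_pM2l //.
  rewrite lnM ?posrE ?divr_gt0 // -/f mulrDr.
  have h1 : t - n <= t * ln (t / n).
    have q0 : 0 < n / t by rewrite divr_gt0.
    have := ler_wpM2l (ltW t0) (ln_le_sub1 q0).
    rewrite -[ln (n / t)]opprK -lnV ?posrE // invf_div mulrN.
    rewrite (_ : t * (n / t - 1) = n - t); last by field; rewrite lt0r_neq0.
    clear; lra.
  have h2 := ler_wpM2r f0 t1; move: t1 h1 h2; clear; lra.
have Ph1 : Ph <= n.
  apply: (@le_trans _ _ (#|E|%:R * N^-1)).
    apply: sum_le_card => e eE; apply: phi_le; first by rewrite exprn_gt0.
    have /andP[+ _] := xb e eE; apply: le_trans; rewrite divr_ge0 ?exprn_ge0 ?(ltW c0) // ltW //.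
  by rewrite ler_pdivrMr ?exprn_gt0 // -exprS -natrX ler_nat; exact: card_edges_le.
have kapE : kap = L%:R * (h.+1)`!%:R by rewrite -natrM.
have fE : (h.+2)`!%:R = kr * (h.+1)`!%:R :> R by rewrite factS natrM.
have jL : L%:R = kr - 1 + j%:R by rewrite LE natrD /kr -(natr1 h.+1) addrK.
have j1 : 1 <= j%:R :> R by rewrite ler1n /j subn_gt0.
rewrite fE kapE -/kr -/f.
set fc := (h.+1)`!%:R in fc0 A1 *.
pose a' := n * f - de * n * (f + 1).
have hA : (j%:R - 1) * (fc * a') <= (j%:R - 1) * A by rewrite ler_wpM2l // subr_ge0.
have a'n : a' <= n * f.
  have : 0 <= de * n * (f + 1) by rewrite !mulr_ge0 //; exact: ltW.
  by rewrite /a'; clear; lra.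
have LC' : kr ^+ 2 + kr * f <= e3 / 3 * L%:R by rewrite -ler_pdivrMr.
have kr1 : 1 <= kr by rewrite ler1n.
have g1 : (kr - 1) * (kr * Ph) <= kr ^+ 2 * n.
  apply: (@le_trans _ _ ((kr - 1) * (kr * n))); first by rewrite ler_wpM2l ?subr_ge0 // ler_wpM2l // ltW.
  have : 0 <= kr * n by rewrite mulr_ge0 // ltW.
  by rewrite expr2; clear; lra.
have g2 : kr * a' <= kr * (n * f) by rewrite ler_wpM2l // ltW.
have g3 : L%:R * (de * (f + 1) * n) <= L%:R * (e3 / 3 * n) by rewrite ler_pM2l // ler_pM2r.
have g4 : (kr ^+ 2 + kr * f) * n <= e3 / 3 * L%:R * n by rewrite ler_pM2r.
have main : L%:R * (kr * Ph) + L%:R * (n * f) - L%:R * (e3 * n) + L%:R * (e3 / 3 * n) <= j%:R * (kr * Ph) + (j%:R - 1) * a'.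
  move: g1 g2 g3 g4; rewrite jL /a'; clear; lra.
have main' := ler_wpM2r (ltW fc0) main.
have C6' : C6 <= L%:R * (e3 / 3 * n) * fc.
  apply: (le_trans nC6); rewrite -[X in X <= _]mul1r -[X in X <= _]mulr1.
  have en : 0 <= e3 / 3 * n by rewrite mulr_ge0 ?divr_ge0 // ltW.
  apply: ler_pM => //; [by rewrite mul1r|rewrite ler_wpM2r // ler1n (leq_trans _ hL) //|by rewrite ler1n fact_gt0].
move: main' C6' hA; clear; lra.
Qed.

End PathWeights.

(** * Assembling tight Hamilton cycles *)

Section Assembly.

Local Open Scope nat_scope.

Variables (T : finType) (k : nat) (E : {set {set T}}).
Hypothesis k1 : 1 < k.
Implicit Types (s x y X Y a e t : seq T).

Definition ends s := drop (size s - k.-1) s.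

Lemma ends_cat x y : k.-1 <= size y -> ends (x ++ y) = ends y.
Proof.
move=> h; rewrite /ends drop_cat size_cat ltnNge (_ : size x <= size x + size y - k.-1) /=; last by lia.
by congr (drop _ _); lia.
Qed.

Lemma ends_split a : exists b, a = b ++ ends a.
Proof. by exists (take (size a - k.-1) a); rewrite cat_take_drop. Qed.

Lemma size_ends a : k.-1 <= size a -> size (ends a) = k.-1.
Proof. by move=> h; rewrite size_drop subKn. Qed.

(** Position [l + (k - 1)] lies between the two (k-1)-tuples of a block. *)
Definition ins l t (o : option T) : seq T :=
  if o is Some v then take (l + k.-1) t ++ v :: drop (l + k.-1) t else t.

Lemma size_ins l t o : size (ins l t o) = size t + isSome o.
Proof.
case: o => [v|] /=; last by rewrite addn0.
by rewrite size_cat /= addnS -size_cat cat_take_drop addn1.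
Qed.

Lemma mem_ins l t o (x : T) : (x \in ins l t o) = (x \in t) || (o == Some x).
Proof.
case: o => [v|] /=; last by rewrite orbF.
rewrite mem_cat inE -{3}(cat_take_drop (l + k.-1) t) mem_cat orbCA orbC; congr (_ || _).
by rewrite eq_sym.
Qed.

(** The second (k-1)-tuple is untouched, so a connector attached to it still fits after the
    insertion. *)
Lemma ends_ins l t o : size t = l + 2 * k.-1 -> ends (ins l t o) = ends t.
Proof.
case: o => [v|] //= st.
have sd : k.-1 <= size (drop (l + k.-1) t) by rewrite size_drop st; lia.
by rewrite -cat_rcons ends_cat // -[in RHS](cat_take_drop (l + k.-1) t) ends_cat.
Qed.

Lemma ins_inj l t t' o o' : size t = size t' -> isSome o = isSome o' -> ins l t o = ins l t' o' -> t = t' /\ o = o'.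
Proof.
case: o o' => [v|] [v'|] //= st _ h; have sz : size (take (l + k.-1) t) = size (take (l + k.-1) t').
  by rewrite !size_take st.
move/eqP: h; rewrite eqseq_cat // => /andP[/eqP h1 /eqP [-> h2]].
by rewrite -(cat_take_drop (l + k.-1) t) h1 h2 cat_take_drop.
Qed.

Lemma tight_ins l X t Y o : size t = l + 2 * k.-1 -> (forall v, o = Some v -> absorbs k E l v t) ->
  tight k E (X ++ t ++ Y) -> tight k E (X ++ ins l t o ++ Y).
Proof.
case: o => [v|] // st /(_ v erefl); rewrite /absorbs /= => ab h.
have d2 : drop k.-1 (drop l t) = drop (l + k.-1) t by rewrite drop_drop addnC.
rewrite d2 in ab.
have tE : take (l + k.-1) t = take l t ++ take k.-1 (drop l t) by rewrite takeD.
set u1 := take k.-1 (drop l t) in ab tE; set u2 := drop (l + k.-1) t in ab *.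
have su1 : size u1 = k.-1 by rewrite size_takel // size_drop st; lia.
have su2 : size u2 = k.-1 by rewrite size_drop st; lia.
have tt : t = take l t ++ u1 ++ u2 by rewrite catA -tE cat_take_drop.
rewrite tE -!catA; rewrite {1}tt -!catA in h.
have h1 : tight k E ((X ++ take l t) ++ u1) by apply: (@tight_catl _ _ _ _ (u2 ++ Y)); rewrite -!catA.
have h2 : tight k E (u2 ++ Y) by apply: (@tight_catr _ _ _ (X ++ take l t ++ u1)); rewrite -!catA.
have h3 : tight k E ((X ++ take l t) ++ u1 ++ v :: u2) by apply: tight_glue ab; rewrite ?su1.
have := @tight_glue T k E (X ++ take l t ++ u1 ++ [:: v]) u2 Y; rewrite -!catA /=; apply => //.
- by rewrite su2.
- by rewrite -!catA in h3.
Qed.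

Lemma tight_ins_all l (bs : seq (seq T)) (g : seq (option T)) X : size g = size bs ->
  all (fun t => size t == l + 2 * k.-1) bs ->
  (forall i v, i < size bs -> nth None g i = Some v -> absorbs k E l v (nth [::] bs i)) ->
  tight k E (X ++ flatten bs) -> tight k E (X ++ flatten [seq ins l p.1 p.2 | p <- zip bs g]).
Proof.
elim: bs g X => [|t bs IH] [|o g] X //= [sg] /andP[/eqP st sb] ab h.
rewrite catA; apply: IH => //; first by move=> i v hi; exact: (ab i.+1 v hi).
rewrite -catA; apply: tight_ins => // v ov; exact: (ab 0 v).
Qed.

Fixpoint interl (qs ps : seq (seq T)) : seq (seq T) :=
  if qs is q :: qs' then q :: (if ps is p :: ps' then p :: interl qs' ps' else [::]) else [::].

(** A connector needs only the last [k - 1] vertices before it and the first [k - 1] after it. *)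
Lemma tight_chain X a e (ps qs : seq (seq T)) : k.-1 <= size a -> tight k E (X ++ a) ->
  all (fun p => (k.-1 <= size p) && tight k E p) ps -> size qs = (size ps).+1 ->
  (forall i, i < size qs -> tight k E (ends (nth [::] (a :: ps) i) ++ nth [::] qs i ++
      nth [::] (rcons [seq take k.-1 p | p <- ps] e) i)) ->
  tight k E (X ++ a ++ flatten (interl qs ps) ++ e).
Proof.
elim: ps qs X a => [|p ps IH] [|q qs] X a //= sa ta.
  move=> _ [sq]; rewrite (size0nil sq) => /(_ 0 isT) /= h; rewrite cats0.
  have [b ab] := ends_split a; rewrite [in X ++ a]ab in ta *; rewrite {1}ab -!catA.
  by rewrite catA; apply: tight_glue => //; [rewrite size_ends|rewrite -catA].
move=> /andP[/andP[sp tp] tps] [sq] links.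
have h0 := links 0 isT; rewrite /= in h0.
have [b ab] := ends_split a.
have t1 : tight k E ((X ++ a ++ q) ++ take k.-1 p).
  have := @tight_glue T k E (X ++ b) (ends a) (q ++ take k.-1 p); rewrite size_ends // -!catA.
  by rewrite [b ++ ends a ++ _]catA -ab; apply=> //.
have t2 : tight k E ((X ++ a ++ q) ++ p).
  rewrite -(cat_take_drop k.-1 p); apply: tight_glue => //; first by rewrite size_takel.
  by rewrite cat_take_drop.
have := IH qs (X ++ a ++ q) p sp t2 tps sq; rewrite -!catA => -> //.
by move=> i hi; have := links i.+1 hi.
Qed.

(** A window that wraps around reaches at most [k - 1] vertices past the end, and these belong to
    [e]. *)
Lemma tight_cyclic e s : size e = k.-1 -> k <= size (e ++ s) -> tight k E (e ++ s ++ e) ->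
  forall i, i < size (e ++ s) -> [set v in take k (rot i (e ++ s))]%SET \in E.
Proof.
move=> se; rewrite catA; set w := e ++ s => kw tw i iw.
have k0 : 0 < k by lia.
have sE : i + k <= size (w ++ e) by rewrite size_cat se; lia.
have := tight_window k0 tw sE; rewrite drop_cat iw; suff -> : take k (drop i w ++ e) = take k (rot i w) by [].
rewrite /rot [LHS]take_cat [RHS]take_cat size_drop; case: ltnP => // hd; congr (_ ++ _).
have h1 : k - (size w - i) <= i by move: kw iw hd; clear; lia.
rewrite take_takel // /w take_cat se; case: ltnP => // h2.
rewrite -/w in h2 *; have -> : k - (size w - i) = k.-1 by move: h2 iw k0; clear; lia.
by rewrite subnn take0 cats0 take_oversize // se.
Qed.

End Assembly.

Lemma addn_reorder a b c d x : (a + (b + x + (c + d)) = a + b + c + d + x)%N.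
Proof. by lia. Qed.

(** * From data to a cyclic order *)

Section Data.

Local Open Scope nat_scope.

Variables (T : finType) (k : nat) (E : {set {set T}}) (e0 : seq T) (l M m L q r : nat).
Hypothesis k1 : 1 < k.
Hypothesis se0 : size e0 = k.-1.
Hypothesis M0 : 0 < M.
Hypothesis hL : k <= L.
Hypothesis total : k.-1 + M * (l + 2 * k.-1) + m * L + m.+1 * q + r = #|T|.

Notation blocks := (M.-tuple ((l + 2 * k.-1).-tuple T)).
Notation paths := (m.-tuple (L.-tuple T)).
Notation conns := (seq (q.-tuple T)).
Implicit Types (bs : blocks) (Ps : paths) (Qs : conns) (io : seq 'I_M).

(** Connector [0] starts at the last block and connector [m] leads back to [e0], which closes the
    cycle. *)
Definition vsrc bs Ps i := ends k (nth [::] (last [::] (map val bs) :: map val Ps) i).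
Definition vtgt Ps i := nth [::] (rcons [seq take k.-1 p | p <- map val Ps] e0) i.

Definition okB bs := uniq (e0 ++ flat bs) && tight k E (e0 ++ flat bs).
Definition okP bs Ps := [&& uniq (flat Ps), ~~ has (mem (e0 ++ flat bs)) (flat Ps) & all (fun p => tight k E (val p)) Ps].
Definition okQ bs Ps Qs := [&& uniq (flat Qs), ~~ has (mem (e0 ++ flat bs ++ flat Ps)) (flat Qs) &
  all (fun i => tight k E (vsrc bs Ps i ++ nth [::] (map val Qs) i ++ vtgt Ps i)) (iota 0 (size Qs))].
Definition rest bs Ps Qs := enum (~: [set x in e0 ++ flat bs ++ flat Ps ++ flat Qs]%SET).
Definition okI bs (vs : seq T) io := uniq io && all (fun p : 'I_M * T => absorbs k E l p.2 (tnth bs p.1)) (zip io vs).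

(** For a block outside [io], [index] returns [size io], which equals [size vs] for valid data, and
    [onth] gives [None]. *)
Definition spots (vs : seq T) io : seq (option T) := [seq onth vs (index j io) | j <- enum 'I_M].
(* A vertex of the leftover is inserted into the block whose index [io] assigns to
   it. *)
Definition order_of bs Ps Qs io : seq T :=
  e0 ++ flatten [seq ins k l p.1 p.2 | p <- zip (map val bs) (spots (rest bs Ps Qs) io)] ++
  flatten (interl (map val Qs) (map val Ps)).

Lemma spots_nth w o (i : 'I_M) : nth None (spots w o) i = onth w (index i o).
Proof. by rewrite (nth_map i) ?size_enum_ord // nth_ord_enum. Qed.

Lemma size_spots w o : size (spots w o) = M.
Proof. by rewrite size_map size_enum_ord. Qed.

Lemma mem_interl (qs ps : seq (seq T)) x : size qs = (size ps).+1 ->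
  (x \in flatten (interl qs ps)) = (x \in flatten ps) || (x \in flatten qs).
Proof.
elim: ps qs => [|p ps IH] [|a qs] //= [h]; first by rewrite (size0nil h) /=.
by rewrite !mem_cat IH //; case: (x \in a); case: (x \in p); case: (x \in flatten ps).
Qed.

Lemma size_interl (qs ps : seq (seq T)) : size qs = (size ps).+1 ->
  size (flatten (interl qs ps)) = size (flatten ps) + size (flatten qs).
Proof.
elim: ps qs => [|p ps IH] [|a qs] //= [h]; first by rewrite (size0nil h) /= !cats0.
by rewrite !size_cat IH // addnCA [RHS]addnACA addnA.
Qed.

Variables (bs : blocks) (Ps : paths) (Qs : m.+1.-tuple (q.-tuple T)) (io : r.-tuple 'I_M).
Hypothesis hB : okB bs.
Hypothesis hP : okP bs Ps.
Hypothesis hQ : okQ bs Ps Qs.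
Hypothesis hI : okI bs (rest bs Ps Qs) io.

Let vs := rest bs Ps Qs.

Lemma uniq_used : uniq (e0 ++ flat bs ++ flat Ps ++ flat Qs).
Proof.
have /andP[uB _] := hB; have /and3P[uP dP _] := hP; have /and3P[uQ dQ _] := hQ.
rewrite catA cat_uniq uB cat_uniq uP uQ /= andbT; apply/andP; split; last first.
  apply: contra dQ => /hasP[x xQ xP]; apply/hasP; exists x => //=.
  by rewrite catA mem_cat (_ : x \in flat Ps) ?orbT.
apply/hasP => -[x]; rewrite mem_cat => /orP[xP|xQ] xB.
  by case/hasP: dP; exists x.
by case/hasP: dQ; exists x => //=; rewrite catA mem_cat (_ : x \in e0 ++ flat bs).
Qed.

Lemma size_rest : size vs = r.
Proof.
rewrite /vs /rest -cardE cardsCs setCK cardsE (card_uniqP uniq_used) !size_cat !size_flat !size_tuple se0.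
by rewrite -total -!addnA !subnDA !addKn.
Qed.

Lemma spots_absorb i v : i < M -> nth None (spots vs io) i = Some v -> absorbs k E l v (nth [::] (map val bs) i).
Proof.
move=> iM; rewrite -[i]/(nat_of_ord (Ordinal iM)); move: (Ordinal iM) => {iM}i; rewrite spots_nth => h.
have := hI => /andP[uI /allP aI].
have ilt : index i io < size vs by rewrite -onthTE h.
have szE : size io = size vs by rewrite size_rest size_tuple.
have iio : i \in (io : seq _) by rewrite -index_mem szE.
have := aI (i, v); rewrite (nth_map (tnth bs i)) ?size_tuple // -tnth_nth; apply.
have -> : (i, v) = nth (i, v) (zip io vs) (index i io).
  by rewrite nth_zip //; congr pair; [rewrite nth_index|rewrite (onth_nth v v)].
by apply: mem_nth; rewrite size_zip szE minnn.
Qed.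

Lemma spots_isSome (j : 'I_M) : isSome (onth vs (index j io)) = (j \in (io : seq _)).
Proof. by rewrite onthTE size_rest -[X in _ < X](size_tuple io) index_mem. Qed.

Lemma order_size : size (order_of bs Ps Qs io) = #|T|.
Proof.
have gen (b : seq (seq T)) (g : seq (option T)) : size g = size b ->
    size (flatten [seq ins k l p.1 p.2 | p <- zip b g]) = size (flatten b) + count isSome g.
  elim: b g => [|t b IH] [|o g] //= [sg]; by rewrite !size_cat IH // size_ins addnACA.
have szs : size (spots vs io) = size (map val bs) by rewrite size_spots size_map size_tuple.
rewrite /order_of !size_cat (gen _ _ szs) size_interl ?size_map ?size_tuple //.
rewrite -/(flat bs) -/(flat Ps) -/(flat Qs) !size_flat !size_tuple se0 /spots count_map.
have -> : count (preim (fun j => onth (rest bs Ps Qs) (index j io)) isSome) (enum 'I_M) = r.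
  rewrite (eq_count (a2 := mem (io : seq _))); last by move=> j; rewrite /= spots_isSome.
  rewrite -sum1_count big_enum_cond /= sum1_card -[RHS](size_tuple io); apply/card_uniqP.
  by case/andP: hI.
by rewrite -total addn_reorder.
Qed.

Lemma order_mem x : x \in order_of bs Ps Qs io.
Proof.
have gen (b : seq (seq T)) (g : seq (option T)) : size g = size b ->
    (x \in flatten [seq ins k l p.1 p.2 | p <- zip b g]) = (x \in flatten b) || (Some x \in g).
  elim: b g => [|t b IH] [|o g] //= [sg]; rewrite !mem_cat IH // mem_ins inE eq_sym.
  by case: (x \in t); case: (Some x == o); case: (x \in flatten b).
have szs : size (spots vs io) = size (map val bs) by rewrite size_spots size_map size_tuple.
rewrite /order_of !mem_cat (gen _ _ szs) mem_interl ?size_map ?size_tuple //.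
rewrite -/(flat bs) -/(flat Ps) -/(flat Qs).
case xe : (x \in e0) => //=; case xb : (x \in flat bs) => //=.
case xP : (x \in flat Ps); rewrite ?orbT //=; case xQ : (x \in flat Qs); rewrite ?orbT // orbF /=.
have xv : x \in vs by rewrite mem_enum !inE !mem_cat xe xb xP xQ.
have ilt : index x vs < r by rewrite -[X in _ < X]size_rest index_mem.
pose j := tnth io (Ordinal ilt).
apply/mapP; exists j; first by rewrite mem_enum.
have -> : index j io = index x vs.
  by rewrite /j (tnth_nth j) index_uniq ?size_tuple //; case/andP: hI.
by rewrite onthE (nth_map x) ?nth_index // index_mem.
Qed.

Lemma order_uniq : uniq (order_of bs Ps Qs io).
Proof.
apply: (leq_size_uniq (enum_uniq T)) => [x _|]; first exact: order_mem.
by rewrite order_size -cardE.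
Qed.

Lemma order_tight i : i < #|T| -> [set v in take k (rot i (order_of bs Ps Qs io))]%SET \in E.
Proof.
rewrite -order_size; apply: tight_cyclic => //.
  rewrite -/(order_of bs Ps Qs io) order_size -total.
  have : 0 < M * (l + 2 * k.-1) by rewrite muln_gt0 M0 /=; lia.
  by lia.
have /andP[_ tB] := hB; have /and3P[_ _ tP] := hP; have /and3P[_ _ tQ] := hQ.
have sb : all (fun t => size t == l + 2 * k.-1) (map val bs).
  by apply/allP => t /mapP[t' _ ->]; rewrite size_tuple.
have t1 : tight k E (e0 ++ flatten [seq ins k l p.1 p.2 | p <- zip (map val bs) (spots vs io)]).
  apply: tight_ins_all => //; first by rewrite size_spots size_map size_tuple.
  by move=> j v; rewrite size_map size_tuple; exact: spots_absorb.
move: t1; have : size (spots vs io) = size (map val bs) by rewrite size_spots size_map size_tuple.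
have links i' : i' < size (map val Qs) -> tight k E (ends k (nth [::] (last [::] (map val bs) :: map val Ps) i') ++
    nth [::] (map val Qs) i' ++ nth [::] (rcons [seq take k.-1 p | p <- map val Ps] e0) i').
  by move=> hi; apply: (allP tQ i'); rewrite mem_iota /= add0n -(size_map val).
rewrite -/vs; move: (spots vs io) links sb => g.
have : map val bs != [::] by rewrite -size_eq0 size_map size_tuple -lt0n.
case/lastP: (map val bs) => [//|b t] _; rewrite last_rcons all_rcons => links /andP[/eqP st sb].
case/lastP: g => [|g o]; first by rewrite size_rcons.
rewrite !size_rcons => -[sg]; rewrite zip_rcons // map_rcons flatten_rcons /= => t1.
rewrite -!catA; have := @tight_chain T k E (e0 ++ flatten [seq ins k l p.1 p.2 | p <- zip b g]) (ins k l t o) e0 (map val Ps) (map val Qs).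
rewrite -!catA; apply => //.
- by rewrite size_ins st (leq_trans _ (leq_addr _ _)) // mulSn mul1n addnA leq_addl.
- by apply/allP => p /mapP[p' pP ->]; rewrite size_tuple (allP tP) // andbT (leq_trans (leq_pred k)).
- by rewrite !size_map !size_tuple.
- by case=> [|i'] hi; have := links _ hi; rewrite /= ?ends_ins.
Qed.

End Data.

(** * Recovering the data from the order *)

Section Decode.

Local Open Scope nat_scope.

Variables (T : finType) (k : nat) (E : {set {set T}}) (e0 : seq T) (l M m L q r : nat).
Hypothesis k1 : 1 < k.
Hypothesis se0 : size e0 = k.-1.
Hypothesis M0 : 0 < M.
Hypothesis hL : k <= L.
Hypothesis total : k.-1 + M * (l + 2 * k.-1) + m * L + m.+1 * q + r = #|T|.

Definition datum : finType := (M.-tuple ((l + 2 * k.-1).-tuple T) * (m.-tuple (L.-tuple T) *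
  (m.+1.-tuple (q.-tuple T) * r.-tuple 'I_M)))%type.

Definition okD (d : datum) := okB E e0 d.1 && (okP E e0 d.1 d.2.1 &&
  (okQ E e0 d.1 d.2.1 d.2.2.1 && okI E d.1 (rest e0 d.1 d.2.1 d.2.2.1) d.2.2.2)).

Definition ord (d : datum) := order_of e0 d.1 d.2.1 d.2.2.1 d.2.2.2.

Lemma interl_inj (qs qs' ps ps' : seq (seq T)) : size qs = (size ps).+1 -> size qs' = (size ps').+1 ->
  interl qs ps = interl qs' ps' -> qs = qs' /\ ps = ps'.
Proof.
elim: ps qs qs' ps' => [|p ps IH] [|a qs] [|a' qs'] [|p' ps'] //= [h] [h'] [-> ].
  by rewrite (size0nil h) (size0nil h').
by move=> -> /(IH _ _ _ h h')[-> ->].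
Qed.

Lemma shape_interl (qs ps : seq (seq T)) (a b : nat) : size qs = (size ps).+1 ->
  all (fun x => size x == a) qs -> all (fun x => size x == b) ps ->
  shape (interl qs ps) = a :: flatten (nseq (size ps) [:: b; a]).
Proof.
elim: ps qs => [|p ps IH] [|x qs] //= [h] /andP[/eqP -> sq] //.
by move=> /andP[/eqP -> sp]; rewrite IH.
Qed.

(* The set of used blocks determines the lengths of all pieces of the order. *)
Lemma ord_inj (d d' : datum) : okD d -> okD d' -> ord d = ord d' ->
  [set j in d.2.2.2]%SET = [set j in d'.2.2.2]%SET -> d = d'.
Proof.
case: d d' => [bs [Ps [Qs io]]] [bs' [Ps' [Qs' io']]] /and4P /= [hB hP hQ hI] /and4P /= [hB' hP' hQ' hI'] eo eJ.
have JE j : (j \in (io : seq _)) = (j \in (io' : seq _)) by have := congr1 (fun A : {set _} => j \in A) eJ; rewrite !inE.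
set vs := rest e0 bs Ps Qs in hI; set vs' := rest e0 bs' Ps' Qs' in hI'.
have szv : size vs = r by apply: (size_rest se0 total hB hP hQ).
have szv' : size vs' = r by apply: (size_rest se0 total hB' hP' hQ').
move/eqP: eo; rewrite /ord /order_of /= eqseq_cat // eqxx /= -!flatten_cat => /eqP fe.
have someE (j : 'I_M) : isSome (onth vs (index j io)) = isSome (onth vs' (index j io')).
  by rewrite !onthTE szv szv' -[X in (_ < X) = _](size_tuple io) -[X in _ = (_ < X)](size_tuple io') !index_mem JE.
have sh (b : seq (seq T)) (g : seq (option T)) s : size b = size g -> all (fun t => size t == s) b ->
    shape [seq ins k l p.1 p.2 | p <- zip b g] = [seq s + isSome o | o <- g].
  by elim: b g => [|t b IH] [|o g] //= [sg] /andP[/eqP st sb]; rewrite IH // size_ins st.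
have sball (s : nat) (X : seq (s.-tuple T)) : all (fun t : seq T => size t == s) (map val X).
  by apply/allP => t /mapP[t' _ ->]; rewrite size_tuple.
have szb (b : M.-tuple ((l + 2 * k.-1).-tuple T)) (w : seq T) (i : r.-tuple 'I_M) : size (map val b) = size (spots w i).
  by rewrite size_spots size_map size_tuple.
have pieces := eq_from_flatten_shape fe.
have {}pieces : [seq ins k l p.1 p.2 | p <- zip (map val bs) (spots vs io)] ++ interl (map val Qs) (map val Ps) =
  [seq ins k l p.1 p.2 | p <- zip (map val bs') (spots vs' io')] ++ interl (map val Qs') (map val Ps').
  apply: pieces; rewrite /shape !map_cat -!/(shape _).
  rewrite !(sh _ _ _ (szb _ _ _) (sball _ _)) /spots -!map_comp.
  rewrite !(shape_interl _ (sball _ _) (sball _ _)) ?size_map ?size_tuple //; congr (_ ++ _).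
  by apply: eq_map => j /=; rewrite someE.
move/eqP: pieces; rewrite eqseq_cat; last by rewrite !size_map !size_zip !size_spots !size_map !size_tuple.
move=> /andP[/eqP eb /eqP ei].
have [eQ eP] : map val Qs = map val Qs' /\ map val Ps = map val Ps'.
  by apply: interl_inj ei; rewrite !size_map !size_tuple.
have {}eQ : Qs = Qs' by apply: val_inj; exact: (inj_map val_inj eQ).
have {}eP : Ps = Ps' by apply: val_inj; exact: (inj_map val_inj eP).
have ins_all (b b' : seq (seq T)) (g g' : seq (option T)) s : size b = size g -> size b' = size g' ->
    all (fun t => size t == s) b -> all (fun t => size t == s) b' -> map isSome g = map isSome g' ->
    [seq ins k l p.1 p.2 | p <- zip b g] = [seq ins k l p.1 p.2 | p <- zip b' g'] -> b = b' /\ g = g'.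
  elim: b b' g g' => [|t b IH] [|t' b'] [|o g] [|o' g'] //= [s1] [s2] /andP[/eqP a1 a2] /andP[/eqP b1 b2] [c1 c2] [d1 d2].
  have [-> ->] := ins_inj (etrans a1 (esym b1)) c1 d1.
  by have [-> ->] := IH _ _ _ s1 s2 a2 b2 c2 d2.
have [|eb' eg] := ins_all _ _ _ _ _ (szb _ _ _) (szb _ _ _) (sball _ _) (sball _ _) _ eb.
  by rewrite /spots -!map_comp; apply: eq_map => j /=; rewrite someE.
have {}eb' : bs = bs' by apply: val_inj; exact: (inj_map val_inj eb').
subst bs' Ps' Qs'; congr (_, (_, (_, _))); apply: eq_from_tnth => i.
have ev : vs' = vs by [].
rewrite {}ev in hI' eg szv'; have uI : uniq io by case/andP: hI.
pose j := tnth io i.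
have g1 : onth vs (index j io) = onth vs (index j io').
  have : nth None (spots vs io) j = nth None (spots vs io') j by rewrite eg.
  by rewrite !spots_nth.
have ji : index j io = i by rewrite /j (tnth_nth j) index_uniq ?size_tuple.
have jio : j \in (io' : seq _) by rewrite -JE mem_tnth.
have jlt : index j io' < r by rewrite -[X in _ < X](size_tuple io') index_mem.
case: (vs) (szv) g1 (enum_uniq _ : uniq vs) => [r0|v0 w szw g1 uv]; first by have := ltn_ord i; rewrite -[X in _ < X]r0.
have : nth v0 (v0 :: w) (index j io) = nth v0 (v0 :: w) (index j io') by rewrite -!odflt_onth g1.
move/eqP; rewrite nth_uniq ?szw ?ji ?ltn_ord // => /eqP e.
by rewrite -[tnth io i]/j [RHS](tnth_nth j) e nth_index.
Qed.

Lemma count_orders (G : kgraph k T) : edges G = E ->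
  #|[set d | okD d]%SET| <= #|[set s | tight_hamilton_order G s]%SET| * 2 ^ M.
Proof.
move=> GE; pose s0 : #|T|.-tuple T := enum_tuple T.
pose F (d : datum) : #|T|.-tuple T * {set 'I_M} := (insubd s0 (ord d), [set j in d.2.2.2]%SET).
have Fv d : okD d -> val (F d).1 = ord d.
  by move=> /and4P[h1 h2 h3 h4]; rewrite /F /= val_insubd (order_size se0 total h1 h2 h3 h4) eqxx.
have inj : {in [set d | okD d]%SET &, injective F}.
  move=> d d'; rewrite !inE => hd hd' e; apply: ord_inj => //.
    by rewrite -Fv // -Fv // e.
  by have := congr1 snd e.
rewrite -(card_in_imset inj).
have -> : 2 ^ M = #|[set: {set 'I_M}]| by rewrite -powersetT card_powerset cardsT card_ord.
rewrite -cardsX; apply: subset_leq_card; apply/fintype.subsetP => p /finset.imsetP[d].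
rewrite inE => hd ->; rewrite !inE andbT /tight_hamilton_order Fv //.
move: hd => /and4P[h1 h2 h3 h4].
rewrite (order_uniq se0 total h1 h2 h3 h4) /=; apply/forallP => i; rewrite GE.
exact: (order_tight k1 se0 M0 hL total h1 h2 h3 h4).
Qed.

End Decode.

Section Cycles.

Local Open Scope nat_scope.

(** [same_cycle] allows [#|T| + 1] rotation indices and two directions, so a class has at most
    [2 (#|T| + 1)] members. *)
Lemma card_orders_le (k : nat) (T : finType) (G : kgraph k T) :
  #|[set s | tight_hamilton_order G s]%SET| <= num_tight_hamilton_cycles G * (2 * #|T|.+1).
Proof.
set D := [set s | tight_hamilton_order G s]%SET.
have pD : partition (equivalence_partition (@same_cycle T #|T|) D) D.
  by apply: equivalence_partitionP => s t u _ _ _; exact: same_cycle_equivalence.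
rewrite (card_partition pD) /num_tight_hamilton_cycles -/D -sum_nat_const; apply: leq_sum => A.
move=> /finset.imsetP[s _ ->].
pose f (p : bool * 'I_(#|T|.+1)) : #|T|.-tuple T := if p.1 then [tuple of rot p.2 s] else [tuple of rot p.2 (rev s)].
have -> : 2 * #|T|.+1 = #|{: bool * 'I_(#|T|.+1)}| by rewrite card_prod card_bool card_ord.
rewrite -[X in _ <= X]cardsT; apply: leq_trans (leq_imset_card f [set: bool * 'I_(#|T|.+1)]).
apply: subset_leq_card; apply/fintype.subsetP => t; rewrite !inE => /andP[_ /existsP[i /orP[]/eqP h]].
  by apply/finset.imsetP; exists (true, i); rewrite ?inE //; apply: val_inj.
by apply/finset.imsetP; exists (false, i); rewrite ?inE //; apply: val_inj.
Qed.

End Cycles.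

(** * Counting the successive choices *)

Section CountingChoices.

Variable R : realType.

Lemma zip_rcons_take (A B : Type) (y0 : B) (h : seq A) (x : A) (vs : seq B) : (size h < size vs)%N ->
  zip (rcons h x) vs = rcons (zip h vs) (x, nth y0 vs (size h)).
Proof.
elim: h vs => [|a h IH] [|v vs] //= hs; last by rewrite IH.
by case: vs hs.
Qed.

Lemma count_tnth (X : Type) (M : nat) (bs : M.-tuple X) (a : pred X) :
  count a bs = #|[set i | a (tnth bs i)]%SET|.
Proof. by rewrite -sum1_count big_tuple sum1dep_card. Qed.

(** Fewer than [r] blocks are occupied when a leftover vertex chooses, so at least [a] of its
    absorbing blocks are free. *)
Lemma count_spots (T : finType) (k : nat) (E : {set {set T}}) (l M r : nat)
    (bs : M.-tuple ((l + 2 * k.-1).-tuple T)) (vs : seq T) (a : R) : 0 <= a -> size vs = r ->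
  (forall v, v \in vs -> a + r%:R <= (count (absorbs k E l v) (map val bs))%:R) ->
  a ^+ r <= #|[set io : r.-tuple 'I_M | okI E bs vs io]%SET|%:R.
Proof.
move=> a0 sv spots.
apply: (@count_tree R _ (okI E bs vs)) => //; first by rewrite /okI; case: (vs).
move=> h hr /andP[uh ah].
case: vs sv spots ah => [|v0 w] sv spots ah; first by rewrite -sv in hr.
set vs := v0 :: w in sv spots ah *.
have hs : (size h < size vs)%N by rewrite sv.
have vin : nth v0 vs (size h) \in vs by apply: mem_nth.
set v := nth v0 vs (size h) in vin.
have := spots v vin; rewrite count_map count_tnth => hc.
set S := [set i | _]%SET in hc.
have sub : S :\: [set x in h]%SET \subset [set x | okI E bs vs (rcons h x)]%SET.
  apply/fintype.subsetP => x; rewrite !inE => /andP[xh ax].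
  rewrite /okI (zip_rcons_take v0 x hs) rcons_uniq xh uh all_rcons ah andbT.
  by rewrite /= andbT; exact: ax.
have : (#|S| <= #|[set x | okI E bs vs (rcons h x)]%SET| + r)%N.
  apply: (@leq_trans (#|S :\: [set x in h]%SET| + r)); last by rewrite leq_add2r subset_leq_card.
  rewrite -(cardsID [set x in h]%SET S) addnC leq_add2l.
  apply: (leq_trans (subset_leq_card (subsetIr _ _))); rewrite cardsE.
  by apply: (leq_trans (card_size _)); exact: ltnW.
by rewrite -(ler_nat R) natrD; move: hc; lra.
Qed.

(** At each greedy step, connectors with repeated vertices or with vertices of earlier connectors
    make up at most half of the guaranteed [beta |Z|^q]. *)
Lemma count_conns (T : finType) (k : nat) (E : {set {set T}}) (e0 : seq T) (l M m L q : nat)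
    (bs : M.-tuple ((l + 2 * k.-1).-tuple T)) (Ps : m.-tuple (L.-tuple T)) (d beta : R) :
  let Z := ~: [set x in e0 ++ flat bs ++ flat Ps]%SET in
  (1 < k)%N -> size e0 = k.-1 -> (0 < M)%N -> (k <= L)%N -> uniq (e0 ++ flat bs) -> uniq (flat Ps) ->
  dirac_on k d E Z set0 -> 0 <= beta -> connects k d q beta -> (0 < #|Z|)%N ->
  (q * q + q * (m.+1 * q))%:R <= beta / 2 * #|Z|%:R ->
  (beta / 2 * #|Z|%:R ^+ q) ^+ m.+1 <= #|[set Qs : m.+1.-tuple (q.-tuple T) | okQ E e0 bs Ps Qs]%SET|%:R.
Proof.
move=> Z k1 se0 M0 hL ueb uP hd be0 con Z0 big.
have Zr : 0 < #|Z|%:R :> R by rewrite ltr0n.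
apply: (@count_tree R _ (okQ E e0 bs Ps)) => //.
  by rewrite mulr_ge0 ?divr_ge0 ?exprn_ge0.
move=> h hm /and3P[uh dh ah].
have ub : uniq (flat bs) by move: ueb; rewrite cat_uniq => /and3P[].
have uflat (s : nat) (X : seq (s.-tuple T)) (t : seq T) : uniq (flat X) -> t \in map val X -> uniq t.
  rewrite /flat; elim: X => [//|y X IH] /=; rewrite cat_uniq inE => /and3P[uy _ /IH uX] /orP[/eqP -> //|].
  exact: uX.
have szin (s : nat) (X : seq (s.-tuple T)) (t : seq T) : t \in map val X -> size t = s.
  by move=> /mapP[y _ ->]; rewrite size_tuple.
set i := size h.
have lastin : last [::] (map val bs) \in map val bs.
  have : size (map val bs) = M by rewrite size_map size_tuple.
  by case: (map val bs) => [|y X] /= sz; [rewrite -sz in M0|exact: mem_last].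
have srcP (t : seq T) : uniq t -> (k.-1 <= size t)%N -> uniq (ends k t) /\ size (ends k t) = k.-1.
  by move=> ut st; rewrite size_ends // drop_uniq.
have hi : (i < m.+1)%N by [].
have [us ss] : uniq (vsrc bs Ps i) /\ size (vsrc bs Ps i) = k.-1.
  apply: srcP; rewrite /vsrc; case: (i) hi => [|j] hj /=.
  - exact: uflat lastin.
  - by apply: (uflat _ Ps) => //; apply: mem_nth; rewrite size_map size_tuple.
  - by rewrite (szin _ _ _ lastin) mulSn mul1n addnA leq_addl.
  - rewrite (szin _ Ps); first by rewrite (leq_trans (leq_pred k)).
    by apply: mem_nth; rewrite size_map size_tuple.
have [ut st] : uniq (vtgt k e0 Ps i) /\ size (vtgt k e0 Ps i) = k.-1.
  rewrite /vtgt nth_rcons !size_map size_tuple; case: ltnP => im; last first.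
    have -> : i == m by rewrite eqn_leq im -ltnS hi.
    by split=> //; move: ueb; rewrite cat_uniq => /andP[].
  rewrite (nth_map [::]) ?size_map ?size_tuple //.
  have pin : nth [::] (map val Ps) i \in map val Ps by apply: mem_nth; rewrite size_map size_tuple.
  by rewrite take_uniq ?(uflat _ _ _ uP) // size_takel // (szin _ _ _ pin) (leq_trans (leq_pred k)).
have noset0 (s : seq T) : ~~ has (mem set0) s by apply/hasPn => x _; rewrite /= inE.
have := con T E Z set0 _ _ hd ss st us ut (noset0 _) (noset0 _).
set C := connectors _ _ _ _ _ _ => hC.
pose U := [set x in flat h]%SET.
have cU : (#|U| <= m.+1 * q)%N.
  rewrite cardsE (leq_trans (card_size _)) // size_flat leq_mul2r; apply/orP; right; exact: ltnW.
set Bad := [set t : q.-tuple T | all (mem Z) t && ~~ (uniq t && ~~ has (mem U) t)]%SET.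
have hBad : #|Bad|%:R <= beta / 2 * #|Z|%:R ^+ q.
  rewrite -(ler_pM2r Zr).
  have := card_bad_tuples Z U q; rewrite -/Bad => hb.
  have {}hb := leq_trans hb (leq_mul (leq_add (leqnn (q * q)%N) (leq_mul (leqnn q) cU)) (leqnn _)).
  rewrite -(ler_nat R) !natrM natrX in hb; apply: (le_trans hb).
  have := ler_wpM2r (exprn_ge0 q (ltW Zr)) big; rewrite -/Z !natrD !natrM => h2; apply: (le_trans h2).
  by rewrite le_eqVlt; apply/orP; left; apply/eqP; ring.
have sub : C :\: Bad \subset [set x | okQ E e0 bs Ps (rcons h x)]%SET.
  apply/fintype.subsetP => x; rewrite !inE => /andP[nb /andP[xZ xt]].
  move: nb; rewrite xZ /= negbK => /andP[ux hx].
  rewrite /okQ flat_rcons cat_uniq uh ux andbT /= has_cat negb_or dh /= size_rcons -(addn1 (size h)) iotaD all_cat add0n /= andbT.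
  apply/and4P; split.
  - by apply: contra hx => /hasP[y yx yh]; apply/hasP; exists y => //=; rewrite inE.
  - by apply/hasPn => y yx; have := allP xZ y yx; rewrite !inE.
  - apply/allP => j; rewrite mem_iota /= add0n => hj.
    by have := allP ah j; rewrite mem_iota /= add0n => /(_ hj); rewrite map_rcons nth_rcons size_map hj.
  by rewrite map_rcons nth_rcons size_map ltnn eqxx.
have : (#|C| <= #|[set x | okQ E e0 bs Ps (rcons h x)]%SET| + #|Bad|)%N.
  apply: (@leq_trans (#|C :\: Bad| + #|Bad|)); last by rewrite leq_add2r subset_leq_card.
  by rewrite -(cardsID Bad C) addnC leq_add2l subset_leq_card // subsetIr.
by rewrite -(ler_nat R) natrD; move: hC hBad; lra.
Qed.

Lemma count_data (T : finType) (k : nat) (E : {set {set T}}) (e0 : seq T) (l M m L q r : nat) (a b c d : R)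
  (A : pred (M.-tuple ((l + 2 * k.-1).-tuple T)))
  (B : M.-tuple ((l + 2 * k.-1).-tuple T) -> pred (m.-tuple (L.-tuple T))) :
  0 <= a -> 0 <= b -> 0 <= c -> 0 <= d ->
  (forall bs, A bs -> okB E e0 bs) -> (forall bs Ps, A bs -> B bs Ps -> okP E e0 bs Ps) ->
  a <= #|[set bs | A bs]%SET|%:R -> (forall bs, A bs -> b <= #|[set Ps | B bs Ps]%SET|%:R) ->
  (forall bs Ps, A bs -> B bs Ps -> c <= #|[set Qs : m.+1.-tuple (q.-tuple T) | okQ E e0 bs Ps Qs]%SET|%:R) ->
  (forall bs Ps (Qs : m.+1.-tuple (q.-tuple T)), A bs -> B bs Ps -> okQ E e0 bs Ps Qs ->
     d <= #|[set io : r.-tuple 'I_M | okI E bs (rest e0 bs Ps Qs) io]%SET|%:R) ->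
  a * (b * (c * d)) <= #|[set x : datum T k l M m L q r | okD E e0 x]%SET|%:R.
Proof.
move=> a0 b0 c0 d0 AB BP ha hb hc hd.
have bcd0 : 0 <= b * (c * d) by rewrite !mulr_ge0.
have cd0 : 0 <= c * d by rewrite mulr_ge0.
have h1 bs Ps : A bs -> B bs Ps -> c * d <= #|[set p : m.+1.-tuple (q.-tuple T) * r.-tuple 'I_M |
    okQ E e0 bs Ps p.1 && okI E bs (rest e0 bs Ps p.1) p.2]%SET|%:R.
  move=> hA hB; have hd' (Qs : m.+1.-tuple (q.-tuple T)) := hd bs Ps Qs hA hB.
  exact: (@card_pairs_ge R _ _ (fun Qs : m.+1.-tuple (q.-tuple T) => okQ E e0 bs Ps Qs)
    (fun Qs (io : r.-tuple 'I_M) => okI E bs (rest e0 bs Ps Qs) io) c _ d0 (hc _ _ hA hB) hd').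
have h2 bs : A bs -> b * (c * d) <= #|[set p : m.-tuple (L.-tuple T) * (m.+1.-tuple (q.-tuple T) * r.-tuple 'I_M) |
    B bs p.1 && (okQ E e0 bs p.1 p.2.1 && okI E bs (rest e0 bs p.1 p.2.1) p.2.2)]%SET|%:R.
  move=> hA; have h1' (Ps : m.-tuple (L.-tuple T)) := h1 bs Ps hA.
  exact: (@card_pairs_ge R _ _ (B bs) (fun Ps (p : m.+1.-tuple (q.-tuple T) * r.-tuple 'I_M) =>
    okQ E e0 bs Ps p.1 && okI E bs (rest e0 bs Ps p.1) p.2) b _ cd0 (hb bs hA) h1').
have h3 := @card_pairs_ge R _ _ A (fun bs (p : m.-tuple (L.-tuple T) * (m.+1.-tuple (q.-tuple T) * r.-tuple 'I_M)) =>
  B bs p.1 && (okQ E e0 bs p.1 p.2.1 && okI E bs (rest e0 bs p.1 p.2.1) p.2.2)) a _ bcd0 ha h2.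
apply: (le_trans h3); rewrite ler_nat; apply: (@subset_leq_card (datum T k l M m L q r)).
apply/fintype.subsetP => x; rewrite !inE /okD.
by move=> /andP[hA /andP[hB ->]]; rewrite (AB _ hA) (BP _ _ hA hB).
Qed.

End CountingChoices.

(** * Counting *)

Lemma sub_tight (T : finType) (k : nat) (E E' : {set {set T}}) (s : seq T) : E \subset E' ->
  tight k E s -> tight k E' s.
Proof.
move=> sub; elim: s => //= u s IH /andP[/implyP h /IH ->]; rewrite andbT.
by apply/implyP => /h; exact: (fintype.subsetP sub).
Qed.

(** * Counting systems of disjoint paths *)

Section PathsCount.

Variable R : realType.

Lemma ln_fact_ge n : n%:R * ln n%:R - n%:R <= ln n`!%:R :> R.
Proof.
elim: n => [|n IH]; first by rewrite mul0r subr0 fact0 ln1.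
case: n IH => [|n] IH; first by rewrite mul1r (_ : 1`! = 1)%N // ln1 sub0r lerN10.
have p0 : 0 < n.+1%:R :> R by rewrite ltr0n.
have p1 : 0 < n.+2%:R :> R by rewrite ltr0n.
rewrite factS natrM lnM ?posrE ?ltr0n ?fact_gt0 // -/(n.+2)%N.
have q0 : 0 < n.+2%:R / n.+1%:R :> R by rewrite divr_gt0.
have h := ler_wpM2l (ltW p0) (ln_le_sub1 q0).
have e : n.+1%:R * (n.+2%:R / n.+1%:R - 1) = n.+2%:R - n.+1%:R :> R by field; rewrite lt0r_neq0.
rewrite e ln_div ?posrE // in h.
have n2 : n.+2%:R = n.+1%:R + 1 :> R by rewrite -natr1.
have e2 : n.+2%:R * ln n.+2%:R = n.+1%:R * ln n.+2%:R + ln n.+2%:R :> R by rewrite {1}n2 mulrDl mul1r.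
move: IH h; rewrite e2 mulrBr; move: (n.+1%:R * ln n.+2%:R) (n.+1%:R * ln n.+1%:R) => u v; lra.
Qed.

Lemma ln_fact_le n : ln n`!%:R <= n%:R * ln n%:R :> R.
Proof.
elim: n => [|n IH]; first by rewrite mul0r fact0 ln1.
rewrite factS natrM lnM ?posrE ?ltr0n ?fact_gt0 // -natr1 mulrDl mul1r addrC lerD2r.
apply: (le_trans IH); case: n {IH} => [|n]; first by rewrite !mul0r.
by rewrite natr1 ler_wpM2l // ler_ln ?posrE ?ltr0n // ler_nat.
Qed.

Lemma ln_fact_step a L : (0 < a + L)%N -> ln (a + L)`!%:R - ln a`!%:R <= L%:R * ln (a + L)%:R :> R.
Proof.
move=> h; have p : 0 < (a + L)%:R :> R by rewrite ltr0n.
rewrite lerBlDr mulr_natl -lnXn // -lnM ?posrE ?exprn_gt0 ?ltr0n ?fact_gt0 //.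
rewrite ler_ln ?posrE ?mulr_gt0 ?exprn_gt0 ?ltr0n ?fact_gt0 // -natrX -natrM ler_nat.
have := ffact_fact (leq_addl a L); rewrite addnK => <-; rewrite leq_mul2r; apply/orP; right.
by elim: L {h p} => [|L IH] //; rewrite addnS; move: (a + L).+1 => b; clear; elim: L => [|L IH]; rewrite ?ffactn0 // ffactnSr expnSr leq_mul // ?leq_subr.
Qed.

(** Each summand dominates the logarithms of the [L] integers up to [Nend + (i + 1) L]. *)
Lemma sum_ln_ge (Nend m L : nat) : (0 < L)%N ->
  ln (Nend + m * L)`!%:R - ln Nend`!%:R <= \sum_(i < m) L%:R * ln (Nend + i.+1 * L)%:R :> R.
Proof.
move=> L0; elim: m => [|m IH]; first by rewrite big_ord0 mul0n addn0 subrr.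
rewrite big_ord_recr /=; have := @ln_fact_step (Nend + m * L) L.
have -> : (Nend + m * L + L = Nend + m.+1 * L)%N by rewrite mulSn [(L + _)%N]addnC addnA.
have p : (0 < Nend + m.+1 * L)%N by rewrite addn_gt0 muln_gt0 L0 orbT.
by move=> /(_ p); move: IH; lra.
Qed.

Lemma codeg_tuple (T : finType) (S : {set T}) j : #|S| = j -> exists t : j.-tuple T, [set x in t]%SET = S.
Proof.
move=> cS; have sz : size (enum S) == j by rewrite -cardE cS.
by exists (Tuple sz); apply/setP => x; rewrite inE /= mem_enum.
Qed.

(** [n ln n - n] is the Stirling value of the summed logarithms of the sizes; the other main terms
    are path entropies. The uncovered set has to keep the codegree condition, as the connections are
    made inside it. *)
Lemma paths_count (k : nat) (eta eps : R) : (1 < k)%N -> 0 < eta <= 1 / 8 -> 0 < eps ->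
  exists th ga0 : R, [/\ 0 < th <= 1 & 0 < ga0] /\ forall ga : R, 0 < ga -> ga <= ga0 -> ga <= 1 / 2 ->
  exists L1 : nat, forall L, (L1 <= L)%N -> (k <= L)%N /\ exists n0 : nat,
  forall (T : finType) (E : {set {set T}}) (V : {set T}) (x : {set T} -> R) (m Nend : nat),
  let n := #|V|%:R : R in let N := n ^+ k.-1 in
  {in E, forall e : {set T}, #|e| = k} ->
  (forall S : {set T}, #|S| = k.-1 -> (1 / 2 + 2 * eta) * n <= #|[set v in V | v |: S \in E]%SET|%:R) ->
  (n0 <= #|V|)%N -> #|~: V|%:R <= th * n ->
  {in E, forall e, 0 <= x e} -> (forall v, edeg E x v = 1) ->
  #|V| = (Nend + m * L)%N -> ga * n <= Nend%:R -> Nend%:R <= 2 * ga * n ->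
  exists B : pred (m.-tuple (L.-tuple T)),
   (forall Ps, B Ps -> [/\ uniq (flat Ps), all (mem V) (flat Ps), all (fun p => tight k E (val p)) Ps &
        dirac_on k (1 / 2 + eta) E (V :\: [set y in flat Ps]%SET) set0]) /\
   expR (n * ln n - n - Nend%:R * ln n + k%:R * (\sum_(e in E) phi N (x e)) + n * ln (k.-1)`!%:R - eps * n) <=
   #|[set Ps | B Ps]%SET|%:R.
Proof.
move=> k1 /andP[eta0 eta8] eps0.
have kr : 0 < k%:R :> R by rewrite ltr0n ltnW.
pose f : R := ln (k.-1)`!%:R.
have f0 : 0 <= f by apply: ln_ge0; rewrite ler1n fact_gt0.
have kf : 0 < k%:R + f by apply: ltr_wpDr.
pose e2 := eps / (8 * k%:R); pose e3 := eps / 8; pose e4 := eps / 8.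
have e20 : 0 < e2 by rewrite divr_gt0 // mulr_gt0.
have e30 : 0 < e3 by rewrite divr_gt0.
have ke2 : k%:R * e2 = eps / 8 by rewrite /e2; field; rewrite lt0r_neq0.
have eta01 : 0 < eta <= 1 by rewrite eta0; move: eta8; clear; lra.
have [th [c [D [[th0 c01 D1] [n1 regm]]]]] := @regular_matching R k eta e2 k1 eta01 e20.
have [L0 pathw] := @path_weights R k e3 k1 e30.
exists (Order.min th 1), (eps / (16 * (k%:R + f))); split.
  by split; [rewrite lt_min th0 ltr01 ge_min lexx orbT|rewrite divr_gt0 // mulr_gt0].
move=> ga ga0 ga1 ga2.
have gkf : 2 * ga * (k%:R + f) <= eps / 8.
  have : ga * (16 * (k%:R + f)) <= eps by rewrite -ler_pdivlMr // mulr_gt0.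
  by clear; lra.
(* [L] also has to make [m * ln L] negligible, since the total path weight is about [n / L]. *)
exists (maxn L0 (maxn k (Num.bound (16 * `|- 1 - ln (eps / 16)| / eps)).+1)) => L.
rewrite !geq_max => /and3P[LL0 kL LL2]; split=> //.
have Lr0 : 0 < L%:R :> R by rewrite ltr0n (leq_trans _ kL) // ltnW.
have Lpos : (0 < L)%N by rewrite (leq_trans _ kL) // ltnW.
have lnL : ln L%:R <= eps / 8 * L%:R.
  have q0 : 0 < eps / 16 * L%:R by rewrite mulr_gt0 // divr_gt0.
  have h1 := ln_le_sub1 q0; rewrite lnM ?posrE ?divr_gt0 // in h1.
  have h2 : 16 * `|- 1 - ln (eps / 16)| / eps <= L%:R.
    apply: ltW; apply: (lt_le_trans (archi_boundP _)); last by rewrite ler_nat ltnW.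
    by rewrite divr_ge0 ?mulr_ge0 // ltW.
  rewrite ler_pdivrMr // in h2; have h3 := ler_norm (- 1 - ln (eps / 16)).
  move: h1 h2 h3; clear; lra.
have [kL' pathw'] := pathw L LL0.
have [K [k1' [al [C5 [[K1 k10 /andP[al0 al1] C50] [n2 pw']]]]]] := pathw' c D c01 D1.
have K0 : 0 < K by apply: lt_le_trans K1.
have lK0 : 0 <= ln K by rewrite ln_ge0.
have G0 : 0 <= 2 * ln K by rewrite mulr_ge0.
have ga01 : 0 < ga <= 1 by rewrite ga0; move: ga2; clear; lra.
have [ep0 [ep00 [n3 proc]]] := @process_count R L k.-1 2 k1' K (2 * ln K) ga eta e4 (2 ^+ k.-1)
   Lpos (ler1n _ 2) k10 K1 G0 ga01 eta0 e30 (exprn_ge0 _ (ler0n _ 2)).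
pose ta := eps / (16 * (ln K + 1)).
have lK1 : 0 < ln K + 1 by move: lK0; clear; lra.
have ta0 : 0 < ta by rewrite divr_gt0 // mulr_gt0.
exists (maxn n1 (maxn n2 (maxn n3 (maxn (Num.bound (C5 / ep0)).+1 (Num.bound (C5 / ta / ta)).+1)))).
move=> T E V x m Nend n N Eu cod; rewrite !geq_max => /and5P[nn1 nn2 nn3 nn4 nn5] cA x0 xdeg VE gN gN2.
have bnd (y : R) : 0 <= y -> ((Num.bound y).+1 <= #|V|)%N -> y <= n.
  by move=> y0 h; apply: ltW; apply: (lt_le_trans (archi_boundP y0)); rewrite ler_nat ltnW.
have n0 : 0 < n by rewrite ltr0n (leq_trans _ nn4).
have C5a : C5 <= ep0 * n.
  have p : 0 <= C5 / ep0 by apply: divr_ge0 => //; exact: ltW.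
  by have := bnd _ p nn4; rewrite ler_pdivrMr // mulrC.
have C5b : C5 / ta <= ta * n.
  have p : 0 <= C5 / ta / ta by have t' := ltW ta0; apply: divr_ge0 => //; apply: divr_ge0.
  by have := bnd _ p nn5; rewrite ler_pdivrMr // [n * _]mulrC.
have thn : #|~: V|%:R <= th * n.
  by apply: (le_trans cA); rewrite ler_wpM2r ?(ltW n0) // ge_min lexx.
have Tn : #|T|%:R <= 2 * n.
  have : (#|T| = #|V| + #|~: V|)%N by rewrite cardsC.
  move=> ->; rewrite natrD -/n.
  have : #|~: V|%:R <= 1 * n by apply: (le_trans cA); rewrite ler_wpM2r ?(ltW n0) // ge_min lexx orbT.
  by clear; lra.
have cod1 (S : {set T}) : S \subset V -> #|S| = k.-1 -> (1 / 2 + eta) * n <= #|[set v in V | v |: S \in E]%SET|%:R.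
  move=> _ cS; apply: le_trans (cod S cS); rewrite ler_wpM2r ?(ltW n0) //; move: eta0; clear; lra.
have [x' [xb xs xent]] := regm T E V x al Eu cod1 nn1 thn x0 xdeg al0.
set E0 := [set e in E | e \subset V]%SET in xb xs xent.
have E0u : {in E0, forall e : {set T}, #|e| = k} by move=> e; rewrite inE => /andP[/Eu].
have E0V : {in E0, forall e : {set T}, e \subset V} by move=> e; rewrite inE => /andP[].
have cod0 (S : {set T}) : S \subset V -> #|S| = k.-1 -> n / 2 <= #|[set v in V | v |: S \in E0]%SET|%:R.
  move=> SV cS; apply: (@le_trans _ _ ((1 / 2 + eta) * n)).
    by rewrite mulrC ler_wpM2r ?(ltW n0) //; move: eta0; clear; lra.
  apply: (le_trans (cod1 S SV cS)); rewrite ler_nat subset_leq_card //.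
  apply/fintype.subsetP => v; rewrite !inE => /andP[vV ->].
  by rewrite vV /= finset.subUset finset.sub1set vV.
have [w [[w0 wu wsupp wb wdeg2] [wcod1 wsq went]]] := pw' T E0 V x' E0u E0V nn2 xb cod0 xs.
rewrite -/n -/N in wb wcod1 went xent.
have nL : n ^+ L = n ^+ L.-1 * n by rewrite -exprSr prednK.
have nLp : 0 < n ^+ L.-1 by rewrite exprn_gt0.
pose g P := if 0 < w P then ln K - ln (n ^+ L.-1 * w P) else 0.
have gb P : 0 <= g P <= 2 * ln K.
  rewrite /g; case: ifP => wP; last by rewrite lexx.
  have /andP[h1 h2] := wb P wP; have q0 : 0 < n ^+ L.-1 * w P by rewrite mulr_gt0.
  rewrite subr_ge0 ler_ln ?posrE // h2 /=.
  have : ln K^-1 <= ln (n ^+ L.-1 * w P) by rewrite ler_ln ?posrE ?invr_gt0.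
  by rewrite lnV ?posrE //; clear; lra.
have hg P : 0 < w P -> ln ((n ^+ L * w P)^-1) = g P - ln (n * K).
  move=> wP; have q0 : 0 < n ^+ L.-1 * w P by rewrite mulr_gt0.
  rewrite /g wP nL mulrAC lnV ?posrE ?mulr_gt0 // [ln (n ^+ L.-1 * w P * n)]lnM ?posrE // (lnM n0 K0).
  by clear; ring.
(* Indexing by all (k-1)-tuples keeps [#|I|] polynomial; tuples with repetitions get the whole
   vertex set, of density [1]. *)
pose I : finType := k.-1.-tuple T.
pose Nb (t : I) : {set T} := if #|[set y in t]%SET| == k.-1 then [set v | v |: [set y in t]%SET \in E]%SET else setT.
have hNb t : (1 / 2 + 2 * eta) * n <= #|Nb t :&: V|%:R.
  rewrite /Nb; case: ifP => [/eqP ct|_]; last first.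
    by rewrite finset.setTI -[X in _ <= X]mul1r ler_wpM2r ?(ltW n0) //; move: eta8; clear; lra.
  apply: (le_trans (cod _ ct)); rewrite ler_nat subset_leq_card //.
  by apply/fintype.subsetP => v; rewrite !inE => /andP[-> ->].
have cI : #|I|%:R <= 2 ^+ k.-1 * n ^+ k.-1.
  rewrite card_tuple natrX -exprMn lerXn2r ?nnegrE // mulr_ge0 // ltW.
have wsq' : \sum_(v in V) (wdeg w V v - 1) ^+ 2 <= ep0 * #|V|%:R by apply: le_trans C5a.
have pr := proc T I #|V| m Nend w g Nb V (1 / 2 + 2 * eta) nn3 erefl VE gN cI w0 wu gb hg wdeg2 wcod1 wsq' hNb.
set okZ := proc_ok Nb _ in pr.
pose B := fun Ps : m.-tuple (L.-tuple T) => pvalid w okZ V Ps.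
exists B; split.
  move=> Ps hP.
  have wpu (P : L.-tuple T) : 0 < w P -> uniq P by move=> wP; case uP: (uniq P) => //; move: wP; rewrite wu ?uP ?ltxx.
  have [h1 h2 h3 h4] := pvalidP wpu hP; split=> //.
    apply/allP => P PPs; have /andP[_ tE0] := wsupp P (allP h3 P PPs).
    by apply: sub_tight tE0; apply/fintype.subsetP => e; rewrite inE => /andP[].
  split=> // [e eE|S cS _]; first by rewrite -setI_eq0 finset.setI0.
  have [t tS] := codeg_tuple cS.
  have := forallP h4 t; rewrite /Nb tS cS eqxx.
  have -> : 1 / 2 + 2 * eta - eta = 1 / 2 + eta by clear; ring.
  move=> h; apply: (le_trans h); rewrite ler_nat; apply: subset_leq_card; apply/fintype.subsetP => v.
  by rewrite !inE => /andP[-> ->].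
have V0 : (0 < #|V|)%N by rewrite -(ltr_nat R).
rewrite -(ncount_card w okZ m V V0) -/n.
have nm : 0 < (n ^+ L) ^+ m by rewrite !exprn_gt0.
apply: le_trans (ler_wpM2r (ltW nm) pr).
have -> : (n ^+ L) ^+ m = expR (m%:R * (L%:R * ln n)).
  by rewrite -[LHS]lnK ?posrE // lnXn ?exprn_gt0 // lnXn // !mulr_natl.
rewrite -expRD ler_expR -/n.
set S1 := \sum_(i < m) _; set Y := wsum _ V.
pose q := (m * L)%N%:R / n.
have nE : n = Nend%:R + (m * L)%N%:R by rewrite /n VE natrD.
have lx (y : R) : 0 < y -> ln (y ^+ L) = L%:R * ln y by move=> y0; rewrite lnXn // mulr_natl.
have S1E : S1 = \sum_(i < m) (L%:R * ln (Nend + i.+1 * L)%N%:R) - m%:R * (L%:R * ln n + ln L%:R + ln K).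
  have -> : m%:R * (L%:R * ln n + ln L%:R + ln K) = \sum_(i < m) (L%:R * ln n + ln L%:R + ln K).
    by rewrite sumr_const card_ord mulr_natl.
  rewrite -sumrB /S1; apply: eq_bigr => i _.
  have p : 0 < (Nend + i.+1 * L)%N%:R :> R by rewrite ltr0n addn_gt0 muln_gt0 Lpos orbT.
  have -> : n * ((Nend + i.+1 * L)%N%:R / n) ^+ L / L%:R / (n * K) = (Nend + i.+1 * L)%N%:R ^+ L / (n ^+ L * (L%:R * K)).
    rewrite exprMn exprVn; have := lt0r_neq0 n0; have := lt0r_neq0 K0; have := lt0r_neq0 Lr0.
    have : n ^+ L != 0 by rewrite lt0r_neq0 // exprn_gt0.
    by move: (n ^+ L) => u *; field; apply/and4P.
  rewrite ln_div ?posrE ?mulr_gt0 ?exprn_gt0 // lnM ?posrE ?mulr_gt0 ?exprn_gt0 // (lnM Lr0 K0) !lx //.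
  by clear; ring.
have S2 : n * ln n - n - Nend%:R * ln n <= \sum_(i < m) (L%:R * ln (Nend + i.+1 * L)%N%:R).
  apply: le_trans (sum_ln_ge _ _ Lpos); rewrite -VE.
  have h1 := ln_fact_ge #|V|; have h2 := ln_fact_le Nend; rewrite -/n in h1.
  have h3 : Nend%:R * ln Nend%:R <= Nend%:R * ln n.
    have N0 : 0 < Nend%:R :> R by apply: lt_le_trans gN; rewrite mulr_gt0.
    rewrite ler_wpM2l // ler_ln ?posrE // nE lerDl //.
  by move: h1 h2 h3; clear; lra.
have wsumE : L%:R * wsum w V = \sum_(v in V) wdeg w V v by rewrite wdeg_total.
have ws1 : n - 2 * ta * n <= L%:R * wsum w V.
  rewrite wsumE; have h1 : \sum_(v in V) (1 - ta - (wdeg w V v - 1) ^+ 2 / ta) <= \sum_(v in V) wdeg w V v.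
    apply: ler_sum => v _; move: (wdeg w V v) => b.
    have : 0 <= ((b - 1 + ta) ^+ 2 + (b - 1) ^+ 2 + ta ^+ 2) / (2 * ta).
      by rewrite divr_ge0 ?addr_ge0 ?sqr_ge0 // mulr_ge0 // ltW.
    have -> : ((b - 1 + ta) ^+ 2 + (b - 1) ^+ 2 + ta ^+ 2) / (2 * ta) = (b - 1) ^+ 2 / ta + (b - 1) + ta.
      by field; rewrite lt0r_neq0.
    by clear; lra.
  apply: le_trans h1; rewrite sumrB -mulr_suml sumr_const -[X in _ <= X - _]mulr_natl -/n.
  have : (\sum_(v in V) (wdeg w V v - 1) ^+ 2) / ta <= C5 / ta by rewrite ler_pM2r ?invr_gt0.
  by move: C5b; clear; lra.
have YE : Y = ln K * wsum w V - \sum_(P | inV V P) w P * ln (n ^+ L.-1 * w P).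
  rewrite /Y /wsum mulr_sumr -sumrB; apply: eq_bigr => P _; rewrite /g.
  have := w0 P; rewrite le_eqVlt => /orP[/eqP <-|->]; first by rewrite ltxx !mul0r mulr0 subrr.
  by clear; ring.
set Ph := \sum_(e in E) _ in xent *; set Ph' := \sum_(e in E0) _ in xent went.
pose Y' := k%:R * Ph' + n * f - e3 * n.
have Y'n : Y' <= (k%:R + f) * n.
  have : Ph' <= n.
    apply: (@le_trans _ _ (#|E0|%:R * N^-1)).
      apply: sum_le_card => e eE; apply: phi_le; first by rewrite exprn_gt0.
      have /andP[+ _] := xb e eE; apply: le_trans.
      by case/andP: c01 => c0 _; rewrite divr_ge0 ?exprn_ge0 // ltW.
    rewrite ler_pdivrMr ?exprn_gt0 // -exprS prednK ?(ltnW k1) // -natrX ler_nat.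
    exact: card_edges_le.
  move=> h; have := ler_wpM2l (ltW kr) h; have : 0 <= e3 * n by rewrite mulr_ge0 // ltW.
  by rewrite /Y'; clear; lra.
have q01 : 0 <= q <= 1.
  by rewrite /q divr_ge0 ?(ltW n0) //= ler_pdivrMr // mul1r nE lerDr.
have /andP[q0 q1] := q01.
have qn : (1 - q) * n = Nend%:R.
  have -> : (1 - q) * n = n - (m * L)%N%:R by rewrite /q; field; rewrite lt0r_neq0.
  by rewrite nE; clear; ring.
(* The uncovered fraction [1 - q] is at most [2 * ga], and [Y'] is at most [(k + f) n]. *)
have qY' : Y' - eps / 8 * n <= q * Y'.
  have : (1 - q) * Y' <= eps / 8 * n.
    apply: (@le_trans _ _ ((1 - q) * ((k%:R + f) * n))); first by rewrite ler_wpM2l // subr_ge0.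
    rewrite mulrCA qn; apply: (@le_trans _ _ ((k%:R + f) * (2 * ga * n))); first by rewrite ler_wpM2l // ltW.
    by have := ler_wpM2r (ltW n0) gkf; clear; lra.
  by clear; lra.
(* The shifts by [ln K] cancel: [m] of them were subtracted in [S1], and the sum of [g] returns them
   up to the deviation of the total weight from [n / L]. *)
have qK : m%:R * ln K - eps / 8 * n <= q * (ln K * wsum w V).
  have -> : q * (ln K * wsum w V) = m%:R / n * (ln K * (L%:R * wsum w V)) by rewrite /q natrM; clear; ring.
  apply: (@le_trans _ _ (m%:R / n * (ln K * (n - 2 * ta * n)))); last first.
    by rewrite ler_wpM2l ?divr_ge0 ?(ltW n0) // ler_wpM2l.
  have -> : m%:R / n * (ln K * (n - 2 * ta * n)) = m%:R * ln K - m%:R * (2 * ta * ln K) by field; rewrite lt0r_neq0.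
  rewrite lerD2l lerN2.
  have h1 : 2 * ta * ln K <= eps / 8.
    have : ta * ln K <= ta * (ln K + 1) by rewrite ler_wpM2l ?(ltW ta0) // lerDl.
    have -> : ta * (ln K + 1) = eps / 16 by rewrite /ta; field; rewrite lt0r_neq0.
    by clear; lra.
  have mn : m%:R <= n.
    rewrite nE natrM; apply: (@le_trans _ _ (m%:R * L%:R)); last by rewrite lerDr.
    by rewrite ler_peMr // ler1n.
  apply: (@le_trans _ _ (n * (eps / 8))); last by rewrite mulrC.
  by apply: ler_pM => //; apply: mulr_ge0 => //; apply: mulr_ge0 => //; exact: ltW.
have qYY : q * (ln K * wsum w V) + q * Y' <= q * Y.
  by rewrite -mulrDr ler_wpM2l // YE lerD2l lerNr /Y' /f; move: went; clear; lra.
have mL : m%:R * ln L%:R <= eps / 8 * n.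
  apply: (@le_trans _ _ (m%:R * (eps / 8 * L%:R))); first by rewrite ler_wpM2l.
  have : eps / 8 * (m%:R * L%:R) <= eps / 8 * n.
    by rewrite ler_wpM2l ?divr_ge0 ?(ltW eps0) // nE natrM lerDr.
  by clear; lra.
have kPh : k%:R * Ph - eps / 8 * n <= k%:R * Ph'.
  have := ler_wpM2l (ltW kr) xent; rewrite mulrBr mulrA ke2; clear; lra.
have qYe : (m * L)%N%:R / n * Y = q * Y by [].
rewrite qYe S1E.
have en : 0 < eps * n by rewrite mulr_gt0.
move: S2 qYY qK qY' mL kPh en; rewrite /Y' /e3 /e4 -/f; clear; lra.
Qed.

End PathsCount.

(** * Final choice of constants and the total count *)

Section FinalCount.

Variable R : realType.

Lemma small_log (b e : R) : 0 < b -> 0 < e -> exists2 ga : R, 0 < ga <= b & 2 * ga * ln (2 / ga) <= e.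
Proof.
move=> b0 e0; pose u := Order.min (1 / 2) (Order.min b (e / 8)).
have u0 : 0 < u by rewrite !lt_min b0 !divr_gt0.
have u1 : u <= 1 / 2 by rewrite ge_min lexx.
have ub : u <= b by rewrite !ge_min lexx orbT.
have ue : u <= e / 8 by rewrite !ge_min lexx !orbT.
have uu : 2 * u ^+ 2 <= u.
  by rewrite expr2 mulrA -[X in _ <= X]mul1r ler_wpM2r ?(ltW u0) //; move: u1; clear; lra.
exists (2 * u ^+ 2); first by rewrite mulr_gt0 ?exprn_gt0 //= (le_trans uu).
have iu : 0 < u^-1 by rewrite invr_gt0.
have -> : 2 / (2 * u ^+ 2) = u^-1 ^+ 2 by field; rewrite lt0r_neq0.
rewrite lnXn // (_ : ln u^-1 *+ 2 = 2 * ln u^-1); last by rewrite mulr_natl.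
have h : u * ln u^-1 <= 1.
  have := ler_wpM2l (ltW u0) (ln_le_sub1 iu).
  by rewrite mulrBr divff ?lt0r_neq0 //; move: u0; clear; lra.
have -> : 2 * (2 * u ^+ 2) * (2 * ln u^-1) = 8 * u * (u * ln u^-1) by clear; ring.
apply: (@le_trans _ _ (8 * u * 1)); first by rewrite ler_wpM2l // mulr_ge0 // ltW.
by move: ue; clear; lra.
Qed.

Lemma ln_small (c : R) : 0 < c -> exists n0 : nat, forall n, (n0 <= n)%N -> (0 < n)%N -> ln n%:R <= c * n%:R.
Proof.
move=> c0; have c2 : 0 < c / 2 by rewrite divr_gt0.
exists (Num.bound (2 * `|- 1 - ln (c / 2)| / c)) => n hn n0.
have nr : 0 < n%:R :> R by rewrite ltr0n.
have q0 : 0 < c / 2 * n%:R by rewrite mulr_gt0.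
have h1 := ln_le_sub1 q0; rewrite lnM ?posrE // in h1.
have h2 : 2 * `|- 1 - ln (c / 2)| / c <= n%:R.
  apply: ltW; apply: (lt_le_trans (archi_boundP _)); last by rewrite ler_nat.
  by rewrite divr_ge0 ?mulr_ge0 // ltW.
rewrite ler_pdivrMr // in h2; have h3 := ler_norm (- 1 - ln (c / 2)).
by move: h1 h2 h3; clear; lra.
Qed.

Lemma nat_floor (y : R) : 2 <= y -> exists2 M : nat, M%:R <= y & y / 2 <= M%:R.
Proof.
move=> y2; have y0 : 0 <= y by move: y2; clear; lra.
have := truncn_itv y0 => /andP[h1 h2]; exists (Num.truncn y) => //.
by move: h2; rewrite -natr1; move: y2; clear; lra.
Qed.

Lemma min_codegree_le (k : nat) (T : finType) (G : kgraph k T) (S : {set T}) :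
  #|S| = k.-1 -> (min_codegree G <= degree G S)%N.
Proof.
move=> cS; rewrite /min_codegree.
have : S \in index_enum {set T} by rewrite mem_index_enum.
elim: (index_enum _) => [//|A r IH]; rewrite inE big_cons => /orP[/eqP <-|/IH h].
  by rewrite cS eqxx geq_minl.
by case: ifP => // _; rewrite (leq_trans _ h) // geq_minr.
Qed.

Lemma ln_bin_ge (k N n : nat) : (0 < n)%N -> (n + k.-1 <= N)%N ->
  k.-1%:R * ln n%:R - ln (k.-1)`!%:R <= ln 'C(N, k.-1)%:R :> R.
Proof.
move=> n0 nN; have p : (n ^ k.-1 <= N ^_ k.-1)%N.
  move: nN; move: k.-1 => j; elim: j => [|j IH] h; first by rewrite ffactn0.
  rewrite expnSr ffactnSr; apply: leq_mul; first by apply: IH; rewrite (leq_trans _ h) // leq_add2l.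
  by rewrite leq_subRL; [rewrite addnC (leq_trans _ h) // leq_add2l|rewrite (leq_trans _ h) // ltnW // ltn_addl].
have nr : 0 < n%:R :> R by rewrite ltr0n.
have Cp : (0 < 'C(N, k.-1))%N by rewrite bin_gt0 (leq_trans _ nN) // leq_addl.
rewrite lerBlDr mulr_natl -lnXn // -lnM ?posrE ?ltr0n ?fact_gt0 //.
by rewrite ler_ln ?posrE ?exprn_gt0 ?mulr_gt0 ?ltr0n ?fact_gt0 // -natrX -natrM bin_ffact ler_nat.
Qed.

Lemma split_length (ga : R) (n L : nat) : (0 < L)%N -> 0 < ga <= 1 / 2 -> L%:R + 1 <= ga * n%:R ->
  exists m Nend : nat, [/\ n = (Nend + m * L)%N, ga * n%:R <= Nend%:R & Nend%:R <= 2 * ga * n%:R].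
Proof.
move=> L0 /andP[ga0 ga1] h; have y0 : 0 <= ga * n%:R by rewrite mulr_ge0 // ltW.
have := truncn_itv y0 => /andP[h1 h2]; set g := (Num.truncn (ga * n%:R)).+1 in h2.
have gE : g%:R = (Num.truncn (ga * n%:R))%:R + 1 :> R by rewrite /g -natr1.
have L1 : 1 <= L%:R :> R by rewrite ler1n.
have gn : (g <= n)%N.
  rewrite -(ler_nat R) gE; have : ga * n%:R <= 1 / 2 * n%:R by rewrite ler_wpM2r.
  by move: h h1 L1; clear; lra.
exists ((n - g) %/ L)%N, (g + (n - g) %% L)%N.
have hm : ((n - g) %% L)%:R <= L%:R :> R by rewrite ler_nat ltnW // ltn_mod.
split.
- by rewrite -addnA [(_ %% _ + _)%N]addnC -divn_eq subnKC.
- by rewrite natrD; apply: (le_trans (ltW h2)); rewrite lerDl.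
by rewrite natrD; move: h h1 gE hm; clear; lra.
Qed.

Lemma ln_product_le (a b t v xi y P u : R) (s M m q r : nat) :
  0 < a -> 0 < b -> 0 < t -> 0 < v -> 0 < xi -> 0 < P -> 0 < u ->
  (a * t ^+ s) ^+ M * (expR y * ((b * v ^+ q) ^+ m * (xi * t) ^+ r)) <= P * (2 * u) * 2 ^+ M ->
  M%:R * (ln a + s%:R * ln t) + y + m%:R * (ln b + q%:R * ln v) + r%:R * (ln xi + ln t)
   <= ln P + (ln 2 + ln u) + M%:R * ln 2.
Proof.
move=> a0 b0 t0 v0 xi0 P0 u0 h.
have h1 : 0 < (a * t ^+ s) ^+ M by rewrite exprn_gt0 // mulr_gt0 // exprn_gt0.
have h2 : 0 < (b * v ^+ q) ^+ m by rewrite exprn_gt0 // mulr_gt0 // exprn_gt0.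
have h3 : 0 < (xi * t) ^+ r by rewrite exprn_gt0 // mulr_gt0.
have h4 : 0 < 2 ^+ M :> R by rewrite exprn_gt0.
have h5 : 0 < P * (2 * u) by rewrite !mulr_gt0.
have lX (z : R) (i : nat) : 0 < z -> ln (z ^+ i) = i%:R * ln z by move=> z0; rewrite lnXn // mulr_natl.
have h6 : 0 < expR y * ((b * v ^+ q) ^+ m * (xi * t) ^+ r) by rewrite !mulr_gt0 ?expR_gt0.
move: h; rewrite -ler_ln ?posrE; [|exact: mulr_gt0|exact: mulr_gt0].
rewrite (lnM (x := _ ^+ M)) ?posrE // (lnM (x := expR y)) ?posrE ?expR_gt0 ?mulr_gt0 // expRK.
rewrite (lnM (x := _ ^+ m)) ?posrE // (lnM (x := P * _)) ?posrE // !lX ?mulr_gt0 ?exprn_gt0 //.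
rewrite (lnM (x := a)) ?posrE ?exprn_gt0 // (lnM (x := b)) ?posrE ?exprn_gt0 // !lX //.
rewrite (lnM (x := xi)) ?posrE // (lnM (x := P)) ?posrE ?mulr_gt0 // (lnM (x := 2)) ?posrE //.
by clear; lra.
Qed.

(** Constants are fixed in the order: absorption ([cA], [te]), leftover ([xi], [ga]), path length
    [L]. The leftover has to fit into the absorbing blocks, and [L] has to be so large that the
    connectors fit into the leftover. *)
Lemma cycles_lower (k : nat) (delta eps : R) : (1 < k)%N -> 1 / 2 < delta -> 0 < eps ->
  exists n0 : nat, forall (T : finType) (G : kgraph k T) (x : {set T} -> R),
  (n0 <= #|T|)%N -> delta * #|T|%:R <= (min_codegree G)%:R -> perfect_fractional_matching G x ->
  (0 < num_tight_hamilton_cycles G)%N /\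
  k%:R * (\sum_(e in edges G) x e * ln (1 / x e)) - #|T|%:R * ln 'C(#|T|, k.-1)%:R + #|T|%:R * ln #|T|%:R - #|T|%:R
    - eps * #|T|%:R <= ln (num_tight_hamilton_cycles G)%:R.
Proof.
move=> k1 de2 eps0.
have kr : 0 < k%:R :> R by rewrite ltr0n ltnW.
have [f [f0 fE]] : exists f : R, 0 <= f /\ f = ln (k.-1)`!%:R.
  by exists (ln (k.-1)`!%:R); split=> //; apply: ln_ge0; rewrite ler1n fact_gt0.
have [ep [ep0 epE]] : exists ep : R, 0 < ep /\ eps = 16 * ep.
  by exists (eps / 16); split; [rewrite divr_gt0|clear; field].
have [eta [eta0 eta8 etad]] : exists e : R, [/\ 0 < e, e <= 1 / 8 & 1 / 2 + 4 * e <= delta].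
  exists (Order.min ((delta - 1 / 2) / 4) (1 / 8)); rewrite lt_min !divr_gt0 ?subr_gt0 // ge_min lexx orbT.
  split=> //; have : Order.min ((delta - 1 / 2) / 4) (1 / 8) <= (delta - 1 / 2) / 4 by rewrite ge_min lexx.
  by clear; lra.
have etah : 0 < eta < 1 / 2 by rewrite eta0; move: eta8; clear; lra.
have [l [ca [tha [rho [[l0 ca0 tha0 /andP[rho0 rho1]] [n1 habs]]]]]] := @absorbing_blocks R k eta k1 etah.
have [q [be [bep be1 hcon]]] : exists q be, [/\ 0 < be, be <= 1 & connects k (1 / 2 + eta) q be].
  have [q hq0] := connects_exists k1 eta0; have [be0 be00 hcon0] := hq0 q (leqnn _).
  exists q, (Order.min be0 1); rewrite lt_min be00 ltr01 ge_min lexx orbT; split=> //.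
  move=> T E Z F a b h1 h2 h3 h4 h5 h6 h7; apply: le_trans (hcon0 T E Z F a b h1 h2 h3 h4 h5 h6 h7).
  by rewrite ler_wpM2r ?exprn_ge0 // ge_min lexx.
have eta08 : 0 < eta <= 1 / 8 by rewrite eta0.
have [th [ga0 [[/andP[th0 th1] ga00] hpc]]] := @paths_count R k eta ep k1 eta08 ep0.
pose s := (l + 2 * k.-1)%N.
have s0 : (0 < s)%N by rewrite /s addn_gt0 l0.
have sr : 0 < s%:R :> R by rewrite ltr0n.
have s1 : 1 <= s%:R :> R by rewrite ler1n.
have [lr [lr0 lrE]] : exists lr : R, 0 < lr /\ lr = ln rho^-1.
  by exists (ln rho^-1); split=> //; apply: ln_gt0; rewrite invf_gt1.
have l20 : 0 < ln 2 :> R by apply: ln_gt0; rewrite ltr1n.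
have l21 : ln 2 <= 1 :> R by have := @ln_le_sub1 R 2; rewrite ltr0n => /(_ isT); clear; lra.
(* From [(1 / 2)^count <= t rho^M] the count is at least [(M lr - ln t) / ln 2]; half of [M lr] is
   given up for [ln t]. *)
have [cA [cA0 cAE]] : exists cA : R, 0 < cA /\ 2 * cA * ln 2 = lr.
  by exists (lr / (2 * ln 2)); split; [rewrite divr_gt0 // mulr_gt0|field; rewrite lt0r_neq0].
have [te [te0 te1 te2 te3 tec]] : exists te : R, [/\ 0 < te, te <= tha, te <= th / 4, te <= eta &
    te * `|ln ca| + te * f + te <= ep / 8].
  have al0 : 0 < `|ln ca| + f + 1 by have := normr_ge0 (ln ca); move: f0; clear; lra.
  exists (Order.min tha (Order.min (th / 4) (Order.min eta (ep / 8 / (`|ln ca| + f + 1))))); split.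
  - by rewrite !lt_min tha0 eta0 !divr_gt0.
  - by rewrite ge_min lexx.
  - by rewrite !ge_min lexx !orbT.
  - by rewrite !ge_min lexx !orbT.
  - rewrite -mulrDr -[X in _ + X]mulr1 -mulrDr -ler_pdivlMr //.
    by rewrite !ge_min lexx !orbT.
have tca : 0 <= te * `|ln ca| by rewrite mulr_ge0 // ltW.
have tf : 0 <= te * f by rewrite mulr_ge0 // ltW.
(* Chosen such that [2 xi t <= cA M]: every vertex has at least twice as many absorbing blocks as
   there are leftover vertices. *)
have [xi [xi0 xiE]] : exists xi : R, 0 < xi /\ xi * (4 * s%:R) = cA * te.
  exists (cA * te / (4 * s%:R)); split; first by rewrite divr_gt0 ?mulr_gt0.
  by rewrite divfK // lt0r_neq0 // mulr_gt0.
have [ga [gap g1 g2 g3 glog]] : exists ga : R, [/\ 0 < ga, ga <= ga0, ga <= 1 / 2, ga <= xi / 2 & 2 * ga * ln (2 / ga) <= ep].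
  have b0 : 0 < Order.min ga0 (Order.min (1 / 2) (xi / 2)) by rewrite !lt_min ga00 !divr_gt0.
  have [ga /andP[gap gab] glog] := small_log b0 ep0.
  by exists ga; split=> //; apply: (le_trans gab); rewrite !ge_min lexx ?orbT.
have [L1 hL] := hpc ga gap g1 g2.
have [b0 [b00 b0E]] : exists b0 : R, 0 <= b0 /\ - b0 <= ln (be / 2).
  by exists `|ln (be / 2)|; split=> //; rewrite lerNnormlW.
have bg0 : 0 < be * ga by rewrite mulr_gt0.
(* These bounds make the connectors small in comparison with the leftover, and the cost [b0] of each
   of them negligible. *)
have [L LL1 [Lq Lb]] : exists2 L, (L1 <= L)%N & 8 * q%:R ^+ 2 <= be * ga * L%:R /\ b0 <= ep * L%:R.
  pose L := maxn L1 (maxn (Num.bound (8 * q%:R ^+ 2 / (be * ga))).+1 (Num.bound (b0 / ep)).+1).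
  exists L; first by rewrite leq_maxl.
  split.
    have p : 0 <= 8 * q%:R ^+ 2 / (be * ga) by rewrite divr_ge0 ?mulr_ge0 ?exprn_ge0 // ltW.
    rewrite [be * ga * _]mulrC -ler_pdivrMr //.
    apply: ltW; apply: (lt_le_trans (archi_boundP p)); rewrite ler_nat ltnW // /L.
    by rewrite leq_max leq_max leqnn orbT.
  have p : 0 <= b0 / ep by rewrite divr_ge0 // ltW.
  rewrite [ep * _]mulrC -ler_pdivrMr //.
  apply: ltW; apply: (lt_le_trans (archi_boundP p)); rewrite ler_nat ltnW // /L.
  by rewrite !leq_max leqnn !orbT.
have [kL [n2 hcnt]] := hL L LL1.
have Lpos : (0 < L)%N by rewrite (leq_trans _ kL) // ltnW.
have Lr : 0 < L%:R :> R by rewrite ltr0n.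
have k20 : 0 < k%:R + 2 :> R by rewrite addr_gt0.
have [c9 [c90 c91 c92]] : exists c9 : R, [/\ 0 < c9, c9 <= te * lr / (4 * s%:R) & c9 <= ep / (k%:R + 2)].
  exists (Order.min (te * lr / (4 * s%:R)) (ep / (k%:R + 2))).
  by rewrite lt_min !divr_gt0 ?mulr_gt0 // !ge_min !lexx orbT.
have [n3 hln] := ln_small c90.
pose B1 := k%:R / te; pose B2 := 2 * s%:R / te; pose B3 := 4 * (L%:R + 1) / ga.
pose B4 := 16 * q%:R ^+ 2 / (be * ga); pose B5 := b0 / ep.
exists (maxn (maxn n1 (maxn n3 (maxn (2 * n2) (maxn k 3))))
  (maxn (Num.bound B1).+1 (maxn (Num.bound B2).+1 (maxn (Num.bound B3).+1 (maxn (Num.bound B4).+1 (Num.bound B5).+1))))).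
move=> T G x; rewrite !geq_max => /andP[/and5P[nn1 nn3 nn2 nk n33] /and5P[nb1 nb2 nb3 nb4 nb5]] cod [x0 xdeg].
set E := edges G in x0 xdeg *.
pose nT := #|T|; pose t : R := nT%:R.
rewrite -/nT -/t.
have bnd (y z : R) : 0 <= y -> 0 < z -> ((Num.bound (y / z)).+1 <= nT)%N -> y <= z * t.
  move=> y0 z0 h; rewrite mulrC -ler_pdivrMr //; have p : 0 <= y / z by rewrite divr_ge0 // ltW.
  by apply: ltW; apply: (lt_le_trans (archi_boundP p)); rewrite ler_nat ltnW.
have nT0 : (0 < nT)%N by apply: leq_trans n33.
have t0 : 0 < t by rewrite ltr0n.
have t3 : 3 <= t by rewrite ler_nat.
have kt : k%:R <= te * t by apply: bnd nb1.
have st : 2 * s%:R <= te * t by apply: bnd nb2; rewrite ?mulr_ge0.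
have Lt : 4 * (L%:R + 1) <= ga * t by apply: bnd nb3; rewrite ?mulr_ge0 ?addr_ge0.
have qt : 16 * q%:R ^+ 2 <= be * ga * t by apply: bnd nb4; rewrite ?mulr_ge0 ?exprn_ge0.
have bt : b0 <= ep * t by apply: bnd nb5.
have lt9 := hln nT nn3 nT0; rewrite -/t in lt9.
have lt1 : ln t <= te * lr / (4 * s%:R) * t by apply: (le_trans lt9); rewrite ler_wpM2r ?(ltW t0).
have lt2 : (k%:R + 2) * ln t <= ep * t.
  have : ln t <= ep / (k%:R + 2) * t by apply: (le_trans lt9); rewrite ler_wpM2r ?(ltW t0).
  by rewrite mulrAC ler_pdivlMr // mulrC.
have lt0 : 0 <= ln t by rewrite ln_ge0 // ler1n.
have [|M M1 M2] := @nat_floor (te * t / s%:R); first by rewrite ler_pdivlMr.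
have Ms : M%:R * s%:R <= te * t by rewrite -ler_pdivlMr.
have Mlow : te * t <= 2 * s%:R * M%:R.
  by move: M2; rewrite ler_pdivrMr // ler_pdivrMr //; clear; lra.
have M0 : (0 < M)%N.
  rewrite lt0n; apply: contraTneq Mlow => ->; rewrite mulr0 -ltNge mulr_gt0 //.
have Mt : M%:R <= te * t by apply: le_trans Ms; rewrite ler_peMr.
have Eu : {in E, forall e : {set T}, #|e| = k} by move=> e; exact: edges_uniform.
have degS (S : {set T}) : #|S| = k.-1 -> delta * t <= #|[set v | v |: S \in E]%SET|%:R.
  by move=> cS; apply: (le_trans cod); rewrite ler_nat; exact: min_codegree_le.
have dirT : dirac_on k (1 / 2 + eta) E setT set0.
  split=> // [e _|S cS _]; first by rewrite -setI_eq0 finset.setI0.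
  rewrite cardsT -/nT -/t; apply: (@le_trans _ _ (delta * t)).
    by rewrite ler_wpM2r ?(ltW t0) //; move: etad eta0; clear; lra.
  by apply: (le_trans (degS S cS)); rewrite ler_nat subset_leq_card //; apply/fintype.subsetP => v; rewrite !inE.
pose e0 := take k.-1 (enum T).
have k1T : (k.-1 <= nT)%N by rewrite (leq_trans (leq_pred k)).
have se0 : size e0 = k.-1 by rewrite size_takel // -cardE.
have ue0 : uniq e0 by rewrite take_uniq // enum_uniq.
have hM : (M * (l + 2 * k.-1))%:R <= tha * #|T|%:R.
  by rewrite natrM; apply: (le_trans Ms); rewrite ler_wpM2r.
pose A (bs : M.-tuple ((l + 2 * k.-1).-tuple T)) := [&& uniq (e0 ++ flat bs), tight k E (e0 ++ flat bs) &
  [forall v, (1 / 2) ^+ count (absorbs k E l v) (map val bs) <= #|T|%:R * rho ^+ M]].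
have cb : (ca * t ^+ s) ^+ M <= #|[set bs | A bs]%SET|%:R := habs T E e0 M dirT nn1 se0 ue0 hM.
have spots bs v : A bs -> cA * M%:R <= (count (absorbs k E l v) (map val bs))%:R.
  move=> /and3P[_ _ /forallP/(_ v)]; set cnt := count _ _ => h.
  have h2 : (1 / 2) ^+ cnt > 0 :> R by rewrite exprn_gt0 // divr_gt0.
  have h3 : ln ((1 / 2) ^+ cnt) <= ln (t * rho ^+ M).
    by rewrite ler_ln ?posrE // mulr_gt0 // exprn_gt0.
  rewrite lnXn ?divr_gt0 // lnM ?posrE ?exprn_gt0 // lnXn // div1r lnV ?posrE ?ltr0n // in h3.
  have rE : ln rho = - lr by rewrite lrE lnV ?opprK // posrE.
  rewrite rE -[X in X <= _]mulr_natl -[X in _ <= _ + X]mulr_natl in h3.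
  have h4 : 2 * ln t <= M%:R * lr.
    have : 4 * s%:R * ln t <= te * lr * t.
      by move: lt1; rewrite mulrAC ler_pdivlMr ?mulr_gt0 //; clear; lra.
    have := ler_wpM2r (ltW lr0) Mlow => h5 h6; rewrite -(ler_pM2l sr); move: h5 h6; clear; lra.
  have h5 : cA * M%:R * ln 2 <= cnt%:R * ln 2.
    have : cA * M%:R * ln 2 = M%:R * lr / 2 by rewrite -cAE; clear; field.
    by move: h3 h4; clear; lra.
  by move: h5; rewrite ler_pM2r.
pose a0 := (k.-1 + M * s)%N.
have a0t : a0%:R <= 2 * te * t.
  have : k.-1%:R <= k%:R :> R by rewrite ler_nat leq_pred.
  by rewrite /a0 natrD natrM; move: kt Ms; clear; lra.
have tet : te * t <= 1 / 8 * t by rewrite ler_wpM2r ?(ltW t0) // (le_trans te3).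
have a0T : (a0 <= nT)%N by rewrite -(ler_nat R) -/t; move: a0t tet t0; clear; lra.
pose n := (nT - a0)%N; pose nr : R := n%:R.
have nE : nr = t - a0%:R by rewrite /nr /n natrB.
have a0p : 0 <= a0%:R :> R by [].
have nt : nr <= t by rewrite nE; move: a0p; clear; lra.
have nhalf : t / 2 <= nr by rewrite nE; move: a0t tet t0; clear; lra.
have nr0 : 0 < nr by apply: lt_le_trans nhalf; rewrite divr_gt0.
have n0 : (0 < n)%N by rewrite -(ltr_nat R).
have n2n : (n2 <= n)%N.
  by rewrite -(ler_nat R) -/nr; move: nn2; rewrite -(ler_nat R) natrM -/nT -/t; move: nhalf; clear; lra.
have [|m [Nend [nmE gN gN2]]] := @split_length ga n L Lpos (introT andP (conj gap g2)).
  by have := ler_wpM2l (ltW gap) nhalf; rewrite -/nr; move: Lt Lr; clear; lra.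
rewrite -/nr in gN gN2.
have Ne0 : 0 < Nend%:R :> R by apply: lt_le_trans gN; rewrite mulr_gt0.
have mL : m%:R * L%:R <= t.
  by apply: le_trans nt; rewrite /nr nmE natrD natrM lerDr.
pose V (bs : M.-tuple ((l + 2 * k.-1).-tuple T)) := ~: [set y in e0 ++ flat bs]%SET.
have cVc bs : A bs -> #|~: V bs| = a0.
  by move=> /and3P[ub _ _]; rewrite /V finset.setCK cardsE (card_uniqP ub) size_cat size_flat size_tuple se0.
have cV bs : A bs -> #|V bs| = n by move=> hA; rewrite cardsCs cVc.
pose N : R := nr ^+ k.-1.
pose Ph := \sum_(e in E) phi N (x e).
pose X := nr * ln nr - nr - Nend%:R * ln nr + k%:R * Ph + nr * f - ep * nr.
pose good bs (B : pred (m.-tuple (L.-tuple T))) := A bs ->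
   (forall Ps, B Ps -> [/\ uniq (flat Ps), all (mem (V bs)) (flat Ps), all (fun p => tight k E (val p)) Ps &
        dirac_on k (1 / 2 + eta) E (V bs :\: [set y in flat Ps]%SET) set0]) /\
   expR X <= #|[set Ps | B Ps]%SET|%:R.
(* The path systems depend on the blocks already chosen; [choice] below turns them into a function
   of [bs]. *)
have exg bs : exists B, good bs B.
  case: (boolP (A bs)) => [hA|nA]; last by exists xpredT => /(negP nA).
  have cVb := cV bs hA.
  have codV (S : {set T}) : #|S| = k.-1 -> (1 / 2 + 2 * eta) * #|V bs|%:R <= #|[set v in V bs | v |: S \in E]%SET|%:R.
    move=> cS; rewrite cVb -/nr.
    have : (#|[set v | v |: S \in E]%SET| <= #|[set v in V bs | v |: S \in E]%SET| + a0)%N.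
      rewrite -(cVc bs hA); apply: leq_trans (leq_card_setU _ _); apply: subset_leq_card.
      apply/fintype.subsetP => v; rewrite !inE => ->; rewrite andbT; exact: orbN.
    rewrite -(ler_nat R) natrD; have := degS S cS.
    have h1 : (1 / 2 + 4 * eta) * t <= delta * t by rewrite ler_wpM2r // ltW.
    have h2 : (1 / 2 + 2 * eta) * nr <= (1 / 2 + 2 * eta) * t.
      by rewrite ler_wpM2l //; move: eta0; clear; lra.
    have h3 : te * t <= eta * t by rewrite ler_wpM2r // ltW.
    by move: a0t h1 h2 h3; clear; lra.
  have thV : #|~: V bs|%:R <= th * #|V bs|%:R.
    rewrite cVc // cVb -/nr; have : te * t <= th / 4 * t by rewrite ler_wpM2r // ltW.
    have : th * (t / 2) <= th * nr by rewrite ler_wpM2l // ltW.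
    by move: a0t; clear; lra.
  have n2V : (n2 <= #|V bs|)%N by rewrite cVb.
  have nmV : #|V bs| = (Nend + m * L)%N by rewrite cVb.
  have gN' : ga * #|V bs|%:R <= Nend%:R by rewrite cVb.
  have gN2' : Nend%:R <= 2 * ga * #|V bs|%:R by rewrite cVb.
  have [B [hB1 hB2]] := hcnt T E (V bs) x m Nend Eu codV n2V thV x0 xdeg nmV gN' gN2'.
  exists B => _; split=> //; rewrite cVb -/nr -/N -/Ph -fE in hB2; exact: hB2.
have [Bf hBf] := choice exg.
have cZ bs (Ps : m.-tuple (L.-tuple T)) : A bs -> Bf bs Ps ->
   V bs :\: [set y in flat Ps]%SET = ~: [set y in e0 ++ flat bs ++ flat Ps]%SET /\
   #|V bs :\: [set y in flat Ps]%SET| = Nend.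
  move=> hA hB; have [h _] := hBf bs hA; have [uP PV _ _] := h Ps hB; split.
    by apply/setP => y; rewrite !inE !mem_cat !negb_or andbC andbA.
  have sub : [set y in flat Ps]%SET \subset V bs.
    by apply/fintype.subsetP => y; rewrite inE => /(allP PV).
  rewrite cardsD (finset.setIidPr sub) cV // cardsE (card_uniqP uP) size_flat size_tuple nmE.
  by rewrite addnK.
have q2 : (q * q + q * (m.+1 * q))%:R <= be / 2 * Nend%:R.
  have h1 : be / 2 * (ga * (t / 2)) <= be / 2 * Nend%:R.
    rewrite ler_wpM2l ?divr_ge0 ?(ltW bep) //; apply: le_trans gN; rewrite ler_wpM2l // ltW //.
  have h2 : 8 * q%:R ^+ 2 * m%:R <= be * ga * t.
    apply: (@le_trans _ _ (be * ga * L%:R * m%:R)); first by rewrite ler_wpM2r.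
    by rewrite -mulrA [L%:R * _]mulrC ler_wpM2l // ltW.
  have -> : (q * q + q * (m.+1 * q))%:R = q%:R ^+ 2 * m%:R + 2 * q%:R ^+ 2 :> R.
    by rewrite natrD !natrM -natr1; clear; ring.
  by move: h1 h2 qt; clear; lra.
have qm : (m.+1 * q <= Nend)%N.
  have : (m.+1 * q <= q * q + q * (m.+1 * q))%N.
    by case: (q) => [|q']; rewrite ?muln0 // (leq_trans (leq_pmull _ (ltn0Sn q'))) // leq_addl.
  rewrite -(ler_nat R) => h; rewrite -(ler_nat R); apply: (le_trans h); apply: (le_trans q2).
  have := ler_wpM2r (ltW Ne0) be1; move: Ne0; clear; lra.
pose r := (Nend - m.+1 * q)%N.
have total : (k.-1 + M * (l + 2 * k.-1) + m * L + m.+1 * q + r = #|T|)%N.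
  rewrite -[LHS]addnA subnKC // -[LHS]addnA [(m * L + Nend)%N]addnC -nmE -/s -/a0 subnKC //.
have rN : r%:R <= Nend%:R :> R by rewrite ler_nat leq_subr.
have rxi : r%:R <= xi * t.
  apply: (le_trans rN); apply: (le_trans gN2).
  apply: (@le_trans _ _ (2 * ga * t)); first by rewrite ler_wpM2l // mulr_ge0 // ltW.
  by rewrite ler_wpM2r ?(ltW t0) //; move: g3; clear; lra.
have xiM : 2 * (xi * t) <= cA * M%:R.
  have h1 := ler_wpM2l (ltW cA0) Mlow.
  have h2 : xi * (4 * s%:R) * t = cA * te * t by rewrite xiE.
  by rewrite -(ler_pM2l sr); move: h1 h2; clear; lra.
have xit0 : 0 < xi * t by rewrite mulr_gt0.
have c1p : 0 < be / 2 * Nend%:R ^+ q by rewrite mulr_gt0 ?divr_gt0 ?exprn_gt0.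
have a1p : 0 < ca * t ^+ s by rewrite mulr_gt0 ?exprn_gt0.
have data := @count_data R T k E e0 l M m L q r ((ca * t ^+ s) ^+ M) (expR X)
   ((be / 2 * Nend%:R ^+ q) ^+ m.+1) ((xi * t) ^+ r) A Bf
   (exprn_ge0 _ (ltW a1p)) (expR_ge0 _) (exprn_ge0 _ (ltW c1p)) (exprn_ge0 _ (ltW xit0)).
have AB bs : A bs -> okB E e0 bs by move=> /and3P[h1 h2 _]; rewrite /okB h1 h2.
have BP bs Ps : A bs -> Bf bs Ps -> okP E e0 bs Ps.
  move=> hA hB; have [h _] := hBf bs hA; have [uP PV tP _] := h Ps hB; rewrite /okP uP tP andbT /=.
  by apply/hasPn => y /(allP PV); rewrite !inE.
have {}data := data AB BP cb (fun bs hA => (hBf bs hA).2).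
have DATA : (ca * t ^+ s) ^+ M * (expR X * ((be / 2 * Nend%:R ^+ q) ^+ m.+1 * (xi * t) ^+ r)) <=
   #|[set d : datum T k l M m L q r | okD E e0 d]%SET|%:R.
  apply: data => [bs Ps hA hB|bs Ps Qs hA hB hQ].
    have [h _] := hBf bs hA; have [uP PV tP dZ] := h Ps hB; have [ZE cZN] := cZ bs Ps hA hB.
    have /and3P[ub _ _] := hA.
    rewrite ZE in dZ cZN; rewrite -cZN.
    apply: count_conns dZ (ltW bep) hcon _ _ => //; rewrite cZN //.
    by rewrite -(ltr_nat R).
  apply: count_spots; first exact: ltW.
    exact: (size_rest se0 total (AB bs hA) (BP bs Ps hA hB) hQ).
  by move=> v _; apply: le_trans (spots bs v hA); move: rxi xiM; clear; lra.
set Psi := num_tight_hamilton_cycles G.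
have CO : (#|[set d : datum T k l M m L q r | okD E e0 d]%SET| <= Psi * (2 * nT.+1) * 2 ^ M)%N.
  apply: (leq_trans (count_orders k1 se0 M0 kL total (G := G) erefl)).
  by rewrite leq_mul2r card_orders_le orbT.
have lhs0 : 0 < (ca * t ^+ s) ^+ M * (expR X * ((be / 2 * Nend%:R ^+ q) ^+ m.+1 * (xi * t) ^+ r)).
  by rewrite mulr_gt0 ?exprn_gt0 // mulr_gt0 ?expR_gt0 // mulr_gt0 ?exprn_gt0.
have Psi0 : (0 < Psi)%N.
  rewrite lt0n; apply: contraTneq (lt_le_trans lhs0 DATA) => P0.
  by move: CO; rewrite P0 !mul0n leqn0 => /eqP ->; rewrite ltxx.
split=> //.
have Pr : 0 < Psi%:R :> R by rewrite ltr0n.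
have be20 : 0 < be / 2 by rewrite divr_gt0.
have main : M%:R * (ln ca + s%:R * ln t) + X + m.+1%:R * (ln (be / 2) + q%:R * ln Nend%:R) + r%:R * (ln xi + ln t)
   <= ln Psi%:R + (ln 2 + ln (t + 1)) + M%:R * ln 2.
  apply: ln_product_le => //; first by rewrite addr_gt0.
  apply: (le_trans DATA); move: CO; rewrite -(ler_nat R) !natrM natrX.
  by rewrite (_ : nT.+1%:R = t + 1) // /t natr1.
(* The total weight of [x] is [t / k], so returning from [phi N] to entropy costs [t (k - 1) ln nr];
   together with [nr * f] this becomes the binomial coefficient. *)
have HPh : k%:R * Ph = k%:R * (\sum_(e in E) x e * ln (1 / x e)) - t * (k.-1%:R * ln nr).
  have N0 : 0 < N by rewrite exprn_gt0.
  have lnN : ln N = k.-1%:R * ln nr by rewrite /N lnXn // mulr_natl.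
  have -> : Ph = \sum_(e in E) x e * ln (1 / x e) - (\sum_(e in E) x e) * ln N.
    rewrite mulr_suml -sumrB; apply: eq_bigr => e eE; rewrite /phi.
    have := x0 e eE; rewrite le_eqVlt => /orP[/eqP xz|xp]; first by rewrite -xz !mul0r subr0 oppr0.
    by rewrite lnM ?posrE // div1r lnV ?posrE //; clear; ring.
  have kx : t = k%:R * \sum_(e in E) x e.
    rewrite -(edeg_sum x Eu (V := setT)) => [|e _]; last exact: finset.subsetT.
    rewrite (eq_bigr (fun _ => 1)) => [|v _]; last exact: xdeg.
    by rewrite sumr_const cardsT.
  by rewrite kx lnN; clear; ring.
have lnt : ln nr <= ln t by rewrite ler_ln.
have bin : k.-1%:R * ln nr - f <= ln 'C(nT, k.-1)%:R.
  by rewrite fE; apply: ln_bin_ge => //; rewrite -[X in (_ <= X)%N](subnK a0T) leq_add2l /a0 leq_addr.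
have F0 := ler_wpM2l (ltW t0) bin.
have F1 : - (te * t * `|ln ca|) <= M%:R * ln ca.
  have h1 : M%:R * `|ln ca| <= te * t * `|ln ca| by rewrite ler_wpM2r.
  have h2 : M%:R * - ln ca <= M%:R * `|ln ca| by rewrite ler_wpM2l // -normrN ler_norm.
  by move: h1 h2; clear; lra.
have F2 : nr * ln t - 4 * te * t <= nr * ln nr.
  have e1 : nr = t * (1 + - (a0%:R / t)) by rewrite nE; field; rewrite lt0r_neq0.
  have y2 : - (1 / 2) <= - (a0%:R / t).
    by rewrite lerN2 ler_pdivrMr //; move: a0t tet t0; clear; lra.
  have p : 0 < 1 + - (a0%:R / t) by move: y2; clear; lra.
  have ay0 : 0 <= a0%:R / t by rewrite divr_ge0 // ltW.
  have := ln_ge_abs y2; rewrite normrN (ger0_norm ay0) => h.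
  have e2 : ln nr = ln t + ln (1 + - (a0%:R / t)) by rewrite {1}e1 lnM ?posrE.
  have h2 := ler_wpM2l (ltW nr0) h.
  have h3 : nr * (a0%:R / t) <= a0%:R by rewrite mulrA ler_pdivrMr // mulrC ler_wpM2l.
  by rewrite e2; move: h2 h3 a0t; clear; lra.
have F3 : Nend%:R * ln nr <= Nend%:R * ln t by rewrite ler_wpM2l.
have F4 : - (2 * (ep * t)) <= m.+1%:R * ln (be / 2).
  have h1 : m.+1%:R * (- b0) <= m.+1%:R * ln (be / 2) by rewrite ler_wpM2l.
  have h2 : m%:R * b0 <= m%:R * (ep * L%:R) by rewrite ler_wpM2l.
  have h3 : ep * (m%:R * L%:R) <= ep * t by rewrite ler_wpM2l // ltW.
  by move: h1 h2 h3 bt; rewrite -natr1; clear; lra.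
have g20 : 0 < 2 / ga by rewrite divr_gt0.
have lg : ln (2 / ga) = - ln (ga / 2).
  by rewrite -lnV ?posrE ?divr_gt0 // invfM invrK mulrC.
have gh0 : 0 < ga / 2 by rewrite divr_gt0.
have F5a : ln t - ln (2 / ga) <= ln Nend%:R.
  rewrite lg opprK -lnM ?posrE // ler_ln ?posrE ?mulr_gt0 //; apply: le_trans gN.
  by have := ler_wpM2l (ltW gap) nhalf; clear; lra.
have F5b : - ln (2 / ga) <= ln xi.
  by rewrite lg opprK ler_ln ?posrE //; move: g3 gap; clear; lra.
have F5 : Nend%:R * (ln t - ln (2 / ga)) <= m.+1%:R * (q%:R * ln Nend%:R) + r%:R * (ln xi + ln t).
  have NE : Nend%:R = m.+1%:R * q%:R + r%:R :> R by rewrite -natrM -natrD subnKC.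
  have h1 : m.+1%:R * q%:R * (ln t - ln (2 / ga)) <= m.+1%:R * q%:R * ln Nend%:R.
    by rewrite ler_wpM2l // mulr_ge0.
  have h2 : r%:R * (ln t - ln (2 / ga)) <= r%:R * (ln xi + ln t).
    by rewrite ler_wpM2l //; move: F5b; clear; lra.
  by rewrite {1}NE; move: h1 h2; clear; lra.
have lg0 : 0 <= ln (2 / ga) by rewrite ln_ge0 // ler_pdivlMr //; move: g2; clear; lra.
have F6 : Nend%:R * ln (2 / ga) <= ep * t.
  apply: (@le_trans _ _ (2 * ga * t * ln (2 / ga))).
    rewrite ler_wpM2r //; apply: (le_trans gN2); rewrite ler_wpM2l // mulr_ge0 // ltW //.
  by rewrite mulrAC ler_wpM2r // ltW.
have F7 : nr = t - k.-1%:R - M%:R * s%:R by rewrite nE /a0 natrD natrM; clear; ring.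
have ke : k%:R = k.-1%:R + 1 :> R by rewrite natr1 prednK // ltnW.
have F8 : k.-1%:R * ln t + ln 2 + ln (t + 1) <= ep * t.
  have h1 : ln 2 <= ln t by rewrite ler_ln ?posrE //; move: t3; clear; lra.
  have h2 : ln (t + 1) <= ln t + ln t.
    rewrite -lnM ?posrE // ler_ln ?posrE ?mulr_gt0 ?addr_gt0 //.
    have : 3 * t <= t * t by rewrite ler_wpM2r // ltW.
    by move: t3; clear; lra.
  by move: lt2 h1 h2; rewrite ke; clear; lra.
have F9 : t * f - 2 * te * t * f <= nr * f.
  by have := ler_wpM2r f0 a0t; rewrite nE; clear; lra.
have F10 : M%:R * ln 2 <= te * t by apply: le_trans Mt; rewrite ler_piMr.
have F11 := ler_wpM2r (ltW t0) tec.
have F12 : ep * nr <= ep * t by rewrite ler_wpM2l // ltW.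
have F13 : (M%:R * s%:R + nr) * ln t = (t - k.-1%:R) * ln t by rewrite F7; congr (_ * _); clear; ring.
have tca' : 0 <= te * `|ln ca| * t by rewrite mulr_ge0 // ltW.
have tf' : 0 <= te * f * t by rewrite mulr_ge0 // ltW.
have te' : 0 <= te * t by rewrite mulr_ge0 // ltW.
have ept : 0 <= ep * t by rewrite mulr_ge0 // ltW.
move: main; rewrite /X HPh epE.
move: (\sum_(e in E) _) (ln 'C(nT, k.-1)%:R) F0 => H lC F0.
move: F0 F1 F2 F3 F4 F5 F6 F8 F9 F10 F11 F12 F13 tca' tf' te' ept nt; clear; lra.
Qed.

End FinalCount.

Theorem theorem1p6 (R : realType) (k : nat) (delta : R)
    (hk : (2 <= k)%N) (hdelta : 1 / 2 < delta) (eps : R) (heps : 0 < eps) :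
  exists n0 : nat, forall (T : finType) (G : kgraph k T) (n : nat),
    n = #|T| -> (n0 <= n)%N ->
    delta * n%:R <= (min_codegree G)%:R ->
    (k%:R%:E * entropy R G
       - (n%:R * log2 ('C(n, k.-1)%:R : R))%:E
       + (n%:R * log2 (n%:R : R))%:E
       - (n%:R * log2 (expR 1 : R))%:E
       - (eps * n%:R)%:E
     <= log2e (num_tight_hamilton_cycles G)%:R%:E)%E.
Proof.
have l20 : 0 < ln 2 :> R by apply: ln_gt0; rewrite ltr1n.
have kr : 0 < k%:R :> R by rewrite ltr0n ltnW.
(* The count is in natural logarithms, hence the factor [ln 2]. *)
have [n0 h0] := @cycles_lower R k delta (eps * ln 2) hk hdelta (mulr_gt0 heps l20).
exists n0 => T G _ -> nn cod.
(* Without a perfect fractional matching the left-hand side is [-oo]; one matching already makes the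
   number of cycles positive. *)
case: (pselect (exists x : {set T} -> R, perfect_fractional_matching G x)) => [[x0 px0]|no]; last first.
  suff -> : entropy R G = -oo%E by rewrite gt0_muleNy ?lte_fin //= leNye.
  rewrite /entropy (_ : [set _ | x in _]%classic = classical_sets.set0) ?ereal_sup0 //.
  by rewrite -classical_sets.subset0 => y [x px _]; apply: no; exists x.
have [P0 _] := h0 T G x0 nn cod px0; set Psi := num_tight_hamilton_cycles G in P0 *.
have Pr : 0 < Psi%:R :> R by rewrite ltr0n.
rewrite /log2e lne_EFin //.
pose n : R := #|T|%:R.
(* [y] is the value of [k h(G)] at which the claim is an equality; it bounds the entropy of each
   matching, hence the supremum. *)
have [y yE] : exists y : R, y = n * log2 'C(#|T|, k.-1)%:R - n * log2 n + n * log2 (expR 1) + eps * n + ln Psi%:R / ln 2.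
  by eexists.
have ub : (k%:R%:E * entropy R G <= y%:E)%E.
  rewrite -[y](divfK (lt0r_neq0 kr)) [_ * k%:R]mulrC EFinM lee_pmul2l ?lte_fin //.
  apply: ge_ereal_sup => _ [x px <-]; rewrite lee_fin ler_pdivlMr //.
  have [_ h] := h0 T G x nn cod px.
  have -> : matching_entropy G x * k%:R = k%:R * (\sum_(e in edges G) x e * ln (1 / x e)) / ln 2.
    rewrite mulrC -mulrA; congr (_ * _); rewrite mulr_suml; apply: eq_bigr => e _.
    by rewrite /log2 mulrA.
  rewrite ler_pdivrMr // yE /log2 expRK.
  have -> : (n * (ln 'C(#|T|, k.-1)%:R / ln 2) - n * (ln n / ln 2) + n * (1 / ln 2) + eps * n + ln Psi%:R / ln 2) * ln 2 =
     n * ln 'C(#|T|, k.-1)%:R - n * ln n + n + eps * ln 2 * n + ln Psi%:R by field; rewrite lt0r_neq0.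
  by move: h; rewrite -/n -/Psi; clear; lra.
apply: (@le_trans _ _ (y%:E - (n * log2 'C(#|T|, k.-1)%:R)%:E + (n * log2 n)%:E - (n * log2 (expR 1))%:E - (eps * n)%:E)%E).
  by rewrite !leeD2r.
by rewrite -!EFinN -!EFinD -EFinM lee_fin yE; clear; lra.
Qed.
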